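(* Let $\Gamma\subset \mathrm{PSL}(2,\mathbb{R})$ be a cocompact, torsion-free Fuchsian group, let $H_1\subset\Gamma$ be the hyperbolic subgroup stabilizing the imaginary axis, and let $l$ be the corresponding closed geodesic. Then, as $X\to\infty$, $$N(X,l)= \sum_{1/2<s_j\le1}\frac{2}{\pi}\gamma_1(s_j)|\hat{u}_j|^2X^{s_j}+O\big(X^{2/3}\big),$$ where $$\gamma_1(s)=\frac{\pi}{2}\,\frac{\Gamma(s+1/2)\,\Gamma((s+1)/2)}{\Gamma(s/2)^3}\,\frac{4}{s(2s-1)},\qquad \hat{u}_j=\int_l u_j\,ds,$$ the sum is over all indices $j$ with $1/2<s_j\le 1$, and the implied constant depends on $\Gamma$ and the geodesic $l$.
   Context: $\mathbb{H}$ is the hyperbolic upper half-plane with metric $ds^2=(dx^2+dy^2)/y^2$, measure $d\mu=dx\,dy/y^2$ and Laplacian $\Delta=-y^2(\partial_x^2+\partial_y^2)$. $\Gamma\subset\mathrm{PSL}(2,\mathbb{R})$ is a discrete, cocompact, torsion-free group, conjugated so that the imaginary axis $I=\{iy:y>0\}$ projects to a closed geodesic of $\Gamma\backslash\mathbb{H}$; $H_1=\left\langle \begin{pmatrix} m&0\\0&m^{-1}\end{pmatrix}\right\rangle$, $m>1$, is the stabilizer of $I$ in $\Gamma$, and $l=\{iy: 1\le y\le m^2\}$ represents the closed geodesic $H_1\backslash I$ (of length $2\log m$). For $\gamma=\begin{pmatrix} a&b\\c&d\end{pmatrix}\in\Gamma$ put $B(\gamma)=|ad+bc|$; this depends only on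 the double coset $H_1\gamma H_1$. Define $$N(X,l)=\#\{\gamma\in H_1\backslash\Gamma/H_1 : B(\gamma)<X\}.$$ $\{u_j\}_{j\ge0}$ is a complete orthonormal system in $L^2(\Gamma\backslash\mathbb{H})$ of real-valued eigenfunctions of $\Delta$, with eigenvalues $\lambda_j=s_j(1-s_j)$, $s_j=1/2+it_j$, where $s_j\in(1/2,1]$ if $\lambda_j<1/4$ and $t_j\ge 0$ if $\lambda_j\ge 1/4$. In $\Gamma(\cdot)$ with a numerical argument, $\Gamma$ denotes the Gamma function. *)

(* Defs.v *)
From HB Require Import structures.
From mathcomp Require Import all_boot all_order all_algebra.
From mathcomp Require Import complex.
From mathcomp Require Import all_classical all_reals all_analysis.
Import Order.TTheory GRing.Theory Num.Theory.
Import numFieldNormedType.Exports.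

Set Implicit Arguments.
Unset Strict Implicit.
Unset Printing Implicit Defensive.

Local Open Scope classical_set_scope.
Local Open Scope ring_scope.
Local Open Scope complex_scope.

Section HyperbolicPlane.
Context {R : realType}.
Implicit Types (G : set 'M[R]_2) (g : 'M[R]_2) (z : R * R) (u f : R * R -> R).

(* The point x + iy of the upper half-plane is the pair (x, y). *)
Definition upper_half_plane : set (R * R) := [set z | 0 < z.2].

Definition mobius g z : R * R :=
  let zc : R[i] := z.1 +i* z.2 in
  let w := ((g 0 0)%:C * zc + (g 0 1)%:C) / ((g 1 0)%:C * zc + (g 1 1)%:C) in
  (complex.Re w, complex.Im w).

(* A subgroup of PSL(2, R) is represented by its full preimage in SL(2, R),
   that is, by a subgroup of SL(2, R) which contains -1. *)
Definition psl2_subgroup G :=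
  [/\ G `<=` [set g | \det g = 1],
      G (- 1%:M),
      (forall g h, G g -> G h -> G (g *m h)) &
      (forall g, G g -> G (invmx g))].

Definition discrete_subgroup G := forall g, G g -> isolated G g.

(* Torsion-freeness of the image in PSL(2, R), where g and -g coincide. *)
Definition psl2_torsion_free G := forall g n, G g -> (0 < n)%N ->
  (g ^+ n = 1 \/ g ^+ n = - 1) -> (g = 1 \/ g = - 1).

Definition cocompact G := exists K : set (R * R),
  [/\ compact K, K `<=` upper_half_plane &
      forall z, upper_half_plane z -> exists2 g, G g & K (mobius g z)].

Definition imaginary_axis : set (R * R) := [set z | z.1 = 0 /\ 0 < z.2].

Definition axis_stabilizer G : set 'M[R]_2 :=
  [set g | G g /\ mobius g @` imaginary_axis = imaginary_axis].

(* The subgroup of PSL(2, R) generated by diag(m, m^-1), again as a full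
   preimage in SL(2, R). *)
Definition hyperbolic_subgroup (m : R) : set 'M[R]_2 :=
  let h : 'M[R]_2 := diag_mx (\row_j (if j == 0 then m else m^-1)) in
  [set g | exists k : int, g = h ^ k \/ g = - (h ^ k)].

Definition Bcoef g : R := `|g 0 0 * g 1 1 + g 0 1 * g 1 0|.

Definition double_coset (H : set 'M[R]_2) g : set 'M[R]_2 :=
  [set k | exists h1 h2, [/\ H h1, H h2 & k = h1 *m g *m h2]].

(* N(X, l); the cardinality is +oo for an infinite set. *)
Definition Ncount G (m X : R) : \bar R :=
  counting [set D : set 'M[R]_2 | exists g,
    [/\ G g, Bcoef g < X & D = double_coset (hyperbolic_subgroup m) g]].

Definition automorphic G f :=
  forall g z, G g -> upper_half_plane z -> f (mobius g z) = f z.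

(* A Borel set which meets every orbit of G on the upper half-plane exactly
   once; integration over the quotient is integration over such a set. *)
Definition fundamental_set G (F : set (R * R)) :=
  [/\ measurable (F : set (measurableTypeR R * measurableTypeR R)),
      F `<=` upper_half_plane &
      forall z, upper_half_plane z ->
        exists! w, F w /\ exists2 g, G g & w = mobius g z].

(* The integral of f over F for the measure dx dy / y^2. *)
Definition hyp_integral (F : set (R * R)) f : \bar R :=
  (\int[(@lebesgue_measure R \x @lebesgue_measure R)%E]_(z in F)
     (f z / z.2 ^+ 2)%R%:E)%E.

Definition square_integrable G F f :=
  [/\ automorphic G f, measurable_fun
        (upper_half_plane : set (measurableTypeR R * measurableTypeR R)) f &
      (hyp_integral F (fun z => (f z ^+ 2)%R) < +oo)%E].

(* Completeness is stated as triviality of the orthogonal complement in the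
   real space L^2; as the u_j are real-valued, this is the same as in the
   complex one. *)
Definition complete_orthonormal_system G F (u : nat -> R * R -> R) :=
  [/\ (forall j, square_integrable G F (u j)),
      (forall i j, hyp_integral F (fun z => u i z * u j z) = (i == j)%:R%:E) &
      (forall f, square_integrable G F f ->
         (forall j, hyp_integral F (fun z => f z * u j z) = 0%E) ->
         {ae (@lebesgue_measure R \x @lebesgue_measure R)%E,
            forall z, F z -> f z = 0})].

Definition dx f : R * R -> R := fun z => 'D_((1, 0) : R * R) f z.
Definition dy f : R * R -> R := fun z => 'D_((0, 1) : R * R) f z.

Definition C0 f := forall z, upper_half_plane z -> {for z, continuous f}.

Definition C1 f :=
  [/\ C0 f,
      (forall z, upper_half_plane z ->
         derivable f z ((1, 0) : R * R) /\ derivable f z ((0, 1) : R * R)),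
      C0 (dx f) & C0 (dy f)].

Definition C2 f := [/\ C1 f, C1 (dx f) & C1 (dy f)].

Definition hyp_laplacian f : R * R -> R :=
  fun z => - z.2 ^+ 2 * (dx (dx f) z + dy (dy f) z).

Definition eigenfunction G (lam : R) f :=
  [/\ automorphic G f, C2 f &
      forall z, upper_half_plane z -> hyp_laplacian f z = lam * f z].

(* The order on R[i] is the partial order of numClosedFieldType: s < s' means
   that s' - s is a positive real. *)
Definition spectral_parameter (lam : R) (s : R[i]) :=
  [/\ lam%:C = s * (1 - s),
      lam < 4^-1 -> 2^-1 < s <= 1 &
      4^-1 <= lam -> exists2 t : R, 0 <= t & s = 2^-1 +i* t].

(* Euler's integral, convergent for s > 0. *)
Definition Gamma_function (s : R) : R :=
  \int[lebesgue_measure]_(t in `]0, +oo[) (t `^ (s - 1) * expR (- t)).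

Definition gamma1 (s : R) : R :=
  pi / 2 * (Gamma_function (s + 2^-1) * Gamma_function ((s + 1) / 2)
            / Gamma_function (s / 2) ^+ 3) * (4 / (s * (2 * s - 1))).

(* The arc length on l = {iy : 1 <= y <= m^2} is ds = dy / y. *)
Definition geodesic_period (m : R) f : R :=
  \int[lebesgue_measure]_(y in `[1, m ^+ 2]) (f (0, y) / y).

End HyperbolicPlane.

(* Main.v *)
(** Put [v = x / y] and [t = log y]. A kernel [k(v)] on one period of the axis, made automorphic, is expanded
along the [u_j] and integrated over the geodesic: the spectral side is a sum of [\hat u_j] times the integral of
[k] against the even solution [V_j] of [((1 + v^2) V')' = - lam_j V] with [V_j(0) = \hat u_j], the geometric side a
sum over double cosets. For [k = (2 / pi) |v| sqrt (Y^2 - v^2)] a double coset with [abcd > 0] contributes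
[max (0, Y^2 + 1 - B^2)], while those with [abcd < 0] ([B < 1]) are finite in number. Hence [N] is squeezed between
difference quotients in [Y^2] over windows of relative length [X^(-1/3)]. The main terms come from Euler integrals
for [V_j]; the rest is bounded by an energy estimate, two integrations by parts, and [sum_(t_j <= T) \hat u_j^2 = O(T)].
Only finitely many [lam_j <= 1/4] occur (Caccioppoli and Poincare inequalities). *)
Require Import Defs.
From HB Require Import structures.
From mathcomp Require Import all_boot all_order all_algebra.
From mathcomp Require Import complex.
From mathcomp Require Import all_classical all_reals all_analysis.
From mathcomp Require Import measurable_realfun ring lra.
Import Order.TTheory GRing.Theory Num.Theory.
Import numFieldNormedType.Exports.
Set Implicit Arguments.
Unset Strict Implicit.
Unset Printing Implicit Defensive.
Local Open Scope classical_set_scope.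
Local Open Scope ring_scope.
Local Open Scope complex_scope.

Local Notation sqrt := Num.sqrt.
Local Notation mfun := (measurable_fun setT).
Local Notation planeT R := (measurableTypeR R * measurableTypeR R)%type.
Local Notation leb R := (@lebesgue_measure R).
Local Notation leb2 R := (@lebesgue_measure R \x @lebesgue_measure R)%E.

(** The geodesic is a null set, so an expansion in L^2 has no meaning on it. Parseval is applied to
    the tube of width d around the geodesic and to the tube of the kernel, and d tends to 0;
    absolute convergence comes from the estimates that bound the error. The kernel is dictated by
    the curve p(t) = ac e^t + bd e^-t of a double coset with abcd > 0: for q = ac e^t - bd e^-t one
    has p^2 = q^2 + 4abcd, dq = p dt and B^2 = 1 + 4abcd, so the weight |v| turns the integral of
    the kernel into the area of a half-disc. This yields a counting function integrated once in Y^2,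
    hence the difference quotients. Over a window of relative length eta the differenced main term
    varies by X eta, and the oscillating part contributes X^(1/2) eta^(-1/2), since frequencies
    beyond 1 / eta are damped. The two balance at eta = X^(-1/3). Groups are given by their
    preimages in SL(2, R), so every element occurs with both signs; this is the source of most
    factors 2. The constant may not depend on the orthonormal system, so two systems are compared
    through the growth of the geometric side. *)

Lemma eq_ler {d} {T : porderType d} (x y : T) : x = y -> (x <= y)%O.
Proof. by move=> ->. Qed.

(** * Change of variables for non-negative integrals: image measures with a density *)

Section WeightedImage.
Context d d' (T : measurableType d) (T' : measurableType d') (R : realType).
Context (mu : {measure set T -> \bar R}).
Variables (f : T -> R) (phi : T -> T').
Hypotheses (mf : mfun f) (f0 : forall x, 0 <= f x).
Hypothesis mphi : mfun phi.

(** The push-forward under [phi] of the measure with density [f]. The hypotheses are arguments, so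
    that the measure structure is found from the term alone. *)
Definition weighted_image of mfun f & (forall x, 0 <= f x) &
 mfun phi :=
 fun A : set T' => (\int[mu]_(x in phi @^-1` A) (f x)%:E)%E.

Let mfE : mfun (fun x => (f x)%:E).
Proof. exact/measurable_EFinP. Qed.
Let mpre A : measurable A -> measurable (phi @^-1` A).
Proof. by move=> mA; rewrite -[X in measurable X]setTI; exact: mphi. Qed.

Local Notation nu := (weighted_image mf f0 mphi).

Let nu0 : nu set0 = 0%E.
Proof. by rewrite /weighted_image preimage_set0 integral_set0. Qed.
Let nu_ge0 A : (0 <= nu A)%E. Proof. by apply: integral_ge0 => x _; rewrite lee_fin. Qed.
Let nu_sigma : semi_sigma_additive nu.
Proof.
move=> F mF tF mUF; rewrite /weighted_image preimage_bigcup ge0_integral_bigcup//.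
- by apply: is_cvg_nneseries => n _ _; apply: integral_ge0 => x _; rewrite lee_fin.
- by move=> k; exact: mpre.
- exact: measurable_funTS.
- by move=> x _; rewrite lee_fin.
- apply/trivIsetP => i j _ _ ij; rewrite -preimage_setI.
 by move/trivIsetP : tF => /(_ _ _ _ _ ij) ->//; rewrite preimage_set0.
Qed.

HB.instance Definition _ := isMeasure.Build _ _ _ nu nu0 nu_ge0 nu_sigma.

Import HBNNSimple.

(** Both sides are limits along simple approximations of [g], by monotone convergence; for an
    indicator the identity is the definition of the measure. *)
Lemma ge0_integral_weighted_image (g : T' -> \bar R) :
 mfun g -> (forall x, (0 <= g x)%E) ->
 (\int[nu]_x g x = \int[mu]_x ((f x)%:E * g (phi x)))%E.
Proof.
move=> mg g0.
pose g_ := nnsfun_approx measurableT mg.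
have gcvg x : (EFin \o (fun n => g_ n x)) n @[n --> \oo] --> g x.
 exact: cvg_nnsfun_approx.
transitivity (limn (fun n => \int[nu]_x (g_ n x)%:E))%E.
 rewrite -monotone_convergence//.
 - by apply: eq_integral => y _; apply/esym/cvg_lim => //; exact: gcvg.
 - by move=> n; exact/measurable_EFinP/measurable_funP.
 - by move=> n y _; rewrite lee_fin.
 - by move=> y _ p q pq; rewrite lee_fin; exact/lefP/nd_nnsfun_approx.
transitivity (limn (fun n => \int[mu]_x ((f x)%:E * (g_ n (phi x))%:E)))%E; last first.
 rewrite -monotone_convergence//.
 - apply: eq_integral => y _; apply/cvg_lim => //.
 by apply: cvgeZl => //; exact: gcvg.
 - move=> n; apply: emeasurable_funM => //; apply/measurable_EFinP.
 by apply: measurableT_comp => //; exact: measurable_funP.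
 - by move=> n y _; rewrite mule_ge0// ?lee_fin.
 - move=> y _ p q pq; apply: lee_wpmul2l; rewrite lee_fin//.
 exact/lefP/nd_nnsfun_approx.
congr (limn _); apply/funext => n.
under [in LHS]eq_integral do rewrite fimfunE -fsumEFin//.
rewrite ge0_integral_fsum//; last 2 first.
 - by move=> y; exact/measurable_EFinP/measurable_funM.
 - by move=> y x _; rewrite nnfun_muleindic_ge0.
transitivity (\int[mu]_x \sum_(k \in range (g_ n))
 ((f x)%:E * (k * \1_(g_ n @^-1` [set k]) (phi x))%:E))%E; last first.
 apply: eq_integral => x _; rewrite [X in (_ * X%:E)%E]fimfunE -fsumEFin//.
 by rewrite ge0_mule_fsumr// => k; rewrite nnfun_muleindic_ge0.
rewrite ge0_integral_fsum//; last 2 first.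
 - move=> y; apply: emeasurable_funM => //; apply/measurable_EFinP.
 apply: (measurableT_comp (f := fun x => y * \1_(g_ n @^-1` [set y]) x)) => //.
 exact: measurable_funM.
 - by move=> y x _; rewrite mule_ge0 ?lee_fin// -lee_fin nnfun_muleindic_ge0.
apply: eq_fsbigr => r _; rewrite integralZl_indic_nnsfun// integral_indic//=.
rewrite setIT /weighted_image.
have [r0|r0] := ltP r 0.
 rewrite preimage_nnfun0// preimage_set0 integral_set0 mule0 integral0_eq// => x _.
 by rewrite indic0 mulr0 mule0.
have mr : measurable (g_ n @^-1` [set r]) by exact: measurable_funPTI.
rewrite -(ge0_integralZl mu (mpre mr) (measurable_funTS mfE))//; last first.
 by move=> x _; rewrite lee_fin.
rewrite integral_mkcond; apply: eq_integral => x _.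
rewrite patchE indicE; case: ifPn; rewrite !(inE, notin_setE)/=.
 by move=> gr; rewrite mem_set//= mulr1 muleC.
by move=> gr; rewrite memNset//= mulr0 mule0.
Qed.

End WeightedImage.

(** * The substitution y = e^t on the half-line *)

Section ExponentialSubstitution.
Context (R : realType).
Local Notation mu := (leb R).

Let mexp : mfun (@expR R). Proof. by []. Qed.
Let exp0 (t : R) : 0 <= expR t. Proof. exact: expR_ge0. Qed.

Lemma integral_expR (a b : R) : a <= b ->
 (\int[mu]_(t in `]a, b]) (expR t)%:E = (expR b - expR a)%:E)%E.
Proof.
rewrite le_eqVlt => /predU1P[->|ab].
 by rewrite set_itv_ge ?integral_set0 ?subrr// bnd_simp ltxx.
rewrite integral_itv_obnd_cbnd//; last exact/measurable_EFinP/measurable_funTS.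
rewrite (@continuous_FTC2 _ expR expR)//.
- by apply: continuous_subspaceT => x; exact: continuous_expR.
- split=> //; first by apply: cvg_at_right_filter; exact: continuous_expR.
 by apply: cvg_at_left_filter; exact: continuous_expR.
- by move=> x _; rewrite derive1E derive_val.
Qed.

Lemma integralNy_expR (b : R) :
 (\int[mu]_(t in `]-oo, b]) (expR t)%:E = (expR b)%:E)%E.
Proof.
rewrite -[in LHS](opprK b) (ge0_integration_by_substitutionNy (G := expR)).
- rewrite (@ge0_continuous_FTC2y _ (expR \o -%R) (fun x => - expR (- x)) _ 0).
 + by rewrite sub0e -EFinN !opprK.
 + by move=> x _; exact: expR_ge0.
 + apply: continuous_subspaceT => x; apply: continuous_comp; first exact: continuousN.
 exact: continuous_expR.
 + by rewrite -[X in _ --> X]oppr0; apply: cvgN; exact: cvgr_expR.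
 + by move=> x _; exact: ex_derive.
 + apply: cvgN; apply: cvg_at_right_filter.
 apply: (continuous_comp (f := -%R) (g := expR)); first exact: oppr_continuous.
 exact: continuous_expR.
 + move=> x _; rewrite derive1E derive_val /=.
 by rewrite mulrN1 opprK.
- by apply: continuous_subspaceT => x; exact: continuous_expR.
- by move=> x _; exact: expR_ge0.
Qed.

(** The exponential carries e^t dt to Lebesgue measure on the positive half-line, which is
    recognised by its values on half-open intervals. *)
Lemma ge0_integral_expR_substitution (g : R -> \bar R) :
 mfun g -> (forall x, (0 <= g x)%E) ->
 (\int[mu]_(y in `]0%R, +oo[) g y = \int[mu]_t ((expR t)%:E * g (expR t)))%E.
Proof.
move=> mg g0.
pose e : measurableTypeR R -> measurableTypeR R := @expR R.
have me : mfun e by exact: mexp.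
pose m1 := weighted_image mu mexp exp0 me.
(* The image measure charges only the positive half-line; adding Lebesgue measure on the other half
   gives a measure on the whole line, to which the uniqueness of Lebesgue measure applies. *)
pose D : set R := [set` `]-oo, 0%R]].
have mD : measurable D by exact: measurable_itv.
pose m2 := measure_add m1 (mrestr mu mD).
have expR_le c x : 0 < c -> (expR x <= c) = (x <= ln c).
 by move=> c0; rewrite -[in LHS](lnK c0) ler_expR.
have lt_expR c x : 0 < c -> (c < expR x) = (ln c < x).
 by move=> c0; rewrite -[in LHS](lnK c0) ltr_expR.
have m2A A : (m2 A = m1 A + mrestr mu mD A)%E by exact: measure_addE.
have m2E A : measurable A -> mu A = m2 A.
 apply: lebesgue_measure_unique => _ [[a b] _ <-]/=.
 have [ba|ab] := leP b a; first by rewrite set_itv_ge ?measure0// bnd_simp -leNgt.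
 apply: (eq_trans _ (esym (m2A _))).
 rewrite /m1 /weighted_image /mrestr /= /e.
 have [b0|b0] := leP b 0.
 rewrite (_ : expR @^-1` _ = set0).
 rewrite integral_set0 add0e setIidl// => x /=; rewrite !in_itv/= => /andP[_ xb].
 exact: le_trans xb b0.
 apply/seteqP; split => // x /=; rewrite in_itv/= => /andP[_].
 by rewrite leNgt (le_lt_trans b0)// expR_gt0.
 have [a0|a0] := leP a 0.
 rewrite (_ : expR @^-1` _ = [set` `]-oo, ln b]]); last first.
 apply/seteqP; split => x /=; rewrite !in_itv/= expR_le//; first by case/andP.
 by move=> ->; rewrite (le_lt_trans a0 (expR_gt0 _)).
 rewrite (_ : _ `&` D = [set` `]a, 0]]); last first.
 apply/seteqP; split => x /=; rewrite /D /= !in_itv/=.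
 by case=> /andP[-> _] ->.
 by move=> /andP[-> x0]; rewrite x0 (le_trans x0 (ltW b0)).
 rewrite [X in (X + _)%E]integralNy_expR lnK// !lebesgue_measure_itv/=.
 rewrite !lte_fin ab; case: ltP => [a0'|a0'].
 by rewrite -!EFinB -EFinD; congr EFin; lra.
 by rewrite adde0 -EFinB; congr EFin; lra.
 rewrite (_ : expR @^-1` _ = [set` `]ln a, ln b]]); last first.
 apply/seteqP; split => x /=; by rewrite !in_itv/= expR_le// lt_expR.
 rewrite (_ : _ `&` D = set0); last first.
 apply/seteqP; split => x //=; rewrite /D /= !in_itv/= => -[/andP[ax _]].
 by rewrite leNgt (lt_trans a0 ax).
 rewrite measure0 adde0 [X in _ = X]integral_expR ?ler_ln ?posrE ?ltW//.
 by rewrite !lnK ?posrE// lebesgue_measure_itv/= lte_fin ab.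
rewrite (@eq_measure_integral _ _ _ _ m1); last first.
 move=> A mA AD; apply: (eq_trans (m2E _ mA)); apply: (eq_trans (m2A _)).
 rewrite /mrestr.
 rewrite (_ : A `&` D = set0) ?measure0 ?adde0//.
 apply/seteqP; split => x // -[/AD /=]; rewrite /D /= !in_itv/= andbT => x0.
 by rewrite leNgt x0.
rewrite integral_mkcond (ge0_integral_weighted_image mu mexp exp0 me).
- apply: eq_integral => x _; rewrite patchE mem_set//=.
 by rewrite in_itv/= andbT expR_gt0.
- apply: (measurable_restrictT _ _).1; first exact: measurable_itv.
 exact: measurable_funTS.
- by move=> x; rewrite patchE; case: ifP.
Qed.

End ExponentialSubstitution.

(** * Affine substitutions on the line *)

Section AffineSubstitution.
Context (R : realType).
Local Notation mu := (leb R).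

Lemma ge0_integral_affine (a b : R) (f : R -> \bar R) : a != 0 ->
 mfun f -> (forall x, (0 <= f x)%E) ->
 (\int[mu]_x f x = `|a|%:E * \int[mu]_x f (a * x + b)%R)%E.
Proof.
move=> a0 mf f0.
have ma : mfun (fun _ : measurableTypeR R => `|a|) by [].
have a0' (x : measurableTypeR R) : 0 <= (fun _ : measurableTypeR R => `|a|) x by [].
pose e (x : measurableTypeR R) : measurableTypeR R := a * x + b.
have me : mfun e.
 by apply: measurable_funD => //; exact: measurable_funM.
have mep X : measurable X -> measurable (e @^-1` X).
 by move=> mX; rewrite -[X in measurable X]setTI; exact: me.
pose m1 := weighted_image mu ma a0' me.
have m1E A : measurable A -> mu A = m1 A.
 apply: lebesgue_measure_unique => _ [[c d] _ <-]/=.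
 have [dc|cd] := leP d c.
 by rewrite set_itv_ge ?measure0// bnd_simp -leNgt.
 rewrite /m1 /weighted_image integral_cst; last first.
 by apply: mep; exact: measurable_itv.
 rewrite /= lebesgue_measure_itv/= lte_fin cd.
 have [apos|aneg|] := ltgtP 0 a; last by move=> a00; rewrite -a00 eqxx in a0.
 rewrite (_ : e @^-1` _ = [set` `](c - b) / a, (d - b) / a]]); last first.
 by apply/seteqP; split => x /=; rewrite /e !in_itv/= ltr_pdivrMr// ler_pdivlMr// ltrBlDr lerBrDr mulrC.
 rewrite lebesgue_measure_itv/= lte_fin ltr_pM2r ?invr_gt0// ltrD2r cd.
 by rewrite -!EFinB -EFinM gtr0_norm//; congr EFin; field.
 rewrite (_ : e @^-1` _ = [set` `[(d - b) / a, (c - b) / a[]); last first.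
 by apply/seteqP; split => x /=; rewrite /e !in_itv/= ltr_ndivlMr// ler_ndivrMr// ltrBlDr lerBrDr mulrC andbC.
 rewrite lebesgue_measure_itv/= lte_fin ltr_nM2r ?invr_lt0// ltrD2r cd.
 by rewrite -!EFinB -EFinM ltr0_norm//; congr EFin; field.
rewrite (@eq_measure_integral _ _ _ _ m1); last by move=> A mA _; exact: m1E.
rewrite (ge0_integral_weighted_image mu ma a0' me)// ge0_integralZl//.
exact: measurableT_comp.
Qed.

End AffineSubstitution.

(** * The coordinates (x / y, log y) and the measure-preserving maps that generate the group
    action *)

Section HyperbolicCoordinates.
Context {R : realType}.
Local Notation mu := (leb R).
Local Notation plane := (planeT R).
Local Notation L := (leb2 R).

(* The point with [x / y = p.1] and [log y = p.2]; in these coordinates the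
 hyperbolic measure [dx dy / y^2] is the Lebesgue measure of the plane. *)
Definition hpt (p : R * R) : R * R := (p.1 * expR p.2, expR p.2).

Lemma measurable_hpt : mfun (hpt : plane -> plane).
Proof.
apply: measurable_fun_pair => //=; last exact: measurableT_comp.
by apply: measurable_funM => //; exact: measurableT_comp.
Qed.

(** Tonelli, then x = v y at fixed y, then y = e^t: the Jacobian y e^t cancels y^-2. *)
Lemma ge0_integral_hpt (f : plane -> \bar R) :
 mfun f -> (forall z, (0 <= f z)%E) ->
 (\int[L]_(z in upper_half_plane) (f z * ((z.2 ^+ 2)^-1)%:E) = \int[L]_p f (hpt p))%E.
Proof.
move=> mf f0.
have mH : measurable (upper_half_plane : set plane).
 rewrite [X in measurable X](_ : _ = setT `*` [set` `]0, +oo[]).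
 by apply: measurableX => //; exact: measurable_itv.
 by apply/seteqP; split => -[x y] /=; rewrite /upper_half_plane/= in_itv/= andbT// => -[].
(* A version of y^-2 on y > 0 whose measurability on the whole line is immediate. *)
pose w (y : R) := expR (- 2 * ln y).
have wE y : 0 < y -> (y ^+ 2)^-1 = w y.
 by move=> y0; rewrite /w mulNr expRN mulrC expRM_natr lnK.
pose h : plane -> \bar R := ((fun z : plane => f z * (w z.2)%:E) \_ (upper_half_plane : set plane))%E.
have mh : mfun h.
 apply: (measurable_restrictT _ mH).1; apply: measurable_funTS.
 apply: emeasurable_funM => //; apply/measurable_EFinP.
 apply: (measurableT_comp (f := w)); last exact: measurable_snd.
 by apply: measurableT_comp => //; apply: measurable_funM => //; exact: measurable_ln.
have h0 z : (0 <= h z)%E.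
 by rewrite /h patchE; case: ifP => // _; rewrite mule_ge0// lee_fin expR_ge0.
rewrite (_ : (\int[L]_(z in upper_half_plane) _)%E = \int[L]_z h z)%E; last first.
 rewrite integral_mkcond; apply: eq_integral => z _; rewrite /h !patchE.
 by case: ifPn => //; rewrite inE => z0; rewrite wE.
rewrite fubini_tonelli2// fubini_tonelli2//; last first.
 by apply: measurableT_comp => //; exact: measurable_hpt.
have ms : mfun (fun p : plane => (p.1 * p.2, p.2) : plane).
 apply: measurable_fun_pair; last exact: measurable_snd.
 by apply: measurable_funM; [exact: measurable_fst|exact: measurable_snd].
have mfs : mfun (fun p : plane => f (p.1 * p.2, p.2)).
 exact: (measurableT_comp mf ms).
transitivity (\int[mu]_(y in [set` `]0%R, +oo[])
 ((expR (- ln y))%:E * \int[mu]_v f (v * y, y)%R))%E.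
 rewrite [RHS]integral_mkcond; apply: eq_integral => y _; rewrite /fubini_G patchE.
 case: ifPn; rewrite ?(inE, notin_setE)/= in_itv/= andbT => y0; last first.
 by apply: integral0_eq => x _; rewrite /h patchE memNset.
 rewrite (@ge0_integral_affine _ y 0)/=; [|by rewrite gt_eqF| |by []]; last first.
 exact: (measurable_fun_pair1 y mh).
 rewrite gtr0_norm//.
 under eq_integral do rewrite /h patchE mem_set//= addr0 muleC mulrC.
 rewrite ge0_integralZl//; last 2 first.
 - exact: (measurable_fun_pair1 y mfs).
 - by rewrite lee_fin expR_ge0.
 rewrite muleA -EFinM; congr (_%:E * _)%E.
 rewrite /w -{1}(lnK y0) -expRD; congr expR; lra.
rewrite ge0_integral_expR_substitution.
- apply: eq_integral => t _; rewrite muleA -EFinM expRK -expRD addrN expR0 mul1e.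
 by rewrite /fubini_G.
- apply: emeasurable_funM.
 by apply/measurable_EFinP; apply: measurableT_comp => //; apply: measurableT_comp => //; exact: measurable_ln.
 exact: (measurable_fun_fubini_tonelli_G _ mfs).
- by move=> y; rewrite mule_ge0 ?lee_fin ?expR_ge0// integral_ge0.
Qed.
Let ge0_fubini (f : plane -> \bar R) : mfun f -> (forall z, (0 <= f z)%E) ->
 (\int[L]_p f p = \int[mu]_t \int[mu]_v f (v, t))%E.
Proof. by move=> mf f0; rewrite fubini_tonelli2. Qed.
Let ge0_fubini' (f : plane -> \bar R) : mfun f -> (forall z, (0 <= f z)%E) ->
 (\int[L]_p f p = \int[mu]_v \int[mu]_t f (v, t))%E.
Proof. by move=> mf f0; rewrite fubini_tonelli1. Qed.

(** With b(t) = k e^-t this is the horizontal translation z -> z + k. Together with the two maps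
    below it generates the action of SL(2, R). *)
Lemma ge0_integral_translate_fst (b : R -> R) (f : plane -> \bar R) :
 mfun b -> mfun f -> (forall z, (0 <= f z)%E) ->
 (\int[L]_p f ((p.1 + b p.2)%R, p.2) = \int[L]_p f p)%E.
Proof.
move=> mb mf f0; rewrite !ge0_fubini//; last first.
 apply: (measurableT_comp mf); apply: measurable_fun_pair; last exact: measurable_snd.
 apply: measurable_funD; first exact: measurable_fst.
 by apply: measurableT_comp => //; exact: measurable_snd.
apply: eq_integral => t _; rewrite [RHS](@ge0_integral_affine _ 1 (b t))//=; last first.
 exact: (measurable_fun_pair1 t mf).
by rewrite normr1 mul1e; apply: eq_integral => v _; rewrite mul1r.
Qed.

Lemma ge0_integral_translate_snd (b : R) (f : plane -> \bar R) :
 mfun f -> (forall z, (0 <= f z)%E) ->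
 (\int[L]_p f (p.1, (p.2 + b)%R) = \int[L]_p f p)%E.
Proof.
move=> mf f0; rewrite !ge0_fubini'//; last first.
 apply: (measurableT_comp mf); apply: measurable_fun_pair; first exact: measurable_fst.
 by apply: measurable_funD => //; exact: measurable_snd.
apply: eq_integral => v _; rewrite [RHS](@ge0_integral_affine _ 1 b)//=; last first.
 exact: (measurable_fun_pair2 v mf).
by rewrite normr1 mul1e; apply: eq_integral => t _; rewrite mul1r.
Qed.

(** With b(v) = ln (c^2 (1 + v^2)) this is the map z -> - 1 / (c^2 z). *)
Lemma ge0_integral_inversion (b : R -> R) (f : plane -> \bar R) :
 mfun b -> mfun f -> (forall z, (0 <= f z)%E) ->
 (\int[L]_p f (- p.1, - p.2 - b p.1)%R = \int[L]_p f p)%E.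
Proof.
move=> mb mf f0; rewrite !ge0_fubini'//; last first.
 apply: (measurableT_comp mf); apply: measurable_fun_pair.
 by apply: measurableT_comp => //; exact: measurable_fst.
 apply: measurable_funB; first by apply: measurableT_comp => //; exact: measurable_snd.
 by apply: measurableT_comp => //; exact: measurable_fst.
rewrite [RHS](@ge0_integral_affine _ (-1) 0)//; last 2 first.
- exact: (measurable_fun_fubini_tonelli_F _ mf).
- by move=> x; exact: integral_ge0.
rewrite normrN normr1 mul1e.
apply: eq_integral => v _; rewrite [RHS](@ge0_integral_affine _ (-1) (- b v))//=; last first.
 exact: (measurable_fun_pair2 _ mf).
rewrite normrN normr1 mul1e; apply: eq_integral => t _.
by rewrite !mulN1r addr0.
Qed.

End HyperbolicCoordinates.

(** * The action of SL(2, R) in these coordinates and the invariance of the measure *)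

Section MobiusAction.
Context {R : realType}.
Implicit Types (g h : 'M[R]_2) (z p : R * R).
Local Notation plane := (planeT R).
Local Notation L := (leb2 R).

Lemma det_mx2 g : \det g = g 0 0 * g 1 1 - g 0 1 * g 1 0.
Proof.
rewrite (expand_det_row _ 0) !big_ord_recl big_ord0 addr0 /cofactor !det_mx11 !mxE /=.
rewrite expr0 mul1r expr1 mulN1r mulrN.
by congr (_ * g _ _ - g _ _ * g _ _); exact: val_inj.
Qed.

Lemma mulmx2E g h i j : (g *m h) i j = g i 0 * h 0 j + g i 1 * h 1 j.
Proof.
rewrite mxE !big_ord_recl big_ord0 addr0.
by congr (_ + g _ _ * h _ _); exact: val_inj.
Qed.

Lemma ord2P (P : 'I_2 -> Prop) : P 0 -> P 1 -> forall i, P i.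
Proof.
move=> P0 P1 [[|[|//]] Hi].
- by rewrite (_ : Ordinal Hi = 0)//; exact: val_inj.
- by rewrite (_ : Ordinal Hi = 1)//; exact: val_inj.
Qed.

Lemma mx2P g h : g 0 0 = h 0 0 -> g 0 1 = h 0 1 -> g 1 0 = h 1 0 -> g 1 1 = h 1 1 -> g = h.
Proof. by move=> *; apply/matrixP; apply: ord2P; apply: ord2P. Qed.

Definition toC z : R[i] := z.1 +i* z.2.

Lemma toC_inj : injective toC.
Proof. by move=> [x y] [x' y'] [-> ->]. Qed.

Lemma toC_mobius g z : toC (mobius g z) =
 ((g 0 0)%:C * toC z + (g 0 1)%:C) / ((g 1 0)%:C * toC z + (g 1 1)%:C).
Proof.
have E (w : R[i]) : complex.Re w +i* complex.Im w = w by case: w.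
exact: E.
Qed.

Lemma mobius_denom_neq0 g z : \det g = 1 -> 0 < z.2 ->
 (g 1 0)%:C * toC z + (g 1 1)%:C != 0 :> R[i].
Proof.
rewrite det_mx2 => d1 z0; apply/eqP => /eqP; rewrite eq_complex /= !mul0r !addr0 subr0.
move=> /andP[/eqP h1 /eqP h2].
have c0 : g 1 0 = 0 by move/eqP : h2; rewrite mulf_eq0 (gt_eqF z0) orbF => /eqP.
move: h1 d1; rewrite c0 mul0r add0r => ->.
by rewrite !mulr0 subr0 => /esym/eqP; rewrite oner_eq0.
Qed.

(** This is |c z + d|^2 at the point z = [hpt p]. *)
Definition mobius_q g p := (g 1 0 * (p.1 * expR p.2) + g 1 1) ^+ 2 + (g 1 0 * expR p.2) ^+ 2.

Lemma mobius_q_gt0 g p : \det g = 1 -> 0 < mobius_q g p.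
Proof.
rewrite det_mx2 => d1; rewrite /mobius_q lt_neqAle addr_ge0 ?sqr_ge0// andbT eq_sym.
rewrite paddr_eq0 ?sqr_ge0// !sqrf_eq0 mulf_eq0 (gt_eqF (expR_gt0 _)) orbF.
apply/negP => /andP[/[swap]/eqP c0]; rewrite c0 mul0r add0r => /eqP d0.
by move: d1; rewrite c0 d0 !mulr0 subr0 => /esym/eqP; rewrite oner_eq0.
Qed.

(* The action of [SL2] in the coordinates of [hpt]. *)
Definition hact g p : R * R :=
 (g 0 0 * g 1 0 * (expR p.2 * (1 + p.1 ^+ 2)) + g 0 1 * g 1 1 * expR (- p.2)
 + (g 0 0 * g 1 1 + g 0 1 * g 1 0) * p.1,
 p.2 - ln (mobius_q g p)).

Lemma hpt_inj : injective (@hpt R).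
Proof.
move=> [v t] [v' t'] [] /[swap] /expR_inj -> h; congr (_, _).
by apply: (mulIf _ h); rewrite gt_eqF ?expR_gt0.
Qed.

Lemma hpt_gt0 p : upper_half_plane (hpt p).
Proof. exact: expR_gt0. Qed.

Lemma hpt_surj z : upper_half_plane z -> hpt (z.1 / z.2, ln z.2) = z.
Proof.
by case: z => x y /= y0; rewrite /hpt/= lnK// divfK// gt_eqF.
Qed.

Lemma mobius_hpt g p : \det g = 1 -> mobius g (hpt p) = hpt (hact g p).
Proof.
move=> g1; have q0 := mobius_q_gt0 p g1; move: g1; rewrite det_mx2 => g1.
have e0 := expR_gt0 p.2.
rewrite /hact /hpt /= expRB lnK// expRN; move: q0 e0; rewrite /mobius_q /mobius /=.
move: (expR p.2) => E q0 E0.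
rewrite !mul0r !addr0 !subr0.
congr (_, _); first by field; rewrite !gt_eqF.
set Q := _ + _ in q0 *.
transitivity (E * (g 0 0 * g 1 1 - g 0 1 * g 1 0) / Q); last by rewrite g1 mulr1.
by field; rewrite gt_eqF.
Qed.

Lemma mobiusM g h z : \det g = 1 -> \det h = 1 -> 0 < z.2 ->
 mobius (g *m h) z = mobius g (mobius h z).
Proof.
move=> g1 h1 z0; apply: toC_inj; rewrite !toC_mobius !mulmx2E.
have gh1 : \det (g *m h) = 1 by rewrite det_mulmx g1 h1 mulr1.
have := mobius_denom_neq0 h1 z0; have := mobius_denom_neq0 gh1 z0.
rewrite !mulmx2E !rmorphD !rmorphM /= => n1 n2.
field; rewrite n2/=; apply: contra n1 => /eqP n1; apply/eqP.
by rewrite -[RHS]n1; ring.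
Qed.

Lemma hactM g h p : \det g = 1 -> \det h = 1 -> hact (g *m h) p = hact g (hact h p).
Proof.
move=> g1 h1; apply: hpt_inj; rewrite -!mobius_hpt ?det_mulmx ?g1 ?h1 ?mulr1//.
by rewrite mobiusM//; exact: hpt_gt0.
Qed.

Lemma hact1 p : hact 1%:M p = p.
Proof.
case: p => v t; rewrite /hact /mobius_q /= !mxE /= !(mulr0, mul0r, mulr1, mul1r, addr0, add0r).
by rewrite expr0n expr1n/= addr0 ln1 subr0.
Qed.

Lemma hactN g p : hact (- g) p = hact g p.
Proof.
rewrite /hact /mobius_q !mxE !mulrNN; congr (_, _ - ln _).
by rewrite !mulNr -opprD !sqrrN.
Qed.

Lemma measurable_hact g : mfun (hact g : plane -> plane).
Proof.
have m1 := @measurable_fst _ _ (measurableTypeR R) (measurableTypeR R).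
have m2 := @measurable_snd _ _ (measurableTypeR R) (measurableTypeR R).
have mE : mfun (fun p : plane => expR p.2) by exact: measurableT_comp.
have mEN : mfun (fun p : plane => expR (- p.2)).
 by apply: measurableT_comp => //; exact: measurableT_comp.
apply: measurable_fun_pair.
 apply: measurable_funD; first apply: measurable_funD.
 - apply: measurable_funM => //; apply: measurable_funM => //.
 by apply: measurable_funD => //; exact: measurable_funX.
 - exact: measurable_funM.
 - exact: measurable_funM.
apply: measurable_funB => //; apply: measurableT_comp; first exact: measurable_ln.
apply: measurable_funD; apply: measurable_funX; last exact: measurable_funM.
by apply: measurable_funD => //; apply: measurable_funM => //; exact: measurable_funM.
Qed.

(** Bruhat decomposition: for c <> 0, g z = a / c - 1 / (c^2 (z + d / c)) is a translation, an
    inversion and a translation; for c = 0 it is a dilation and a translation. Each factor preserves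
    the measure. *)
Lemma ge0_integral_hact g (f : plane -> \bar R) : \det g = 1 ->
 mfun f -> (forall z, (0 <= f z)%E) ->
 (\int[L]_p f (hact g p) = \int[L]_p f p)%E.
Proof.
move=> g1 mf f0; have := g1; rewrite det_mx2 => d1.
have [c0|c0] := eqVneq (g 1 0) 0.
 have {}d1 : g 0 0 * g 1 1 = 1 by rewrite -d1 c0 mulr0 subr0.
 rewrite -(ge0_integral_translate_snd (- ln (g 1 1 ^+ 2)) mf)//.
 rewrite -(ge0_integral_translate_fst (b := fun t => g 0 1 * g 1 1 * expR (- t))
 (f := fun p => f (p.1, p.2 + - ln (g 1 1 ^+ 2))))//=; last 2 first.
 - apply: measurable_funM => //; apply: measurableT_comp => //; exact: measurableT_comp.
 - apply: (measurableT_comp mf); apply: measurable_fun_pair; first exact: measurable_fst.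
 by apply: measurable_funD => //; exact: measurable_snd.
 apply: eq_integral => p _; congr (f (_, _)).
 by rewrite c0 d1 !mulr0 !mul0r !add0r addr0 mul1r addrC.
 by rewrite /mobius_q c0 !mul0r expr0n addr0 add0r.
pose a := g 0 0; pose b := g 0 1; pose c := g 1 0; pose d := g 1 1.
pose f3 p := f (p.1 + a / c * expR (- p.2), p.2).
have mt k : mfun (fun t : R => k * expR (- t)).
 by apply: measurable_funM => //; apply: measurableT_comp => //; exact: measurableT_comp.
have mtr k : mfun (fun p : plane => (p.1 + k * expR (- p.2), p.2) : plane).
 apply: measurable_fun_pair; last exact: measurable_snd.
 apply: measurable_funD; first exact: measurable_fst.
 by apply: (measurableT_comp (mt k)); exact: measurable_snd.
have ml : mfun (fun v : R => ln (c ^+ 2) + ln (1 + v ^+ 2)).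
 apply: measurable_funD => //; apply: measurableT_comp; first exact: measurable_ln.
 by apply: measurable_funD => //; exact: measurable_funX.
have mf3 : mfun (f3 : plane -> \bar R) by exact: (measurableT_comp mf (mtr _)).
have f30 z : (0 <= f3 z)%E by exact: f0.
rewrite -(ge0_integral_translate_fst (mt (a / c)) mf)//.
rewrite -(ge0_integral_inversion ml mf3)//.
rewrite -(ge0_integral_translate_fst (mt (d / c))
 (f := fun p => f3 (- p.1, - p.2 - (ln (c ^+ 2) + ln (1 + p.1 ^+ 2)))))//=; last first.
 apply: (measurableT_comp mf3); apply: measurable_fun_pair.
 by apply: measurableT_comp => //; exact: measurable_fst.
 apply: measurable_funB; first by apply: measurableT_comp => //; exact: measurable_snd.
 by apply: (measurableT_comp ml); exact: measurable_fst.
apply: eq_integral => p _; rewrite /f3 /=; congr (f _).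
set v1 := p.1 + _.
have c2 : 0 < c ^+ 2 by rewrite lt_neqAle sqr_ge0 eq_sym sqrf_eq0 c0.
have v2 : 0 < 1 + v1 ^+ 2 by rewrite ltr_pwDl ?sqr_ge0.
have qE : mobius_q g p = c ^+ 2 * expR p.2 ^+ 2 * (1 + v1 ^+ 2).
 rewrite /mobius_q /v1 -/c -/d expRN; field.
 by rewrite c0 gt_eqF ?expR_gt0.
have lnqE : ln (mobius_q g p) = ln (c ^+ 2) + p.2 *+ 2 + ln (1 + v1 ^+ 2).
 by apply: expR_inj; rewrite mulr2n !expRD !lnK ?posrE ?mobius_q_gt0// qE -expr2.
rewrite /hact; congr pair; last by rewrite lnqE; lra.
rewrite !opprD !opprK !expRD !lnK// /v1 expRN -/a -/b -/c -/d.
have e0 : expR p.2 != 0 by rewrite gt_eqF ?expR_gt0.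
have bE : b = (a * d - 1) / c by rewrite -[X in _ - X]d1 -/a -/b -/c -/d opprB addrCA subrr addr0 mulfK.
by rewrite bE; field; rewrite e0 c0.
Qed.

End MobiusAction.

(** * Finiteness properties of discrete subgroups *)

Section DiscreteGroups.
Context {R : realType}.
Implicit Types (g h : 'M[R]_2) (G : set 'M[R]_2) (p : R * R).

Lemma finite_set_injective_image T U (A : set T) (f : T -> U) (B : set U) :
 {in A &, injective f} -> f @` A `<=` B -> finite_set B -> finite_set A.
Proof.
move=> injf fAB /(sub_finite_set fAB) fin.
have [->//|/set0P[a0 Aa0]] := eqVneq A set0.
have /choice[k kP] : forall y, exists x, (f @` A) y -> A x /\ f x = y.
 move=> y; have [[x Ax <-]|ny] := pselect ((f @` A) y); first by exists x.
 by exists a0 => /ny.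
apply: sub_finite_set (finite_image k fin) => x Ax /=.
exists (f x); first by exists x.
have [|kA kE] := kP (f x); first by exists x.
by apply: injf => //; exact: mem_set.
Qed.

(** The adjugate, hence the inverse in determinant 1. Its entries are those of [g] up to sign and
    order, so entry bounds carry over. *)
Definition inv2 g : 'M[R]_2 := \matrix_(i, j)
 (if i == 0 then (if j == 0 then g 1 1 else - g 0 1)
 else (if j == 0 then - g 1 0 else g 0 0)).

Lemma mulmx_inv2 g : \det g = 1 -> g *m inv2 g = 1%:M.
Proof.
rewrite det_mx2 => d; apply: mx2P; rewrite mulmx2E !mxE /=.
- by rewrite -[RHS]d mulrN.
- by rewrite mulrN mulrC addNr.
- by rewrite mulrN mulrC addrN.
- by rewrite -[RHS]d mulrN addrC mulrC [X in _ - X]mulrC.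
Qed.

Lemma invmx_inv2 g : \det g = 1 -> invmx g = inv2 g.
Proof.
move=> d; have u : g \in unitmx by rewrite unitmxE d unitr1.
by rewrite -[RHS](mulKmx u) mulmx_inv2// mulmx1.
Qed.

Lemma det_inv2 g : \det (inv2 g) = \det g.
Proof. by rewrite !det_mx2 !mxE /=; ring. Qed.

Lemma inv2_le M g : (forall i j, `|g i j| <= M) -> forall i j, `|inv2 g i j| <= M.
Proof. by move=> gM; apply: ord2P; apply: ord2P; rewrite !mxE /= ?normrN. Qed.

Section Group.
Variable G : set 'M[R]_2.
Hypotheses (subG : psl2_subgroup G) (discG : discrete_subgroup G).

Lemma psl2_det g : G g -> \det g = 1. Proof. by case: subG => + _ _ _; exact. Qed.
Lemma psl2N1 : G (- 1%:M). Proof. by case: subG. Qed.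
Lemma psl2M g h : G g -> G h -> G (g *m h). Proof. by case: subG => _ _ + _; exact. Qed.
Lemma psl2V g : G g -> G (inv2 g).
Proof. by move=> Gg; rewrite -invmx_inv2 ?psl2_det//; case: subG => _ _ _; exact. Qed.
Lemma psl2_1 : G 1%:M.
Proof.
rewrite (_ : 1%:M = (- 1%:M) *m (- 1%:M)); first by apply: psl2M; exact: psl2N1.
by rewrite mulNmx mulmxN opprK mul1mx.
Qed.
Lemma psl2N g : G g -> G (- g).
Proof. by move=> Gg; rewrite -[g]mul1mx -mulNmx; apply: psl2M => //; exact: psl2N1. Qed.

Lemma discrete_near1 : exists2 e : R, 0 < e &
 forall g, G g -> (forall i j, `|g i j - 1%:M i j| < e) -> g = 1%:M.
Proof.
have [_ [V /nbhs_ballP[e /= e0 eV] VG]] := discG psl2_1.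
exists e => // g Gg ge.
have : (V `&` G) g.
 split => //; apply: eV; split => // i j; rewrite /ball/= distrC; exact: ge.
by rewrite VG.
Qed.

(** Pigeonhole: the entries are sorted into cells of width [d]. Two elements in the same cells have
    g h^-1 - 1 = (g - h) h^-1 so small that discreteness at the identity gives g = h. *)
Lemma finite_bounded (M : R) : finite_set [set g | G g /\ forall i j, `|g i j| <= M].
Proof.
have [e e0 He] := discrete_near1.
pose M' : R := `|M| + 1; have M0 : 0 < M' by rewrite ltr_wpDl.
(* An entry of (g - h) h^-1 is at most 2 d M' = 2 e / 3 < e. *)
pose d := e / (M' *+ 3); have d0 : 0 < d by rewrite divr_gt0// pmulrn_rgt0.
pose tr (x : R) := Num.trunc ((x + M') / d).
pose f g := ((tr (g 0 0), tr (g 0 1)), (tr (g 1 0), tr (g 1 1))).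
pose N := (Num.trunc (M' *+ 2 / d)).+1.
have trE x y : `|x| <= M -> `|y| <= M -> tr x = tr y -> `|x - y| < d.
 have pos z : `|z| <= M -> 0 <= (z + M') / d.
 move=> zM; rewrite divr_ge0 ?(ltW d0)// /M'.
 have := lerNnormlW zM; have := ler_norm M; lra.
 move=> /pos/truncn_itv /andP[]; rewrite -/(tr x) => + + /pos/truncn_itv /andP[].
 rewrite -/(tr y) => + + + + E; rewrite E -natr1.
 rewrite !ler_pdivlMr// !ltr_pdivrMr// => h1 h2 h3 h4.
 rewrite ltr_norml; apply/andP; split; move: h1 h2 h3 h4; rewrite mulrDl mul1r; lra.
apply: (@finite_set_injective_image _ _ _ f ((`I_N `*` `I_N) `*` (`I_N `*` `I_N))).
- move=> g h /set_mem[Gg gM] /set_mem[Gh hM] [E1 E2 E3 E4].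
 suff E : g *m inv2 h = 1%:M.
 have u : inv2 h \in unitmx by rewrite unitmxE det_inv2 psl2_det// unitr1.
 have E' : h *m inv2 h = 1%:M by apply: mulmx_inv2; exact: psl2_det.
 by rewrite -[g](mulmxK u) E -E' mulmxK.
 apply: He; first by apply: psl2M => //; exact: psl2V.
 move=> i j; rewrite -(mulmx_inv2 (psl2_det Gh)) !mulmx2E.
 have gh k l : `|g k l - h k l| < d.
 by move: k l; apply: ord2P; apply: ord2P; apply: trE.
 have iM := inv2_le hM.
 rewrite (_ : _ - _ = (g i 0 - h i 0) * inv2 h 0 j + (g i 1 - h i 1) * inv2 h 1 j); last by ring.
 apply: le_lt_trans (ler_normD _ _) _; rewrite !normrM.
 apply: (@le_lt_trans _ _ (d * M' + d * M')).
 have MM' : M <= M' by rewrite /M' (le_trans (ler_norm M))// lerDl.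
 by apply: lerD; apply: ler_pM => //; rewrite ?(ltW (gh _ _))// (le_trans (iM _ _)).
 rewrite (_ : _ + _ = e * (2 / 3)); first by lra.
 by rewrite /d -mulr_natl; field; rewrite gt_eqF.
- move=> _ [g [Gg gM] <-] /=.
 have H x : `|x| <= M -> (tr x < N)%N.
 move=> xM; rewrite /N ltnS /tr; apply: le_truncn; rewrite ler_pM2r ?invr_gt0// mulr2n.
 by rewrite lerD2r /M' (le_trans (ler_norm x))// (le_trans xM)// (le_trans (ler_norm M))// lerDl.
 by split; split; rewrite /=; exact: H.
- by apply: finite_setX; apply: finite_setX; exact: finite_II.
Qed.

Lemma countable_psl2 : countable G.
Proof.
rewrite (_ : G = \bigcup_(n : nat) [set g | G g /\ forall i j, `|g i j| <= n%:R]).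
 by apply: bigcup_countable => // n _; apply: finite_set_countable; exact: finite_bounded.
apply/seteqP; split=> [g Gg|g [n _ []//]].
pose S := `|g 0 0| + `|g 0 1| + `|g 1 0| + `|g 1 1|.
exists (Num.trunc S).+1 => //; split=> //.
have SN := ltW (truncnS_gt S).
have := normr_ge0 (g 0 0); have := normr_ge0 (g 0 1).
have := normr_ge0 (g 1 0); have := normr_ge0 (g 1 1).
by move=> ? ? ? ?; apply: ord2P; apply: ord2P; apply: le_trans SN; rewrite /S; lra.
Qed.

Lemma ler_norm_of_sqr (x y : R) : 0 <= y -> x ^+ 2 <= y ^+ 2 -> `|x| <= y.
Proof. by move=> y0; rewrite -[x ^+ 2]real_normK ?num_real// ler_sqr ?nnegrE. Qed.

(** The height of g p is t - ln |c z + d|^2, so a lower bound for it bounds |c z + d|; the imaginary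
    part then bounds c and the real part bounds d. *)
Lemma hact_row_bound (A T : R) g p : \det g = 1 -> `|p.1| <= A -> `|p.2| <= T -> - T <= (hact g p).2 ->
 `|g 1 0| <= expR (T * 3) * (1 + A) /\ `|g 1 1| <= expR (T * 3) * (1 + A).
Proof.
move=> g1 pA pT hT; have q0 := mobius_q_gt0 p g1.
have A0 : 0 <= A by exact: le_trans pA.
have T0 : 0 <= T by exact: le_trans pT.
have /andP[pT1 pT2] : - T <= p.2 <= T by rewrite -ler_norml.
have q2 : mobius_q g p <= expR T ^+ 2.
 rewrite -[leLHS]lnK// -expRM_natr ler_expR; move: hT; rewrite /hact /=; lra.
have ET : 1 <= expR T by rewrite -expR0 ler_expR.
have E3 : expR (T * 3) = expR T ^+ 3 by rewrite expRM_natr.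
have cE : `|g 1 0 * expR p.2| <= expR T.
 apply: ler_norm_of_sqr; first exact: expR_ge0.
 by apply: le_trans q2; rewrite /mobius_q lerDr sqr_ge0.
have dE : `|g 1 0 * (p.1 * expR p.2) + g 1 1| <= expR T.
 apply: ler_norm_of_sqr; first exact: expR_ge0.
 by apply: le_trans q2; rewrite /mobius_q lerDl sqr_ge0.
have cB : `|g 1 0| <= expR T ^+ 2.
 rewrite (_ : g 1 0 = g 1 0 * expR p.2 * expR (- p.2)); last first.
 by rewrite -mulrA -expRD addrN expR0 mulr1.
 rewrite normrM expr2 ler_pM// gtr0_norm ?expR_gt0// ler_expR; lra.
have T3 : expR T ^+ 2 <= expR T ^+ 3 by exact: ler_weXn2l.
have T1 : expR T <= expR T ^+ 3 by rewrite -[leLHS]expr1; exact: ler_weXn2l.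
split.
 rewrite E3; apply: (le_trans cB); apply: (le_trans T3).
 by rewrite ler_peMr ?lerDl// exprn_ge0// expR_ge0.
have dB : `|g 1 1| <= expR T + expR T * A.
 rewrite (_ : g 1 1 = (g 1 0 * (p.1 * expR p.2) + g 1 1) - (g 1 0 * expR p.2) * p.1); last by ring.
 by apply: le_trans (ler_normB _ _) _; rewrite lerD// normrM ler_pM.
rewrite E3 mulrDr mulr1; apply: (le_trans dB); rewrite lerD//.
by rewrite ler_wpM2r.
Qed.

Definition rot2 : 'M[R]_2 := \matrix_(i, j)
 (if i == 0 then (if j == 0 then 0 else -1) else (if j == 0 then 1 else 0)).

(** The previous bound controls the bottom row of g. The top row of g is the bottom row of
    [rot2 *m g], that is, of g followed by z -> - 1 / z, so the same bound applies to it. *)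
Lemma finite_return (A T : R) : finite_set [set g | G g /\ exists p,
 [/\ `|p.1| <= A, `|p.2| <= T, `|(hact g p).1| <= A & `|(hact g p).2| <= T]].
Proof.
(* The map z -> - 1 / z sends t to - t - ln (1 + v^2), which is at least - T - A^2. *)
pose T1 := T * 3 + A ^+ 2.
apply: sub_finite_set (finite_bounded (expR (T1 * 3) * (1 + A))) => g [Gg [p [p1 p2 h1 h2]]].
split => //; have g1 := psl2_det Gg.
have T0 : 0 <= T by exact: le_trans p2.
have A0 : 0 <= A by exact: le_trans p1.
have TT : T <= T1 by rewrite /T1; have := sqr_ge0 A; lra.
have [c d] : `|g 1 0| <= expR (T1 * 3) * (1 + A) /\ `|g 1 1| <= expR (T1 * 3) * (1 + A).
 apply: (hact_row_bound g1 p1 (le_trans p2 TT)).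
 by move: h2; rewrite ler_norml => /andP[h2 _]; apply: le_trans h2; rewrite lerN2.
have S1 : \det rot2 = 1 by rewrite det_mx2 !mxE /=; ring.
have Sg1 : \det (rot2 *m g) = 1 by rewrite det_mulmx S1 g1 mulr1.
have [] : `|(rot2 *m g) 1 0| <= expR (T1 * 3) * (1 + A) /\ `|(rot2 *m g) 1 1| <= expR (T1 * 3) * (1 + A).
 apply: (hact_row_bound Sg1 p1 (le_trans p2 TT)).
 rewrite hactM//; move: (hact g p) h1 h2 => -[v t] /= h1 h2.
 rewrite /hact /= /mobius_q /= !mxE /= addr0 !mul1r.
 have -> : (v * expR t) ^+ 2 + expR t ^+ 2 = expR t ^+ 2 * (1 + v ^+ 2) by ring.
 have v2 : v ^+ 2 <= A ^+ 2.
 by rewrite -[leLHS]real_normK ?num_real// ler_sqr ?nnegrE.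
 have v0 : 0 < 1 + v ^+ 2 by rewrite ltr_pwDl ?sqr_ge0.
 have : ln (1 + v ^+ 2) <= v ^+ 2.
 by apply: le_ln1Dx; have := sqr_ge0 v; lra.
 rewrite lnM ?posrE ?exprn_gt0 ?expR_gt0// -expRM_natr expRK /T1.
 move: h2; rewrite ler_norml => /andP[]; lra.
rewrite !mulmx2E !mxE /= !(mul1r, mul0r, addr0) => a b.
by apply: ord2P; apply: ord2P.
Qed.

End Group.
End DiscreteGroups.

(** * Unfolding an integral over a fundamental set to the whole plane *)

Section Unfolding.
Context {R : realType}.
Implicit Types (g h : 'M[R]_2) (p : R * R).
Local Notation plane := (planeT R).
Local Notation L := (leb2 R).
Variable G : set 'M[R]_2.
Hypotheses (subG : psl2_subgroup G) (discG : discrete_subgroup G).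
Variable e : nat -> 'M[R]_2.
Hypothesis bij_e : set_bij [set: nat] G e.
Variable F' : set (R * R).
Hypothesis mF' : measurable (F' : set plane).
Hypothesis fundF' : forall p, exists! w, F' w /\ exists2 g, G g & w = hact g p.

Let Ge n : G (e n). Proof. by case: bij_e => + _ _; apply. Qed.

Lemma hact_inv2K g p : G g -> hact (inv2 g) (hact g p) = p.
Proof.
move=> Gg; have g1 := psl2_det subG Gg.
rewrite -hactM ?det_inv2//.
have -> : inv2 g *m g = 1%:M.
 have u : g \in unitmx by rewrite unitmxE g1 unitr1.
 by rewrite -invmx_inv2// mulVmx.
exact: hact1.
Qed.

(** A fixed point is a root of c z^2 + (d - a) z - b, a real quadratic, which has at most one root
    in the upper half-plane; [key] holds the real and imaginary parts of the equation. *)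
Lemma hact_fixed_unique g p p' : \det g = 1 -> g <> 1%:M -> g <> - 1%:M ->
 hact g p = p -> hact g p' = p' -> p = p'.
Proof.
move=> g1 gn1 gnN1.
have key q : hact g q = q ->
 g 1 0 * ((q.1 * expR q.2) ^+ 2 - expR q.2 ^+ 2) + (g 1 1 - g 0 0) * (q.1 * expR q.2) - g 0 1 = 0
 /\ 2 * g 1 0 * (q.1 * expR q.2) + (g 1 1 - g 0 0) = 0.
 move=> hq; have := toC_mobius g (hpt q); rewrite mobius_hpt// hq => /eqP.
 have n0 := mobius_denom_neq0 g1 (hpt_gt0 q).
 rewrite eq_sym -(inj_eq (mulIf n0)) divfK// eq_complex /= => /andP[/eqP h1 /eqP h2].
 have E0 : expR q.2 != 0 by rewrite gt_eqF ?expR_gt0.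
 split; first by apply/eqP; rewrite -oppr_eq0; apply/eqP; move: h1; rewrite !mul0r; lra.
 by apply: (mulIf E0); rewrite mul0r; move: h2; rewrite !mul0r; lra.
move=> /key[h1 h2] /key[h1' h2'].
have d1 := g1; rewrite det_mx2 in d1.
have [c0|c0] := eqVneq (g 1 0) 0.
 exfalso; move: h2 h1; rewrite c0 mulr0 !mul0r !add0r => ad.
 rewrite ad mul0r add0r => /eqP; rewrite oppr_eq0 => /eqP b0.
 have {}ad : g 1 1 = g 0 0 by lra.
 have /eqP : g 0 0 ^+ 2 = 1 by rewrite expr2 -{2}ad -d1 c0 mulr0 subr0.
 rewrite sqrf_eq1 => /orP[/eqP a1|/eqP a1].
 by apply: gn1; apply: mx2P; rewrite !mxE //= ?ad ?a1.
 by apply: gnN1; apply: mx2P; rewrite !mxE //= ?ad ?a1 ?oppr0.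
have xE : p.1 * expR p.2 = p'.1 * expR p'.2.
 by apply: (mulfI c0); lra.
have EE : expR p.2 ^+ 2 = expR p'.2 ^+ 2.
 by apply: (mulfI c0); rewrite xE in h1; lra.
apply: hpt_inj; rewrite /hpt xE; congr (_, _).
by apply/eqP; rewrite -(eqrXn2 (n := 2)) ?expR_ge0// EE.
Qed.

(** Each element other than 1 and - 1 fixes at most one point, and the group is countable. *)
Lemma hact_fixed_null : {ae L, forall p, forall g, G g -> g <> 1%:M -> g <> - 1%:M -> hact g p <> p}.
Proof.
pose Fx n : set plane := [set p | e n <> 1%:M /\ e n <> - 1%:M /\ hact (e n) p = p].
have nFx n : L.-negligible (Fx n).
 have [->|/set0P[p0 Fp0]] := eqVneq (Fx n) set0; first exact: negligible_set0.
 exists ([set p0.1] `*` [set p0.2]); split.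
 - by apply: measurableX; exact: measurable_set1.
 - rewrite product_measure1E; [|exact: measurable_set1..].
 by rewrite [X in (X * _)%E]lebesgue_measure_set1 mul0e.
 move=> p [n1 [nN1 hp]]; case: Fp0 => _ [_ hp0].
 by rewrite (hact_fixed_unique (psl2_det subG (Ge n)) n1 nN1 hp hp0).
have := negligible_bigcup nFx; apply: negligibleS => p /= /existsNP[g].
move=> /not_implyP[Gg /not_implyP[g1 /not_implyP[gN1 /contrapT hp]]].
have [_ _ /(_ g Gg)[n _ en]] := bij_e.
by exists n => //; rewrite /Fx/= en.
Qed.

Lemma nneseries_psl2 (f : 'M[R]_2 -> \bar R) : (forall g, (0 <= f g)%E) ->
 (\sum_(n <oo) f (e n) = \esum_(g in G) f g)%E.
Proof. by move=> f0; rewrite nneseries_esumT// -(reindex_esum _ G e). Qed.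

Lemma esum_psl2_Mr h (f : 'M[R]_2 -> \bar R) : G h ->
 (\esum_(g in G) f (g *m h) = \esum_(g in G) f g)%E.
Proof.
move=> Gh; rewrite [RHS](reindex_esum G G (fun g => g *m h))//; split.
- by move=> g Gg; exact: psl2M.
- move=> g g' _ _ /(congr1 (fun x => x *m inv2 h)).
 by rewrite -!mulmxA mulmx_inv2 ?mulmx1// (psl2_det subG).
- move=> g Gg; exists (g *m inv2 h); first by apply: psl2M => //; exact: psl2V.
 have u : h \in unitmx by rewrite unitmxE (psl2_det subG Gh) unitr1.
 by rewrite -(invmx_inv2 (psl2_det subG Gh)) mulmxKV.
Qed.

Lemma inv2K g : inv2 (inv2 g) = g.
Proof. by apply: mx2P; rewrite !mxE /= ?opprK. Qed.

Lemma esum_psl2_V (f : 'M[R]_2 -> \bar R) :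
 (\esum_(g in G) f (inv2 g) = \esum_(g in G) f g)%E.
Proof.
rewrite [RHS](reindex_esum G G inv2)//; split.
- by move=> g Gg; exact: psl2V.
- by move=> g g' _ _ /(congr1 inv2); rewrite !inv2K.
- by move=> g Gg; exists (inv2 g); [exact: psl2V|exact: inv2K].
Qed.

Lemma psl2_neqN g : G g -> g <> - g.
Proof.
move=> /(psl2_det subG) g1 gN; move: g1; rewrite det_mx2.
have E i j : g i j = 0.
 by have := congr1 (fun M : 'M[R]_2 => M i j) gN; rewrite mxE => H; lra.
by rewrite !E mul0r subr0 => /esym/eqP; rewrite oner_eq0.
Qed.

(** At a point with trivial stabilizer exactly g and - g lead into the fundamental set. *)
Lemma esum_fundamental p :
 (forall g, G g -> g <> 1%:M -> g <> - 1%:M -> hact g p <> p) ->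
 (\esum_(g in G) (\1_F' (hact g p))%:E = 2%:E :> \bar R)%E.
Proof.
move=> free; have [w [[F'w [g0 Gg0 wE]] uw]] := fundF' p.
have E g : G g -> F' (hact g p) -> g = g0 \/ g = - g0.
 move=> Gg F'g; have gw : hact g p = hact g0 p.
 by rewrite -wE; apply/esym/uw; split => //; exists g.
 have hp : hact (inv2 g0 *m g) p = p.
 by rewrite hactM ?det_inv2 ?(psl2_det subG)// gw hact_inv2K.
 have G' : G (inv2 g0 *m g) by apply: psl2M => //; exact: psl2V.
 have u : g0 \in unitmx by rewrite unitmxE (psl2_det subG Gg0) unitr1.
 have [h1|h1] := pselect (inv2 g0 *m g = 1%:M).
 by left; rewrite -[g](mulKVmx u) invmx_inv2 ?(psl2_det subG)// h1 mulmx1.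
 have [h2|h2] := pselect (inv2 g0 *m g = - 1%:M).
 by right; rewrite -[g](mulKVmx u) invmx_inv2 ?(psl2_det subG)// h2 mulmxN mulmx1.
 by have := free _ G' h1 h2.
have -> : (\esum_(g in G) (\1_F' (hact g p))%:E = \esum_(g in [set g0; (- g0)%R]) (1 : \bar R))%E.
 rewrite [RHS]esum_mkcond [LHS]esum_mkcond; apply: eq_esum => g _.
 case: ifPn => [/set_mem Gg|/negP nGg].
 rewrite indicE; case: (pselect (F' (hact g p))) => [F'g|nF'].
 by rewrite (mem_set F'g) ifT//; apply: mem_set; exact: E.
 rewrite (memNset nF') ifF//; apply/negbTE/negP => /set_mem[] gE; apply: nF'; rewrite gE ?hactN -wE//.
 rewrite ifF//; apply/negbTE/negP => /set_mem[] gE; apply: nGg; apply: mem_set; rewrite gE//.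
 exact: psl2N.
have fin : finite_set [set g0; - g0] by exact: finite_set2.
rewrite esum_fset// fsbigU0//=.
- by rewrite !fsbig_set1 -EFinD.
- by move=> g [/= -> /(psl2_neqN Gg0)].
Qed.

(** Moving the n-th term by [e n] replaces F' by one of its translates; almost everywhere the
    indicators of all translates add up to 2. *)
Lemma poincare_unfolding (f phi : plane -> R) :
 mfun f -> (forall p, 0 <= f p) ->
 mfun phi -> (forall p, 0 <= phi p) ->
 (forall g p, G g -> phi (hact g p) = phi p) ->
 (\int[L]_(p in F') ((\sum_(n <oo) (f (hact (e n) p))%:E) * (phi p)%:E) =
 2%:E * \int[L]_p (f p * phi p)%:E)%E.
Proof.
move=> mf f0 mphi phi0 iphi.
have m1 n : mfun (fun p : plane => \1_F' (hact (inv2 (e n)) p) : R).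
 apply: (measurableT_comp (f := \1_F' : plane -> R)); first exact: measurable_indic.
 exact: measurable_hact.
have m2 : mfun (fun p : plane => f p * phi p) by exact: measurable_funM.
have fphi0 p : 0 <= f p * phi p by rewrite mulr_ge0.
have m3 n : mfun (fun p : plane => ((f p * phi p) * \1_F' (hact (inv2 (e n)) p))%:E).
 by apply/measurable_EFinP; exact: measurable_funM.
have i0 n p : 0 <= (f p * phi p) * \1_F' (hact (inv2 (e n)) p) by rewrite mulr_ge0.
transitivity (\int[L]_(p in F') (\sum_(n <oo) (f (hact (e n) p) * phi (hact (e n) p))%:E))%E.
 apply: eq_integral => p _; rewrite muleC -nneseriesZl//.
 by apply: eq_eseriesr => n _; rewrite -EFinM iphi// mulrC.
 by move=> n _; rewrite lee_fin.
rewrite integral_nneseries//; last 2 first.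
- move=> n; apply: measurable_funTS; apply/measurable_EFinP; apply: (measurableT_comp m2).
 exact: measurable_hact.
- by move=> n p _; rewrite lee_fin.
transitivity (\sum_(n <oo) \int[L]_p ((f p * phi p) * \1_F' (hact (inv2 (e n)) p))%:E)%E.
 apply: eq_eseriesr => n _.
 rewrite -(ge0_integral_hact (psl2_det subG (Ge n)))//; last by move=> z; rewrite lee_fin.
 rewrite integral_mkcond; apply: eq_integral => p _.
 rewrite hact_inv2K// patchE indicE; case: (_ \in _) => /=; first by rewrite mulr1.
 by rewrite mulr0.
rewrite -integral_nneseries//; last by move=> n p _; rewrite lee_fin.
rewrite -ge0_integralZl//; last 2 first.
- exact/measurable_EFinP.
- by move=> p _; rewrite lee_fin.
apply: ae_eq_integral => //.
- by apply: ge0_emeasurable_sum => [n p _ _|n _] //; rewrite lee_fin.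
- by apply: emeasurable_funM => //; exact/measurable_EFinP.
apply: negligibleS hact_fixed_null => p; apply: contra_not => free _.
under eq_eseriesr do rewrite EFinM.
rewrite nneseriesZl//.
rewrite muleC; congr (_ * _)%E.
rewrite (nneseries_psl2 (f := fun g => (\1_F' (hact (inv2 g) p))%:E))//.
by rewrite (esum_psl2_V (fun g => (\1_F' (hact g p))%:E)) esum_fundamental.
Qed.

End Unfolding.

(** * Parseval's identity for an orthonormal system that is complete among invariant functions *)

Section Parseval.
Context d (T : measurableType d) (R : realType) (mu : {measure set T -> \bar R}).
Context (D : set T) (mD : measurable D).
Implicit Types f g h : T -> R.

Definition L2 f := mfun f /\ (\int[mu]_(x in D) (f x ^+ 2)%:E < +oo)%E.
Definition ip f g := (\int[mu]_(x in D) (f x * g x))%R.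

Let sq_integrable f : L2 f -> mu.-integrable D (EFin \o (fun x => f x ^+ 2)).
Proof.
move=> [mf f2]; apply/integrableP; split.
 by apply/measurable_EFinP/measurable_funX/measurable_funTS.
by under eq_integral do rewrite /= ger0_norm ?sqr_ge0//.
Qed.

Lemma L2_integrableM f g : L2 f -> L2 g -> mu.-integrable D (EFin \o (fun x => f x * g x)).
Proof.
move=> Lf Lg; have := integrableD mD (sq_integrable Lf) (sq_integrable Lg).
apply: le_integrable => //.
 by apply/measurable_EFinP/measurable_funM; apply: measurable_funTS; [case: Lf|case: Lg].
move=> x _ /=; rewrite lee_fin [leRHS]ger0_norm ?addr_ge0 ?sqr_ge0//.
rewrite ler_norml; apply/andP; split.
 by have := sqr_ge0 (f x + g x); have := sqr_ge0 (f x); have := sqr_ge0 (g x); rewrite !expr2; nra.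
by have := sqr_ge0 (f x - g x); have := sqr_ge0 (f x); have := sqr_ge0 (g x); rewrite !expr2; nra.
Qed.

Lemma L2D f g : L2 f -> L2 g -> L2 (fun x => f x + g x).
Proof.
move=> Lf Lg; split; first by apply: measurable_funD; [case: Lf|case: Lg].
have := integrableD mD (integrableD mD (sq_integrable Lf) (sq_integrable Lf))
 (integrableD mD (sq_integrable Lg) (sq_integrable Lg)).
move=> /integrableP[_]; apply: le_lt_trans; apply: ge0_le_integral => //.
- by move=> x _; rewrite lee_fin sqr_ge0.
- by apply/measurable_EFinP/measurable_funX/measurable_funTS/measurable_funD; [case: Lf|case: Lg].
- apply: measurableT_comp => //; apply/measurable_EFinP.
 do 2 apply: measurable_funD; apply: measurable_funX; apply: measurable_funTS; by [case: Lf|case: Lg].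
move=> x _ /=; rewrite lee_fin ger0_norm ?addr_ge0 ?sqr_ge0//.
by have := sqr_ge0 (f x - g x); rewrite !expr2; nra.
Qed.

Lemma L2Z (k : R) f : L2 f -> L2 (fun x => k * f x).
Proof.
move=> Lf; split; first by apply: measurable_funM => //; case: Lf.
have := integrableZl mD (k ^+ 2) (sq_integrable Lf).
move=> /integrableP[_]; apply: le_lt_trans; apply: ge0_le_integral => //.
- by move=> x _; rewrite lee_fin sqr_ge0.
- by apply/measurable_EFinP/measurable_funX/measurable_funTS/measurable_funM => //; case: Lf.
- apply: measurableT_comp => //; apply/measurable_EFinP.
 by apply: measurable_funM => //; apply/measurable_funX/measurable_funTS; case: Lf.
move=> x _ /=; rewrite lee_fin exprMn ler_norm//.
Qed.

Lemma L2_0 : L2 (fun=> 0).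
Proof. by split => //; rewrite integral0_eq// => x _; rewrite expr0n. Qed.

Lemma L2_sum n (F : nat -> T -> R) : (forall j, L2 (F j)) -> L2 (fun x => \sum_(j < n) F j x).
Proof.
move=> LF; elim: n => [|n IH].
 by under eq_fun do rewrite big_ord0; exact: L2_0.
by under eq_fun do rewrite big_ord_recr; exact: L2D.
Qed.

Lemma ipC f g : ip f g = ip g f.
Proof. by apply: eq_Rintegral => x _; rewrite mulrC. Qed.

Lemma ipDl f g h : L2 f -> L2 g -> L2 h -> ip (fun x => f x + g x) h = ip f h + ip g h.
Proof.
move=> Lf Lg Lh; rewrite /ip -RintegralD//; try exact: L2_integrableM.
by apply: eq_Rintegral => x _; rewrite mulrDl.
Qed.

Lemma ipZl (k : R) f h : L2 f -> L2 h -> ip (fun x => k * f x) h = k * ip f h.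
Proof.
move=> Lf Lh; rewrite /ip -RintegralZl//; try exact: L2_integrableM.
by apply: eq_Rintegral => x _; rewrite mulrA.
Qed.

Lemma ip0l h : ip (fun=> 0) h = 0.
Proof. by rewrite /ip /Rintegral integral0_eq// => x _; rewrite mul0r. Qed.

Lemma ip_suml n (F : nat -> T -> R) h : (forall j, L2 (F j)) -> L2 h ->
 ip (fun x => \sum_(j < n) F j x) h = \sum_(j < n) ip (F j) h.
Proof.
move=> LF Lh; elim: n => [|n IH].
 by under eq_fun do rewrite big_ord0; rewrite big_ord0; exact: ip0l.
under eq_fun do rewrite big_ord_recr.
by rewrite big_ord_recr/= ipDl ?IH//; exact: L2_sum.
Qed.

Lemma ip_ge0 f : 0 <= ip f f.
Proof. by apply: Rintegral_ge0 => x _; rewrite -expr2 sqr_ge0. Qed.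

Lemma integral_sqE f : L2 f -> (\int[mu]_(x in D) (f x ^+ 2)%:E = (ip f f)%:E)%E.
Proof.
move=> Lf; rewrite /ip /Rintegral fineK.
 by apply: eq_integral => x _; rewrite expr2.
by apply: integrable_fin_num => //; exact: L2_integrableM.
Qed.

(* AM-GM in place of the Cauchy-Schwarz inequality *)
Lemma ip_le (c : R) f g : 0 < c -> L2 f -> L2 g -> `|ip f g| <= c * ip f f + c^-1 * ip g g.
Proof.
move=> c0 Lf Lg.
have H k : `|k| = 1 -> 0 <= c * ip f f + c^-1 * ip g g - k * ip f g.
 move=> k1; have k2 : k ^+ 2 = 1 by rewrite -real_normK ?num_real// k1 expr1n.
 have Lk : L2 (fun x => (- (k / 2 / c)) * g x) by exact: L2Z.
 have := ip_ge0 (fun x => f x + (- (k / 2 / c)) * g x).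
 rewrite ipDl//; last exact: L2D.
 rewrite ![ip _ (fun x => f x + _)]ipC !ipDl// !ipZl// ![ip _ (fun x => _ * g x)]ipC !ipZl// (ipC g f).
 have := ip_ge0 f; have := ip_ge0 g.
 move: (ip f f) (ip f g) (ip g g) => A B C C0 A0 H.
 have {}H : 0 <= A - k / c * B + k ^+ 2 / 4 / c ^+ 2 * C.
 by move: H; rewrite (_ : _ + _ = A - k / c * B + k ^+ 2 / 4 / c ^+ 2 * C)//; field; rewrite gt_eqF.
 have := mulr_ge0 (ltW c0) H; rewrite k2.
 rewrite [X in 0 <= X -> _](_ : _ = c * A - k * B + c^-1 * C / 4); last by field; rewrite gt_eqF.
 have : 0 <= c^-1 * C by rewrite mulr_ge0// invr_ge0 ltW.
 lra.
rewrite ler_norml; have := H 1 (normr1 _); have := H (-1); rewrite normrN normr1 => /(_ erefl).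
by lra.
Qed.

Section Orthonormal.
Variable e : nat -> T -> R.
Hypotheses (Le : forall j, L2 (e j)) (on : forall i j, ip (e i) (e j) = (i == j)%:R).

Definition comb n (b : nat -> R) := fun x => \sum_(j < n) b j * e j x.

Lemma L2_comb n b : L2 (comb n b).
Proof. by apply: (@L2_sum n (fun j x => b j * e j x)) => j; exact: L2Z. Qed.

Lemma ip_comb n b h : L2 h -> ip (comb n b) h = \sum_(j < n) b j * ip h (e j).
Proof.
move=> Lh; rewrite (@ip_suml n (fun j x => b j * e j x))//; last by move=> j; exact: L2Z.
by apply: eq_bigr => j _; rewrite ipZl// ipC.
Qed.

Lemma ip_comb_e n b (j : nat) : ip (comb n b) (e j) = if (j < n)%N then b j else 0.
Proof.
rewrite ip_comb//; under eq_bigr do rewrite on.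
have [jn|nj] := ltnP j n.
 rewrite (bigD1 (Ordinal jn))//= eqxx mulr1 big1 ?addr0// => i ij.
 by rewrite eq_sym (negbTE (_ : (i : nat) != j)) ?mulr0.
by rewrite big1// => i _; rewrite gtn_eqF ?mulr0// (leq_trans (ltn_ord i)).
Qed.

Lemma ip_comb2 n b : ip (comb n b) (comb n b) = \sum_(j < n) b j ^+ 2.
Proof.
rewrite ip_comb; last exact: L2_comb.
by apply: eq_bigr => j _; rewrite ip_comb_e ltn_ord expr2.
Qed.

Lemma bessel n f : L2 f -> \sum_(j < n) ip f (e j) ^+ 2 <= ip f f.
Proof.
move=> Lf; pose b j := ip f (e j); have Lb := L2_comb n b.
have Lnb : L2 (fun x => (-1) * comb n b x) by exact: L2Z.
have := ip_ge0 (fun x => f x + (-1) * comb n b x).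
rewrite ipDl//; last exact: L2D.
rewrite ![ip _ (fun x => f x + _)]ipC !ipDl// !ipZl// ![ip _ (fun x => _ * comb n b x)]ipC !ipZl//.
rewrite ip_comb2 !ip_comb//.
under [X in -1 * X]eq_bigr do rewrite -expr2.
by rewrite /b; lra.
Qed.


Lemma bessel_cvg f : L2 f -> cvgn (series (fun j => ip f (e j) ^+ 2)).
Proof.
move=> Lf; apply: nondecreasing_is_cvgn.
 by apply: nondecreasing_series => n _ _; exact: sqr_ge0.
exists (ip f f) => _ [n _ <-]; rewrite seriesEord; exact: bessel.
Qed.

Lemma bessel_tail f (c : R) : L2 f -> 0 < c ->
 exists N, forall p q, (N <= p)%N -> (p <= q)%N ->
 ip (comb q (fun j => if (p <= j)%N then ip f (e j) else 0))
 (comb q (fun j => if (p <= j)%N then ip f (e j) else 0)) <= c.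
Proof.
move=> Lf c0; pose u := series (fun j => ip f (e j) ^+ 2).
have /cvgrPdist_le/(_ _ c0)[N _ HN] : u n @[n --> \oo] --> limn u by exact: bessel_cvg.
exists N => p q Np pq; rewrite ip_comb2.
have ul n : u n <= limn u.
 apply: nondecreasing_cvgn_le; last exact: bessel_cvg.
 by apply: nondecreasing_series => ? _ _; exact: sqr_ge0.
have := HN p Np; rewrite ger0_norm ?subr_ge0//; apply: le_trans.
rewrite lerBrDr; apply: le_trans (ul q).
rewrite {2}/u seriesEord (eq_bigr (fun j : 'I_q => if (p <= j)%N then ip f (e j) ^+ 2 else 0)); last first.
 by move=> j _; case: ifP => // _; rewrite expr0n.
rewrite -big_mkcond/= /u /series /= [X in _ + X](_ : _ = \sum_(0 <= j < p) ip f (e j) ^+ 2)//.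
rewrite [leRHS](bigID (fun j : 'I_q => (p <= j)%N))/= lerD2l.
rewrite big_mkord -(big_ord_narrow_cond (P := predT) pq (F := fun j => ip f (e j) ^+ 2))/=.
by under [leRHS]eq_bigl do rewrite -ltnNge.
Qed.

(** The function sum_k 4^k (t_(k+1) - t_k)^2 has integral at most sum_k 4^-k, so it is finite almost
    everywhere, and there the increments are O(2^-k). *)
Lemma ae_cvg_subseq (t : nat -> T -> R) : (forall k, mfun (t k)) ->
 (forall k, \int[mu]_(x in D) ((t k.+1 x - t k x) ^+ 2)%:E <= ((16 ^+ k)^-1)%:E)%E ->
 {ae mu, forall x, D x -> cvgn (t ^~ x)}.
Proof.
move=> mt tle.
pose B x := (\sum_(k <oo) (4 ^+ k * (t k.+1 x - t k x) ^+ 2)%:E)%E.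
have mB k : measurable_fun D (fun x => (4 ^+ k * (t k.+1 x - t k x) ^+ 2)%:E).
 apply/measurable_EFinP/measurable_funM => //; apply: measurable_funX.
 by apply: measurable_funB; exact: measurable_funTS.
have B0 k x : D x -> (0 <= (4 ^+ k * (t k.+1 x - t k x) ^+ 2)%:E)%E.
 by move=> _; rewrite lee_fin mulr_ge0 ?sqr_ge0// exprn_ge0.
have mBB : measurable_fun D B by apply: ge0_emeasurable_sum => // k x Dx _; exact: B0.
have iB : mu.-integrable D B.
 apply/integrableP; split => //.
 rewrite (eq_integral B); last by move=> x /set_mem Dx; rewrite gee0_abs// nneseries_ge0// => k _ _; exact: B0.
 rewrite integral_nneseries//.
 apply: (@le_lt_trans _ _ (\sum_(k <oo) (((1 / 4) ^+ k)%:E : \bar R))%E).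
 apply: lee_nneseries => [k _ _|k _]; first by apply: integral_ge0 => x Dx; exact: B0.
 under eq_integral do rewrite EFinM.
 rewrite ge0_integralZl_EFin//; last 2 first.
 - by move=> x _; rewrite lee_fin sqr_ge0.
 - by apply/measurable_EFinP/measurable_funX/measurable_funB; exact: measurable_funTS.
 apply: (le_trans (lee_wpmul2l _ (tle k))); first by rewrite lee_fin exprn_ge0.
 rewrite -EFinM lee_fin -exprVn -exprMn; apply: lerXn2r; rewrite ?nnegrE; lra.
 have S4 n : \sum_(0 <= k < n) (1 / 4 : R) ^+ k = 4 / 3 - 4 / 3 * (1 / 4) ^+ n.
 elim: n => [|n IH]; first by rewrite big_geq// expr0; lra.
 by rewrite big_nat_recr//= IH exprS; lra.
 apply: (@le_lt_trans _ _ (4 / 3)%:E); last exact: ltry.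
 apply: lime_le; first by apply: is_cvg_nneseries => k _ _; rewrite lee_fin exprn_ge0//; lra.
 apply: nearW => n; rewrite sumEFin lee_fin S4.
 by rewrite gerBl mulr_ge0 ?exprn_ge0//; lra.
have := integrable_ae mD iB; apply: filterS => x /[swap] Dx /(_ Dx) Bx.
have /fineK Bxe := Bx; set M := fine (B x) in Bxe.
have M0 : 0 <= M by rewrite /M fine_ge0// nneseries_ge0// => k _ _; exact: B0.
have dB k : `|t k.+1 x - t k x| <= (1 + M) * 2^-1 ^+ k.
 have H : 4 ^+ k * (t k.+1 x - t k x) ^+ 2 <= M.
 rewrite -lee_fin Bxe; apply: (@le_trans _ _ (\sum_(0 <= i < k.+1) (4 ^+ i * (t i.+1 x - t i x) ^+ 2)%:E)%E).
 rewrite big_nat_recr//= leeDr// sume_ge0// => i _; exact: B0.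
 by apply: nneseries_lim_ge => i _ _; exact: B0.
 rewrite -ler_sqr ?nnegrE ?mulr_ge0 ?exprn_ge0//; last by lra.
 rewrite real_normK ?num_real// exprMn -exprM mulnC exprM.
 rewrite (_ : 2^-1 ^+ 2 = 4^-1 :> R); last by rewrite exprVn; congr (_^-1); lra.
 rewrite exprVn ler_pdivlMr ?exprn_gt0// mulrC (le_trans H)//.
 by rewrite expr2; nra.
have : cvgn (series (fun k => t k.+1 x - t k x)).
 apply: normed_cvg; apply: (series_le_cvg _ _ dB) => [k|k|].
 - exact: normr_ge0.
 - by rewrite mulr_ge0 ?exprn_ge0//; lra.
 - by apply: is_cvg_geometric_series; rewrite ger0_norm; lra.
move=> cs; have E n : t 0%N x + series (fun k => t k.+1 x - t k x) n = t n x.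
 by rewrite /series/= telescope_sumr// addrC subrK.
suff -> : t ^~ x = cst (t 0%N x) + series (fun k => t k.+1 x - t k x).
 by apply: is_cvgD => //; exact: is_cvg_cst.
by apply/funext => n; exact/esym/E.
Qed.

Lemma comb_sub p q b x : (p <= q)%N ->
 comb q b x - comb p b x = comb q (fun j => if (p <= j)%N then b j else 0) x.
Proof.
move=> pq; rewrite /comb [X in X - _](bigID (fun j : 'I_q => (p <= j)%N))/=.
rewrite [X in _ + X - _](_ : _ = \sum_(j < p) b j * e j x).
 rewrite addrK big_mkcond; apply: eq_bigr => j _; case: ifP => // _; by rewrite mul0r.
rewrite (big_ord_widen_cond q predT (fun j => b j * e j x) pq)/=.
by apply: eq_bigl => j; rewrite -ltnNge.
Qed.

Variable eqv : T -> T -> Prop.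
Definition invariant_fun f := forall x y, eqv x y -> f x = f y.
Hypothesis cls_e : forall j, invariant_fun (e j).
Hypothesis complete : forall r, L2 r -> invariant_fun r ->
 (forall j, ip r (e j) = 0) -> ip r r = 0.

Lemma invariant_comb n b : invariant_fun (comb n b).
Proof. by move=> x y xy; apply: eq_bigr => j _; rewrite (cls_e j xy). Qed.

(** Completeness is only available for functions invariant at every point. The limit is therefore
    taken as a pointwise upper limit, which inherits invariance everywhere, even where the sequence
    diverges. *)
Lemma riesz_fischer f : L2 f -> exists g (nk : nat -> nat),
 [/\ L2 g, invariant_fun g, (forall k, (k <= nk k)%N) &
 let t k := comb (nk k) (fun j => ip f (e j)) in
 forall k, ip (fun x => g x + (-1) * t k x) (fun x => g x + (-1) * t k x) <= (16 ^+ k)^-1].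
Proof.
move=> Lf; pose a j := ip f (e j).
have /choice[N HN] : forall k, exists N, forall p q, (N <= p)%N -> (p <= q)%N ->
 ip (comb q (fun j => if (p <= j)%N then a j else 0))
 (comb q (fun j => if (p <= j)%N then a j else 0)) <= (16 ^+ k)^-1.
 by move=> k; apply: bessel_tail => //; rewrite invr_gt0 exprn_gt0.
(* The maximum makes [nk] non-decreasing, and the summand [k] makes it tend to infinity. *)
pose nk k := (\max_(i < k.+1) N i + k)%N.
have nkN k : (N k <= nk k)%N by rewrite /nk (leq_trans _ (leq_addr _ _))// (leq_bigmax (ord_max : 'I_k.+1)).
have nkS k : (nk k <= nk k.+1)%N by rewrite /nk [X in (_ <= X + _)%N]big_ord_recr/= leq_add// leq_maxl.
have nkm k l : (k <= l)%N -> (nk k <= nk l)%N.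
 by move=> kl; rewrite -(subnK kl) addnC; elim: (l - k)%N => [|n IH]; rewrite ?addn0// addnS (leq_trans IH).
pose t k := comb (nk k) a.
have Lt k : L2 (t k) by exact: L2_comb.
have mt k : mfun (t k) by case: (Lt k).
have tle k l : (k <= l)%N -> (\int[mu]_(x in D) ((t l x - t k x) ^+ 2)%:E <= ((16 ^+ k)^-1)%:E)%E.
 move=> kl; under eq_integral do rewrite /t comb_sub ?nkm//.
 by rewrite integral_sqE ?lee_fin; [exact: HN (nkN _) (nkm _ _ kl)|exact: L2_comb].
have tcvg := ae_cvg_subseq mt (fun k => tle k k.+1 (leqnSn k)).
pose g x := fine (limn_esup (fun k => (t k x)%:E)).
have mg : mfun g.
 apply: measurableT_comp => //; apply: measurable_fun_limn_esup => k.
 exact/measurable_EFinP.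
(* Fatou's lemma in the larger index of the Cauchy estimate [tle]. *)
have gt k : (\int[mu]_(x in D) ((g x - t k x) ^+ 2)%:E <= ((16 ^+ k)^-1)%:E)%E.
 pose F l x := (((t (l + k)%N x - t k x) ^+ 2)%:E : \bar R).
 have mF l : measurable_fun D (F l).
 by apply/measurable_EFinP/measurable_funX/measurable_funB; exact: measurable_funTS.
 have F0 l x : D x -> (0 <= F l x)%E by rewrite lee_fin sqr_ge0.
 apply: (@le_trans _ _ (\int[mu]_(x in D) limn_einf (F ^~ x))%E).
 apply: eq_ler; apply: ae_eq_integral => //.
 - by apply/measurable_EFinP/measurable_funX/measurable_funB; exact: measurable_funTS.
 - rewrite (_ : (fun x => _) = (fun x => - limn_esup (fun l => - F l x))%E).
 apply: measurableT_comp => //; apply: measurable_fun_limn_esup => l.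
 exact: measurableT_comp.
 apply/funext => x; have := limn_esupN (F ^~ x); rewrite /comp => ->.
 by rewrite oppeK.
 apply: filterS tcvg => x + Dx => /(_ Dx) /cvg_ex[l tl].
 have tE : (t k0 x)%:E @[k0 --> \oo] --> l%:E by apply: cvg_EFin => //; exact: nearW.
 have -> : g x = l by rewrite /g (cvg_limn_einf_sup tE).2.
 suff /cvg_limn_einf_sup[-> _] : F ^~ x l0 @[l0 --> \oo] --> ((l - t k x) ^+ 2)%:E by [].
 rewrite /F; apply: cvg_EFin; first exact: nearW.
 rewrite /=; under eq_fun do rewrite expr2.
 have tk : t (l0 + k)%N x @[l0 --> \oo] --> l by rewrite (cvg_shiftn k (t ^~ x)).
 by rewrite expr2; apply: cvgM; apply: cvgB => //; exact: cvg_cst.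
 apply: (le_trans (fatou _ mD mF F0)).
 rewrite limn_einf_lim; apply: lime_le; first exact: is_cvg_einfs.
 by apply: nearW => n; apply: le_trans (tle k (n + k)%N (leq_addl _ _)); apply: ereal_inf_lbound; exists n => /=.
have Lgt k : L2 (fun x => g x + (-1) * t k x).
 split; first by apply: measurable_funD => //; exact: measurable_funM.
 under eq_integral do rewrite mulN1r.
 by apply: (le_lt_trans (gt k)); exact: ltry.
exists g, nk; split.
- rewrite (_ : g = fun x => (g x + (-1) * t 0%N x) + t 0%N x); first exact: L2D.
 by apply/funext => x; rewrite mulN1r subrK.
- by move=> x y xy; rewrite /g; congr (fine (limn_esup _)); apply/funext => k; congr EFin; exact: invariant_comb.
- by move=> k; rewrite /nk leq_addl.
- move=> /= k; have := gt k; under eq_integral do rewrite -mulN1r.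
 by rewrite (integral_sqE (Lgt k)) lee_fin.
Qed.

(** The limit g of the expansion of f has the same coefficients as f, so completeness gives f = g in
    L^2. The partial sums along [nk] converge to the inner product; Bessel makes the series
    absolutely convergent, so the whole series has the same limit. *)
Theorem parseval f h : L2 f -> invariant_fun f -> L2 h ->
 series (fun j => ip f (e j) * ip h (e j)) n @[n --> \oo] --> ip f h.
Proof.
move=> Lf If Lh.
have [g [nk [Lg Ig nkk Hg]]] := riesz_fischer Lf.
pose t k := comb (nk k) (fun j => ip f (e j)).
have Lt k : L2 (t k) by exact: L2_comb.
have LN f' : L2 f' -> L2 (fun x => (-1) * f' x) by exact: L2Z.
have small (x K : R) : (forall k, `|x| <= (2 ^+ k)^-1 * K) -> x = 0.
 move=> H; apply/eqP; rewrite -normr_le0; apply/ler_addgt0Pr => eps eps0; rewrite add0r.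
 have K0 : 0 <= K by have := H 0%N; rewrite expr0 invr1 mul1r; apply: le_trans.
 pose k := Num.trunc (K / eps); apply: (le_trans (H k)).
 rewrite mulrC ler_pdivrMr ?exprn_gt0// mulrC -ler_pdivrMr//.
 apply: (le_trans (ltW (truncnS_gt _))); rewrite -/k -natrX ler_nat.
 exact: ltn_expl.
(* The weight 2^k in [ip_le] balances 2^k 16^-k against 2^-k. *)
have close h' k : L2 h' -> `|ip g h' - ip (t k) h'| <= (2 ^+ k)^-1 * (1 + ip h' h').
 move=> Lh'; have -> : ip g h' - ip (t k) h' = ip (fun x => g x + (-1) * t k x) h'.
 by rewrite ipDl ?ipZl ?mulN1r//; exact: LN.
 have p2 : 0 < 2 ^+ k :> R by rewrite exprn_gt0.
 apply: (le_trans (ip_le p2 _ Lh')); first by apply: L2D => //; exact: LN.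
 rewrite mulrDr mulr1 lerD2r; apply: (le_trans (ler_wpM2l (ltW p2) (Hg k))).
 rewrite ler_pdivrMr ?exprn_gt0// mulrC ler_pdivlMr// -exprMn.
 by apply: lerXn2r; rewrite ?nnegrE; lra.
have ge j : ip g (e j) = ip f (e j).
 apply/eqP; rewrite -subr_eq0; apply/eqP; apply: (small _ (1 + ip (e j) (e j))) => k.
 have := close (e j) (k + j.+1)%N (Le j).
 rewrite ip_comb_e// ifT; last by rewrite (leq_trans _ (nkk _))// leq_addl.
 move=> /le_trans; apply; rewrite ler_wpM2r ?addr_ge0 ?ip_ge0//.
 by rewrite lef_pV2 ?posrE ?exprn_gt0// ler_weXn2l ?leq_addr//; lra.
pose r x := f x + (-1) * g x.
have Lr : L2 r by apply: L2D => //; exact: LN.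
have r0 : ip r r = 0.
 apply: complete => //.
 by move=> x y xy; rewrite /r (If x y)// (Ig x y).
 by move=> j; rewrite ipDl ?ipZl// ?ge ?mulN1r ?subrr//; exact: LN.
have fgh : ip f h = ip g h.
 apply/eqP; rewrite -subr_eq0; apply/eqP; apply: (small _ (ip h h)) => k.
 have -> : ip f h - ip g h = ip r h by rewrite ipDl ?ipZl ?mulN1r//; exact: LN.
 have p2 : 0 < 2 ^+ k :> R by rewrite exprn_gt0.
 by apply: (le_trans (ip_le p2 Lr Lh)); rewrite r0 mulr0 add0r.
have cv : cvgn (series (fun j => ip f (e j) * ip h (e j))).
 apply: normed_cvg; apply: (@series_le_cvg _ _ (fun j => ip f (e j) ^+ 2 + ip h (e j) ^+ 2)).
 - by move=> k; exact: normr_ge0.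
 - by move=> k; rewrite addr_ge0 ?sqr_ge0.
 - move=> k; rewrite /= normrM -[ip f (e k) ^+ 2]real_normK ?num_real//.
 rewrite -[ip h (e k) ^+ 2]real_normK ?num_real//.
 have := sqr_ge0 (`|ip f (e k)| - `|ip h (e k)|).
 have := normr_ge0 (ip f (e k)); have := normr_ge0 (ip h (e k)).
 by move: `|ip f (e k)| `|ip h (e k)| => A B; rewrite !expr2; nra.
 - rewrite (_ : series _ = series (fun j => ip f (e j) ^+ 2) + series (fun j => ip h (e j) ^+ 2)).
 by apply: is_cvgD; exact: bessel_cvg.
 by apply/funext => n; rewrite /series/= big_split.
have /cvg_ex[l cl] := cv; suff <- : l = ip f h by [].
have H1 : ip (t k) h @[k --> \oo] --> l.
 have -> : (fun k => ip (t k) h) = series (fun j => ip f (e j) * ip h (e j)) \o nk.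
 by apply/funext => k; rewrite /= /t ip_comb// seriesEord.
 apply: cvg_comp cl; apply/cvgnyPge => A; near=> k.
 by apply: leq_trans (nkk k); near: k; exact: nbhs_infty_ge.
have H2 : ip (t k) h @[k --> \oo] --> ip f h.
 rewrite fgh; apply/cvgrPdist_le => eps eps0.
 have : geometric (1 + ip h h) (2^-1) n @[n --> \oo] --> (0 : R).
 by apply: cvg_geometric; rewrite ger0_norm; lra.
 move=> /cvgrPdist_le/(_ _ eps0); apply: filterS => k.
 rewrite sub0r normrN /geometric/= => /(le_trans (ler_norm _)); apply: le_trans.
 by rewrite exprVn mulrC; exact: close.
exact: (cvg_unique _ H1 H2).
Unshelve. all: by end_near.
Qed.

End Orthonormal.
End Parseval.

(** * The chain rule along a curve, from continuous partial derivatives *)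

Section PlaneCalculus.
Context {R : realType}.
Local Notation mu := (leb R).

Lemma is_derive_estimate (g : R -> R) (t l : R) :
 (forall eps, 0 < eps -> \forall s \near (0 : R), `|g (t + s) - g t - s * l| <= eps * `|s|) ->
 is_derive t 1 g l.
Proof.
move=> H.
have C : h^-1 *: ((g \o shift t) (h *: (1 : R)) - g t) @[h --> 0^'] --> l.
 apply/cvgrPdist_le => eps eps0; near=> s.
 have s0 : s != 0 by near: s; exact: nbhs_dnbhs_neq.
 have : `|g (t + s) - g t - s * l| <= eps * `|s|.
 by near: s; apply: nbhs_dnbhs; exact: H.
 rewrite /= /GRing.scale /= mulr1 (addrC s) -ler_pdivrMr ?normr_gt0// -normfV -normrM distrC.
 by congr (`|_| <= _); field.
have D : derivable g t 1 by apply/cvg_ex; exists l.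
by apply: DeriveDef => //; exact/cvg_lim.
Unshelve. all: by end_near. Qed.

Lemma is_derive_estimateP (g : R -> R) (t l : R) : is_derive t 1 g l ->
 forall eps, 0 < eps -> \forall s \near (0 : R), `|g (t + s) - g t - s * l| <= eps * `|s|.
Proof.
move=> [/cvg_ex[l' gl'] dl] eps eps0.
have <- : l' = l by rewrite -dl; apply/esym/cvg_lim.
move/cvgrPdist_le : gl' => /(_ _ eps0) H.
have : \forall s \near (0 : R), s != 0 -> `|l' - s^-1 *: ((g \o shift t) (s *: (1 : R)) - g t)| <= eps.
 by move: H; rewrite near_withinE.
apply: filterS => s; have [->|s0 /(_ isT)] := eqVneq s 0.
 by rewrite addr0 subrr mul0r subr0 normr0 mulr0.
rewrite /= /GRing.scale /= mulr1 (addrC s) distrC => h.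
rewrite -ler_pdivrMr ?normr_gt0// -normfV -normrM; apply: le_trans h.
by apply: eq_ler; congr `|_|; field.
Unshelve. all: by end_near. Qed.

Lemma norm_MVT (f df : R -> R) (a b : R) :
 (forall x, Num.min a b <= x <= Num.max a b -> is_derive x 1 f (df x)) ->
 exists2 c, Num.min a b <= c <= Num.max a b & f b - f a = df c * (b - a).
Proof.
have main (x y : R) : x < y -> (forall z, x <= z <= y -> is_derive z 1 f (df z)) ->
 exists2 c, x <= c <= y & f y - f x = df c * (y - x).
 move=> xy H.
 have H1 z : z \in `]x, y[ -> is_derive z 1 f (df z).
 by rewrite in_itv/= => /andP[/ltW xz /ltW zy]; apply: H; rewrite xz.
 have H2 : {within `[x, y], continuous f}.
 by apply: derivable_within_continuous => z; rewrite in_itv/= => zxy; have [] := H z zxy.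
 have [c cxy E] := MVT xy H1 H2.
 by exists c => //; move: cxy; rewrite in_itv/= => /andP[/ltW -> /ltW ->].
have [ab|ba|<-] := ltgtP a b.
- by apply: main.
- move=> /(main b a ba)[c cba E]; exists c => //.
 by rewrite -opprB E -mulrN opprB.
- by move=> _; exists a; rewrite ?lexx ?subrr ?mulr0.
Qed.

Variables (f fx fy : R * R -> R).
Hypothesis dfx : forall z, upper_half_plane z -> is_derive z.1 1 (fun x => f (x, z.2)) (fx z).
Hypothesis dfy : forall z, upper_half_plane z -> is_derive z.2 1 (fun y => f (z.1, y)) (fy z).
Hypothesis cfx : forall z, upper_half_plane z -> {for z, continuous fx}.
Hypothesis cfy : forall z, upper_half_plane z -> {for z, continuous fy}.

Lemma near_upper_half_plane (z : R * R) : upper_half_plane z -> \forall w \near z, upper_half_plane w.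
Proof.
move=> z0; have : \forall y \near z.2, 0 < y by apply: lt_nbhsr.
by move=> /(@cvg_snd _ _ (nbhs z.1) (nbhs z.2) _)/=; case: z z0.
Qed.

(** The mean value theorem on a horizontal and a vertical leg; continuity of the partial derivatives
    controls the two intermediate points. *)
Lemma C1_estimate z : upper_half_plane z -> forall eps, 0 < eps ->
 exists2 d, 0 < d & forall h k, `|h| < d -> `|k| < d ->
 `|f (z.1 + h, z.2 + k) - f z - h * fx z - k * fy z| <= eps * (`|h| + `|k|).
Proof.
move=> z0 eps eps0.
have /cvgrPdist_le/(_ _ eps0) Hx := cfx z0.
have /cvgrPdist_le/(_ _ eps0) Hy := cfy z0.
have : \forall w \near z, upper_half_plane w /\ (`|fx z - fx w| <= eps /\ `|fy z - fy w| <= eps).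
 by apply: filterI; [exact: near_upper_half_plane|exact: filterI].
move=> /nbhs_ballP[d /= d0 Hd]; exists d => // h k hd kd.
have inb (x y : R) : `|x - z.1| <= `|h| -> `|y - z.2| <= `|k| ->
 [/\ 0 < y, `|fx z - fx (x, y)| <= eps & `|fy z - fy (x, y)| <= eps].
 move=> xh yk; have [|? [? ?]] := Hd (x, y); last by split.
 by split; rewrite /ball/= distrC; [exact: le_lt_trans hd|exact: le_lt_trans kd].
have minmax (a b c : R) : Num.min a (a + b) <= c <= Num.max a (a + b) -> `|c - a| <= `|b|.
 rewrite minEle maxEle; case: (lerP a (a + b)); rewrite ?lerDl ?gtrDl => b0 /andP[h1 h2].
 by rewrite !ger0_norm//; lra.
 by rewrite ler0_norm ?ltr0_norm//; lra.
have [x xI Ex] : exists2 x, Num.min z.1 (z.1 + h) <= x <= Num.max z.1 (z.1 + h) &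
 f (z.1 + h, z.2 + k) - f (z.1, z.2 + k) = fx (x, z.2 + k) * (z.1 + h - z.1).
 apply: (@norm_MVT (fun x => f (x, z.2 + k)) (fun x => fx (x, z.2 + k))) => x xI.
 apply: (dfx (z := (x, z.2 + k))); have [] // := inb x (z.2 + k) (minmax _ _ _ xI).
 by rewrite addrC addKr.
have [y yI Ey] : exists2 y, Num.min z.2 (z.2 + k) <= y <= Num.max z.2 (z.2 + k) &
 f (z.1, z.2 + k) - f (z.1, z.2) = fy (z.1, y) * (z.2 + k - z.2).
 apply: (@norm_MVT (fun y => f (z.1, y)) (fun y => fy (z.1, y))) => y yI.
 apply: (dfy (z := (z.1, y))); have [] // := inb z.1 y _ (minmax _ _ _ yI).
 by rewrite subrr normr0.
have [_ Bx _] : [/\ 0 < z.2 + k, `|fx z - fx (x, z.2 + k)| <= eps & `|fy z - fy (x, z.2 + k)| <= eps].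
 by apply: inb; [exact: minmax|rewrite addrC addKr].
have [_ _ By] : [/\ 0 < y, `|fx z - fx (z.1, y)| <= eps & `|fy z - fy (z.1, y)| <= eps].
 by apply: inb; [rewrite subrr normr0|exact: minmax].
have -> : f z = f (z.1, z.2) by case: (z).
rewrite (_ : _ - _ = (fx (x, z.2 + k) - fx z) * h + (fy (z.1, y) - fy z) * k); last first.
 rewrite -[X in X - _ - _ - _](subrK (f (z.1, z.2 + k))) Ex.
 rewrite -[X in _ + X - _ - _ - _](subrK (f (z.1, z.2))) Ey.
 ring.
apply: (le_trans (ler_normD _ _)); rewrite !normrM mulrDr.
by apply: lerD; apply: ler_wpM2r => //; rewrite distrC.
Qed.

Lemma is_derive_curve (a b : R -> R) (t a' b' : R) :
 is_derive t 1 a a' -> is_derive t 1 b b' -> 0 < b t ->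
 is_derive t 1 (fun t => f (a t, b t)) (a' * fx (a t, b t) + b' * fy (a t, b t)).
Proof.
move=> da db bt0; apply: is_derive_estimate => eps eps0.
pose z := (a t, b t); pose M := `|a'| + `|b'| + 2; pose K := `|fx z| + `|fy z| + 1.
have M0 : 0 < M by rewrite /M; have := normr_ge0 a'; have := normr_ge0 b'; lra.
have K0 : 0 < K by rewrite /K; have := normr_ge0 (fx z); have := normr_ge0 (fy z); lra.
have e1 : 0 < eps / 2 / M by rewrite !divr_gt0.
have e2 : 0 < eps / 2 / K by rewrite !divr_gt0.
have [d d0 Hd] := C1_estimate (z := z) bt0 e1.
have dM : 0 < d / M by rewrite divr_gt0.
near=> s.
have sd : `|s| < d / M by near: s; apply/nbhs_ballP; exists (d / M) => //= y; rewrite /ball/= sub0r normrN.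
have A1 : `|a (t + s) - a t - s * a'| <= 1 * `|s| by near: s; exact: is_derive_estimateP.
have B1 : `|b (t + s) - b t - s * b'| <= 1 * `|s| by near: s; exact: is_derive_estimateP.
have A2 : `|a (t + s) - a t - s * a'| <= eps / 2 / K * `|s| by near: s; exact: is_derive_estimateP.
have B2 : `|b (t + s) - b t - s * b'| <= eps / 2 / K * `|s| by near: s; exact: is_derive_estimateP.
pose h := a (t + s) - a t; pose k := b (t + s) - b t.
have hk : `|h| + `|k| <= M * `|s|.
 have : `|h| <= `|s| + `|a'| * `|s|.
 rewrite -[h](subrK (s * a')); apply: le_trans (ler_normD _ _) _; apply: lerD.
 by rewrite mul1r in A1.
 by rewrite normrM mulrC.
 have : `|k| <= `|s| + `|b'| * `|s|.
 rewrite -[k](subrK (s * b')); apply: le_trans (ler_normD _ _) _; apply: lerD.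
 by rewrite mul1r in B1.
 by rewrite normrM mulrC.
 by rewrite /M; lra.
have sM : M * `|s| < d by rewrite mulrC -ltr_pdivlMr.
have hd : `|h| < d by have := normr_ge0 k; lra.
have kd : `|k| < d by have := normr_ge0 h; lra.
have := Hd h k hd kd; rewrite /z /=.
have -> : a t + h = a (t + s) by rewrite /h addrC subrK.
have -> : b t + k = b (t + s) by rewrite /k addrC subrK.
rewrite -/z => E1.
rewrite (_ : _ - _ = (f (a (t + s), b (t + s)) - f z - h * fx z - k * fy z)
 + ((h - s * a') * fx z + (k - s * b') * fy z)); last by rewrite /h /k; ring.
apply: (le_trans (ler_normD _ _)).
have -> : eps * `|s| = eps / 2 / M * (M * `|s|) + eps / 2 / K * `|s| * K by field; rewrite !gt_eqF.
apply: lerD; first by apply: (le_trans E1); rewrite ler_wpM2l// ltW.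
apply: (le_trans (ler_normD _ _)); rewrite !normrM.
have e20 : 0 <= eps / 2 / K * `|s| by rewrite mulr_ge0// ltW.
rewrite {2}/K !mulrDr mulr1; apply: ler_wpDr => //.
by apply: lerD; apply: ler_wpM2r.
Unshelve. all: by end_near. Qed.

End PlaneCalculus.

(** * Differentiation under the integral sign on a compact segment *)

Section DifferentiationUnderIntegral.
Context {R : realType}.
Local Notation mu := (leb R).

Lemma continuous2_fst (f : R * R -> R) (t : R) : continuous f -> continuous (fun v => f (v, t)).
Proof.
move=> cf v; apply: (continuous_comp (f := fun v => (v, t)) (g := f)); last exact: cf.
exact: (cvg_pair cvg_id (cvg_cst _)).
Qed.

Lemma cont2_snd (f : R * R -> R) (v : R) : continuous f -> continuous (fun t => f (v, t)).
Proof.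
move=> cf t; apply: (continuous_comp (f := fun t => (v, t)) (g := f)); last exact: cf.
exact: (cvg_pair (cvg_cst _) cvg_id).
Qed.

Lemma rectangle_bounded (f : R * R -> R) (a b c d : R) : continuous f ->
 exists M, forall v t, a <= v <= b -> c <= t <= d -> `|f (v, t)| <= M.
Proof.
move=> cf.
have comp : compact (`[a, b] `*` `[c, d] : set (R * R)) by apply: compact_setX; exact: segment_compact.
have cf' : {within (`[a, b] `*` `[c, d] : set (R * R)), continuous f} by exact: continuous_subspaceT.
have [M [_ HM]] := compact_bounded (continuous_compact cf' comp).
exists (M + 1) => v t vab tcd; apply: HM; first by rewrite ltrDl.
by exists (v, t) => //; split; rewrite /= in_itv.
Qed.

Lemma is_derive_under_integral (f fd : R * R -> R) (a b : R) :
 continuous f -> continuous fd ->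
 (forall v t : R, is_derive v 1 (fun v => f (v, t)) (fd (v, t))) ->
 forall v : R, is_derive v 1 (fun v => \int[mu]_(t in `[a, b]) f (v, t))
 (\int[mu]_(t in `[a, b]) fd (v, t)).
Proof.
move=> cf cfd df v.
have [M HM] := rectangle_bounded (v - 1) (v + 1) a b cfd.
have M0 : 0 <= `|M| by [].
have Iv : `]v - 1, v + 1[%classic v by rewrite /= in_itv/=; apply/andP; split; lra.
have H1 x : `]v - 1, v + 1[%classic x -> mu.-integrable `[a, b] (EFin \o (fun t => f (x, t))).
 move=> _; apply: continuous_compact_integrable; first exact: segment_compact.
 by apply: continuous_subspaceT; exact: cont2_snd.
have H2 x t : `]v - 1, v + 1[%classic x -> `[a, b]%classic t -> derivable (fun v => f (v, t)) x 1.
 by move=> _ _; have [] := df x t.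
have p1 x t : partial1of2 (fun v t => f (v, t)) x t = fd (x, t).
 by rewrite partial1of2E; have [] := df x t.
have H3 : mu.-integrable `[a, b] (EFin \o (fun=> `|M|)).
 apply: continuous_compact_integrable; first exact: segment_compact.
 by apply: continuous_subspaceT => x; exact: cst_continuous.
have H4 x t : `]v - 1, v + 1[%classic x -> `[a, b]%classic t ->
 `|partial1of2 (fun v t => f (v, t)) x t| <= `|M|.
 rewrite /= !in_itv/= => /andP[/ltW h1 /ltW h2] tab; rewrite p1.
 by apply: le_trans (ler_norm M); apply: HM; rewrite ?h1 ?h2.
have mB : measurable (`[a, b] : set (measurableTypeR R)) by exact: measurable_itv.
have D := derivable_under_integral mB Iv H1 H2 (fun=> M0) H3 H4.
have E := differentiation_under_integral mB Iv H1 H2 (fun=> M0) H3 H4.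
apply: DeriveDef => //; rewrite -derive1E E.
by apply: eq_Rintegral => t _; exact: p1.
Qed.

End DifferentiationUnderIntegral.

(** * Derivative rules in one real variable and their automation *)

Section RealDerivatives.
Context {R : realType}.
Implicit Types (f g : R -> R) (x : R).

Lemma is_derive1_id x : is_derive x (1 : R) (fun y : R => y) 1.
Proof. exact: is_derive_id. Qed.

Lemma is_derive1_cst (c x : R) : is_derive x (1 : R) (fun=> c) 0.
Proof. exact: is_derive_cst. Qed.

Lemma is_derive1D f g x df dg : is_derive x (1 : R) f df -> is_derive x (1 : R) g dg ->
 is_derive x (1 : R) (fun y => f y + g y) (df + dg).
Proof. by move=> hf hg; exact: is_deriveD. Qed.

Lemma is_derive1N f x df : is_derive x (1 : R) f df -> is_derive x (1 : R) (fun y => - f y) (- df).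
Proof. by move=> hf; exact: is_deriveN. Qed.

Lemma is_derive1M f g x df dg : is_derive x (1 : R) f df -> is_derive x (1 : R) g dg ->
 is_derive x (1 : R) (fun y => f y * g y) (df * g x + f x * dg).
Proof.
move=> hf hg; apply: (@is_derive_eq _ _ _ _ _ _ _ _ (is_deriveM hf hg)).
by rewrite /GRing.scale /=; ring.
Qed.

Lemma is_derive1X f x df n : is_derive x (1 : R) f df ->
 is_derive x (1 : R) (fun y => f y ^+ n) (n%:R * f x ^+ n.-1 * df).
Proof.
move=> hf; elim: n => [|n IH].
 rewrite mul0r mul0r (_ : (fun y => f y ^+ 0) = cst 1); first exact: is_derive_cst.
 by apply/funext => y; rewrite expr0.
rewrite (_ : (fun y => f y ^+ n.+1) = (fun y => f y * f y ^+ n)); last first.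
 by apply/funext => y; rewrite exprS.
apply: (@is_derive_eq _ _ _ _ _ _ _ _ (is_derive1M hf IH)).
case: n {IH} => [|n] /=; first by rewrite !expr0; ring.
by rewrite exprS -[in RHS]natr1; ring.
Qed.

Lemma is_derive1V f x df : f x != 0 -> is_derive x (1 : R) f df ->
 is_derive x (1 : R) (fun y => (f y)^-1) (- df / f x ^+ 2).
Proof.
move=> f0 hf; apply: (@is_derive_eq _ _ _ _ _ _ _ _ (is_deriveV f0 hf)).
by rewrite /GRing.scale /=; field.
Qed.

Lemma is_derive1_expR f x df : is_derive x (1 : R) f df ->
 is_derive x (1 : R) (fun y => expR (f y)) (expR (f x) * df).
Proof.
move=> hf; have he := is_derive_expR (f x).
by apply: (@is_derive_eq _ _ _ _ _ _ _ _ (is_derive1_comp he hf)).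
Qed.

Lemma is_derive1_ln f x df : 0 < f x -> is_derive x (1 : R) f df ->
 is_derive x (1 : R) (fun y => ln (f y)) (df / f x).
Proof.
move=> f0 hf; have he := is_derive1_ln f0.
by apply: (@is_derive_eq _ _ _ _ _ _ _ _ (is_derive1_comp he hf)); rewrite mulrC.
Qed.

Lemma is_derive1_sqrt f x df : 0 < f x -> is_derive x (1 : R) f df ->
 is_derive x (1 : R) (fun y => sqrt (f y)) (df / (2 * sqrt (f x))).
Proof.
move=> f0 hf; have he := is_derive1_sqrt f0.
by apply: (@is_derive_eq _ _ _ _ _ _ _ _ (is_derive1_comp he hf)); rewrite mulrC.
Qed.

Lemma is_derive1_powR f x df (a : R) : 0 < f x -> is_derive x (1 : R) f df ->
 is_derive x (1 : R) (fun y => f y `^ a) (a * f x `^ (a - 1) * df).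
Proof.
move=> f0 hf; have he := is_derive1_powR a f0.
by apply: (@is_derive_eq _ _ _ _ _ _ _ _ (is_derive1_comp he hf)).
Qed.

End RealDerivatives.

(** Differentiates along the syntax of the function. [isd] leaves the side conditions (positive or
    non-zero arguments) and the identity between the computed and the stated derivative. *)
Ltac isd1 := lazymatch goal with
 | |- is_derive _ _ (fun=> ?c) _ => apply: is_derive1_cst
 | |- is_derive _ _ (fun y => y) _ => apply: is_derive1_id
 | |- is_derive _ _ (fun y => @?f y + @?g y) _ => eapply (@is_derive1D _ f g); isd1
 | |- is_derive _ _ (fun y => - @?f y) _ => eapply (@is_derive1N _ f); isd1
 | |- is_derive _ _ (fun y => @?f y * @?g y) _ => eapply (@is_derive1M _ f g); isd1
 | |- is_derive _ _ (fun y => (@?f y) ^+ ?n) _ => eapply (@is_derive1X _ f); isd1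
 | |- is_derive _ _ (fun y => expR (@?f y)) _ => eapply (@is_derive1_expR _ f); isd1
 | |- is_derive _ _ (fun y => (@?f y)^-1) _ => eapply (@is_derive1V _ f); [|isd1]
 | |- is_derive _ _ (fun y => ln (@?f y)) _ => eapply (@is_derive1_ln _ f); [|isd1]
 | |- is_derive _ _ (fun y => sqrt (@?f y)) _ => eapply (@is_derive1_sqrt _ f); [|isd1]
 | |- is_derive _ _ (fun y => (@?f y) `^ ?a) _ => eapply (@is_derive1_powR _ f); [|isd1]
 | |- _ => first [eassumption | apply: is_derive1_cst | match goal with H : forall _, is_derive _ _ _ _ |- _ => eapply H end | idtac]
 end.
Ltac isd := eapply is_derive_eq; [isd1 |]; cbv beta.

(** Elimination of the y-derivatives: [U1] and [U2] stand for the period integrals of e^t u_x and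
    e^(2t) u_xx, [Y1] for that of e^t u_y. The two relations express periodicity in t; the first and
    its derivative in v turn U_2 + Y_y into ((1 + v^2) U_1)'. Only the mixed derivative d_x d_y u
    occurs, so no symmetry of second derivatives is involved. *)
Lemma divergence_form {R : realType} (U1 U2 Y1 Yx Yy : R -> R) (v c : R) :
 (forall w : R, is_derive w 1 U1 (U2 w)) -> (forall w : R, is_derive w 1 Y1 (Yx w)) ->
 (forall w, w * U1 w + Y1 w = 0) -> (forall w, Y1 w + w * Yx w + Yy w = 0) ->
 U2 v + Yy v = c -> is_derive v 1 (fun v => (1 + v ^+ 2) * U1 v) c.
Proof.
move=> dU1 dY1 E1 E3 <-.
have E2 w : U1 w + w * U2 w + Yx w = 0.
 have D : is_derive w 1 (fun w => w * U1 w + Y1 w) (U1 w + w * U2 w + Yx w).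
 by isd; ring.
 have D0 : is_derive w (1 : R) (fun w => w * U1 w + Y1 w) 0.
 rewrite (_ : (fun w => w * U1 w + Y1 w) = cst 0); first exact: is_derive_cst.
 by apply/funext => x; exact: E1.
 by have [_ <-] := D; have [_ <-] := D0.
have E5 : U2 v + Yy v = (1 + v ^+ 2) * U2 v + 2 * v * U1 v.
 have := congr1 (fun z => v * z) (E2 v); rewrite mulr0.
 by have := E1 v; have := E3 v; rewrite expr2; lra.
by rewrite E5; isd; ring.
Qed.

(** * The differential equation satisfied by the integral of an eigenfunction over one period *)

Section PeriodOde.
Context {R : realType}.
Local Notation mu := (leb R).
Implicit Types f : R * R -> R.

Lemma is_derive_dx f z : derivable f z ((1, 0) : R * R) ->
 is_derive z.1 (1 : R) (fun x => f (x, z.2)) (dx f z).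
Proof.
move=> df.
have E : (fun h : R => h^-1 *: ((f \o shift z) (h *: ((1, 0) : R * R)) - f z)) =
 (fun h => h^-1 *: (((fun x => f (x, z.2)) \o shift z.1) (h *: (1 : R)) - f (z.1, z.2))).
 apply/funext => h /=; congr (_ *: (f _ - f _)); last by case: (z).
 by change ((h *: (1 : R) + z.1, h *: (0 : R) + z.2) = (h *: (1 : R) + z.1, z.2)); rewrite scaler0 add0r.
apply: DeriveDef; first by rewrite /derivable -E.
by rewrite /dx /derive E.
Qed.

Lemma is_derive_dy f z : derivable f z ((0, 1) : R * R) ->
 is_derive z.2 (1 : R) (fun y => f (z.1, y)) (dy f z).
Proof.
move=> df.
have E : (fun h : R => h^-1 *: ((f \o shift z) (h *: ((0, 1) : R * R)) - f z)) =
 (fun h => h^-1 *: (((fun y => f (z.1, y)) \o shift z.2) (h *: (1 : R)) - f (z.1, z.2))).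
 apply/funext => h /=; congr (_ *: (f _ - f _)); last by case: (z).
 by change ((h *: (0 : R) + z.1, h *: (1 : R) + z.2) = (z.1, h *: (1 : R) + z.2)); rewrite scaler0 add0r.
apply: DeriveDef; first by rewrite /derivable -E.
by rewrite /dy /derive E.
Qed.

Lemma C1_dx f : C1 f -> forall z, upper_half_plane z ->
 is_derive z.1 (1 : R) (fun x => f (x, z.2)) (dx f z).
Proof. by move=> [_ df _ _] z z0; apply: is_derive_dx; case: (df z z0). Qed.

Lemma C1_dy f : C1 f -> forall z, upper_half_plane z ->
 is_derive z.2 (1 : R) (fun y => f (z.1, y)) (dy f z).
Proof. by move=> [_ df _ _] z z0; apply: is_derive_dy; case: (df z z0). Qed.

Lemma cont_hpt : continuous (@hpt R).
Proof.
move=> p.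
have c2 : expR q.2 @[q --> p] --> expR p.2.
 by apply: continuous_cvg; [exact: continuous_expR|exact: cvg_snd].
have c1 : q.1 * expR q.2 @[q --> p] --> p.1 * expR p.2 by apply: cvgM => //; exact: cvg_fst.
exact: (cvg_pair c1 c2).
Qed.

Lemma cont_comp_hpt f : C0 f -> continuous (f \o @hpt R).
Proof.
move=> cf p; apply: continuous_comp; first exact: cont_hpt.
by apply: cf; exact: hpt_gt0.
Qed.

Lemma cont_exp_hpt f k : C0 f -> continuous (fun p => expR p.2 ^+ k * f (hpt p)).
Proof.
move=> cf p; apply: cvgM; last exact: cont_comp_hpt.
have cE : expR q.2 @[q --> p] --> expR p.2.
 by apply: continuous_cvg; [exact: continuous_expR|exact: cvg_snd].
elim: k => [|k IH]; first by under eq_fun do rewrite expr0; rewrite expr0; exact: cvg_cst.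
by under eq_fun do rewrite exprS; rewrite exprS; exact: cvgM.
Qed.

Lemma is_derive_hpt_fst f (v t : R) : C1 f ->
 is_derive v 1 (fun v => f (hpt (v, t))) (expR t * dx f (hpt (v, t))).
Proof.
move=> cf; have [_ _ c1 c2] := cf.
apply: (is_derive_eq (is_derive_curve (C1_dx cf) (C1_dy cf) c1 c2 (a := fun v => v * expR t) (b := fun=> expR t) (a' := expR t) (b' := 0) _ _ _)).
- by isd; ring.
- exact: expR_gt0.
- by rewrite /hpt/= mul0r addr0.
Qed.

Lemma is_derive_hpt_snd f (v t : R) : C1 f ->
 is_derive t 1 (fun t => f (hpt (v, t))) (expR t * (v * dx f (hpt (v, t)) + dy f (hpt (v, t)))).
Proof.
move=> cf; have [_ _ c1 c2] := cf.
apply: (is_derive_eq (is_derive_curve (C1_dx cf) (C1_dy cf) c1 c2 (a := fun t => v * expR t) (b := expR) (a' := v * expR t) (b' := expR t) _ _ _)).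
- exact: expR_gt0.
- by rewrite /hpt/=; ring.
Qed.

Variables (u : R * R -> R) (lam ell : R).
Hypotheses (C2u : C2 u) (ell0 : 0 < ell).
Hypothesis lapu : forall z, upper_half_plane z -> hyp_laplacian u z = lam * u z.
Hypothesis peru : forall v t, u (hpt (v, t + ell)) = u (hpt (v, t)).

Let C1u : C1 u. Proof. by case: C2u. Qed.
Let C1ux : C1 (dx u). Proof. by case: C2u. Qed.
Let C1uy : C1 (dy u). Proof. by case: C2u. Qed.
Let C0u : C0 u. Proof. by case: C1u. Qed.
Let C0ux : C0 (dx u). Proof. by case: C1u. Qed.
Let C0uy : C0 (dy u). Proof. by case: C1u. Qed.
Let C0uxx : C0 (dx (dx u)). Proof. by case: C1ux. Qed.
Let C0uxy : C0 (dx (dy u)). Proof. by case: C1uy. Qed.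
Let C0uyy : C0 (dy (dy u)). Proof. by case: C1uy. Qed.

(** Every derivative in v brings out a factor e^t, so the weights e^(kt) close the family under
    differentiation. *)
Definition hpt_int k f v := \int[mu]_(t in `[0, ell]) (expR t ^+ k * f (hpt (v, t))).

Lemma hpt_intD k f g v : C0 f -> C0 g ->
 hpt_int k (fun z => f z + g z) v = hpt_int k f v + hpt_int k g v.
Proof.
move=> cf cg; rewrite /hpt_int -RintegralD//; last 2 first.
- apply: continuous_compact_integrable; first exact: segment_compact.
 by apply: continuous_subspaceT; apply: (cont2_snd (f := fun p => expR p.2 ^+ k * f (hpt p))); exact: cont_exp_hpt.
- apply: continuous_compact_integrable; first exact: segment_compact.
 by apply: continuous_subspaceT; apply: (cont2_snd (f := fun p => expR p.2 ^+ k * g (hpt p))); exact: cont_exp_hpt.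
by apply: eq_Rintegral => t _; rewrite mulrDr.
Qed.

Lemma hpt_intZ k f v (c : R) : C0 f -> hpt_int k (fun z => c * f z) v = c * hpt_int k f v.
Proof.
move=> cf; rewrite /hpt_int -RintegralZl//.
 by apply: eq_Rintegral => t _; rewrite mulrCA.
apply: continuous_compact_integrable; first exact: segment_compact.
by apply: continuous_subspaceT; apply: (cont2_snd (f := fun p => expR p.2 ^+ k * f (hpt p))); exact: cont_exp_hpt.
Qed.

Lemma is_derive_hpt_int k f (v : R) : C1 f -> is_derive v 1 (hpt_int k f) (hpt_int k.+1 (dx f) v).
Proof.
move=> cf; have [c0 _ cx _] := cf.
apply: (is_derive_under_integral (f := fun p => expR p.2 ^+ k * f (hpt p))
 (fd := fun p => expR p.2 ^+ k.+1 * dx f (hpt p))).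
- exact: cont_exp_hpt.
- exact: cont_exp_hpt.
move=> v' t; have D := is_derive_hpt_fst v' t cf.
by isd; rewrite /= exprSr; ring.
Qed.

(* the [t]-derivative of [e^(kt) f] has zero integral when that function is [ell]-periodic *)
Lemma hpt_int_periodic k f v : C1 f ->
 (forall t, expR (t + ell) ^+ k * f (hpt (v, t + ell)) = expR t ^+ k * f (hpt (v, t))) ->
 k%:R * hpt_int k f v + v * hpt_int k.+1 (dx f) v + hpt_int k.+1 (dy f) v = 0.
Proof.
move=> cf pf; have [c0 _ cx cy] := cf.
pose F t := expR t ^+ k * f (hpt (v, t)).
pose F' t := k%:R * (expR t ^+ k * f (hpt (v, t))) + (v * (expR t ^+ k.+1 * dx f (hpt (v, t)))
 + expR t ^+ k.+1 * dy f (hpt (v, t))).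
have dF (t : R) : is_derive t 1 F (F' t).
 have D := is_derive_hpt_snd v t cf.
 rewrite /F; isd; rewrite /F' exprS.
 by case: (k) => [|n] /=; rewrite ?exprS; ring.
have cF' : continuous F'.
 have c1 := @cont2_snd _ _ v (cont_exp_hpt (k := k) c0).
 have c2 := @cont2_snd _ _ v (cont_exp_hpt (k := k.+1) cx).
 have c3 := @cont2_snd _ _ v (cont_exp_hpt (k := k.+1) cy).
 move=> t.
 apply: cvgD; first by apply: cvgM; [exact: cvg_cst|exact: c1].
 by apply: cvgD; [apply: cvgM; [exact: cvg_cst|exact: c2]|exact: c3].
have : (\int[mu]_(t in `[0, ell]) F' t = F ell - F 0)%R.
 rewrite /Rintegral (continuous_FTC2 (F := F))//.
 - exact: continuous_subspaceT.
 - have cF : continuous F by apply: (@cont2_snd _ _ v (cont_exp_hpt (k := k) c0)).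
 split; first by move=> t _; have [] := dF t.
 + by apply: cvg_at_right_filter; exact: cF.
 + by apply: cvg_at_left_filter; exact: cF.
 - by move=> t _; rewrite derive1E; have [] := dF t.
have -> : F ell = F 0 by rewrite /F -[ell]add0r pf.
rewrite subrr => <-.
have cint (g : R -> R) : continuous g -> mu.-integrable `[0, ell] (EFin \o g).
 move=> cg; apply: continuous_compact_integrable; first exact: segment_compact.
 exact: continuous_subspaceT.
have c1 := @cont2_snd _ _ v (cont_exp_hpt (k := k) c0).
have c2 := @cont2_snd _ _ v (cont_exp_hpt (k := k.+1) cx).
have c3 := @cont2_snd _ _ v (cont_exp_hpt (k := k.+1) cy).
have cm (c : R) (g : R -> R) : continuous g -> continuous (fun t => c * g t).
 by move=> cg t; apply: cvgM; [exact: cvg_cst|exact: cg].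
have ca (g h : R -> R) : continuous g -> continuous h -> continuous (fun t => g t + h t).
 by move=> cg ch t; apply: cvgD; [exact: cg|exact: ch].
have lin (a b : R) (g1 g2 g3 : R -> R) : continuous g1 -> continuous g2 -> continuous g3 ->
 \int[mu]_(t in `[0, ell]) (a * g1 t + (b * g2 t + g3 t)) =
 a * \int[mu]_(t in `[0, ell]) g1 t + b * \int[mu]_(t in `[0, ell]) g2 t + \int[mu]_(t in `[0, ell]) g3 t.
 move=> C1 C2 C3; rewrite RintegralD//; [|exact: (cint _ (cm _ _ C1))|exact: (cint _ (ca _ _ (cm _ _ C2) C3))].
 rewrite RintegralD//; [|exact: (cint _ (cm _ _ C2))|exact: (cint _ C3)].
 by rewrite RintegralZl ?RintegralZl ?addrA//; [exact: (cint _ C2)|exact: (cint _ C1)].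
exact/esym/(lin k%:R v _ _ _ c1 c2 c3).
Qed.

(** Differentiate u(e^ell x, e^ell y) = u(x, y) in y: u_y scales by e^-ell, which the factor e^t
    compensates. *)
Lemma dy_periodic (w t : R) :
 expR (t + ell) * dy u (hpt (w, t + ell)) = expR t * dy u (hpt (w, t)).
Proof.
pose x := w * expR t; pose y := expR t; have y0 : 0 < y by exact: expR_gt0.
have peru' (z : R) : 0 < z -> u (expR ell * x, expR ell * z) = u (x, z).
 move=> z0; have := peru (x / z) (ln z).
 have -> : hpt (x / z, ln z) = (x, z) by apply: (hpt_surj (z := (x, z))).
 move=> <-; rewrite /hpt /= expRD lnK ?posrE//; congr (u (_, _)); last by rewrite mulrC.
 by field; rewrite gt_eqF.
have [_ _ cx cy] := C1u.
have D1 : is_derive y 1 (fun y => u (expR ell * x, expR ell * y)) (expR ell * dy u (expR ell * x, expR ell * y)).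
 apply: (is_derive_eq (is_derive_curve (C1_dx C1u) (C1_dy C1u) cx cy (a := fun=> expR ell * x) (b := fun y => expR ell * y) (a' := 0) (b' := expR ell) _ _ _)).
 - by isd; ring.
 - by rewrite mulr_gt0 ?expR_gt0.
 - by rewrite mul0r add0r.
have D2 : is_derive y 1 (fun y => u (x, y)) (dy u (x, y)) by exact: (C1_dy C1u (z := (x, y))).
have E : expR ell * dy u (expR ell * x, expR ell * y) = dy u (x, y).
 have [_ <-] := D2; have [_ <-] := D1.
 apply: near_eq_derive; last first.
 by have := lt_nbhsr y0; apply: filterS => z; exact: peru'.
rewrite /hpt /= expRD.
have -> : w * (expR t * expR ell) = expR ell * x by rewrite /x; ring.
have -> : expR t * expR ell = expR ell * y by rewrite mulrC.
by rewrite -/y -/x -E; ring.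
Qed.

Lemma period_ode (v : R) : is_derive v 1 (hpt_int 0 u) (hpt_int 1 (dx u) v) /\
 is_derive v 1 (fun v => (1 + v ^+ 2) * hpt_int 1 (dx u) v) (- lam * hpt_int 0 u v).
Proof.
split; first exact: is_derive_hpt_int.
apply: (@divergence_form _ _ (hpt_int 2 (dx (dx u))) (hpt_int 1 (dy u))
 (hpt_int 2 (dx (dy u))) (hpt_int 2 (dy (dy u)))) => [w|w|w|w|].
- exact: is_derive_hpt_int.
- exact: is_derive_hpt_int.
- have := @hpt_int_periodic 0 u w C1u; rewrite mul0r add0r; apply => t.
 by rewrite !expr0 !mul1r peru.
- have := @hpt_int_periodic 1 (dy u) w C1uy; rewrite mul1r; apply => t.
 by rewrite !expr1; exact: dy_periodic.
- rewrite -hpt_intD// -hpt_intZ// /hpt_int.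
 apply: eq_Rintegral => t _; have := lapu (hpt_gt0 (v, t)).
 rewrite /hyp_laplacian /= expr0 mul1r => H.
 by rewrite mulNr -H; ring.
Qed.

End PeriodOde.

(** * Continuity rules and their automation *)

Section ContinuousFor.
Context {R : realType} {T : topologicalType}.
Implicit Types (f g : T -> R) (x : T).

Lemma cont_cst (c : R) x : {for x, continuous (fun _ : T => c)}.
Proof. exact: cst_continuous. Qed.

Lemma contD f g x : {for x, continuous f} -> {for x, continuous g} -> {for x, continuous (fun y => f y + g y)}.
Proof. by move=> cf cg; exact: (cvgD cf cg). Qed.

Lemma contN f x : {for x, continuous f} -> {for x, continuous (fun y => - f y)}.
Proof. by move=> cf; exact: (cvgN cf). Qed.

Lemma contM f g x : {for x, continuous f} -> {for x, continuous g} -> {for x, continuous (fun y => f y * g y)}.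
Proof. by move=> cf cg; exact: (cvgM cf cg). Qed.

Lemma contX f x n : {for x, continuous f} -> {for x, continuous (fun y => f y ^+ n)}.
Proof.
move=> cf; elim: n => [|n IH].
 by rewrite (_ : (fun y => f y ^+ 0) = cst 1); [exact: cst_continuous|apply/funext => y; rewrite expr0].
rewrite (_ : (fun y => f y ^+ n.+1) = (fun y => f y * f y ^+ n)); first exact: contM.
by apply/funext => y; rewrite exprS.
Qed.

Lemma contV f x : f x != 0 -> {for x, continuous f} -> {for x, continuous (fun y => (f y)^-1)}.
Proof. by move=> f0 cf; apply: cvgV. Qed.

Lemma cont_sqrt f x : {for x, continuous f} -> {for x, continuous (fun y => sqrt (f y))}.
Proof. by move=> cf; apply: continuous_comp; [exact: cf|exact: sqrt_continuous]. Qed.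

Lemma cont_expR f x : {for x, continuous f} -> {for x, continuous (fun y => expR (f y))}.
Proof. by move=> cf; apply: continuous_comp; [exact: cf|exact: continuous_expR]. Qed.

Lemma cont_ln f x : 0 < f x -> {for x, continuous f} -> {for x, continuous (fun y => ln (f y))}.
Proof. by move=> f0 cf; apply: continuous_comp; [exact: cf|exact: continuous_ln]. Qed.

Lemma cont_norm f x : {for x, continuous f} -> {for x, continuous (fun y => `|f y|)}.
Proof. by move=> cf; apply: continuous_comp; [exact: cf|exact: norm_continuous]. Qed.

Lemma contT f : (forall x, {for x, continuous f}) -> continuous f.
Proof. by []. Qed.

Lemma cont_comp (h : R -> R) f x : continuous h -> {for x, continuous f} ->
 {for x, continuous (fun y => h (f y))}.
Proof. by move=> ch cf; apply: continuous_comp; [exact: cf|exact: ch]. Qed.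

End ContinuousFor.

Lemma cont_id {R : realType} (x : R) : {for x, continuous (fun y : R => y)}.
Proof. by move=> ?. Qed.

Lemma cont_fst {R : realType} (x : R * R) : {for x, continuous (fun y : R * R => y.1)}.
Proof. exact: cvg_fst. Qed.

Lemma cont_snd {R : realType} (x : R * R) : {for x, continuous (fun y : R * R => y.2)}.
Proof. exact: cvg_snd. Qed.

Lemma is_derive_cont {R : realType} (f : R -> R) x df : is_derive x (1 : R) f df -> {for x, continuous f}.
Proof. by move=> [df1 _]; exact/differentiable_continuous/derivable1_diffP. Qed.


Ltac ctn := lazymatch goal with
 | |- {for ?x, continuous _} => ctn1
 | |- continuous _ => apply: contT => ?; ctn1
 end
with ctn1 := lazymatch goal with
 | |- {for _, continuous (fun=> ?c)} => apply: cont_cst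
 | |- {for _, continuous (fun y => y)} => apply: cont_id
 | |- {for _, continuous (fun y => y.1)} => apply: cont_fst
 | |- {for _, continuous (fun y => y.2)} => apply: cont_snd
 | |- {for _, continuous (fun y => @?f y + @?g y)} => apply (@contD _ _ f g); ctn1
 | |- {for _, continuous (fun y => - @?f y)} => apply (@contN _ _ f); ctn1
 | |- {for _, continuous (fun y => @?f y * @?g y)} => apply (@contM _ _ f g); ctn1
 | |- {for _, continuous (fun y => (@?f y) ^+ ?n)} => apply (@contX _ _ f); ctn1
 | |- {for _, continuous (fun y => (@?f y)^-1)} => apply (@contV _ _ f); [|ctn1]
 | |- {for _, continuous (fun y => sqrt (@?f y))} => apply (@cont_sqrt _ _ f); ctn1
 | |- {for _, continuous (fun y => expR (@?f y))} => apply (@cont_expR _ _ f); ctn1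
 | |- {for _, continuous (fun y => ln (@?f y))} => apply (@cont_ln _ _ f); [|ctn1]
 | |- {for _, continuous (fun y => `|@?f y|)} => apply (@cont_norm _ _ f); ctn1
 | |- _ => first [apply: cont_cst | match goal with
 | H : continuous _ |- _ => apply: H
 | H : forall _, {for _, continuous _} |- _ => apply: H
 | H : forall _, is_derive _ _ _ _ |- _ => apply: (is_derive_cont (H _)) end | eassumption | match goal with H : continuous ?h |- {for _, continuous (fun y => ?h (@?f y))} => apply (@cont_comp _ _ h f); [exact H|ctn1] end | idtac]
 end.

(** * Integrals of continuous functions over a segment *)

Section SegmentIntegral.
Context {R : realType}.
Local Notation mu := (leb R).
Implicit Types (f g : R -> R) (a b : R).

Definition cont_on a b f := forall x, a <= x <= b -> {for x, continuous f}.

Definition deriv_in a b F f := forall x, a < x < b -> is_derive x (1 : R) F (f x).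

Lemma contW a b f : continuous f -> cont_on a b f.
Proof. by move=> cf x _; exact: cf. Qed.

Lemma cont_on_within a b f : cont_on a b f -> {within `[a, b], continuous f}.
Proof. by move=> cf; apply: continuous_in_subspaceT => x; rewrite inE/= in_itv/=; exact: cf. Qed.

Lemma segint_itg a b f : cont_on a b f -> mu.-integrable `[a, b] (EFin \o f).
Proof.
by move=> cf; apply: continuous_compact_integrable; [exact: segment_compact|exact: cont_on_within].
Qed.

Lemma segintD a b f g : cont_on a b f -> cont_on a b g ->
 \int[mu]_(x in `[a, b]) (f x + g x) = \int[mu]_(x in `[a, b]) f x + \int[mu]_(x in `[a, b]) g x.
Proof. by move=> cf cg; rewrite RintegralD//; exact: segint_itg. Qed.

Lemma segintZ a b (c : R) f : cont_on a b f ->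
 \int[mu]_(x in `[a, b]) (c * f x) = c * \int[mu]_(x in `[a, b]) f x.
Proof. by move=> cf; rewrite RintegralZl//; exact: segint_itg. Qed.

Lemma segintB a b f g : cont_on a b f -> cont_on a b g ->
 \int[mu]_(x in `[a, b]) (f x - g x) = \int[mu]_(x in `[a, b]) f x - \int[mu]_(x in `[a, b]) g x.
Proof. by move=> cf cg; rewrite RintegralB//; exact: segint_itg. Qed.

Lemma segint_le a b f g : cont_on a b f -> cont_on a b g -> (forall x, a <= x <= b -> f x <= g x) ->
 \int[mu]_(x in `[a, b]) f x <= \int[mu]_(x in `[a, b]) g x.
Proof.
move=> cf cg H; apply: (le_Rintegral _ (segint_itg cf) (segint_itg cg)) => //.
Qed.

Lemma segint_norm_le a b f g : cont_on a b f -> cont_on a b g ->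
 (forall x, a <= x <= b -> `|f x| <= g x) ->
 `|\int[mu]_(x in `[a, b]) f x| <= \int[mu]_(x in `[a, b]) g x.
Proof.
move=> cf cg H; apply: le_trans (le_normr_Rintegral _ _) _ => //; first exact: segint_itg.
apply: segint_le => //; move=> x xab; have c := cf x xab; ctn.
Qed.

Lemma segint_cst a b (c : R) : a <= b -> \int[mu]_(x in `[a, b]) c = c * (b - a).
Proof.
move=> ab; rewrite Rintegral_cst//= lebesgue_measure_itv/= lte_fin.
case: ltP => [_|ba]; first by rewrite -EFinD.
by rewrite (_ : b = a) ?subrr//; apply/eqP; rewrite eq_le ba ab.
Qed.

Lemma segint_chasles a b c f : a <= b -> b <= c -> cont_on a c f ->
 \int[mu]_(x in `[a, c]) f x = \int[mu]_(x in `[a, b]) f x + \int[mu]_(x in `[b, c]) f x.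
Proof.
move=> ab bc cf; have I := segint_itg cf.
have := @Rintegral_itvB _ f (BLeft a) (BRight c) b I.
rewrite !bnd_simp => /(_ ab bc) H.
rewrite -[LHS](subrK (\int[mu]_(x in `[a, b]) f x)) H addrC; congr (_ + _).
rewrite Rintegral_itv_obnd_cbnd//; apply: (integrableS _ _ _ I) => //.
by apply: subset_itv; rewrite bnd_simp.
Qed.

(* The primitive need only be differentiable in the open interval: this is used for
 primitives such as that of the square root of [r^2 - x^2]. *)
Lemma segint_FTC a b F f : a <= b -> cont_on a b f -> cont_on a b F -> deriv_in a b F f ->
 \int[mu]_(x in `[a, b]) f x = F b - F a.
Proof.
rewrite le_eqVlt => /predU1P[<- _ _ _|ab cf cF dF].
 by rewrite set_itv1 Rintegral_set1 subrr.
rewrite /Rintegral (continuous_FTC2 (F := F))//.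
- exact: cont_on_within.
- split; first by move=> x; rewrite in_itv/= => xab; have [] := dF x xab.
 + by apply: cvg_at_right_filter; apply: cF; rewrite lexx ltW.
 + by apply: cvg_at_left_filter; apply: cF; rewrite lexx ltW.
- by move=> x; rewrite in_itv/= => xab; rewrite derive1E; have [] := dF x xab.
Qed.

Lemma le0_derive_le a b F f : a <= b -> cont_on a b F ->
 (forall x, a < x < b -> is_derive x (1 : R) F (f x)) -> (forall x, a < x < b -> f x <= 0) ->
 F b <= F a.
Proof.
move=> ab cF dF f0; apply: (@ler0_derive1_le_cc _ F a b); rewrite ?in_itv/= ?lexx ?ab//.
- by move=> x; rewrite in_itv/= => xab; have [] := dF x xab.
- by move=> x; rewrite in_itv/= => xab; rewrite derive1E; have [_ ->] := dF x xab; exact: f0.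
- exact: cont_on_within.
Qed.

Lemma segint_eq a b f g : (forall x, a <= x <= b -> f x = g x) ->
 \int[mu]_(x in `[a, b]) f x = \int[mu]_(x in `[a, b]) g x.
Proof. by move=> H; apply: eq_Rintegral => x; rewrite inE/= in_itv/=; exact: H. Qed.

(* Integration by parts against the antiderivative [W] of [V]: the second mean value theorem. *)
Lemma segint_monotone_bound a b f f' V W M : a <= b -> cont_on a b V -> cont_on a b f' ->
 (forall x, a <= x <= b -> is_derive x (1 : R) f (f' x)) ->
 (forall x, a <= x <= b -> is_derive x (1 : R) W (V x)) ->
 (forall x, a <= x <= b -> `|W x| <= M) ->
 (forall x, a <= x <= b -> 0 <= f' x) \/ (forall x, a <= x <= b -> f' x <= 0) ->
 `|\int[mu]_(x in `[a, b]) (f x * V x)| <= M * (`|f a| + `|f b| + `|f b - f a|).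
Proof.
move=> ab cV cf' df dW WM sg.
have aab : a <= a <= b by rewrite lexx ab.
have bab : a <= b <= b by rewrite lexx ab.
have M0 : 0 <= M by apply: le_trans (WM a aab).
have cf : cont_on a b f by move=> x xab; exact: is_derive_cont (df x xab).
have cW : cont_on a b W by move=> x xab; exact: is_derive_cont (dW x xab).
have cfW : cont_on a b (fun x => f' x * W x).
 by move=> x xab; have := cf' x xab; have := cW x xab => ? ?; ctn.
have cfV : cont_on a b (fun x => f x * V x).
 by move=> x xab; have := cf x xab; have := cV x xab => ? ?; ctn.
have E : \int[mu]_(x in `[a, b]) (f x * V x) = f b * W b - f a * W a - \int[mu]_(x in `[a, b]) (f' x * W x).
 apply/eqP; rewrite -subr_eq opprK -segintD//; apply/eqP.
 apply: (@segint_FTC _ _ (fun x => f x * W x)) => //.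
 - by move=> x xab; exact: contD (cfV x xab) (cfW x xab).
 - by move=> x xab; exact: contM (cf x xab) (cW x xab).
 move=> x /andP[/ltW ax /ltW xb]; have xab : a <= x <= b by rewrite ax.
 have := df x xab; have := dW x xab => d1 d2.
 by isd; ring.
have If' : \int[mu]_(x in `[a, b]) f' x = f b - f a.
 apply: segint_FTC => // x /andP[/ltW ax /ltW xb]; apply: df; by rewrite ax.
have B : `|\int[mu]_(x in `[a, b]) (f' x * W x)| <= M * `|f b - f a|.
 have cM : cont_on a b (fun x => M * f' x) by move=> x xab; have := cf' x xab => ?; ctn.
 have cMN : cont_on a b (fun x => M * - f' x) by move=> x xab; have := cf' x xab => ?; ctn.
 have cN : cont_on a b (fun x => - f' x) by move=> x xab; have := cf' x xab => ?; ctn.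
 case: sg => [s0|s0].
 apply: (@le_trans _ _ (\int[mu]_(x in `[a, b]) (M * f' x))).
 apply: segint_norm_le => // x xab; rewrite normrM (ger0_norm (s0 x xab)) mulrC.
 by rewrite ler_wpM2r ?s0// WM.
 by rewrite segintZ// If' ler_wpM2l// ler_norm.
 apply: (@le_trans _ _ (\int[mu]_(x in `[a, b]) (M * - f' x))).
 apply: segint_norm_le => // x xab; rewrite normrM (ler0_norm (s0 x xab)) mulrC.
 by rewrite ler_wpM2r ?oppr_ge0 ?s0// WM.
 rewrite segintZ//.
 have -> : \int[mu]_(x in `[a, b]) (- f' x) = - (f b - f a).
 rewrite -If' -mulN1r -segintZ//; apply: segint_eq => x _; by rewrite mulN1r.
 by rewrite ler_wpM2l// -normrN ler_norm.
rewrite E; apply: le_trans (ler_normB _ _) _.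
have -> : M * (`|f a| + `|f b| + `|f b - f a|) = (M * `|f b| + M * `|f a|) + M * `|f b - f a| by ring.
apply: lerD => //; apply: le_trans (ler_normB _ _) _; rewrite !normrM.
by apply: lerD; rewrite mulrC ler_wpM2r// WM.
Qed.

End SegmentIntegral.

(** * The weights (1 + x^2)^(1/2) and (1 + x^2)^(1/4) *)

Section JapaneseBracket.
Context {R : realType}.
Implicit Types x y : R.

Definition jb x : R := sqrt (1 + x ^+ 2).
Definition rho x : R := sqrt (jb x).

Lemma w_gt0 x : 0 < 1 + x ^+ 2.
Proof. by rewrite ltr_wpDr ?sqr_ge0. Qed.

Lemma jb_gt0 x : 0 < jb x. Proof. by rewrite sqrtr_gt0 w_gt0. Qed.
Lemma jb_sqr x : jb x ^+ 2 = 1 + x ^+ 2. Proof. by rewrite sqr_sqrtr// ltW// w_gt0. Qed.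
Lemma jb0 : jb 0 = 1. Proof. by rewrite /jb expr0n addr0 sqrtr1. Qed.

Lemma jb_ge1 x : 1 <= jb x.
Proof.
by rewrite -ler_sqr ?nnegrE ?(ltW (jb_gt0 x))// jb_sqr expr1n lerDl sqr_ge0.
Qed.

Lemma norm_lt_jb x : `|x| < jb x.
Proof. by rewrite -ltr_sqr ?nnegrE ?(ltW (jb_gt0 x))// jb_sqr real_normK ?num_real// ltrDr. Qed.

Lemma jb_gex x : x <= jb x.
Proof. exact: le_trans (ler_norm x) (ltW (norm_lt_jb x)). Qed.

Lemma xjb_gt0 x : 0 < x + jb x.
Proof. by have := norm_lt_jb x; rewrite ltr_norml => /andP[]; lra. Qed.

Lemma is_derive_jb x : is_derive x (1 : R) jb (x / jb x).
Proof.
rewrite /jb; isd; first exact: w_gt0.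
by rewrite /= expr1; field; rewrite gt_eqF ?jb_gt0.
Qed.

Lemma rho_gt0 x : 0 < rho x. Proof. by rewrite sqrtr_gt0 jb_gt0. Qed.
Lemma rho_sqr x : rho x ^+ 2 = jb x. Proof. by rewrite sqr_sqrtr// ltW// jb_gt0. Qed.
Lemma rho_ge1 x : 1 <= rho x.
Proof. by rewrite -ler_sqr ?nnegrE ?(ltW (rho_gt0 x))// rho_sqr expr1n jb_ge1. Qed.

Lemma jb_le x y : 0 <= x -> x <= y -> jb x <= jb y.
Proof.
move=> x0 xy; rewrite ler_sqrt ?(ltW (w_gt0 _))//.
by rewrite lerD2l lerXn2r// nnegrE (le_trans x0).
Qed.

Lemma rho_le x y : 0 <= x -> x <= y -> rho x <= rho y.
Proof. by move=> x0 xy; rewrite /rho ler_sqrt ?(ltW (jb_gt0 _))// jb_le. Qed.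

End JapaneseBracket.

(** * Energy estimates for the even solution of ((1 + x^2) V')' = - lam V *)

Section EvenSolution.
Context {R : realType}.
Local Notation mu := (leb R).
Variables (V P : R -> R) (lam : R).
Hypothesis dV : forall x : R, is_derive x (1 : R) V (P x / (1 + x ^+ 2)).
Hypothesis dP : forall x : R, is_derive x (1 : R) P (- lam * V x).
Hypothesis P0 : P 0 = 0.

Local Notation r := (@jb R).
Local Notation rho := (@rho R).

Lemma cont_V : continuous V. Proof. by move=> x; exact: is_derive_cont (dV x). Qed.
Lemma cont_P : continuous P. Proof. by move=> x; exact: is_derive_cont (dP x). Qed.

(** The quantity P^2 / (1 + x^2) + lam V^2 decreases and starts at lam V(0)^2. For lam = 0 it
    carries no information on V, but then P vanishes and V is constant. *)
Lemma even_solution_le (x : R) : 0 <= lam -> 0 <= x -> `|V x| <= `|V 0|.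
Proof.
move=> lam0 x0.
have [lam00|lamn0] := eqVneq lam 0.
 have Pc y : 0 <= y -> P y = 0.
 move=> y0; have := @segint_FTC _ 0 y P (fun z => - lam * V z) y0.
 rewrite P0 subr0 => <- //.
 - by rewrite (@segint_eq _ _ _ _ (fun=> 0)) ?segint_cst ?mul0r// => z _; rewrite lam00; ring.
 - by apply: contW; ctn.
 - by apply: contW; exact: cont_P.
 have := @segint_FTC _ 0 x V (fun z => P z / (1 + z ^+ 2)) x0.
 rewrite (@segint_eq _ _ _ _ (fun=> 0)); last by move=> z /andP[z0 _]; rewrite Pc// mul0r.
 rewrite segint_cst// mul0r => H; suff -> : V x = V 0 by [].
 apply/eqP; rewrite -subr_eq0; apply/eqP/esym/H => //.
 - by move=> z _; ctn; rewrite gt_eqF ?w_gt0.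
 - by apply: contW; exact: cont_V.
have lamp : 0 < lam by rewrite lt0r lamn0.
pose e y := P y ^+ 2 * (1 + y ^+ 2)^-1 + lam * V y ^+ 2.
have de (y : R) : is_derive y (1 : R) e (- 2 * y * (P y / (1 + y ^+ 2)) ^+ 2).
 have w0 := w_gt0 y.
 rewrite /e; isd; first by rewrite gt_eqF.
 by rewrite /= expr1; field; rewrite gt_eqF.
have : e x <= e 0.
 apply: (le0_derive_le x0 _ (fun y _ => de y)); first by move=> y _; exact: is_derive_cont (de y).
 by move=> y /andP[/ltW y0 _]; rewrite mulNr mulNr oppr_le0; apply: mulr_ge0; rewrite ?sqr_ge0 ?mulr_ge0.
rewrite /e P0 expr0n mul0r add0r => H.
rewrite -ler_sqr ?nnegrE// !real_normK ?num_real// -(ler_pM2l lamp); apply: le_trans H.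
by rewrite lerDr mulr_ge0 ?sqr_ge0 ?invr_ge0// ltW// w_gt0.
Qed.

(* The energy of [(1 + x^2)^(1/4) V], which solves [p'' = - (t^2 - 1 / (4 w)) p] in the
 variable [arsinh x]. *)
Definition energy (k x : R) : R := (P x + x * V x / 2) ^+ 2 / r x + k ^+ 2 * r x * V x ^+ 2.
(** The primitive vanishing at 0 of (q / r + 1 / (4 r^3)) / k with r = (1 + x^2)^(1/2), which bounds
    the logarithmic derivative of the energy. *)
Definition energy_rate (k q x : R) : R := (q * ln (x + r x) + x / (4 * r x)) / k.

(** Gronwall: with A = P + x V / 2 the derivative of the energy is 2 A V (q + 1 / (4 r^2)) / r, and
    2 k A V <= A^2 / r + k^2 r V^2. Splitting lam - 1/4 as k^2 - q with k > 0 keeps the estimate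
    usable when lam is close to 1/4. *)
Lemma energy_le k q x : 0 < k -> 0 <= q -> lam = 4^-1 + k ^+ 2 - q -> 0 <= x ->
 energy k x <= k ^+ 2 * V 0 ^+ 2 * expR (energy_rate k q x).
Proof.
move=> k0 q0 lamE x0.
pose phi y := energy k y * expR (- energy_rate k q y).
pose dE y := 2 * (P y + y * V y / 2) * V y / r y * (q + 1 / (4 * (1 + y ^+ 2))).
have drr := @is_derive_jb R.
have denergy (y : R) : is_derive y (1 : R) (energy k) (dE y).
 have w0 := w_gt0 y; have rp := jb_gt0 y; rewrite /energy.
 isd; first by rewrite gt_eqF.
 rewrite /dE /= expr1 lamE.
 have E := jb_sqr y.
 have -> : 1 + y ^+ 2 = r y ^+ 2 by rewrite E.
 have yE : y ^+ 2 = r y ^+ 2 - 1 by rewrite E; ring.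
 have rn0 : r y != 0 by rewrite gt_eqF.
 apply/eqP; rewrite -subr_eq0; apply/eqP.
 transitivity ((y ^+ 2 - (r y ^+ 2 - 1)) * ((r y)^-1 ^+ 3 * (- V y * (P y + y * V y / 2) / 2))); last by rewrite yE; ring.
 by field.
have drate (y : R) : is_derive y (1 : R) (energy_rate k q) ((q / r y + 1 / (4 * r y * (1 + y ^+ 2))) / k).
 have w0 := w_gt0 y; have rp := jb_gt0 y; have xr := xjb_gt0 y.
 rewrite /energy_rate.
 isd => //; first by rewrite gt_eqF// mulr_gt0.
 have E := jb_sqr y.
 have -> : 1 + y ^+ 2 = r y ^+ 2 by rewrite E.
 have yE : y ^+ 2 = r y ^+ 2 - 1 by rewrite E; ring.
 have rn0 : r y != 0 by rewrite gt_eqF.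
 have xn0 : y + r y != 0 by rewrite gt_eqF.
 have kn0 : k != 0 by rewrite gt_eqF.
 apply/eqP; rewrite -subr_eq0; apply/eqP.
 transitivity ((y ^+ 2 - (r y ^+ 2 - 1)) * (- (4 * r y ^+ 3 * k)^-1)); last by rewrite yE; ring.
 by field; rewrite rn0 xn0 kn0.
pose dphi y := (dE y - energy k y * ((q / r y + 1 / (4 * r y * (1 + y ^+ 2))) / k)) * expR (- energy_rate k q y).
have dphiE (y : R) : is_derive y (1 : R) phi (dphi y).
 have d1 := denergy y; have d2 := drate y.
 by rewrite /phi; isd; rewrite /dphi; ring.
have : phi x <= phi 0.
 apply: (le0_derive_le x0 _ (fun y _ => dphiE y)); first by move=> y _; exact: is_derive_cont (dphiE y).
 move=> y _; rewrite /dphi pmulr_lle0 ?expR_gt0// subr_le0.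
 have w0 := w_gt0 y; have rp := jb_gt0 y.
 have -> : energy k y * ((q / r y + 1 / (4 * r y * (1 + y ^+ 2))) / k) =
 energy k y / k * ((q + 1 / (4 * (1 + y ^+ 2))) / r y).
 by field; rewrite !gt_eqF.
 have -> : dE y = 2 * (P y + y * V y / 2) * V y * ((q + 1 / (4 * (1 + y ^+ 2))) / r y) by rewrite /dE; ring.
 apply: ler_wpM2r.
 by apply: divr_ge0; [apply: addr_ge0 => //; apply: divr_ge0 => //; rewrite mulr_ge0// ltW|exact: ltW].
 rewrite ler_pdivlMr// /energy -subr_ge0.
 have -> : (P y + y * V y / 2) ^+ 2 / r y + k ^+ 2 * r y * V y ^+ 2 - 2 * (P y + y * V y / 2) * V y * k =
 ((P y + y * V y / 2) - k * r y * V y) ^+ 2 / r y by field; rewrite gt_eqF.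
 by rewrite divr_ge0 ?sqr_ge0// ltW.
have -> : phi 0 = k ^+ 2 * V 0 ^+ 2.
 rewrite /phi /energy /energy_rate jb0 P0 (add0r 1) ln1.
 have -> : (q * 0 + 0 / (4 * 1)) / k = 0 by ring.
 by rewrite oppr0 expR0; field.
by rewrite /phi expRN ler_pdivrMr ?expR_gt0.
Qed.

Lemma even_solution_bound k q x : 0 < k -> 0 <= q -> lam = 4^-1 + k ^+ 2 - q -> 0 <= x ->
 V x ^+ 2 <= V 0 ^+ 2 * expR (energy_rate k q x) / r x.
Proof.
move=> k0 q0 lamE x0; have := energy_le k0 q0 lamE x0; have rp := jb_gt0 x => H.
have k20 : 0 < k ^+ 2 by rewrite exprn_gt0.
rewrite ler_pdivlMr// -(ler_pM2l k20) [X in _ <= X]mulrA; apply: le_trans H.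
rewrite /energy.
have -> : k ^+ 2 * (V x ^+ 2 * r x) = k ^+ 2 * r x * V x ^+ 2 by ring.
by rewrite lerDr divr_ge0 ?sqr_ge0// ltW.
Qed.

Section LargeParameter.
Variable t : R.
Hypotheses (t1 : 1 <= t) (lamE : lam = 4^-1 + t ^+ 2).

Let t0 : 0 < t. Proof. exact: lt_le_trans t1. Qed.
Lemma energy_le2 x : 0 <= x -> energy t x <= 2 * t ^+ 2 * V 0 ^+ 2.
Proof.
move=> x0; have lamE' : lam = 4^-1 + t ^+ 2 - 0 by rewrite subr0.
apply: le_trans (energy_le t0 (lexx 0) lamE' x0) _.
have -> : 2 * t ^+ 2 * V 0 ^+ 2 = t ^+ 2 * V 0 ^+ 2 * 2 by ring.
apply: ler_wpM2l; first by rewrite mulr_ge0 ?sqr_ge0.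
have e2 : energy_rate t 0 x <= 4^-1.
 have r4 : 0 < 4 * r x by rewrite mulr_gt0// jb_gt0.
 rewrite /energy_rate mul0r add0r ler_pdivrMr// ler_pdivrMr//.
 apply: le_trans (jb_gex x) _.
 have -> : 4^-1 * t * (4 * r x) = t * r x by field.
 by rewrite ler_peMl// ltW// jb_gt0.
apply: le_trans (_ : expR 4^-1 <= _); first by rewrite ler_expR.
have := expR_ge1Dx (- 4^-1 : R); rewrite expRN => H.
have e0 := expR_gt0 (4^-1 : R).
rewrite -[leLHS]invrK -[leRHS]invrK lef_pV2 ?posrE ?invr_gt0//.
by apply: le_trans H; lra.
Qed.

Lemma large_V x : 0 <= x -> `|V x| <= 2 * `|V 0| / rho x.
Proof.
move=> x0; have H := energy_le2 x0; have rp := rho_gt0 x; have r1 := jb_gt0 x.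
rewrite ler_pdivlMr// -ler_sqr ?nnegrE ?mulr_ge0// ?(ltW rp)//.
rewrite !exprMn rho_sqr !real_normK ?num_real//.
have H2 : t ^+ 2 * r x * V x ^+ 2 <= 2 * t ^+ 2 * V 0 ^+ 2.
 apply: le_trans H; rewrite /energy lerDr divr_ge0 ?sqr_ge0// ltW//.
have t20 : 0 < t ^+ 2 by rewrite exprn_gt0.
rewrite -(ler_pM2l t20).
have -> : t ^+ 2 * (V x ^+ 2 * r x) = t ^+ 2 * r x * V x ^+ 2 by ring.
apply: le_trans H2 _.
have -> : 2 * t ^+ 2 * V 0 ^+ 2 = t ^+ 2 * V 0 ^+ 2 * 2 by ring.
have -> : t ^+ 2 * (2 ^+ 2 * V 0 ^+ 2) = t ^+ 2 * V 0 ^+ 2 * 4 by ring.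
by apply: ler_wpM2l; [rewrite mulr_ge0 ?sqr_ge0|lra].
Qed.

Lemma large_P x : 0 <= x -> `|P x| <= 3 * t * `|V 0| * rho x.
Proof.
move=> x0; have H := energy_le2 x0; have rp := rho_gt0 x; have r1 := jb_gt0 x.
have HV := large_V x0.
have HA : `|P x + x * V x / 2| <= 2 * t * `|V 0| * rho x.
 rewrite -ler_sqr ?nnegrE ?mulr_ge0// ?(ltW rp) ?(ltW t0)//.
 rewrite !exprMn rho_sqr !real_normK ?num_real//.
 rewrite -ler_pdivrMr//; apply: le_trans (_ : energy t x <= _).
 by rewrite /energy lerDl; apply: mulr_ge0; [apply: mulr_ge0; [exact: sqr_ge0|exact: ltW]|exact: sqr_ge0].
 apply: le_trans H _; rewrite -subr_ge0.
 have -> : 2 ^+ 2 * t ^+ 2 * V 0 ^+ 2 - 2 * t ^+ 2 * V 0 ^+ 2 = 2 * (t * V 0) ^+ 2 by ring.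
 by rewrite mulr_ge0// sqr_ge0.
have HB : `|x * V x / 2| <= `|V 0| * rho x.
 rewrite !normrM (ger0_norm x0) (ger0_norm (_ : 0 <= 2^-1)) ?invr_ge0//.
 rewrite ler_pdivrMr//.
 apply: le_trans (_ : r x * (2 * `|V 0| / rho x) <= _).
 by apply: ler_pM => //; exact: jb_gex.
 rewrite -{1}rho_sqr; apply: eq_ler; field.
 by rewrite gt_eqF.
have -> : P x = (P x + x * V x / 2) - x * V x / 2 by rewrite addrK.
apply: le_trans (ler_normB _ _) _; apply: le_trans (lerD HA HB) _.
have : `|V 0| * rho x <= t * (`|V 0| * rho x) by rewrite ler_peMl// mulr_ge0// ltW.
lra.
Qed.
Let lam_gt0 : 0 < lam. Proof. by rewrite lamE addr_gt0// exprn_gt0. Qed.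
Let lam_ge : t ^+ 2 <= lam. Proof. by rewrite lamE lerDr. Qed.

(** An antiderivative of V, because P' = - lam V; it gains a factor 1 / t. *)
Definition primV x := - P x / lam.

Lemma is_derive_primV (x : R) : is_derive x (1 : R) primV (V x).
Proof. by have d := dP x; rewrite /primV; isd; field; rewrite gt_eqF. Qed.

Lemma large_primV x : 0 <= x -> `|primV x| <= 3 * `|V 0| * rho x / t.
Proof.
move=> x0; rewrite /primV normrM normrN normfV (gtr0_norm lam_gt0).
rewrite ler_pdivrMr//; apply: le_trans (large_P x0) _.
have -> : 3 * `|V 0| * rho x / t * lam = (3 * `|V 0| * rho x) * (lam / t) by ring.
have -> : 3 * t * `|V 0| * rho x = (3 * `|V 0| * rho x) * t by ring.
apply: ler_wpM2l; first by rewrite !mulr_ge0// ltW// rho_gt0.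
by rewrite ler_pdivlMr// -expr2.
Qed.

(* [primV2' = primV] since [(1 + x^2) V' = P]. *)
Definition primV2 x := - ((1 + x ^+ 2) * V x - V 0 - 2 * x * primV x) / (lam + 2).

Lemma is_derive_primV2 (x : R) : is_derive x (1 : R) primV2 (primV x).
Proof.
have d := dV x; have d1 := is_derive_primV x; have w0 := w_gt0 x.
have l2 : 0 < lam + 2 by rewrite addr_gt0.
rewrite /primV2; isd; rewrite /= expr1 [in RHS]/primV.
have -> : P x = - lam * primV x by rewrite /primV; field; rewrite gt_eqF.
by field; rewrite !gt_eqF.
Qed.

Lemma large_primV2 x : 0 <= x -> `|primV2 x| <= 9 * `|V 0| * rho x ^+ 3 / t ^+ 2.
Proof.
move=> x0; have l2 : 0 < lam + 2 by rewrite addr_gt0.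
have rp := rho_gt0 x; have V00 : 0 <= `|V 0| by [].
rewrite /primV2 normrM normrN normfV (gtr0_norm l2) ler_pdivrMr//.
have B1 : `|(1 + x ^+ 2) * V x| <= 2 * `|V 0| * rho x ^+ 3.
 rewrite normrM (gtr0_norm (w_gt0 x)) -jb_sqr.
 apply: le_trans (ler_wpM2l (sqr_ge0 _) (large_V x0)) _.
 rewrite -{1}rho_sqr; apply: eq_ler; field.
 by rewrite gt_eqF.
have B2 : `|V 0| <= `|V 0| * rho x ^+ 3.
 by rewrite ler_peMr// exprn_ege1// rho_ge1.
have B3 : `|2 * x * primV x| <= 6 * `|V 0| * rho x ^+ 3.
 rewrite normrM (ger0_norm (_ : 0 <= 2 * x)) ?mulr_ge0//.
 apply: le_trans (_ : 2 * r x * (3 * `|V 0| * rho x) <= _).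
 apply: ler_pM => //; first by rewrite mulr_ge0.
 by rewrite ler_wpM2l// jb_gex.
 apply: le_trans (large_primV x0) _; rewrite ler_pdivrMr// ler_peMr//.
 by rewrite !mulr_ge0// ltW.
 rewrite -{1}rho_sqr; apply: eq_ler; ring.
have -> : 9 * `|V 0| * rho x ^+ 3 / t ^+ 2 * (lam + 2) = 9 * `|V 0| * rho x ^+ 3 * ((lam + 2) / t ^+ 2) by ring.
apply: le_trans (_ : 9 * `|V 0| * rho x ^+ 3 <= _); last first.
 apply: ler_peMr; first by apply: mulr_ge0; [rewrite mulr_ge0|exact/exprn_ge0/ltW].
 by rewrite ler_pdivlMr ?exprn_gt0// mul1r (le_trans lam_ge)// lerDl.
apply: le_trans (ler_normB _ _) _; apply: le_trans (lerD (ler_normB _ _) B3) _.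
have := lerD B1 B2; lra.
Qed.

End LargeParameter.
End EvenSolution.

(** * Substitution on a segment *)

Section SegmentSubstitution.
Context {R : realType}.
Local Notation mu := (leb R).

Lemma is_derive_segint (g : R -> R) (c x : R) : continuous g -> c < x ->
 is_derive x (1 : R) (fun y => \int[mu]_(z in `[c, y]) g z) (g x).
Proof.
move=> cg cx.
have xx1 : x < x + 1 by rewrite ltrDl.
have I : mu.-integrable `[c, x + 1] (EFin \o g) by apply: segint_itg; exact: contW.
have [d e] := continuous_FTC1_closed xx1 I cx (cg x).
by apply: DeriveDef; [exact: d|rewrite -derive1E; exact: e].
Qed.

(** The chain rule for the primitive of [g] based at [c], which lies strictly below the range of [F]
    so that the primitive is differentiable there; [F] need not be monotone. *)
Lemma segint_subst (g F f : R -> R) (a b c : R) : a <= b -> continuous g ->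
 (forall x, a <= x <= b -> is_derive x (1 : R) F (f x)) -> cont_on a b f ->
 (forall x, a <= x <= b -> c < F x) -> F a <= F b ->
 \int[mu]_(y in `[F a, F b]) g y = \int[mu]_(x in `[a, b]) (g (F x) * f x).
Proof.
move=> ab cg dF cf cF Fab.
have aab : a <= a <= b by rewrite lexx ab.
have bab : a <= b <= b by rewrite lexx ab.
pose Gp y := \int[mu]_(z in `[c, y]) g z.
have dG x : a <= x <= b -> is_derive x (1 : R) (Gp \o F) (g (F x) * f x).
 move=> xab; have d1 := dF x xab; have d2 := is_derive_segint cg (cF x xab).
 by apply: (@is_derive_eq _ _ _ _ _ _ _ _ (is_derive1_comp d2 d1)).
rewrite (@segint_FTC _ a b (Gp \o F) (fun x => g (F x) * f x))//.
- have E := segint_chasles (ltW (cF a aab)) Fab (contW (a := c) (b := F b) cg).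
 by rewrite /= /Gp E addrAC subrr add0r.
- move=> x xab; apply: contM; last exact: cf.
 by apply: continuous_comp; [exact: is_derive_cont (dF x xab)|exact: cg].
- by move=> x xab; exact: is_derive_cont (dG x xab).
- by move=> x /andP[/ltW ax /ltW xb]; apply: dG; rewrite ax.
Qed.

End SegmentSubstitution.

(** * The weight (Y^2 - x^2)^(1/2) and its moments *)

Section Chord.
Context {R : realType}.
Local Notation mu := (leb R).
Implicit Types Y x a : R.

(** It vanishes for |x| >= Y, since the square root of a negative number is 0; two radii can thus be
    compared on the larger segment. *)
Definition chord Y x : R := sqrt (Y ^+ 2 - x ^+ 2).

Lemma chord_ge0 Y x : 0 <= chord Y x. Proof. exact: sqrtr_ge0. Qed.

Lemma cont_chord Y : continuous (chord Y).
Proof. by rewrite /chord; ctn. Qed.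

Lemma chord_eq0 Y x : Y ^+ 2 <= x ^+ 2 -> chord Y x = 0.
Proof. by move=> H; rewrite /chord ler0_sqrtr// subr_le0. Qed.

Lemma chord_sqr Y x : x ^+ 2 <= Y ^+ 2 -> chord Y x ^+ 2 = Y ^+ 2 - x ^+ 2.
Proof. by move=> H; rewrite sqr_sqrtr// subr_ge0. Qed.

Lemma chord_le Y1 Y2 x : Y1 ^+ 2 <= Y2 ^+ 2 -> chord Y1 x <= chord Y2 x.
Proof. by move=> H; rewrite /chord; exact/ler_wsqrtr/lerB. Qed.

Lemma chord_leY Y x : 0 <= Y -> chord Y x <= Y.
Proof.
move=> Y0; rewrite -[leRHS]ger0_norm// -sqrtr_sqr; apply: ler_wsqrtr.
by rewrite lerBlDr lerDl sqr_ge0.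
Qed.

Lemma sqr_lt0l Y x : 0 <= x -> x < Y -> x ^+ 2 < Y ^+ 2.
Proof. by move=> x0 xY; rewrite ltr_sqr ?nnegrE// ltW// (le_lt_trans x0). Qed.

Lemma sqr_le0l Y x : 0 <= x -> x <= Y -> x ^+ 2 <= Y ^+ 2.
Proof. by move=> x0 xY; rewrite ler_sqr ?nnegrE// (le_trans x0). Qed.

Lemma chord_gt0 Y x : x ^+ 2 < Y ^+ 2 -> 0 < chord Y x.
Proof. by move=> H; rewrite sqrtr_gt0 subr_gt0. Qed.

Lemma is_derive_chord Y x : x ^+ 2 < Y ^+ 2 -> is_derive x (1 : R) (chord Y) (- x / chord Y x).
Proof.
move=> H; have c0 := chord_gt0 H.
rewrite /chord; isd; first by rewrite subr_gt0.
by rewrite -/(chord Y x) /= expr1; field; rewrite gt_eqF.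
Qed.

Lemma quarter_disc Y : 0 <= Y -> \int[mu]_(x in `[0, Y]) chord Y x = pi / 4 * Y ^+ 2.
Proof.
move=> Y0; have pi20 : 0 <= pi / 2 :> R by rewrite divr_ge0 ?pi_ge0.
have S0 : Y * sin 0 = 0 by rewrite sin0 mulr0.
have S1 : Y * sin (pi / 2) = Y by rewrite sin_pihalf mulr1.
have ds (x : R) : is_derive x (1 : R) (fun x => Y * sin x) (Y * cos x).
 by have d := is_derive_sin x; isd; ring.
have cc : continuous (fun x : R => Y * cos x).
 by move=> x; apply: contM; [exact: cont_cst|exact: continuous_cos].
have := @segint_subst _ (chord Y) (fun x => Y * sin x) (fun x => Y * cos x) 0 (pi / 2) (- Y - 1) pi20.
rewrite S0 S1 => ->//; last first.
- move=> x _; have := sin_geN1 x; move=> H; have : Y * -1 <= Y * sin x by rewrite ler_wpM2l.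
 lra.
- exact: contW.
- exact: cont_chord.
rewrite (@segint_eq _ _ _ _ (fun x => Y ^+ 2 * cos x ^+ 2)); last first.
 move=> x /andP[x0 x1]; rewrite /chord.
 have -> : Y ^+ 2 - (Y * sin x) ^+ 2 = (Y * cos x) ^+ 2.
 by rewrite !exprMn cos2sin2; ring.
 rewrite sqrtr_sqr ger0_norm; first by ring.
 by rewrite mulr_ge0// cos_ge0_pihalf// x1 andbT (le_trans _ x0)// oppr_le0.
rewrite (@segint_FTC _ 0 (pi / 2) (fun x => Y ^+ 2 * (x + sin x * cos x) / 2) (fun x => Y ^+ 2 * cos x ^+ 2))//.
- by rewrite sin0 cos_pihalf mulr0 mul0r !addr0; field.
- by apply: contW; have ? := @continuous_cos R; ctn.
- by apply: contW; have ? := @continuous_cos R; have ? := @continuous_sin R; ctn.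
move=> x _; have d1 := is_derive_sin x; have d2 := is_derive_cos x.
isd; rewrite -[RHS]mulr1.
have -> : Y ^+ 2 * cos x ^+ 2 * 1 = Y ^+ 2 * (1 + (cos x ^+ 2 - sin x ^+ 2)) / 2.
 by rewrite sin2cos2; field.
by field.
Qed.

Lemma segint_x_chord Y a : 0 <= a -> a <= Y ->
 \int[mu]_(x in `[a, Y]) (x * chord Y x) = chord Y a ^+ 3 / 3.
Proof.
move=> a0 aY; rewrite (@segint_FTC _ a Y (fun x => - chord Y x ^+ 3 / 3) (fun x => x * chord Y x))//.
- by have -> : chord Y Y = 0 by [rewrite chord_eq0]; ring.
- by apply: contW; have := @cont_chord Y => ?; ctn.
- by apply: contW; have := @cont_chord Y => ?; ctn.
move=> x /andP[ax xY]; have xY2 := sqr_lt0l (le_trans a0 (ltW ax)) xY.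
have d := is_derive_chord xY2; have c0 := chord_gt0 xY2.
by isd; rewrite /=; field; rewrite gt_eqF.
Qed.

Lemma segint_chord_tail (G : R -> R) Y1 Y2 a : 0 <= a -> a <= Y1 -> Y1 <= Y2 ->
 cont_on a Y2 G ->
 \int[mu]_(x in `[a, Y2]) (chord Y1 x * G x) = \int[mu]_(x in `[a, Y1]) (chord Y1 x * G x).
Proof.
move=> a0 a1 Y12 cG; rewrite (@segint_chasles _ a Y1 Y2)//; last first.
 by move=> x xab; have := @cont_chord Y1 => ?; have := cG x xab => ?; ctn.
rewrite [X in _ + X](_ : _ = 0) ?addr0//.
rewrite (@segint_eq _ _ _ _ (fun=> 0)) ?segint_cst ?mul0r// => x /andP[x1 _].
by rewrite chord_eq0 ?mul0r// sqr_le0l// (le_trans a0).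
Qed.

(** Both integrals are explicit cubes of chords. The factor [chord Y2 a] is small when [a] is close
    to [Y2], which is what makes the end of the segment harmless. *)
Lemma segint_x_chord_diff Y1 Y2 a : 0 <= a -> a <= Y1 -> Y1 <= Y2 ->
 \int[mu]_(x in `[a, Y2]) (x * (chord Y2 x - chord Y1 x)) <= (Y2 ^+ 2 - Y1 ^+ 2) * chord Y2 a / 2.
Proof.
move=> a0 a1 Y12.
have c1 := @cont_chord Y1; have c2 := @cont_chord Y2.
rewrite (@segint_eq _ _ _ _ (fun x => x * chord Y2 x - chord Y1 x * x)); last by move=> x _; ring.
rewrite segintB; [|apply: contW; ctn|apply: contW; ctn].
rewrite segint_chord_tail//; last by apply: contW; ctn.
rewrite (@segint_eq _ a Y1 _ (fun x => x * chord Y1 x)); last by move=> x _; ring.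
rewrite !segint_x_chord ?(le_trans a1)//.
have -> : Y2 ^+ 2 - Y1 ^+ 2 = chord Y2 a ^+ 2 - chord Y1 a ^+ 2.
 by rewrite !chord_sqr ?sqr_le0l ?(le_trans a1)//; ring.
have := chord_ge0 Y1 a; have : chord Y1 a <= chord Y2 a by apply: chord_le; rewrite sqr_le0l// (le_trans a0).
set z1 := chord Y1 a; set z2 := chord Y2 a => z12 z10.
rewrite -subr_ge0.
have -> : (z2 ^+ 2 - z1 ^+ 2) * z2 / 2 - (z2 ^+ 3 / 3 - z1 ^+ 3 / 3) = (z2 - z1) ^+ 2 * (z2 + 2 * z1) / 6 by field.
by rewrite divr_ge0// mulr_ge0 ?sqr_ge0// addr_ge0 ?mulr_ge0// (le_trans z10).
Qed.

(* An amplitude [B / sqrt x] contributes at most [B sqrt Y2 (Y2^2 - Y1^2)]. *)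
Lemma chord_diff_generic (G : R -> R) Y1 Y2 B : 0 <= Y1 -> Y1 <= Y2 -> 0 <= B -> cont_on 0 Y2 G ->
 (forall x, 0 <= x <= Y2 -> `|G x| <= B * sqrt x) ->
 `|\int[mu]_(x in `[0, Y2]) ((chord Y2 x - chord Y1 x) * G x)| <= B * sqrt Y2 * (Y2 ^+ 2 - Y1 ^+ 2).
Proof.
move=> Y10 Y12 B0 cG HG; have Y20 := le_trans Y10 Y12.
have c1 := @cont_chord Y1; have c2 := @cont_chord Y2.
apply: le_trans (_ : \int[mu]_(x in `[0, Y2]) (B * sqrt Y2 * (chord Y2 x - chord Y1 x)) <= _).
 apply: segint_norm_le.
 - by move=> x xab; have := cG x xab => ?; ctn.
 - by apply: contW; ctn.
 move=> x xab; have D : 0 <= chord Y2 x - chord Y1 x by rewrite subr_ge0 chord_le// sqr_le0l.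
 rewrite normrM (ger0_norm D) mulrC ler_wpM2r// (le_trans (HG x xab))// ler_wpM2l// ler_wsqrtr//.
 by case/andP: xab.
rewrite segintZ; last by apply: contW; ctn.
apply: ler_wpM2l; first by rewrite mulr_ge0.
rewrite segintB; [|exact: contW..].
rewrite quarter_disc// (@segint_eq _ _ _ (chord Y1) (fun x => chord Y1 x * 1)); last by move=> x _; rewrite mulr1.
rewrite segint_chord_tail//; last by apply: contW; ctn.
rewrite (@segint_eq _ 0 Y1 _ (chord Y1)); last by move=> x _; rewrite mulr1.
rewrite quarter_disc// -mulrBr -[leRHS]mul1r; apply: ler_wpM2r.
 by rewrite subr_ge0 sqr_le0l.
by rewrite ler_pdivrMr// mul1r; have := @pihalf_lt2 R; lra.
Qed.

End Chord.

(** * Pairings of the chord weight with solutions of large spectral parameter *)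

Section LargeParameterPeriods.
Context {R : realType}.
Local Notation mu := (leb R).
Variables (V P : R -> R) (lam t : R).
Hypothesis dV : forall x : R, is_derive x (1 : R) V (P x / (1 + x ^+ 2)).
Hypothesis dP : forall x : R, is_derive x (1 : R) P (- lam * V x).
Hypothesis P0 : P 0 = 0.
Hypotheses (t1 : 1 <= t) (lamE : lam = 4^-1 + t ^+ 2).

Let t0 : 0 < t. Proof. exact: lt_le_trans t1. Qed.
Let cV : continuous V := cont_V dV.
Let W1 : R -> R := primV P lam.
Let W2 : R -> R := primV2 V P lam.
Let dW1 (x : R) : is_derive x (1 : R) W1 (V x). Proof. exact: (is_derive_primV dP t1 lamE). Qed.
Let dW2 (x : R) : is_derive x (1 : R) W2 (W1 x). Proof. exact: (is_derive_primV2 dV dP t1 lamE). Qed.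

Lemma rho_lesqrt (x Y : R) : 1 <= Y -> 0 <= x -> x <= Y -> rho x <= 2 * sqrt Y.
Proof.
move=> Y1 x0 xY; have Y0 : 0 <= Y by rewrite (le_trans _ Y1).
rewrite -ler_sqr ?nnegrE ?mulr_ge0 ?(ltW (rho_gt0 _))// rho_sqr exprMn sqr_sqrtr//.
rewrite -ler_sqr ?nnegrE ?mulr_ge0 ?exprn_ge0 ?(ltW (jb_gt0 _))// jb_sqr.
have : x ^+ 2 <= Y ^+ 2 by exact: sqr_le0l.
have : 1 <= Y ^+ 2 by rewrite exprn_ege1.
rewrite exprMn; lra.
Qed.

Section Split.
Variables (Y a s : R).
Hypotheses (Y1 : 1 <= Y) (a0 : 0 <= a) (aE : a ^+ 2 = Y ^+ 2 * (1 - (2 * t)^-1)) (sE : s = sqrt (2 * t)).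

Let Y0 : 0 < Y. Proof. exact: lt_le_trans Y1. Qed.
Let s0 : 0 < s. Proof. by rewrite sE sqrtr_gt0 mulr_gt0. Qed.
Let s2 : s ^+ 2 = 2 * t. Proof. by rewrite sE sqr_sqrtr// mulr_ge0// ltW. Qed.

Lemma split_lt : a < Y.
Proof.
rewrite -ltr_sqr ?nnegrE// ?(ltW Y0)// aE -subr_gt0.
have -> : Y ^+ 2 - Y ^+ 2 * (1 - (2 * t)^-1) = Y ^+ 2 / (2 * t) by ring.
by rewrite divr_gt0 ?mulr_gt0 ?exprn_gt0.
Qed.

Lemma split_ge : Y ^+ 2 <= 2 * a ^+ 2.
Proof.
rewrite aE -subr_ge0.
have -> : 2 * (Y ^+ 2 * (1 - (2 * t)^-1)) - Y ^+ 2 = Y ^+ 2 * ((t - 1) / t) by field; rewrite gt_eqF.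
by rewrite mulr_ge0 ?sqr_ge0// divr_ge0 ?subr_ge0// ltW.
Qed.

(** The splitting point has Y^2 - a^2 = Y^2 / (2 t). This balances the gain from oscillation on
    [0, a], where derivatives of the weight grow towards a, against the smallness of the weight on
    [a, Y]. *)
Lemma chord_split : chord Y a = Y / s.
Proof.
have h : 0 <= Y / s by rewrite divr_ge0// ltW.
rewrite -[RHS]ger0_norm// -sqrtr_sqr /chord aE exprMn exprVn s2; congr sqrt.
by ring.
Qed.

Lemma rho_split_ge : sqrt Y <= 2 * rho a.
Proof.
rewrite -ler_sqr ?nnegrE ?mulr_ge0 ?(ltW (rho_gt0 _))// exprMn rho_sqr sqr_sqrtr ?(ltW Y0)//.
rewrite -ler_sqr ?nnegrE ?mulr_ge0 ?exprn_ge0 ?(ltW (jb_gt0 _))// ?(ltW Y0)// exprMn jb_sqr.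
have := split_ge; have := sqr_ge0 a; rewrite -exprM; lra.
Qed.

Lemma s_ge1 : 1 <= s.
Proof.
have : 1 ^+ 2 <= s ^+ 2 by rewrite s2 expr1n (le_trans t1)// ler_peMl ?(ltW t0)// ler1n.
by rewrite ler_sqr// ?nnegrE// ltW.
Qed.

(* On [[0, a]] the weight [x (chord Y x - chord Y1 x)] is increasing; on [[a, Y]] the bound of [V]
 suffices. *)
Lemma large_period_diff (Y1' : R) : 0 <= Y1' -> Y1' <= Y -> a < Y1' ->
 `|\int[mu]_(x in `[0, Y]) ((chord Y x - chord Y1' x) * (x * V x))|
 <= 26 * `|V 0| * sqrt Y * (Y ^+ 2 - Y1' ^+ 2) * s / t.
Proof.
move=> y0 yY ay.
have aY := split_lt; have aY' := ltW aY.
have c1 := @cont_chord R Y1'; have c2 := @cont_chord R Y.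
set d := Y ^+ 2 - Y1' ^+ 2; have d0 : 0 <= d by rewrite subr_ge0 sqr_le0l.
rewrite (@segint_eq _ _ _ _ (fun x => x * (chord Y x - chord Y1' x) * V x)); last by move=> x _; ring.
rewrite (@segint_chasles _ 0 a Y)//; last by apply: contW; ctn.
pose f x := x * (chord Y x - chord Y1' x).
pose f' x := (chord Y x - chord Y1' x) + x * (- x / chord Y x + x / chord Y1' x).
have lt1 x : 0 <= x <= a -> x ^+ 2 < Y1' ^+ 2.
 by move=> /andP[x0 xa]; apply: sqr_lt0l => //; exact: le_lt_trans ay.
have lt2 x : 0 <= x <= a -> x ^+ 2 < Y ^+ 2.
 by move=> xa; apply: lt_le_trans (lt1 x xa) _; rewrite sqr_le0l.
have ca2 : chord Y a = Y / s by exact: chord_split.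
have cpos : 0 < chord Y a by rewrite ca2 divr_gt0.
have fa : f a = a * d / (chord Y a + chord Y1' a).
 have S := chord_ge0 Y1' a.
 have -> : d = chord Y a ^+ 2 - chord Y1' a ^+ 2.
 by rewrite !chord_sqr ?ltW ?lt1 ?lt2 ?lexx ?a0// /d; ring.
 by rewrite /f; field; rewrite gt_eqF// ltr_wpDr.
have fa0 : 0 <= f a by rewrite fa divr_ge0 ?mulr_ge0// addr_ge0// chord_ge0.
have fale : f a <= d * s.
 rewrite fa ler_pdivrMr ?ltr_wpDr ?chord_ge0//.
 apply: le_trans (_ : d * s * chord Y a <= _); last first.
 by apply: ler_wpM2l; [rewrite mulr_ge0// ltW|rewrite lerDl chord_ge0].
 have -> : d * s * chord Y a = Y * d by rewrite ca2; field; rewrite gt_eqF.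
 by rewrite ler_wpM2r.
have rY : rho a <= 2 * sqrt Y by exact: rho_lesqrt.
have sY : 0 < sqrt Y by rewrite sqrtr_gt0.
have V00 : 0 <= `|V 0| by [].
have I1 : `|\int[mu]_(x in `[0, a]) (f x * V x)| <= 12 * `|V 0| * sqrt Y * d * s / t.
 have := @segint_monotone_bound _ 0 a f f' V W1 (3 * `|V 0| * rho a / t) a0.
 have -> : f 0 = 0 by rewrite /f mul0r.
 rewrite normr0 add0r subr0 (ger0_norm fa0) => H.
 apply: le_trans (H _ _ _ _ _ _) _.
 - exact: contW.
 - move=> x xa; have e1 : chord Y1' x != 0 by rewrite gt_eqF// chord_gt0// lt1.
 have e2 : chord Y x != 0 by rewrite gt_eqF// chord_gt0// lt2.
 by rewrite /f'; ctn.
 - move=> x xa; have g1 := is_derive_chord (lt1 x xa); have g2 := is_derive_chord (lt2 x xa).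
 by rewrite /f; isd; rewrite /f'; ring.
 - by move=> x _; exact: dW1.
 - move=> x /andP[x0 xa]; apply: le_trans (large_primV dV dP P0 t1 lamE x0) _.
 rewrite ler_wpM2r ?invr_ge0 ?(ltW t0)// ler_wpM2l ?mulr_ge0//; exact: rho_le.
 - left=> x xa; have g1 := chord_gt0 (lt1 x xa); have g2 := chord_gt0 (lt2 x xa).
 have x0 : 0 <= x by case/andP: xa.
 have cc : chord Y1' x <= chord Y x by apply: chord_le; rewrite sqr_le0l.
 rewrite /f' addr_ge0 ?subr_ge0// mulr_ge0//.
 rewrite mulNr addrC subr_ge0; apply: ler_wpM2l => //.
 by rewrite lef_pV2 ?posrE.
 have -> : 12 * `|V 0| * sqrt Y * d * s / t = (3 * `|V 0| / t) * ((2 * sqrt Y) * (d * s + d * s)) by ring.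
 have -> : 3 * `|V 0| * rho a / t * (f a + f a) = (3 * `|V 0| / t) * (rho a * (f a + f a)) by ring.
 apply: ler_wpM2l; first by rewrite divr_ge0 ?mulr_ge0// ltW.
 by apply: ler_pM => //; rewrite ?addr_ge0 ?lerD ?(ltW (rho_gt0 _)).
have I2 : `|\int[mu]_(x in `[a, Y]) (f x * V x)| <= 4 * `|V 0| * sqrt Y * d / s.
 apply: le_trans (_ : \int[mu]_(x in `[a, Y]) (2 * `|V 0| / rho a * f x) <= _).
 apply: segint_norm_le.
 - by apply: contW; rewrite /f; ctn.
 - by apply: contW; rewrite /f; ctn.
 move=> x /andP[ax xY]; have x0 := le_trans a0 ax.
 have f0 : 0 <= f x by rewrite mulr_ge0// subr_ge0 chord_le// sqr_le0l.
 rewrite normrM (ger0_norm f0) mulrC ler_wpM2r//.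
 apply: le_trans (large_V dV dP P0 t1 lamE x0) _.
 by rewrite ler_wpM2l ?mulr_ge0// lef_pV2 ?posrE ?rho_gt0// rho_le.
 rewrite segintZ; last by apply: contW; rewrite /f; ctn.
 have H := segint_x_chord_diff a0 (ltW ay) yY; rewrite -/d in H.
 have rp := rho_gt0 a.
 apply: le_trans (ler_wpM2l _ H) _; first by rewrite divr_ge0 ?mulr_ge0// ltW.
 rewrite ca2.
 have -> : 2 * `|V 0| / rho a * (d * (Y / s) / 2) = (`|V 0| * d / s) * (Y / rho a) by field; rewrite !gt_eqF.
 have -> : 4 * `|V 0| * sqrt Y * d / s = (`|V 0| * d / s) * (4 * sqrt Y) by ring.
 apply: ler_wpM2l; first by rewrite divr_ge0 ?mulr_ge0// ltW.
 rewrite ler_pdivrMr// -{1}(sqr_sqrtr (ltW Y0)) expr2.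
 have -> : 4 * sqrt Y * rho a = sqrt Y * (2 * (2 * rho a)) by ring.
 apply: ler_wpM2l; first exact: ltW.
 by apply: le_trans rho_split_ge _; rewrite ler_peMl ?mulr_ge0 ?(ltW rp)//; lra.
apply: le_trans (ler_normD _ _) _; apply: le_trans (lerD I1 I2) _.
have -> : 4 * `|V 0| * sqrt Y * d / s = 2 * `|V 0| * sqrt Y * d * s / t.
 have -> : t = s ^+ 2 / 2 by rewrite s2; field.
 by field; rewrite gt_eqF.
rewrite -mulrDl -mulrDl -!mulrDl.
rewrite ler_wpM2r ?invr_ge0 ?(ltW t0)// ler_wpM2r ?(ltW s0)// ler_wpM2r// ler_wpM2r ?(ltW sY)//.
by rewrite ler_wpM2r//; lra.
Qed.

(* Two integrations by parts on [[0, a]], where the weight is concave, and one on [[a, Y]], where it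
 decreases to [0]. *)
Lemma large_period : `|\int[mu]_(x in `[0, Y]) (chord Y x * (x * V x))|
 <= 441 * `|V 0| * sqrt Y * Y ^+ 2 * s / t ^+ 2.
Proof.
have aY := split_lt; have aY' := ltW aY.
have c2 := @cont_chord R Y.
have ca2 : chord Y a = Y / s by exact: chord_split.
have cpos : 0 < chord Y a by rewrite ca2 divr_gt0.
have sY : 0 < sqrt Y by rewrite sqrtr_gt0.
have V00 : 0 <= `|V 0| by [].
have rY : rho a <= 2 * sqrt Y by exact: rho_lesqrt.
have Ys0 : 0 <= Y * s by rewrite mulr_ge0// ltW.
have lam0 : 0 <= lam by rewrite lamE addr_ge0// sqr_ge0.
rewrite (@segint_eq _ _ _ _ (fun x => x * chord Y x * V x)); last by move=> x _; ring.
pose f x := x * chord Y x.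
pose f' x := chord Y x - x ^+ 2 / chord Y x.
pose f'' x := - (3 * x / chord Y x + (x / chord Y x) ^+ 3).
have df x : 0 <= x < Y -> is_derive x (1 : R) f (f' x).
 move=> /andP[x0 xY]; have g2 := is_derive_chord (sqr_lt0l x0 xY).
 by rewrite /f; isd; rewrite /f'; ring.
have df' x : 0 <= x < Y -> is_derive x (1 : R) f' (f'' x).
 move=> /andP[x0 xY]; have g2 := is_derive_chord (sqr_lt0l x0 xY).
 have c0 : chord Y x != 0 by rewrite gt_eqF// chord_gt0// sqr_lt0l.
 by rewrite /f'; isd => //; rewrite /f'' /=; field.
have ltY x : 0 <= x <= a -> 0 <= x < Y by move=> /andP[-> /le_lt_trans]; apply.
have fa : 0 <= f a <= Y ^+ 2 / s.
 rewrite /f ca2 mulr_ge0 ?divr_ge0 ?(ltW s0) ?(ltW Y0)//=.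
 by rewrite expr2 -mulrA ler_wpM2r ?divr_ge0 ?(ltW s0) ?(ltW Y0).
have W1le x : 0 <= x -> x <= Y -> `|W1 x| <= 6 * `|V 0| * sqrt Y / t.
 move=> x0 xY; apply: le_trans (large_primV dV dP P0 t1 lamE x0) _.
 rewrite ler_wpM2r ?invr_ge0 ?(ltW t0)//.
 have -> : 6 * `|V 0| * sqrt Y = 3 * `|V 0| * (2 * sqrt Y) by ring.
 by rewrite ler_wpM2l ?mulr_ge0//; exact: rho_lesqrt.
have cf' : cont_on 0 a f' by move=> x xa; exact: is_derive_cont (df' x (ltY x xa)).
have cf : continuous f by rewrite /f; ctn.
have cW : continuous W1 by move=> x; exact: is_derive_cont (dW1 x).
have I1 : `|\int[mu]_(x in `[0, a]) (f x * V x)| <= 435 * `|V 0| * sqrt Y * Y ^+ 2 * s / t ^+ 2.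
 have cA : cont_on 0 a (fun x => f' x * W1 x) by move=> x xa; have ? := cf' x xa; ctn.
 have cB : cont_on 0 a (fun x => f x * V x) by move=> x xa; ctn.
 have E : \int[mu]_(x in `[0, a]) (f x * V x) = f a * W1 a - \int[mu]_(x in `[0, a]) (f' x * W1 x).
 apply/eqP; rewrite -subr_eq opprK -segintD//; apply/eqP.
 rewrite (@segint_FTC _ 0 a (fun x => f x * W1 x) (fun x => f x * V x + f' x * W1 x))//.
 - by rewrite /f !mul0r subr0.
 - by move=> x xa; exact: contD (cB x xa) (cA x xa).
 - by apply: contW; ctn.
 move=> x /andP[/ltW x0 /ltW xa]; have d1 := df x (ltY x _); have d2 := dW1 x.
 have {}d1 : is_derive x (1 : R) f (f' x) by apply: d1; rewrite x0.
 by isd; ring.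
 have f'0 : `|f' 0| <= Y * s.
 rewrite /f' expr0n mul0r subr0 ger0_norm ?chord_ge0//.
 by apply: le_trans (chord_leY _ (ltW Y0)) _; rewrite ler_peMr ?s_ge1// ltW.
 have f'a : `|f' a| <= 2 * (Y * s).
 rewrite /f'; apply: le_trans (ler_normB _ _) _.
 rewrite ger0_norm ?chord_ge0// ger0_norm ?divr_ge0 ?sqr_ge0 ?chord_ge0//.
 have : chord Y a <= Y * s.
 by apply: le_trans (chord_leY _ (ltW Y0)) _; rewrite ler_peMr ?s_ge1// ltW.
 have : a ^+ 2 / chord Y a <= Y * s.
 rewrite ler_pdivrMr// ca2; have -> : Y * s * (Y / s) = Y ^+ 2 by field; rewrite gt_eqF.
 exact: sqr_le0l.
 lra.
 have J : `|\int[mu]_(x in `[0, a]) (f' x * W1 x)| <= 432 * `|V 0| * sqrt Y * Y ^+ 2 * s / t ^+ 2.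
 have := @segint_monotone_bound _ 0 a f' f'' W1 W2 (9 * `|V 0| * rho a ^+ 3 / t ^+ 2) a0.
 move=> H; apply: le_trans (H _ _ _ _ _ _) _.
 - exact: contW.
 - move=> x xa; have ? : chord Y x != 0.
 by have /andP[x0 xY] := ltY x xa; rewrite gt_eqF// chord_gt0// sqr_lt0l.
 by rewrite /f''; ctn.
 - by move=> x xa; apply: df'; exact: ltY.
 - by move=> x _; exact: dW2.
 - move=> x /andP[x0 xa]; apply: le_trans (large_primV2 dV dP P0 t1 lamE x0) _.
 rewrite ler_wpM2r ?invr_ge0 ?sqr_ge0// ler_wpM2l ?mulr_ge0// lerXn2r ?nnegrE ?(ltW (rho_gt0 _))//.
 exact: rho_le.
 - right=> x /andP[x0 _]; rewrite oppr_le0 addr_ge0//.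
 by rewrite divr_ge0 ?mulr_ge0 ?chord_ge0.
 by rewrite exprn_ge0// divr_ge0// chord_ge0.
 have S : `|f' 0| + `|f' a| + `|f' a - f' 0| <= 6 * (Y * s).
 by have := ler_normB (f' a) (f' 0); lra.
 have -> : 432 * `|V 0| * sqrt Y * Y ^+ 2 * s / t ^+ 2 =
 9 * `|V 0| * ((2 * sqrt Y) ^+ 3) / t ^+ 2 * (6 * (Y * s)).
 have -> : (2 * sqrt Y) ^+ 3 = 8 * sqrt Y * Y by rewrite -{3}(sqr_sqrtr (ltW Y0)); ring.
 ring.
 apply: ler_pM => //; rewrite ?divr_ge0 ?mulr_ge0 ?exprn_ge0 ?(ltW (rho_gt0 _)) ?(ltW t0) ?addr_ge0//.
 rewrite ler_wpM2r ?invr_ge0 ?sqr_ge0// ler_wpM2l ?mulr_ge0//.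
 by rewrite lerXn2r ?nnegrE ?(ltW (rho_gt0 _)) ?mulr_ge0 ?(ltW sY).
 rewrite E; apply: le_trans (ler_normB _ _) _.
 have K : `|f a * W1 a| <= 3 * `|V 0| * sqrt Y * Y ^+ 2 * s / t ^+ 2.
 case/andP: fa => fa0 fa1; rewrite normrM (ger0_norm fa0).
 apply: le_trans (ler_pM fa0 (normr_ge0 _) fa1 (W1le a a0 aY')) _.
 apply: eq_ler.
 have -> : t = s ^+ 2 / 2 by rewrite s2; field.
 by field; rewrite gt_eqF.
 apply: le_trans (lerD K J) _; rewrite -!mulrDl; apply: eq_ler.
 by ring.
(* The derivative of the weight is infinite at Y, so the integration by parts stops at b < Y; what
   remains is made smaller than any e > 0 by the trivial bound [I3]. *)
have I2 b : a <= b -> b < Y ->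
 `|\int[mu]_(x in `[a, b]) (f x * V x)| <= 6 * `|V 0| * sqrt Y * Y ^+ 2 * s / t ^+ 2.
 move=> ab bY.
 have in0 x : a <= x <= b -> 0 <= x < Y.
 by move=> /andP[ax xb]; rewrite (le_trans a0 ax) (le_lt_trans xb bY).
 have neg x : a <= x <= b -> f' x <= 0.
 move=> xab; have /andP[x0 xY] := in0 x xab; have c0 := chord_gt0 (sqr_lt0l x0 xY).
 rewrite /f' subr_le0 ler_pdivlMr// -expr2 chord_sqr ?sqr_le0l ?(ltW xY)//.
 rewrite lerBlDr; apply: le_trans split_ge _; rewrite mulrDl mul1r.
 by case/andP: xab => ax _; rewrite lerD ?sqr_le0l.
 have dec : f b <= f a.
 apply: (le0_derive_le (f := f') ab).
 - exact: contW.
 - by move=> x /andP[/ltW ax /ltW xb]; apply/df/in0; rewrite ax.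
 - by move=> x /andP[/ltW ax /ltW xb]; apply: neg; rewrite ax.
 have fb0 : 0 <= f b by rewrite mulr_ge0 ?chord_ge0// (le_trans a0).
 have := @segint_monotone_bound _ a b f f' V W1 (6 * `|V 0| * sqrt Y / t) ab.
 move=> H; apply: le_trans (H _ _ _ _ _ _) _.
 - exact: contW.
 - by move=> x xab; exact: is_derive_cont (df' x (in0 x xab)).
 - by move=> x xab; apply/df/in0.
 - by move=> x _; exact: dW1.
 - by move=> x xab; have /andP[x0 /ltW xY] := in0 x xab; exact: W1le.
 - by right.
 have /andP[fa0 fa1] := fa.
 rewrite (ger0_norm fb0) (ger0_norm fa0) (ler0_norm (_ : f b - f a <= 0)) ?subr_le0//.
 have -> : f a + f b + - (f b - f a) = 2 * f a by ring.
 apply: le_trans (_ : 6 * `|V 0| * sqrt Y / t * (2 * (Y ^+ 2 / s)) <= _).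
 by rewrite ler_wpM2l ?ler_wpM2l// divr_ge0 ?mulr_ge0 ?(ltW sY) ?(ltW t0).
 apply: eq_ler.
 have -> : t = s ^+ 2 / 2 by rewrite s2; field.
 by field; rewrite gt_eqF.
have I3 b : a <= b -> b < Y -> `|\int[mu]_(x in `[b, Y]) (f x * V x)| <= Y ^+ 2 * `|V 0| * (Y - b).
 move=> ab bY; rewrite -segint_cst ?(ltW bY)//; apply: segint_norm_le.
 - by apply: contW; ctn.
 - by apply: contW; ctn.
 move=> x /andP[bx xY]; have x0 := le_trans a0 (le_trans ab bx).
 rewrite normrM; apply: ler_pM => //; last exact: (even_solution_le dV dP P0).
 by rewrite ger0_norm ?mulr_ge0 ?chord_ge0// expr2 ler_pM ?chord_ge0 ?chord_leY ?(ltW Y0).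
apply/ler_addgt0Pr => e e0.
pose M := Y ^+ 2 * `|V 0| + 1.
have M0 : 0 < M by rewrite ltr_wpDl// mulr_ge0// sqr_ge0.
pose b := Num.max a (Y - e / M).
have ab : a <= b by rewrite le_max lexx.
have bY : b < Y by rewrite gt_max aY ltrBlDr ltrDl divr_gt0.
rewrite (@segint_chasles _ 0 a Y)//; last by apply: contW; ctn.
rewrite (@segint_chasles _ a b Y) ?(ltW bY)//; last by apply: contW; ctn.
apply: le_trans (ler_normD _ _) _.
have Eb : Y ^+ 2 * `|V 0| * (Y - b) <= e.
 apply: le_trans (_ : M * (e / M) <= _); last by rewrite mulrCA divff ?mulr1 ?gt_eqF.
 apply: ler_pM; rewrite ?mulr_ge0 ?sqr_ge0 ?subr_ge0 ?(ltW bY) ?lerDl ?(ltW Y0)//.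
 by rewrite lerBlDr addrC -lerBlDr le_max lexx orbT.
have := ler_normD (\int[mu]_(x in `[a, b]) (f x * V x)) (\int[mu]_(x in `[b, Y]) (f x * V x)).
have := I2 b ab bY; have := I3 b ab bY; move: I1 Eb.
have -> : 435 * `|V 0| * sqrt Y * Y ^+ 2 * s / t ^+ 2 = 435 * (`|V 0| * sqrt Y * Y ^+ 2 * s / t ^+ 2) by ring.
have -> : 441 * `|V 0| * sqrt Y * Y ^+ 2 * s / t ^+ 2 = 441 * (`|V 0| * sqrt Y * Y ^+ 2 * s / t ^+ 2) by ring.
have -> : 6 * `|V 0| * sqrt Y * Y ^+ 2 * s / t ^+ 2 = 6 * (`|V 0| * sqrt Y * Y ^+ 2 * s / t ^+ 2) by ring.
by rewrite /f; lra.
Qed.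

End Split.
End LargeParameterPeriods.

(** * Integrals over the line as limits of integrals over segments *)

Section LineIntegral.
Context {R : realType}.
Local Notation mu := (leb R).

Lemma measurable_EFin_cont (f : R -> R) : continuous f ->
 mfun (fun x : measurableTypeR R => (f x)%:E).
Proof. by move=> cf; apply/measurable_EFinP; exact: continuous_measurable_fun. Qed.

Lemma line_cvg (f : R -> R) : continuous f -> (forall x, 0 <= f x) ->
 ((\int[mu]_(x in `[(- n%:R)%R, n%:R%R]) f x)%:E @[n --> \oo] --> \int[mu]_x (f x)%:E)%E.
Proof.
move=> cf f0.
have E n : ((\int[mu]_(x in `[(- n%:R)%R, n%:R%R]) f x)%:E = \int[mu]_(x in `[(- n%:R)%R, n%:R%R]) (f x)%:E)%E.
 by rewrite fineK// integrable_fin_num//; apply: segint_itg; exact: contW.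
under eq_cvg do rewrite E.
have U : \bigcup_n `[- n%:R, n%:R]%classic = [set: measurableTypeR R].
 rewrite -subTset => x _; exists (Num.truncn `|x|).+1 => //=.
 by rewrite in_itv/= -ler_norml ltW// truncnS_gt.
rewrite -U; apply: ge0_nondecreasing_set_cvg_integral => //.
- move=> n p np; apply/subsetPset; apply: subset_itv; rewrite bnd_simp.
 by rewrite lerN2 ler_nat.
 by rewrite ler_nat.
- by move=> n; apply: measurable_funTS; exact: measurable_EFin_cont.
- by move=> n x _; rewrite lee_fin.
Qed.

Definition deriv_line (F f : R -> R) := forall x, is_derive x (1 : R) F (f x).

Lemma ge0_integral_line_FTC (F f : R -> R) (l0 l1 : R) : deriv_line F f ->
 continuous f -> (forall x, 0 <= f x) -> F n%:R @[n --> \oo] --> l1 -> F (- n%:R) @[n --> \oo] --> l0 ->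
 (\int[mu]_x (f x)%:E = (l1 - l0)%:E)%E.
Proof.
move=> dF cf f0 c1 c0.
have H := line_cvg cf f0.
have E n : \int[mu]_(x in `[- n%:R, n%:R]) f x = F n%:R - F (- n%:R).
 apply: segint_FTC; first by rewrite (le_trans (_ : _ <= 0))// oppr_le0.
 - exact: contW.
 - by apply: contW => x; exact: is_derive_cont (dF x).
 - by move=> x _.
rewrite -(cvg_lim _ H)//; apply/cvg_lim => //.
under eq_cvg do rewrite E.
apply: cvg_EFin; first exact: nearW.
exact: cvgB.
Qed.

Lemma ge0_integral_line_shift (b : R) (f : R -> R) : continuous f -> (forall x, 0 <= f x) ->
 (\int[mu]_x (f x)%:E = \int[mu]_x (f (x + b)%R)%:E)%E.
Proof.
move=> cf f0; have := @ge0_integral_affine _ 1 b (EFin \o f).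
rewrite normr1 mul1e => -> //.
- by apply: eq_integral => x _ /=; rewrite mul1r.
exact: measurable_EFin_cont.
Qed.

End LineIntegral.

(** * Gamma and beta integrals in a logarithmic variable *)

Section Gamma.
Context {R : realType}.
Local Notation mu := (leb R).
Implicit Types a b c x : R.

Definition lnq x : R := ln (1 + expR x).
(** Euler's integrands after substituting an exponential: over the line [gker a] integrates to
    Gamma(a), and [bker a c] = e^(a x) (1 + e^x)^-c to the beta value B(a, c - a). *)
Definition gker a x : R := expR (a * x - expR x).
Definition bker a c x : R := expR (a * x - c * lnq x).

Lemma q_gt0 x : 0 < 1 + expR x. Proof. by rewrite addr_gt0// expR_gt0. Qed.

Lemma expR_lnq x : expR (lnq x) = 1 + expR x.
Proof. by rewrite lnK// posrE q_gt0. Qed.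

Lemma is_derive_lnq x : is_derive x (1 : R) lnq (expR (x - lnq x)).
Proof.
rewrite /lnq; isd; first exact: q_gt0.
by rewrite expRD expRN expR_lnq; field; rewrite gt_eqF ?q_gt0.
Qed.

Lemma lnq_ge0 x : 0 <= lnq x.
Proof. by rewrite ln_ge0// lerDl expR_ge0. Qed.

Lemma lnq_gex x : x <= lnq x.
Proof. by rewrite -ler_expR expR_lnq lerDr. Qed.

Lemma cont_lnq : continuous lnq.
Proof. by move=> x; exact: is_derive_cont (is_derive_lnq x). Qed.

Lemma cont_gker a : continuous (gker a). Proof. by rewrite /gker; ctn. Qed.
Lemma cont_bker a c : continuous (bker a c).
Proof. by have ? := cont_lnq; rewrite /bker; ctn. Qed.
Lemma gker_ge0 a x : 0 <= gker a x. Proof. exact: expR_ge0. Qed.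
Lemma bker_ge0 a c x : 0 <= bker a c x. Proof. exact: expR_ge0. Qed.

(** Extended real values let Tonelli be used before finiteness is known. *)
Definition egamma a : \bar R := (\int[mu]_x (gker a x)%:E)%E.
Definition ebeta a c : \bar R := (\int[mu]_x (bker a c x)%:E)%E.

(** Shift x by y in the double integral, exchange the order, then shift y by - ln (1 + e^x): the
    inner integral becomes Gamma(a + b) and the outer one a beta integral. *)
Lemma egamma_beta a b : (egamma a * egamma b = ebeta a (a + b) * egamma (a + b))%E.
Proof.
have mE2 (f : R * R -> R) : mfun (f : measurableTypeR R * measurableTypeR R -> R) ->
 mfun (fun z : measurableTypeR R * measurableTypeR R => (f z)%:E).
 by move=> ?; apply/measurable_EFinP.
have m (f : R -> R) := @measurable_EFin_cont _ f.
have g0 (d : R) x : (0 <= (gker d x)%:E)%E by rewrite lee_fin gker_ge0.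
have b0 (d e : R) x : (0 <= (bker d e x)%:E)%E by rewrite lee_fin bker_ge0.
have mg d := m _ (@cont_gker d).
transitivity (\int[mu]_y \int[mu]_x (gker a (x + y)%R * gker b y)%:E)%E.
 rewrite /egamma -ge0_integralZl//; last by apply: integral_ge0.
 apply: eq_integral => y _.
 rewrite (ge0_integral_line_shift y (@cont_gker a) (gker_ge0 a)).
 have mh : mfun (fun x : measurableTypeR R => (gker a (x + y))%:E).
 by apply: m; rewrite /gker; ctn.
 rewrite -(@ge0_integralZr _ _ _ mu setT measurableT _ mh)//.
rewrite (@fubini_tonelli _ _ (measurableTypeR R) (measurableTypeR R) R mu mu (fun z : measurableTypeR R * measurableTypeR R => (gker a ((z.2 : R) + (z.1 : R))%R * gker b z.1)%:E))/=; last 2 first.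
- apply: mE2; apply: measurable_funM.
 apply: (@measurableT_comp _ _ _ _ _ _ (gker a : measurableTypeR R -> measurableTypeR R)).
 exact: continuous_measurable_fun (@cont_gker a).
 by apply: measurable_funD; [exact: measurable_snd|exact: measurable_fst].
 apply: (@measurableT_comp _ _ _ _ _ _ (gker b : measurableTypeR R -> measurableTypeR R)).
 exact: continuous_measurable_fun (@cont_gker b).
 exact: measurable_fst.
- by move=> z; rewrite lee_fin mulr_ge0// gker_ge0.
rewrite /ebeta muleC -ge0_integralZl//; last 2 first.
- exact: m (@cont_bker a (a + b)).
- by apply: integral_ge0.
apply: eq_integral => x _.
rewrite /egamma muleC -ge0_integralZl//.
have cf : continuous (fun y => gker a (x + y) * gker b y) by rewrite /gker; ctn.
rewrite (ge0_integral_line_shift (- lnq x) cf); last by move=> y; rewrite mulr_ge0// gker_ge0.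
apply: eq_integral => y _; rewrite -EFinM; congr (_%:E).
rewrite /gker /bker -!expRD; congr expR.
have -> : expR (x + (y - lnq x)) = expR x * expR (y - lnq x) by rewrite expRD.
have -> : expR y = (1 + expR x) * expR (y - lnq x).
 by rewrite expRD expRN expR_lnq mulrCA divff ?mulr1// gt_eqF ?q_gt0.
ring.
Qed.

Lemma expR_cvg0 (a : R) : 0 < a -> expR (- (a * n%:R)) @[n --> \oo] --> 0.
Proof.
move=> a0.
have H : expR (- a) < 1 by rewrite expR_lt1 oppr_lt0.
have := cvg_geometric 1 (_ : `|expR (- a)| < 1); rewrite ger0_norm ?expR_ge0// => /(_ H).
by apply: cvg_trans; apply: near_eq_cvg; apply: nearW => n /=; rewrite mul1r -expRM_natr mulNr.
Qed.

Lemma cvg_sub_lnq : n%:R - lnq n%:R @[n --> \oo] --> 0.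
Proof.
have e0 : - expR (- (1 * n%:R)) @[n --> \oo] --> (0 : R).
 by rewrite -[X in _ --> X]oppr0; apply: cvgN; exact: expR_cvg0.
apply: (@squeeze_cvgr _ _ _ _ (fun n => - expR (- (1 * n%:R))) (fun=> 0)) => //; last exact: cvg_cst.
apply: nearW => n; rewrite subr_le0 lnq_gex andbT lerBrDl lerBlDr.
rewrite -ler_expR expR_lnq expRD mul1r.
have := expR_ge1Dx (expR (- n%:R) : R) => H.
apply: le_trans (ler_wpM2l (expR_ge0 _) H).
by rewrite mulrDr mulr1 -expRD subrr expR0 addrC.
Qed.

Lemma sub_lnq_le x y : x <= y -> x - lnq x <= y - lnq y.
Proof.
move=> xy; rewrite -ler_expR !expRD !expRN !expR_lnq.
rewrite ler_pdivrMr ?q_gt0// mulrAC ler_pdivlMr ?q_gt0// !mulrDr !mulr1 [X in _ <= _ + X]mulrC lerD2r.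
by rewrite ler_expR.
Qed.

Lemma ebeta1 (a : R) : 0 < a -> ebeta a (a + 1) = (a^-1)%:E.
Proof.
move=> a0; have dq := is_derive_lnq.
rewrite /ebeta (@ge0_integral_line_FTC _ (fun x => expR (a * (x - lnq x)) / a) _ 0 a^-1).
- by rewrite subr0.
- move=> x; isd; rewrite /bker.
 have -> : a * x - (a + 1) * lnq x = a * (x - lnq x) - lnq x by ring.
 have E : expR (x - lnq x) = 1 - expR (- lnq x).
 by rewrite expRD expRN expR_lnq; field; rewrite gt_eqF ?q_gt0.
 by rewrite E [in RHS]expRD; field; rewrite gt_eqF.
- exact: cont_bker.
- exact: bker_ge0.
- rewrite -[X in _ --> X]mul1r; apply: cvgM; last exact: cvg_cst.
 rewrite -[X in _ --> X]expR0; apply: (@continuous_cvg _ _ _ _ _ _ expR); first exact: continuous_expR.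
 by rewrite -[X in _ --> X](mulr0 a); apply: cvgM; [exact: cvg_cst|exact: cvg_sub_lnq].
rewrite -[X in _ --> X](mul0r a^-1); apply: cvgM; last exact: cvg_cst.
apply: (@squeeze_cvgr _ _ _ _ (fun=> 0) (fun n => expR (- (a * n%:R)))) => //; last first.
- exact: expR_cvg0.
- exact: cvg_cst.
apply: nearW => n; rewrite expR_ge0 ler_expR -mulrN ler_pM2l//.
by rewrite gerDl oppr_le0 lnq_ge0.
Qed.

(** The inequality ln y <= y - 1 at y = (1 + e^x) / (a + 1). It bounds the gamma integrand by the
    beta integrand that has an explicit primitive, whence convergence. *)
Lemma gker_le (a x : R) : 0 < a -> gker a x <= expR (- a + (a + 1) * ln (a + 1)) * bker a (a + 1) x.
Proof.
move=> a0; have a1 : 0 < a + 1 by rewrite addr_gt0.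
rewrite /gker /bker -expRD ler_expR; have q0 := q_gt0 x.
have y0 : -1 < (1 + expR x) / (a + 1) - 1 by rewrite ltrBrDl subrr divr_gt0.
have := le_ln1Dx y0; rewrite addrC subrK lnM ?posrE ?invr_gt0// lnV ?posrE// -/(lnq x) => H.
have {}H : (a + 1) * (lnq x - ln (a + 1)) <= (1 + expR x) - (a + 1).
 rewrite -(ler_pM2l a1) in H; apply: le_trans H _.
 by rewrite mulrBr mulrCA divff ?gt_eqF// !mulr1.
lra.
Qed.

Lemma egamma_fin (a : R) : 0 < a -> (egamma a < +oo)%E.
Proof.
move=> a0; set c : R := expR (- a + (a + 1) * ln (a + 1)).
apply: (@le_lt_trans _ _ (c%:E * ebeta a (a + 1))%E); last by rewrite ebeta1// -EFinM ltry.
rewrite /ebeta -ge0_integralZl//; last 3 first.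
- by apply: measurable_EFin_cont; exact: cont_bker.
- by move=> x _; rewrite lee_fin bker_ge0.
- by rewrite lee_fin expR_ge0.
apply: ge0_le_integral => //.
- by move=> x _; rewrite lee_fin gker_ge0.
- by apply: measurable_EFin_cont; exact: cont_gker.
- apply: emeasurable_funM => //; apply: measurable_EFin_cont; exact: cont_bker.
by move=> x _; rewrite -EFinM lee_fin gker_le.
Qed.

Lemma egamma_Gamma (a : R) : 0 < a -> egamma a = (Gamma_function a)%:E.
Proof.
move=> a0.
suff E : (\int[mu]_(t in `]0%R, +oo[) (t `^ (a - 1) * expR (- t))%:E)%E = egamma a.
 rewrite /Gamma_function /Rintegral E fineK//.
 by rewrite ge0_fin_numE ?egamma_fin// integral_ge0// => x _; rewrite lee_fin gker_ge0.
rewrite ge0_integral_expR_substitution.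
- by apply: eq_integral => x _; rewrite -EFinM -expRM -!expRD /gker; congr (expR _)%:E; ring.
- apply/measurable_EFinP; apply: measurable_funM; first exact: measurable_powR.
 by apply: continuous_measurable_fun; ctn.
by move=> x; rewrite lee_fin mulr_ge0// ?powR_ge0 ?expR_ge0.
Qed.

Lemma Gamma_gt0 (a : R) : 0 < a -> 0 < Gamma_function a.
Proof.
move=> a0; rewrite -lte_fin -egamma_Gamma//.
apply: (@lt_le_trans _ _ (expR (- expR 1))%:E); first by rewrite lte_fin expR_gt0.
have -> : ((expR (- expR 1))%:E = \int[mu]_(x in `[0%R, 1%R]) (cst (expR (- expR 1))%:E x) :> \bar R)%E.
 by rewrite integral_cst//= lebesgue_measure_itv/= lte01 oppr0 adde0 mule1.
have mg := measurable_EFin_cont (@cont_gker a).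
apply: (@le_trans _ _ (\int[mu]_(x in `[0%R, 1%R]) (gker a x)%:E)%E).
 apply: ge0_le_integral => //.
 - by move=> x _; rewrite lee_fin expR_ge0.
 - exact: measurable_funTS.
 move=> x /=; rewrite in_itv/= => /andP[x0 x1]; rewrite lee_fin ler_expR.
 have : 0 <= a * x by rewrite mulr_ge0// ltW.
 have : expR x <= expR 1 by rewrite ler_expR.
 lra.
apply: ge0_subset_integral => //; by move=> x _; rewrite lee_fin gker_ge0.
Qed.

Lemma ebetaE (a b : R) : 0 < a -> 0 < b ->
 ebeta a (a + b) = (Gamma_function a * Gamma_function b / Gamma_function (a + b))%:E.
Proof.
move=> a0 b0; have := egamma_beta a b; have ab := addr_gt0 a0 b0.
have g := Gamma_gt0 ab; rewrite !egamma_Gamma//.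
have e0 : (0 <= ebeta a (a + b))%E by apply: integral_ge0 => x _; rewrite lee_fin bker_ge0.
case: (ebeta a (a + b)) e0 => [r| |]// _.
 by rewrite -!EFinM => -[->]; rewrite mulfK// gt_eqF.
by rewrite -EFinM gt0_mulye.
Qed.

Lemma Gamma1 : Gamma_function (1 : R) = 1.
Proof.
apply: EFin_inj; rewrite -egamma_Gamma// /egamma.
rewrite (@ge0_integral_line_FTC _ (fun x => - expR (- expR x)) _ (-1) 0) ?sub0r ?opprK//.
- by move=> x; isd; rewrite /gker mul1r [RHS]expRD; ring.
- exact: cont_gker.
- exact: gker_ge0.
- rewrite -oppr0; apply: cvgN.
 apply: (@squeeze_cvgr _ _ _ _ (fun=> 0) (fun n => expR (- (1 * n%:R)))); [|exact: cvg_cst|exact: expR_cvg0].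
 apply: nearW => n; rewrite expR_ge0 ler_expR lerN2 mul1r.
 by apply: le_trans (expR_ge1Dx _); rewrite lerDr.
- apply: cvgN; rewrite -[X in _ --> X]expR0.
 apply: (@continuous_cvg _ _ _ _ _ _ expR); first exact: continuous_expR.
 rewrite -[X in _ --> X]oppr0; apply: cvgN.
 have := @expR_cvg0 1 ltr01.
 by apply: cvg_trans; apply: near_eq_cvg; apply: nearW => n /=; rewrite mul1r.
Qed.

(** Compare two values of B(a, 1): 1 / a from the explicit primitive, and Gamma(a) / Gamma(a +
    1). *)
Lemma GammaS (a : R) : 0 < a -> Gamma_function (a + 1) = a * Gamma_function a.
Proof.
move=> a0.
have := @ebetaE a 1 a0 ltr01; rewrite ebeta1// Gamma1 mulr1 => -[E].
have g := Gamma_gt0 (addr_gt0 a0 (@ltr01 R)).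
have a1 : a^-1 != 0 by rewrite invr_eq0 gt_eqF.
by apply: (mulfI a1); rewrite {1}E divfK ?gt_eqF// mulKf// gt_eqF.
Qed.

(* The substitution [x = Y (q / (1 + q))^(1/2)], [q = e^tau]. *)
Lemma chord_moment (Y s : R) (h : R -> R) : 0 < Y -> 0 <= s -> continuous h ->
 (forall x, 0 < x -> h x = chord Y x * expR (s * ln x)) ->
 \int[mu]_(x in `[0, Y]) h x = expR ((s + 2) * ln Y) / 2 *
 (Gamma_function ((s + 1) / 2) * Gamma_function (3 / 2) / Gamma_function (s / 2 + 2)).
Proof.
move=> Y0 s0 ch hE.
have a0 : 0 < (s + 1) / 2 by rewrite divr_gt0// ltr_wpDl.
have := @ebetaE ((s + 1) / 2) (3 / 2) a0 _; rewrite divr_gt0// => /(_ erefl).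
have -> : (s + 1) / 2 + 3 / 2 = s / 2 + 2 by field.
set B := Gamma_function _ * _ / _ => EB.
have H := line_cvg (@cont_bker ((s + 1) / 2) (s / 2 + 2)) (bker_ge0 ((s + 1) / 2) (s / 2 + 2)).
rewrite -/(ebeta _ _) EB in H.
pose xi (t : R) := Y * expR ((t - lnq t) / 2).
have xi0 t : 0 < xi t by rewrite mulr_gt0// expR_gt0.
have xiY t : xi t <= Y.
 by rewrite ger_pMr// -[leRHS]expR0 ler_expR pmulr_lle0// subr_le0 lnq_gex.
pose xi' (t : R) := xi t * (expR (- lnq t) / 2).
have dq := is_derive_lnq; have cq := cont_lnq.
have dxi (t : R) : is_derive t (1 : R) xi (xi' t).
 rewrite /xi; isd; rewrite /xi' /xi.
 have -> : expR (t - lnq t) = 1 - expR (- lnq t).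
 by rewrite expRD expRN expR_lnq; field; rewrite gt_eqF ?q_gt0.
 by field.
have I n : \int[mu]_(x in `[xi (- n%:R), xi n%:R]) h x =
 expR ((s + 2) * ln Y) / 2 * \int[mu]_(t in `[- n%:R, n%:R]) bker ((s + 1) / 2) (s / 2 + 2) t.
 have nn : - n%:R <= n%:R :> R by rewrite (le_trans (_ : _ <= 0))// oppr_le0.
 rewrite (@segint_subst _ h xi xi' (- n%:R) n%:R 0)//; last first.
 - by rewrite /xi ler_pM2l// ler_expR ler_pM2r// sub_lnq_le.
 - by apply: contW; rewrite /xi' /xi; ctn.
 rewrite -segintZ; last by apply: contW; exact: cont_bker.
 apply: segint_eq => t _; rewrite hE//.
 have -> : chord Y (xi t) = Y * expR (- (lnq t / 2)).
 have e0 : 0 <= Y * expR (- (lnq t / 2)) by rewrite mulr_ge0 ?expR_ge0// ltW.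
 rewrite /chord -[RHS]ger0_norm// -sqrtr_sqr; congr sqrt.
 rewrite /xi !exprMn -!expRM_natr.
 have -> : (t - lnq t) / 2 * 2 = t - lnq t by field.
 have -> : - (lnq t / 2) * 2 = - lnq t by field.
 rewrite expRD expRN expR_lnq; field; by rewrite gt_eqF ?q_gt0.
 rewrite /xi' {1 2}/xi lnM ?posrE ?expR_gt0// expRK.
 have -> : Y = expR (ln Y) by rewrite lnK.
 rewrite expRK /bker.
 have -> : expR (ln Y) * expR (- (lnq t / 2)) * expR (s * (ln Y + (t - lnq t) / 2)) *
 (expR (ln Y) * expR ((t - lnq t) / 2) * (expR (- lnq t) / 2)) =
 expR (ln Y) * expR (- (lnq t / 2)) * expR (s * (ln Y + (t - lnq t) / 2)) *
 expR (ln Y) * expR ((t - lnq t) / 2) * expR (- lnq t) / 2 by ring.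
 rewrite [RHS]mulrAC -!expRD; congr (expR _ / _); by field.
have c2 : xi n%:R @[n --> \oo] --> Y.
 rewrite -[X in _ --> X]mulr1; apply: cvgM; first exact: cvg_cst.
 rewrite -[X in _ --> X]expR0; apply: (@continuous_cvg _ _ _ _ _ _ expR); first exact: continuous_expR.
 by rewrite -[X in _ --> X](mul0r 2^-1); apply: cvgM; [exact: cvg_sub_lnq|exact: cvg_cst].
have c1 : xi (- n%:R) @[n --> \oo] --> 0.
 rewrite -[X in _ --> X](mulr0 Y); apply: cvgM; first exact: cvg_cst.
 apply: (@squeeze_cvgr _ _ _ _ (fun=> 0) (fun n => expR (- (2^-1 * n%:R)))); last 2 first.
 - exact: cvg_cst.
 - by apply: expR_cvg0; rewrite invr_gt0.
 apply: nearW => n; rewrite expR_ge0 ler_expR.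
 by have := lnq_ge0 (- n%:R : R); lra.
have [M HM] := @rectangle_bounded R (fun p => h p.1) 0 Y 0 1 (fun p => continuous_comp (@cvg_fst _ _ _ _ _) (ch p.1)).
have {}HM x : 0 <= x <= Y -> `|h x| <= M by move=> xY; apply: (HM x 0) => //; rewrite lexx ler01.
have sub a b : 0 <= a -> a <= b -> b <= Y -> `|\int[mu]_(x in `[a, b]) h x| <= M * (b - a).
 move=> a0' ab bY; rewrite -segint_cst//; apply: segint_norm_le; [exact: contW|apply: contW; ctn|].
 by move=> x /andP[ax xb]; apply: HM; rewrite (le_trans a0' ax) (le_trans xb bY).
have cI : \int[mu]_(x in `[xi (- n%:R), xi n%:R]) h x @[n --> \oo] --> \int[mu]_(x in `[0, Y]) h x.
 apply/subr_cvg0/norm_cvg0P => /=.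
 apply: (@squeeze_cvgr _ _ _ _ (fun=> 0) (fun n => M * xi (- n%:R) + M * (Y - xi n%:R))); last 2 first.
 - exact: cvg_cst.
 - rewrite (_ : 0 = M * 0 + M * (Y - Y)); last by rewrite subrr mulr0 addr0.
 apply: cvgD; apply: cvgM => //; [exact: cvg_cst|exact: cvg_cst|].
 by apply: cvgB => //; exact: cvg_cst.
 apply: nearW => n; rewrite normr_ge0/=.
 have nn : xi (- n%:R) <= xi n%:R.
 rewrite /xi ler_pM2l// ler_expR ler_pM2r// sub_lnq_le// (le_trans (_ : _ <= 0))// oppr_le0.
 rewrite (@segint_chasles _ 0 (xi (- n%:R)) Y) ?(ltW (xi0 _))//; last exact: contW.
 rewrite (@segint_chasles _ (xi (- n%:R)) (xi n%:R) Y)//; last exact: contW.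
 have -> (p q r : R) : q - (p + (q + r)) = - (p + r) by ring.
 rewrite normrN; apply: le_trans (ler_normD _ _) _.
 have := sub 0 (xi (- n%:R)) (lexx 0) (ltW (xi0 _)) (xiY _); rewrite subr0 => ?.
 by apply: lerD => //; apply: sub; rewrite ?(ltW (xi0 _)).
have cB : \int[mu]_(x in `[xi (- n%:R), xi n%:R]) h x @[n --> \oo] --> expR ((s + 2) * ln Y) / 2 * B.
 under eq_cvg do rewrite I.
 by apply: cvgM; [exact: cvg_cst|exact: (fine_cvg H)].
by apply: (cvg_unique _ cI cB).
Qed.

End Gamma.

Lemma bkerE {R : realType} (a c x : R) : bker a c x = expR (a * x - c * lnq x).
Proof. by []. Qed.

(** * Stability of the differential equation under a small source *)

Section OdeCompare.
Context {R : realType}.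

(** Gronwall with zero initial data and source [del]: the energy Q^2 / (1 + y^2) + lam chi^2 plus
    eps^2, multiplied by e^-y, is non-increasing. *)
Lemma ode_compare (chi Q del : R -> R) (lam eps x : R) : 0 <= lam -> 0 <= x ->
 (forall y : R, is_derive y (1 : R) chi (Q y / (1 + y ^+ 2))) ->
 (forall y : R, is_derive y (1 : R) Q (- lam * chi y + del y)) ->
 (forall y, `|del y| <= eps) -> chi 0 = 0 -> Q 0 = 0 ->
 lam * chi x ^+ 2 <= eps ^+ 2 * expR x.
Proof.
move=> lam0 x0 dc dQ del_le c0 Q0.
have eps0 : 0 <= eps by apply: le_trans (del_le 0).
pose e y := Q y ^+ 2 / (1 + y ^+ 2) + lam * chi y ^+ 2.
pose f y := (e y + eps ^+ 2) * expR (- y).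
pose f' y := (2 * Q y * del y / (1 + y ^+ 2) - 2 * y * (Q y / (1 + y ^+ 2)) ^+ 2 - e y - eps ^+ 2) * expR (- y).
have df (y : R) : is_derive y (1 : R) f (f' y).
 have w0 := w_gt0 y.
 rewrite /f /e; isd; first by rewrite gt_eqF.
 by rewrite /f' /e /=; field; rewrite gt_eqF.
have : f x <= f 0.
 apply: (le0_derive_le x0 _ (fun y _ => df y)); first by move=> y _; exact: is_derive_cont (df y).
 move=> y /andP[/ltW y0 _]; rewrite /f' pmulr_lle0 ?expR_gt0//.
 have w0 := w_gt0 y; have iw : 0 < (1 + y ^+ 2)^-1 by rewrite invr_gt0.
 have iw1 : (1 + y ^+ 2)^-1 <= 1 by rewrite invf_le1// lerDl sqr_ge0.
 have T1 : 0 <= 2 * y * (Q y / (1 + y ^+ 2)) ^+ 2 by rewrite mulr_ge0 ?sqr_ge0// mulr_ge0.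
 have T2 : 2 * Q y * del y / (1 + y ^+ 2) <= Q y ^+ 2 / (1 + y ^+ 2) + eps ^+ 2.
 apply: (@le_trans _ _ ((Q y ^+ 2 + eps ^+ 2) / (1 + y ^+ 2))).
 rewrite ler_wpM2r ?(ltW iw)//.
 have D2 : del y ^+ 2 <= eps ^+ 2 by rewrite -real_normK ?num_real// lerXn2r ?nnegrE.
 by have := sqr_ge0 (Q y - del y); rewrite sqrrB => H; lra.
 rewrite mulrDl lerD2l; apply: ler_piMr => //; exact: sqr_ge0.
 have T3 : 0 <= lam * chi y ^+ 2 by rewrite mulr_ge0 ?sqr_ge0.
 by rewrite /e; lra.
rewrite /f /e c0 Q0 !expr0n /= oppr0 expR0 mul0r mulr0 !add0r mulr1 expRN ler_pdivrMr ?expR_gt0// => H.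
apply: le_trans H; rewrite -subr_ge0.
have -> : Q x ^+ 2 / (1 + x ^+ 2) + lam * chi x ^+ 2 + eps ^+ 2 - lam * chi x ^+ 2 =
 Q x ^+ 2 / (1 + x ^+ 2) + eps ^+ 2 by ring.
by rewrite addr_ge0 ?sqr_ge0// divr_ge0 ?sqr_ge0// ltW// w_gt0.
Qed.

End OdeCompare.

(** * Euler's integral and the asymptotics of the even solution for real s *)

Section RealParameter.
Context {R : realType}.
Local Notation mu := (leb R).
Variable s : R.
Hypotheses (s12 : 2^-1 < s) (s1 : s < 1).
Implicit Types x t : R.

Ltac slra := generalize s12 s1; lra.

Local Notation m := ((s - 1) / 2).
Local Notation E x t := (1 + (1 + x ^+ 2) * expR t).

(* With [q = e^t / (1 + e^t)] these are Euler's integrand [q^(s/2-1) (1-q)^(-(1+s)/2) (1 + x^2 q)^m dq]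
 of the even solution, its derivative, the derivative of [(1 + x^2)] times the latter, and the
 function of [t] of which the differential operator applied to the integrand is a derivative. *)
Definition euler x t := expR (s / 2 * (t - lnq t) + m * ln (E x t)).
Definition euler' x t := euler x t * (2 * m * x * expR t / E x t).
Definition euler'' x t := euler x t *
 (2 * m * expR t * ((3 * (1 + x ^+ 2) - 2) * E x t + 2 * (m - 1) * (1 + x ^+ 2) * x ^+ 2 * expR t) / E x t ^+ 2).
Definition euler_flux x t := - (4 * m) * expR (s / 2 * (t - lnq t)) * (1 + expR t) * expR ((m - 1) * ln (E x t)).

Lemma E_gt0 x t : 0 < E x t.
Proof. by rewrite addr_gt0// mulr_gt0 ?w_gt0 ?expR_gt0. Qed.

Lemma is_derive_euler x t : is_derive x (1 : R) (fun x => euler x t) (euler' x t).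
Proof.
have e0 := E_gt0 x t; rewrite /euler; isd; first exact: E_gt0.
by rewrite /euler' /euler /=; field; rewrite gt_eqF.
Qed.

Lemma is_derive_euler' x t : is_derive x (1 : R) (fun x => (1 + x ^+ 2) * euler' x t) (euler'' x t).
Proof.
have e0 := E_gt0 x t; have d := is_derive_euler x t; have w0 := w_gt0 x; rewrite /euler'; isd; first by rewrite gt_eqF.
by rewrite /euler'' /euler' /=; field; rewrite gt_eqF.
Qed.

Lemma is_derive_euler_flux x t :
 is_derive t (1 : R) (euler_flux x) (euler'' x t + s * (1 - s) * euler x t).
Proof.
have e0 := E_gt0 x t; have dq := @is_derive_lnq R; rewrite /euler_flux; isd.
 exact: E_gt0.
have eE : expR ((m - 1) * ln (E x t)) = expR (m * ln (E x t)) / E x t.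
 by rewrite mulrBl mul1r expRD expRN lnK// posrE.
have -> : expR (t - lnq t) = expR t / (1 + expR t) by rewrite expRD expRN expR_lnq.
rewrite eE /euler'' /euler expRD; set A := expR (s / 2 * _); set B := expR (m * _).
have q0 := q_gt0 t; have qn : 1 + expR t != 0 by rewrite gt_eqF.
have en : E x t != 0 by rewrite gt_eqF.
by field; rewrite qn en.
Qed.

Lemma euler0 t : euler 0 t = bker (s / 2) 2^-1 t.
Proof.
rewrite /euler /bker expr0n addr0 mul1r -/(lnq t); congr expR; by field.
Qed.

Lemma euler_ge0 x t : 0 <= euler x t. Proof. exact: expR_ge0. Qed.

Lemma euler_le x t : euler x t <= bker (s / 2) 2^-1 t.
Proof.
rewrite -euler0 /euler ler_expR lerD2l ler_nM2l; last by rewrite pmulr_llt0// subr_lt0.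
rewrite ler_ln ?posrE ?E_gt0// lerD2l ler_pM2r ?expR_gt0// expr0n addr0 lerDl sqr_ge0//.
Qed.

Lemma euler_flux_le x t :
 `|euler_flux x t| <= expR (s / 2 * (t - lnq t) + m * lnq t).
Proof.
rewrite /euler_flux -mulrA -expR_lnq -[X in _ * X]mulrC ger0_norm; last first.
 by rewrite mulr_ge0 ?mulr_ge0 ?expR_ge0// oppr_ge0 pmulr_rle0// pmulr_lle0// subr_le0 ltW.
rewrite expRD.
apply: le_trans (_ : 1 * (expR (s / 2 * (t - lnq t)) * (expR (lnq t) * expR ((m - 1) * ln (E x t)))) <= _).
 rewrite [leLHS](_ : _ = (- (4 * m)) * (expR (s / 2 * (t - lnq t)) * (expR (lnq t) * expR ((m - 1) * ln (E x t))))); last by ring.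
 by apply: ler_wpM2r; [rewrite !mulr_ge0 ?expR_ge0|slra].
rewrite mul1r ler_wpM2l ?expR_ge0// -expRD ler_expR.
have : lnq t <= ln (E x t).
 rewrite ler_ln ?posrE ?q_gt0 ?E_gt0// lerD2l ler_peMl ?expR_ge0// lerDl sqr_ge0//.
move=> H; have : (m - 1) * ln (E x t) <= (m - 1) * lnq t by rewrite ler_nM2l//; slra.
slra.
Qed.

Lemma cont_euler : [/\ continuous (fun p => euler p.1 p.2), continuous (fun p => euler' p.1 p.2) &
 continuous (fun p => euler'' p.1 p.2)].
Proof.
have ? := @cont_lnq R.
have e1 (p : R * R) : E p.1 p.2 != 0 by rewrite gt_eqF ?E_gt0.
have e2 (p : R * R) : E p.1 p.2 ^+ 2 != 0 by rewrite expf_neq0.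
by split; rewrite /euler'' /euler' /euler; ctn; rewrite ?E_gt0//; apply: e2.
Qed.

Lemma eulerE x t : euler x t = expR (s / 2 * (t - lnq t) + m * ln (E x t)).
Proof. by []. Qed.

Lemma euler'0 t : euler' 0 t = 0.
Proof. by rewrite /euler' mulr0 !mul0r mulr0. Qed.

Local Opaque euler euler' euler'' euler_flux bker.

Definition euler_int T x := \int[mu]_(t in `[- T, T]) euler x t.

Lemma cont_euler_snd x : [/\ continuous (euler x), continuous (euler' x) & continuous (euler'' x)].
Proof. by case: cont_euler => c1 c2 c3; split; [have := @cont2_snd _ _ x c1|have := @cont2_snd _ _ x c2|have := @cont2_snd _ _ x c3]. Qed.

Section Solution.
Variables (V P : R -> R).
Hypothesis dV : forall x : R, is_derive x (1 : R) V (P x / (1 + x ^+ 2)).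
Hypothesis dP : forall x : R, is_derive x (1 : R) P (- (s * (1 - s)) * V x).
Hypothesis P0 : P 0 = 0.

(** The truncated Euler integral solves the equation up to the flux through t = T and t = - T, which
    decays with T. The combination of it with V that vanishes at 0 has zero initial data, so it is
    controlled by the flux; as T grows, V is identified with a multiple of the Euler integral. *)
Lemma euler_compare T x : 0 <= T -> 0 <= x ->
 s * (1 - s) * (V 0 * euler_int T x - euler_int T 0 * V x) ^+ 2 <=
 (`|V 0| * (expR (m * T) + expR (- (s / 2 * T)))) ^+ 2 * expR x.
Proof.
move=> T0 x0; have [c1 c2 c3] := cont_euler.
have NT : - T <= T by slra.
pose P1 y := \int[mu]_(t in `[- T, T]) ((1 + y ^+ 2) * euler' y t).
have d1 (y : R) : is_derive y (1 : R) (euler_int T) (P1 y / (1 + y ^+ 2)).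
 apply: (@is_derive_eq _ _ _ _ _ _ _ _ (is_derive_under_integral (- T) T c1 c2 (fun v t => is_derive_euler v t) y)).
 have [_ c2' _] := cont_euler_snd y.
 by rewrite /P1 segintZ; [rewrite [_ * \int[_]_(_ in _) _]mulrC mulfK// gt_eqF ?w_gt0|exact: contW].
have c2w : continuous (fun p : R * R => (1 + p.1 ^+ 2) * euler' p.1 p.2) by ctn.
have d2 (y : R) : is_derive y (1 : R) P1 (- (s * (1 - s)) * euler_int T y + (euler_flux y T - euler_flux y (- T))).
 apply: (@is_derive_eq _ _ _ _ _ _ _ _ (is_derive_under_integral (- T) T c2w c3 (fun v t => is_derive_euler' v t) y)).
 have [c1' _ c3'] := cont_euler_snd y.
 have := @segint_FTC _ (- T) T (euler_flux y) (fun t => euler'' y t + s * (1 - s) * euler y t) NT.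
 move=> <-.
 - have cz : cont_on (- T) T (fun t => s * (1 - s) * euler y t).
 by move=> t _; exact: (@contM _ _ (fun=> s * (1 - s)) (euler y) t (@cont_cst _ _ _ _) (c1' t)).
 rewrite (@segintD _ (- T) T (euler'' y) (fun t => s * (1 - s) * euler y t) (contW c3') cz).
 rewrite (@segintZ _ (- T) T (s * (1 - s)) (euler y) (contW c1')).
 rewrite -/(euler_int T y) /=.
 by move: (\int[mu]_(t in _) euler'' y t) (euler_int T y) => A B; ring.
 - by move=> t tT; exact: contD (c3' t) (contM (@cont_cst _ _ (s * (1 - s)) t) (c1' t)).
 - by move=> t _; exact: is_derive_cont (is_derive_euler_flux y t).
 - by move=> t _; exact: is_derive_euler_flux.
have fl y : `|euler_flux y T - euler_flux y (- T)| <= expR (m * T) + expR (- (s / 2 * T)).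
 apply: le_trans (ler_normB _ _) _; apply: lerD; apply: le_trans (euler_flux_le _ _) _; rewrite ler_expR.
 have h1 := lnq_gex T.
 have : s / 2 * (T - lnq T) <= 0 by rewrite pmulr_rle0 ?subr_le0//; slra.
 have : m * lnq T <= m * T by rewrite ler_nM2l//; slra.
 slra.
 have h1 := lnq_ge0 (- T).
 have : s / 2 * lnq (- T) >= 0 by rewrite mulr_ge0//; slra.
 have : m * lnq (- T) <= 0 by rewrite nmulr_rle0//; slra.
 slra.
have eps0 : 0 <= expR (m * T) + expR (- (s / 2 * T)) by rewrite addr_ge0 ?expR_ge0.
have P10 : P1 0 = 0.
 rewrite /P1 (@segint_eq _ _ _ _ (fun=> 0)) ?segint_cst ?mul0r// => t _.
 by rewrite euler'0 mulr0.
clearbody P1; move: (euler_int T) d1 d2 => F d1 d2.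
apply: (@ode_compare _ (fun y => V 0 * F y - F 0 * V y)
 (fun y => V 0 * P1 y - F 0 * P y)
 (fun y => V 0 * (euler_flux y T - euler_flux y (- T)))) => //.
- by rewrite mulr_ge0//; slra.
- by move=> y; isd; field; rewrite gt_eqF ?w_gt0.
- by move=> y; isd; ring.
- by move=> y; rewrite normrM ler_wpM2l.
- by rewrite mulrC subrr.
by rewrite P0 P10 !mulr0 subr0.
Qed.

End Solution.

(** The connection coefficient: the even solution with V(0) = 1 behaves like alpha(s) x^(s - 1) at
    infinity. *)
Definition alpha (s : R) : R := Gamma_function 2^-1 * Gamma_function (s - 2^-1) / Gamma_function (s / 2) ^+ 2.

Definition line_int (f : R -> R) : R := fine (\int[mu]_x (f x)%:E)%E.

Lemma line_int_cvg (f : R -> R) : continuous f -> (forall x, 0 <= f x) -> (\int[mu]_x (f x)%:E < +oo)%E ->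
 \int[mu]_(t in `[- n%:R, n%:R]) f t @[n --> \oo] --> line_int f.
Proof.
move=> cf f0 fi; have H := line_cvg cf f0.
have F : (\int[mu]_x (f x)%:E)%E = (line_int f)%:E.
 by rewrite fineK// ge0_fin_numE// integral_ge0// => x _; rewrite lee_fin.
by rewrite F in H; exact: (fine_cvg H).
Qed.

Lemma line_int_bker (a b : R) : 0 < a -> 0 < b ->
 (\int[mu]_x (bker a (a + b) x)%:E < +oo)%E /\
 line_int (bker a (a + b)) = Gamma_function a * Gamma_function b / Gamma_function (a + b).
Proof.
move=> a0 b0; rewrite /line_int -/(ebeta a (a + b)) ebetaE//; split; [exact: ltry|by []].
Qed.

Lemma line_int_le (f g : R -> R) : continuous f -> (forall x, 0 <= f x) -> continuous g -> (forall x, f x <= g x) ->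
 (\int[mu]_x (g x)%:E < +oo)%E -> (\int[mu]_x (f x)%:E < +oo)%E.
Proof.
move=> cf f0 cg fg; apply: le_lt_trans; apply: ge0_le_integral => //.
- by move=> x _; rewrite lee_fin.
- exact: measurable_EFin_cont.
- exact: measurable_EFin_cont.
- by move=> x _; rewrite lee_fin.
Qed.

(* [1 - (1 + z)^m <= min (1, z) <= z^k]. *)
Lemma one_sub_pow (z k : R) : 0 < z -> 0 <= k <= 1 -> 0 <= 1 - expR (m * ln (1 + z)) <= expR (k * ln z).
Proof.
move=> z0 /andP[k0 k1]; have l0 : 0 <= ln (1 + z) by rewrite ln_ge0// lerDl ltW.
have m0 : - 1 <= m <= 0 by apply/andP; split; slra.
have/andP[m1 m2] := m0.
apply/andP; split; first by rewrite subr_ge0 -[leRHS]expR0 ler_expR mulr_le0_ge0.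
have h1 : 1 - expR (m * ln (1 + z)) <= 1 by rewrite gerBl expR_ge0.
have h2 : 1 - expR (m * ln (1 + z)) <= z.
 have := expR_ge1Dx (m * ln (1 + z)).
 have : ln (1 + z) <= z by apply: le_ln1Dx; slra.
 have : -1 * ln (1 + z) <= m * ln (1 + z) by rewrite ler_wpM2r.
 slra.
have [z1|z1] := lerP z 1.
 apply: le_trans h2 _; rewrite -{1}(@lnK _ z) ?posrE// ler_expR.
 by rewrite -[leLHS]mul1r ler_wnM2r// ln_le0.
by apply: le_trans h1 _; rewrite -[leLHS]expR0 ler_expR mulr_ge0// ln_ge0// ltW.
Qed.

Section Asymptotics.
Local Opaque Gamma_function line_int.
Variables (V P : R -> R).
Hypothesis dV : forall x : R, is_derive x (1 : R) V (P x / (1 + x ^+ 2)).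
Hypothesis dP : forall x : R, is_derive x (1 : R) P (- (s * (1 - s)) * V x).
Hypothesis P0 : P 0 = 0.

Let s20 : 0 < s / 2. Proof. slra. Qed.
Let s120 : 0 < (1 - s) / 2. Proof. slra. Qed.

Lemma euler_line x : (\int[mu]_t (euler x t)%:E < +oo)%E.
Proof.
have [H _] := line_int_bker s20 s120.
have [c _ _] := cont_euler_snd x.
apply: (line_int_le c (euler_ge0 x) (@cont_bker R (s / 2) 2^-1) (euler_le x)).
have e : s / 2 + (1 - s) / 2 = 2^-1 by field.
by rewrite e in H.
Qed.

Lemma euler_representation x : 0 <= x -> V 0 * line_int (euler x) = line_int (euler 0) * V x.
Proof.
move=> x0; have [c _ _] := cont_euler_snd x; have [c0 _ _] := cont_euler_snd 0.
have H := line_int_cvg c (euler_ge0 x) (euler_line x).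
have H0 := line_int_cvg c0 (euler_ge0 0) (euler_line 0).
pose D n := V 0 * euler_int n%:R x - euler_int n%:R 0 * V x.
have HD : D n @[n --> \oo] --> V 0 * line_int (euler x) - line_int (euler 0) * V x.
 exact: (cvgB (cvgM (cvg_cst _) H) (cvgM H0 (cvg_cst _))).
have HD2 : s * (1 - s) * D n ^+ 2 @[n --> \oo] -->
 s * (1 - s) * (V 0 * line_int (euler x) - line_int (euler 0) * V x) ^+ 2.
 apply: cvgM; first exact: cvg_cst.
 by rewrite expr2; under eq_cvg do rewrite expr2; exact: cvgM.
have HE : (`|V 0| * (expR (m * n%:R) + expR (- (s / 2 * n%:R)))) ^+ 2 * expR x @[n --> \oo] --> 0.
 have e1 : expR (m * n%:R) + expR (- (s / 2 * n%:R)) @[n --> \oo] --> (0 : R).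
 rewrite -[X in _ --> X](addr0 0); apply: cvgD; last exact: expR_cvg0.
 have := @expR_cvg0 _ _ s120; apply: cvg_trans; apply: near_eq_cvg; apply: nearW => n /=.
 by congr expR; field.
 rewrite -[X in _ --> X](mul0r (expR x)); apply: cvgM; last exact: cvg_cst.
 rewrite [X in _ --> X](_ : 0 = (`|V 0| * 0) * (`|V 0| * 0)); last by rewrite !mulr0.
 under eq_cvg do rewrite expr2.
 by apply: cvgM; apply: cvgM => //; exact: cvg_cst.
have S0 : s * (1 - s) * (V 0 * line_int (euler x) - line_int (euler 0) * V x) ^+ 2 <= 0.
 rewrite -(cvg_lim _ HD2)// -[leRHS](cvg_lim _ HE)//.
 apply: ler_lim; [by apply/cvg_ex; eexists; exact: HD2|by apply/cvg_ex; eexists; exact: HE|].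
 by apply: nearW => n; exact: euler_compare.
have s0 : 0 < s * (1 - s) by rewrite mulr_gt0; slra.
move: S0; rewrite pmulr_rle0// => S0.
have : (V 0 * line_int (euler x) - line_int (euler 0) * V x) ^+ 2 = 0.
 by apply/eqP; rewrite eq_le S0 sqr_ge0.
by move/eqP; rewrite sqrf_eq0 subr_eq0 => /eqP.
Qed.

Local Notation kap := ((s - 2^-1) / 2).

Definition asym_const : R :=
 Gamma_function kap * Gamma_function (s / 2 - kap) / Gamma_function (s / 2).

(** With w = 1 + x^2 the base is E = w e^t (1 + z), z = 1 / (w e^t). Replacing (1 + z)^m by 1 leaves
    a beta integral, with an error of at most z^kap; kap = (s - 1/2) / 2 is chosen so that w^(m -
    kap) = w^(-1/4), which is of order x^(-1/2). *)
Lemma euler_asymptotic x :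
 `|line_int (euler x) - expR (m * ln (1 + x ^+ 2)) *
 (Gamma_function (s - 2^-1) * Gamma_function ((1 - s) / 2) / Gamma_function (s / 2))|
 <= expR (- (4^-1 * ln (1 + x ^+ 2))) * asym_const.
Proof.
have [c _ _] := cont_euler_snd x; have w0 := w_gt0 x.
have k0 : 0 < kap by slra.
have k01 : 0 <= kap <= 1 by apply/andP; split; slra.
have p1 : 0 < s - 2^-1 by slra.
have p2 : 0 < s / 2 - kap by slra.
have [F1 L1] := line_int_bker p1 s120.
have [F2 L2] := line_int_bker k0 p2.
have e1 : s - 2^-1 + (1 - s) / 2 = s / 2 by field.
have e2 : kap + (s / 2 - kap) = s / 2 by field.
rewrite e1 in F1 L1; rewrite e2 in F2 L2.
rewrite /asym_const -L1 -L2.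
set lw := ln (1 + x ^+ 2).
have H := line_int_cvg c (euler_ge0 x) (euler_line x).
have H1 := line_int_cvg (@cont_bker R (s - 2^-1) (s / 2)) (bker_ge0 _ _) F1.
have H2 := line_int_cvg (@cont_bker R kap (s / 2)) (bker_ge0 _ _) F2.
have HL : `|euler_int n%:R x - expR (m * lw) * \int[mu]_(t in `[- n%:R, n%:R]) bker (s - 2^-1) (s / 2) t|
 @[n --> \oo] --> `|line_int (euler x) - expR (m * lw) * line_int (bker (s - 2^-1) (s / 2))|.
 exact: (cvg_norm (cvgB H (cvgM (cvg_cst _) H1))).
have HR : expR (- (4^-1 * lw)) * \int[mu]_(t in `[- n%:R, n%:R]) bker kap (s / 2) t
 @[n --> \oo] --> expR (- (4^-1 * lw)) * line_int (bker kap (s / 2)).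
 exact: (cvgM (cvg_cst _) H2).
rewrite -(cvg_lim _ HL)// -[leRHS](cvg_lim _ HR)//.
apply: ler_lim; [by apply/cvg_ex; eexists; exact: HL|by apply/cvg_ex; eexists; exact: HR|].
apply: nearW => n.
have cb1 := @cont_bker R (s - 2^-1) (s / 2); have cb2 := @cont_bker R kap (s / 2).
rewrite -!segintZ; [|exact: contW..].
have cz (r : R) (g : R -> R) : continuous g -> cont_on (- n%:R) n%:R (fun t => r * g t).
 by move=> cg t _; exact: contM (@cont_cst _ _ r t) (cg t).
have c1 := cz (expR (m * lw)) _ cb1; have c2 := cz (expR (- (4^-1 * lw))) _ cb2.
rewrite /euler_int -(@segintB _ _ _ _ _ (contW c) c1).
apply: segint_norm_le => //; first by move=> t tn; exact: contD (c t) (contN (c1 t tn)).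
move=> t _; pose z := expR (- (lw + t)).
have zE : E x t = expR (lw + t) * (1 + z).
 by rewrite mulrDr mulr1 -expRD subrr expR0 expRD lnK ?posrE// addrC.
have eE : euler x t = expR (m * lw) * bker (s - 2^-1) (s / 2) t * expR (m * ln (1 + z)).
 rewrite eulerE zE lnM ?posrE ?expR_gt0//; last by rewrite addr_gt0// expR_gt0.
 rewrite expRK bkerE -!expRD; congr expR; by field.
have /andP[z1 z2] : 0 <= 1 - expR (m * ln (1 + z)) <= expR (kap * ln z).
 exact: one_sub_pow (expR_gt0 _) k01.
rewrite eE; set A := expR (m * lw) * bker _ _ _.
have A0 : 0 <= A by rewrite mulr_ge0 ?expR_ge0 ?bker_ge0.
have -> : A * expR (m * ln (1 + z)) - A = - (A * (1 - expR (m * ln (1 + z)))) by ring.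
rewrite normrN ger0_norm; last exact: mulr_ge0 A0 z1.
apply: le_trans (ler_wpM2l A0 z2) _.
rewrite /A !bkerE /z expRK -!expRD ler_expR; apply: eq_ler; by field.
Qed.

(** The power x^s extended by 0 to x <= 0, which makes it continuous on the whole line for the
    exponents in use. *)
Definition ppow (x : R) : R := if 0 < x then expR (s * ln x) else 0.

Definition asym_error : R := asym_const / line_int (euler 0) + `|alpha s|.

Lemma line_int_euler0 : line_int (euler 0) =
 Gamma_function (s / 2) * Gamma_function ((1 - s) / 2) / Gamma_function 2^-1.
Proof.
have [_] := line_int_bker s20 s120.
have -> : s / 2 + (1 - s) / 2 = 2^-1 by field.
by move=> <-; congr line_int; apply/funext => t; rewrite euler0.
Qed.

Lemma real_asymptotic_lt1 x : 0 <= x ->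
 `|x * V x - V 0 * alpha s * ppow x| <= `|V 0| * asym_error * sqrt x.
Proof.
rewrite le_eqVlt => /predU1P[<-|x0].
 by rewrite mul0r /ppow ltxx mulr0 subr0 normr0 sqrtr0 mulr0.
have G1 := Gamma_gt0 s20; have G2 := Gamma_gt0 s120; have G3 := @Gamma_gt0 R 2^-1.
rewrite invr_gt0 in G3; have {}G3 := G3 (ltr0n _ 2).
have B0 : 0 < line_int (euler 0) by rewrite line_int_euler0 divr_gt0// mulr_gt0.
set B := line_int (euler 0) in B0 *.
have rep := euler_representation (ltW x0); rewrite -/B in rep.
have Vx : V x = V 0 * (line_int (euler x) / B).
 by rewrite mulrA rep mulrAC divff ?mul1r// gt_eqF.
have as1 := euler_asymptotic x.
set lw := ln (1 + x ^+ 2) in as1; set Binf := Gamma_function _ * _ / _ in as1.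
have aE : alpha s = Binf / B.
 rewrite /alpha /Binf /B line_int_euler0.
 move: (Gamma_function (s / 2)) (Gamma_function ((1 - s) / 2)) (Gamma_function 2^-1) (Gamma_function (s - 2^-1)) G1 G2 G3 => g1 g2 g3 g4 G1 G2 G3.
 by field; rewrite !gt_eqF.
have sx : sqrt x = expR (2^-1 * ln x).
 rewrite -[RHS]ger0_norm ?expR_ge0// -sqrtr_sqr -expRM_natr.
 by rewrite mulrAC mulVf ?pnatr_eq0// mul1r lnK.
have lwx : 2 * ln x <= lw.
 have -> : 2 * ln x = ln (x ^+ 2) by rewrite lnXn// mulr_natl.
 by rewrite ler_ln ?posrE ?exprn_gt0 ?w_gt0// lerDr.
have E1 : `|x * (V x - V 0 * alpha s * expR (m * lw))| <= `|V 0| * (asym_const / B) * sqrt x.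
 rewrite Vx aE.
 have -> : x * (V 0 * (line_int (euler x) / B) - V 0 * (Binf / B) * expR (m * lw)) =
 V 0 * (x / B) * (line_int (euler x) - expR (m * lw) * Binf) by field; rewrite gt_eqF.
 rewrite !normrM normfV (gtr0_norm x0) (gtr0_norm B0).
 have ac0 : 0 <= asym_const by move: (le_trans (normr_ge0 _) as1); rewrite pmulr_rge0 ?expR_gt0.
 have -> : `|V 0| * (asym_const / B) * sqrt x = `|V 0| / B * (sqrt x * asym_const) by ring.
 have -> : `|V 0| * (x / B) * `|line_int (euler x) - expR (m * lw) * Binf| =
 `|V 0| / B * (x * `|line_int (euler x) - expR (m * lw) * Binf|) by ring.
 apply: ler_wpM2l; first by rewrite divr_ge0// ltW.
 apply: le_trans (ler_wpM2l (ltW x0) as1) _.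
 rewrite mulrA ler_wpM2r// sx -{1}(@lnK _ x) ?posrE// -expRD ler_expR; slra.
have E2 : `|x * (V 0 * alpha s * expR (m * lw)) - V 0 * alpha s * ppow x| <= `|V 0| * `|alpha s| * sqrt x.
 rewrite /ppow x0.
 have -> : x * (V 0 * alpha s * expR (m * lw)) - V 0 * alpha s * expR (s * ln x) =
 V 0 * alpha s * (x * expR (m * lw) - expR (s * ln x)) by ring.
 rewrite normrM [`|V 0 * _|]normrM; apply: ler_wpM2l; first by rewrite mulr_ge0.
 pose z := expR (- (2 * ln x)).
 have x2 : x ^+ 2 = expR (2 * ln x) by rewrite [2 * _]mulrC expRM_natr lnK.
 have zE : 1 + x ^+ 2 = expR (2 * ln x) * (1 + z).
 by rewrite mulrDr mulr1 -expRD subrr expR0 -x2 addrC.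
 have k0 : 0 <= kap <= 1 by apply/andP; split; slra.
 have /andP[z1 z2] := one_sub_pow (expR_gt0 (- (2 * ln x))) k0.
 rewrite -/z in z1 z2.
 have -> : x * expR (m * lw) - expR (s * ln x) = - (expR (s * ln x) * (1 - expR (m * ln (1 + z)))).
 have -> : lw = 2 * ln x + ln (1 + z).
 by rewrite /lw zE lnM ?posrE ?expR_gt0 ?addr_gt0 ?expR_gt0// expRK.
 have -> : x * expR (m * (2 * ln x + ln (1 + z))) = expR (s * ln x) * expR (m * ln (1 + z)).
 by rewrite -{1}(@lnK _ x) ?posrE// -!expRD; congr expR; field.
 ring.
 rewrite normrN ger0_norm ?mulr_ge0 ?expR_ge0//.
 apply: le_trans (ler_wpM2l (expR_ge0 _) z2) _.
 by rewrite sx /z expRK -expRD ler_expR; apply: eq_ler; field.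
have -> : x * V x - V 0 * alpha s * ppow x =
 x * (V x - V 0 * alpha s * expR (m * lw)) + (x * (V 0 * alpha s * expR (m * lw)) - V 0 * alpha s * ppow x) by ring.
apply: le_trans (ler_normD _ _) _; apply: le_trans (lerD E1 E2) _.
by rewrite /asym_error -/B; apply: eq_ler; ring.
Qed.

End Asymptotics.
End RealParameter.

(** * The constant of the main term *)

Section RealParameterMain.
Context {R : realType}.
Local Notation mu := (leb R).
Local Opaque Gamma_function.

(** At s = 1 the Euler integral at x = 0 diverges; but then lam = 0, V is constant, alpha(1) = 1,
    and the asymptotic formula is exact. *)
Lemma real_asymptotic (s : R) : 2^-1 < s -> s <= 1 -> exists2 C : R, 0 <= C & forall V P : R -> R,
 (forall x : R, is_derive x (1 : R) V (P x / (1 + x ^+ 2))) ->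
 (forall x : R, is_derive x (1 : R) P (- (s * (1 - s)) * V x)) -> P 0 = 0 ->
 forall x, 0 <= x -> `|x * V x - V 0 * alpha s * ppow s x| <= `|V 0| * C * sqrt x.
Proof.
move=> s12; rewrite le_eqVlt => /predU1P[s1|s1]; last first.
 exists `|asym_error s| => // V P dV dP P0 x x0.
 apply: le_trans (real_asymptotic_lt1 s12 s1 dV dP P0 x0) _.
 by rewrite ler_wpM2r// ler_wpM2l// ler_norm.
exists 0 => // V P dV dP P0 x x0.
rewrite mulr0 mul0r normr_le0 subr_eq0 s1.
have a1 : alpha 1 = 1 :> R.
 have h : 0 < 2^-1 :> R by rewrite invr_gt0.
 have := Gamma_gt0 h; rewrite /alpha.
 have -> : 1 - 2^-1 = 2^-1 :> R by field.
 have -> : 1 / 2 = 2^-1 :> R by field.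
 by move: (Gamma_function _) => g g0; field; rewrite gt_eqF.
have lam0 : s * (1 - s) = 0 by rewrite s1 subrr mulr0.
have Pc y : 0 <= y -> P y = 0.
 move=> y0; have dP0 : deriv_in 0 y P (fun=> 0).
 by move=> z _; have := dP z; rewrite lam0 oppr0 mul0r.
 have := segint_FTC y0 (contW (@cst_continuous _ _ (0 : R))) (fun z _ => is_derive_cont (dP z)) dP0.
 by rewrite segint_cst// mul0r P0 subr0 => <-.
have : V x - V 0 = 0.
 have dV0 : deriv_in 0 x V (fun=> 0).
 by move=> z /andP[/ltW z0 _]; have := dV z; rewrite Pc// mul0r.
 have := segint_FTC x0 (contW (@cst_continuous _ _ (0 : R))) (fun z _ => is_derive_cont (dV z)) dV0.
 by rewrite segint_cst// mul0r => <-.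
move/eqP; rewrite subr_eq0 => /eqP ->; rewrite a1 mulr1 /ppow.
case: ltP => [xp|xn]; first by rewrite mul1r lnK// mulrC.
by have -> : x = 0 by [apply/eqP; rewrite eq_le xn x0]; rewrite mul0r mulr0.
Qed.

Lemma ppow_ge0 (s x : R) : 0 <= ppow s x.
Proof. by rewrite /ppow; case: ifP => // _; exact: expR_ge0. Qed.

Lemma cont_ppow (s : R) : 2^-1 <= s -> continuous (ppow s).
Proof.
move=> s12 x; rewrite /continuous_at; have [x0|x0|->] := ltgtP x 0.
- have : \forall y \near x, 0 = ppow s y.
 by have := lt_nbhsl x0; apply: filterS => y y0; rewrite /ppow ltNge (ltW y0).
 have -> : ppow s x = 0 by rewrite /ppow ltNge (ltW x0).
 move=> H; have c : (fun _ : R => 0 : R) y @[y --> x] --> (0 : R) by exact: cvg_cst.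
 by apply: cvg_trans c; apply: near_eq_cvg; exact: H.
- have : \forall y \near x, expR (s * ln y) = ppow s y.
 by have := lt_nbhsr x0; apply: filterS => y y0; rewrite /ppow y0.
 have -> : ppow s x = expR (s * ln x) by rewrite /ppow x0.
 move=> H.
 have c : {for x, continuous (fun y => expR (s * ln y))} by ctn.
 by apply: cvg_trans c; apply: near_eq_cvg; exact: H.
have -> : ppow s 0 = 0 by rewrite /ppow ltxx.
apply: (@squeeze_cvgr _ _ _ _ (fun=> 0) (fun y => sqrt `|y|)); last 2 first.
- exact: cvg_cst.
- have c : {for (0 : R), continuous (fun y : R => sqrt `|y|)} by ctn.
 by move: c; rewrite /prop_for /continuous_at normr0 sqrtr0.
near=> y; rewrite ppow_ge0/= /ppow; case: ltP => y0; last exact: sqrtr_ge0.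
rewrite (gtr0_norm y0); have -> : sqrt y = expR (2^-1 * ln y).
 rewrite -[RHS]ger0_norm ?expR_ge0// -sqrtr_sqr -expRM_natr.
 by rewrite mulrAC mulVf ?pnatr_eq0// mul1r lnK.
have y1 : y < 1 by near: y; apply: lt_nbhsl.
by rewrite ler_expR ler_wnM2r// ln_le0// ltW.
Unshelve. all: by end_near. Qed.

Lemma chord_ppow (Y s : R) : 0 < Y -> 2^-1 <= s ->
 \int[mu]_(x in `[0, Y]) (chord Y x * ppow s x) = expR ((s + 2) * ln Y) / 2 *
 (Gamma_function ((s + 1) / 2) * Gamma_function (3 / 2) / Gamma_function (s / 2 + 2)).
Proof.
move=> Y0 s12; apply: chord_moment => //; first by rewrite (le_trans _ s12).
 by have ? := cont_ppow s12; have ? := @cont_chord R Y; ctn.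
by move=> x x0; rewrite /ppow x0.
Qed.

(** Half of it is the coefficient of V(0)^2 Y^(s + 2) in V(0) times the pairing of V with the kernel
    of radius Y. *)
Definition main_const (s : R) : R := 4 / pi * (alpha s / 2 *
 (Gamma_function ((s + 1) / 2) * Gamma_function (3 / 2) / Gamma_function (s / 2 + 2))).

(** The area of the quarter disc, computed by the sine substitution and again as a beta value. *)
Lemma Gamma_half_sqr : Gamma_function (2^-1 : R) ^+ 2 = pi.
Proof.
have H := @chord_moment R 1 0 (chord 1) ltr01 (lexx 0) (@cont_chord R 1).
have {}H := H (fun x _ => _); rewrite quarter_disc// in H.
have h : 0 < 2^-1 :> R by rewrite invr_gt0.
have g := Gamma_gt0 h.
have e32 : Gamma_function (3 / 2 : R) = 2^-1 * Gamma_function 2^-1.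
 by rewrite -GammaS//; congr Gamma_function; field.
have e2 : Gamma_function (0 / 2 + 2 : R) = 1.
 have -> : 0 / 2 + 2 = 1 + 1 :> R by ring.
 by rewrite GammaS// mul1r Gamma1.
have e1 : (0 + 1) / 2 = 2^-1 :> R by field.
have := H _; rewrite e1 e2 e32 ln1 mulr0 expR0 expr1n => {}H.
have : pi / 4 * 1 = 1 / 2 * (Gamma_function 2^-1 * (2^-1 * Gamma_function 2^-1) / 1) :> R.
 by apply: H => x; rewrite mul0r expR0 mulr1.
move: (Gamma_function _) (pi) => a p E.
have -> : p = 4 * (p / 4 * 1) by field.
by rewrite E; field.
Qed.

(** The factor (s + 2) / 2 arises from differentiating Y^(s + 2) with respect to Y^2. *)
Lemma main_constE (s : R) : 2^-1 < s -> main_const s * ((s + 2) / 2) = 2 / pi * gamma1 s.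
Proof.
move=> s12; have h : 0 < 2^-1 :> R by rewrite invr_gt0.
have p1 : 0 < s - 2^-1 by lra.
have p2 : 0 < s / 2 by lra.
have p3 : 0 < s / 2 + 1 by lra.
have e32 : Gamma_function (3 / 2 : R) = 2^-1 * Gamma_function 2^-1.
 by rewrite -GammaS//; congr Gamma_function; field.
have e1 : Gamma_function (s + 2^-1) = (s - 2^-1) * Gamma_function (s - 2^-1).
 by rewrite -GammaS//; congr Gamma_function; field.
have e2 : Gamma_function (s / 2 + 2) = (s / 2 + 1) * (s / 2 * Gamma_function (s / 2)).
 by rewrite -!GammaS//; congr Gamma_function; ring.
rewrite /main_const /gamma1 /alpha e1 e2 e32.
have := Gamma_half_sqr; have := Gamma_gt0 h; have := Gamma_gt0 p2; have := @pi_gt0 R.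
move: (Gamma_function 2^-1) (Gamma_function (s / 2)) (Gamma_function ((s + 1) / 2)) (Gamma_function (s - 2^-1)) (pi : R) => a b c d p p0 b0 a0 ap.
rewrite -ap in p0 *; clear e32 e1 e2 p1 p3 p0 ap h.
have s0 : 0 < s by lra.
have s2 : 0 < 2 * s - 1 by lra.
have s3 : 0 < s + 2 by lra.
clear s12 p2; field; rewrite !gt_eqF//.
Qed.

End RealParameterMain.

(** * Hyperbolic integrals rewritten in the coordinates (v, t) *)

Section Transport.
Context {R : realType}.
Local Notation plane := (planeT R).
Local Notation L := (leb2 R).
Implicit Types (F : set (R * R)) (f : R * R -> R).

Lemma measurable_upper_half_plane : measurable (@upper_half_plane R : set plane).
Proof.
have mI : measurable (`]0%R, +oo[%classic : set (measurableTypeR R)) by exact: measurable_itv.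
have -> : @upper_half_plane R = setT `&` snd @^-1` (`]0%R, +oo[%classic : set R).
 by rewrite setTI; apply/seteqP; split => z; rewrite /= in_itv/= andbT.
exact: (@measurable_snd _ _ (measurableTypeR R) (measurableTypeR R) measurableT).
Qed.

Lemma measurable_comp_hpt f :
 measurable_fun (upper_half_plane : set plane) (f : plane -> measurableTypeR R) ->
 mfun (f \o @hpt R : plane -> measurableTypeR R).
Proof.
move=> mf; apply: (measurable_comp measurable_upper_half_plane _ mf (@measurable_hpt R)).
by move=> _ [p _ <-]; exact: hpt_gt0.
Qed.

Lemma ge0_hyp_integral F f : measurable (F : set plane) -> F `<=` upper_half_plane ->
 measurable_fun (upper_half_plane : set plane) f -> (forall z, 0 <= f z) ->
 (hyp_integral F f = \int[L]_(p in (@hpt R) @^-1` F) (f (hpt p))%:E)%E.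
Proof.
move=> mF FH mf f0; have mH := measurable_upper_half_plane.
pose g : plane -> \bar R := (fun z : plane => (f z)%:E) \_ (F : set plane).
have mg : mfun g.
 apply/(measurable_restrictT _ mF); apply/measurable_EFinP.
 exact: (measurable_funS mH FH mf).
have g0 z : (0 <= g z)%E by rewrite /g patchE; case: ifP => // _; rewrite lee_fin.
have E := ge0_integral_hpt mg g0.
transitivity (\int[L]_(z in upper_half_plane) (g z * (z.2 ^- 2)%:E))%E.
 rewrite /hyp_integral; have {1}-> : F = upper_half_plane `&` F by rewrite setIC setIidl.
 rewrite integral_mkcondr; apply: eq_integral => z _; rewrite /g /patch.
 by case: ifP => _; rewrite ?mul0e// EFinM.
rewrite E [RHS]integral_mkcond; apply: eq_integral => p _; rewrite /g /patch.
by have -> : (hpt p \in F) = (p \in hpt @^-1` F) by apply/idP/idP; rewrite !inE.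
Qed.

Lemma hyp_integralE F f : measurable (F : set plane) -> F `<=` upper_half_plane ->
 measurable_fun (upper_half_plane : set plane) f ->
 (hyp_integral F f = \int[L]_(p in (@hpt R) @^-1` F) (f (hpt p))%:E)%E.
Proof.
move=> mF FH mf; have mH := measurable_upper_half_plane.
have H (g : R * R -> R) : measurable_fun (upper_half_plane : set plane) g ->
 (\int[L]_(z in F) (Num.max (g z / z.2 ^+ 2) 0)%:E =
 \int[L]_(p in (@hpt R) @^-1` F) (Num.max (g (hpt p)) 0)%:E)%E.
 move=> mg; rewrite -(@ge0_hyp_integral F (fun z => Num.max (g z) 0))//.
 - apply: eq_integral => z _; congr EFin.
 by rewrite -[in LHS](mul0r (z.2 ^+ 2)^-1) -maxr_pMl// invr_ge0 sqr_ge0.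
 - by apply: measurable_maxr => //; exact: mg.
 - by move=> z; rewrite le_max lexx orbT.
rewrite /hyp_integral integralE [RHS]integralE; congr (_ - _)%E.
 rewrite (eq_integral (fun z : plane => (Num.max (f z / z.2 ^+ 2) 0)%:E)); last first.
 by move=> z _; rewrite funeposE -EFin_max.
 rewrite H//; apply: eq_integral => p _; by rewrite funeposE -EFin_max.
have mN : measurable_fun (upper_half_plane : set plane) (fun z => - f z).
 exact: measurableT_comp.
rewrite (eq_integral (fun z : plane => (Num.max ((fun z => - f z) z / z.2 ^+ 2) 0)%:E)); last first.
 by move=> z _; rewrite funenegE -EFinN -EFin_max mulNr.
rewrite (H _ mN); apply: eq_integral => p _; by rewrite funenegE -EFinN -EFin_max.
Qed.

End Transport.

(** * The orthonormal system rewritten in the coordinates (v, t) *)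

Section System.
Context {R : realType}.
Local Notation plane := (planeT R).
Local Notation L := (leb2 R).
Variables (G : set 'M[R]_2) (F : set (R * R)) (u : nat -> R * R -> R).
Hypotheses (subG : psl2_subgroup G) (fundF : fundamental_set G F) (sysu : complete_orthonormal_system G F u).
Local Notation F' := ((@hpt R) @^-1` F : set plane).

Definition orbit_eqv (p q : plane) := exists2 g, G g & (q : R * R) = hact g p.

Lemma measurable_fund : measurable F'.
Proof. by have [mF _ _] := fundF; rewrite -[X in measurable X]setTI; exact: measurable_hpt. Qed.

Lemma fund_unique (p : R * R) : exists! w, F' w /\ exists2 g, G g & w = hact g p.
Proof.
have [_ FH uq] := fundF; have [w [[Fw [g Gg wE]] wu]] := uq _ (hpt_gt0 p).
have hE h : G h -> mobius h (hpt p) = hpt (hact h p).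
 by move=> Gh; rewrite mobius_hpt//; exact: psl2_det subG h Gh.
exists (hact g p); split.
 by split; [rewrite /= -hE// -wE|exists g].
move=> w' [Fw' [g' Gg' E']]; apply: hpt_inj.
by rewrite -hE// -wE; apply: wu; split => //; exists g' => //; rewrite hE// E'.
Qed.

Definition ue j : plane -> R := u j \o @hpt R.

Let mu_ j : measurable_fun (upper_half_plane : set plane) (u j).
Proof. by have [+ _ _] := sysu => /(_ j)[]. Qed.

Lemma ue_L2 j : L2 L F' (ue j).
Proof.
have [mF FH _] := fundF; split; first by apply: (@measurable_comp_hpt _ (u j)); exact: mu_.
have [+ _ _] := sysu => /(_ j)[_ _]; rewrite hyp_integralE//.
by apply: measurable_funX.
Qed.

Lemma ue_orthonormal i j : ip L F' (ue i) (ue j) = (i == j)%:R.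
Proof.
have [mF FH _] := fundF; have [_ + _] := sysu => /(_ i j).
rewrite hyp_integralE//; last exact: measurable_funM.
by rewrite /ip /Rintegral /ue /= => ->.
Qed.

Lemma ue_hact j g p : G g -> ue j (hact g p) = ue j p.
Proof.
move=> Gg; have [+ _ _] := sysu => /(_ j)[+ _ _] => /(_ g _ Gg (hpt_gt0 p)).
by rewrite mobius_hpt//; exact: psl2_det subG g Gg.
Qed.

Lemma ue_invariant j : invariant_fun orbit_eqv (ue j).
Proof. by move=> p q [g Gg ->]; rewrite ue_hact. Qed.

Lemma ue_complete r : L2 L F' r -> invariant_fun orbit_eqv r ->
 (forall j, ip L F' r (ue j) = 0) -> ip L F' r r = 0.
Proof.
move=> Lr invr r0; have [mF FH _] := fundF; have [_ _ cplt] := sysu.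
have mF' := measurable_fund.
(* The function [r] carried to the half-plane. The formula is measurable on the whole plane, and its
   values outside the half-plane do not matter. *)
pose f (z : R * R) := r (z.1 * expR (- ln z.2), ln z.2).
have fE p : f (hpt p) = r p.
 rewrite /f /hpt /= expRK -mulrA -expRD subrr expR0 mulr1.
 by congr r; case: p.
have mf : mfun (f : plane -> R).
 have [mr _] := Lr; apply: (measurableT_comp mr).
 apply: measurable_fun_pair.
 apply: measurable_funM; first exact: measurable_fst.
 apply: (measurableT_comp (@measurable_expR R)); apply: measurableT_comp => //.
 by apply: (measurableT_comp (@measurable_ln R)); exact: measurable_snd.
 by apply: (measurableT_comp (@measurable_ln R)); exact: measurable_snd.
have mfH : measurable_fun (upper_half_plane : set plane) f by exact: measurable_funTS.
have IE : hyp_integral F (fun z => f z ^+ 2) = (ip L F' r r)%:E.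
 rewrite hyp_integralE//; last exact: measurable_funX.
 rewrite -(integral_sqE mF' Lr); apply: eq_integral => p _; by rewrite fE.
have sqf : square_integrable G F f.
 split=> //; last by rewrite IE ltry.
 move=> g z Gg Hz; have zE := hpt_surj Hz.
 rewrite -zE mobius_hpt ?(psl2_det subG Gg)// !fE.
 by rewrite (invr (z.1 / z.2, ln z.2) (hact g (z.1 / z.2, ln z.2)))//; exists g.
have := cplt f sqf; have H j : hyp_integral F (fun z => f z * u j z) = 0%E.
 rewrite hyp_integralE//; last exact: measurable_funM.
 have I := L2_integrableM mF' Lr (ue_L2 j).
 have := r0 j; rewrite /ip /Rintegral => E.
 have E0 := fineK (integrable_fin_num mF' I); rewrite E in E0.
 rewrite [RHS]E0; apply: eq_integral => p _; by rewrite /= fE.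
move=> /(_ H) ae0; apply: EFin_inj; rewrite -IE /hyp_integral.
rewrite (@ae_eq_integral _ _ _ _ _ (cst 0%E)) ?integral_cst ?mul0e//.
- apply/measurable_EFinP; apply: (@eq_measurable_fun _ _ _ _ _ (fun z : plane => f z ^+ 2 * expR (- (2 * ln z.2)))).
 move=> z; rewrite inE => /FH z0; congr (_ * _).
 by rewrite expRN mulrC expRM_natr lnK.
 apply: measurable_funTS; apply: measurable_funM; first exact: measurable_funX.
 apply: (measurableT_comp (@measurable_expR R)); apply: measurableT_comp => //.
 apply: measurable_funM => //; apply: (measurableT_comp (@measurable_ln R)); exact: measurable_snd.
- apply: negligibleS ae0 => z; apply: contra_not => H0 Fz /=.
 by rewrite H0// expr0n mul0r.
Qed.

End System.

(** * Poincare series of bounded functions supported in a box *)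

Section PoincareSeries.
Context {R : realType}.
Implicit Types (p : R * R) (g : 'M[R]_2).
Local Notation plane := (planeT R).
Local Notation mu := (leb R).
Local Notation L := (leb2 R).
Variable G : set 'M[R]_2.
Hypotheses (subG : psl2_subgroup G) (discG : discrete_subgroup G) (cocG : cocompact G).

Definition box (A T : R) : set plane := [set p | `|p.1| <= A /\ `|p.2| <= T].

Lemma cocompact_box : exists A T, forall p, exists2 g, G g & box A T (hact g p).
Proof.
have [K [cK KH HK]] := cocG.
have bnd (f : R * R -> R) : (forall z, upper_half_plane z -> {for z, continuous f}) ->
 exists M, forall z, K z -> `|f z| <= M.
 move=> cf; have cf' : {within K, continuous f}.
 by apply: continuous_in_subspaceT => z; rewrite inE => /KH; exact: cf.
 have [M [_ HM]] := compact_bounded (continuous_compact cf' cK).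
 exists (M + 1) => z Kz; apply: HM; first by rewrite ltrDl.
 by exists z.
have [A HA] : exists M, forall z, K z -> `|z.1 / z.2| <= M.
 by apply: bnd => z z0; ctn; rewrite gt_eqF.
have [T HT] : exists M, forall z, K z -> `|ln z.2| <= M by apply: bnd => z z0; ctn.
exists A, T => p; have [g Gg Kg] := HK _ (hpt_gt0 p); exists g => //.
have := mobius_hpt p (psl2_det subG Gg) => E; rewrite E in Kg.
have Hz := KH _ Kg; have := hpt_surj Hz => /hpt_inj <-.
by split; [exact: (HA _ Kg)|exact: (HT _ Kg)].
Qed.

(** Cocompactness moves p into a fixed box, which only reorders the sum; afterwards only the
    finitely many elements returning one box to itself contribute, whence a bound uniform in p. *)
Lemma box_overlap A T : exists2 M : R, 0 <= M & forall p,
 (\esum_(g in G) (\1_(box A T) (hact g p) : R)%:E <= M%:E)%E.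
Proof.
have [A0 [T0 H0]] := cocompact_box.
pose A1 := Num.max A A0; pose T1 := Num.max T T0.
have fS := finite_return subG discG A1 T1.
set S := [set _ | _] in fS.
exists (\sum_(i \in S) (1 : R)); first by apply: fsumr_ge0.
move=> p.
have [g0 Gg0 Hg0] := H0 p.
have -> : (\esum_(g in G) (\1_(box A T) (hact g p) : R)%:E =
 \esum_(g in G) (\1_(box A T) (hact g (hact g0 p)) : R)%:E)%E.
 rewrite -(esum_psl2_Mr subG (fun g => (\1_(box A T) (hact g p) : R)%:E) Gg0).
 by apply: eq_esum => g Gg; rewrite hactM//; exact: psl2_det subG _ _.
apply: (@le_trans _ _ (\esum_(g in S) 1%E)).
 rewrite esum_mkcond [leRHS]esum_mkcond; apply: le_esum => g _.
 rewrite indicE; case: ifP => [Gg|_]; last by case: ifP.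
 have [gin|_] := boolP (hact g (hact g0 p) \in box A T); last by case: ifP.
 rewrite ifT//; rewrite inE; split; first by rewrite inE in Gg.
 exists (hact g0 p); case: Hg0 => a1 a2; move: gin; rewrite inE => -[b1 b2].
 by split; rewrite le_max ?a1 ?a2 ?b1 ?b2 ?orbT.
by rewrite esum_fset// fsumEFin.
Qed.

Variable e : nat -> 'M[R]_2.
Hypothesis bij_e : set_bij [set: nat] G e.

Let Ge n : G (e n). Proof. by case: bij_e => + _ _; apply. Qed.

Definition poincare (f : plane -> R) (p : plane) : R :=
 fine (\sum_(0 <= n <oo) (f (hact (e n) p))%:E)%E.

Section Bounded.
Variables (f : plane -> R) (B A T : R).
Hypotheses (mf : mfun f) (f0 : forall p, 0 <= f p) (B0 : 0 <= B)
 (fB : forall p, f p <= B * \1_(box A T) p).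

Lemma poincare_bound : exists M, [/\ 0 <= M, forall p, 0 <= poincare f p <= M &
 forall p, (\sum_(0 <= n <oo) (f (hact (e n) p))%:E = (poincare f p)%:E)%E].
Proof.
have [M M0 HM] := box_overlap A T; exists (B * M).
have ge0 p : (0 <= \sum_(0 <= n <oo) (f (hact (e n) p))%:E)%E.
 by apply: nneseries_ge0 => n _ _; rewrite lee_fin.
have le p : (\sum_(0 <= n <oo) (f (hact (e n) p))%:E <= (B * M)%:E)%E.
 apply: (@le_trans _ _ (\sum_(0 <= n <oo) (B%:E * (\1_(box A T) (hact (e n) p) : R)%:E)))%E.
 by apply: lee_nneseries => n _; rewrite ?lee_fin// -EFinM lee_fin.
 rewrite nneseriesZl//.
 rewrite (nneseries_psl2 bij_e (f := fun g => (\1_(box A T) (hact g p) : R)%:E)); last by move=> g; rewrite lee_fin.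
 by rewrite EFinM lee_wpmul2l// lee_fin.
have E p : (\sum_(0 <= n <oo) (f (hact (e n) p))%:E = (poincare f p)%:E)%E.
 by rewrite /poincare fineK// ge0_fin_numE// (le_lt_trans (le p))// ltry.
split=> //; first by rewrite mulr_ge0.
by move=> p; rewrite -!lee_fin -E ge0 le.
Qed.

Lemma measurable_poincare : mfun (poincare f).
Proof.
apply: (measurableT_comp (@fine_measurable R setT measurableT)).
apply: ge0_emeasurable_sum => n; first by move=> p _; rewrite lee_fin.
move=> _; apply/measurable_EFinP; apply: (measurableT_comp mf); exact: measurable_hact.
Qed.

Lemma poincare_hact g p : G g -> poincare f (hact g p) = poincare f p.
Proof.
move=> Gg; congr fine.
rewrite (nneseries_psl2 bij_e (f := fun h => (f (hact h (hact g p)))%:E)); last by move=> h; rewrite lee_fin.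
rewrite (nneseries_psl2 bij_e (f := fun h => (f (hact h p))%:E)); last by move=> h; rewrite lee_fin.
rewrite -(esum_psl2_Mr subG (fun h => (f (hact h p))%:E) Gg).
by apply: eq_esum => h Gh; rewrite hactM//; exact: psl2_det subG _ _.
Qed.

End Bounded.

Lemma measurable_box A T : measurable (box A T).
Proof.
have -> : box A T = (`[- A, A]%classic `*` `[- T, T]%classic).
 by apply/seteqP; split => p; rewrite /box/= !in_itv/= !ler_norml.
by apply: measurableX; exact: measurable_itv.
Qed.

Lemma box_vol A T : (L (box A T) < +oo)%E.
Proof.
have -> : box A T = (`[- A, A]%classic `*` `[- T, T]%classic).
 by apply/seteqP; split => p; rewrite /box/= !in_itv/= !ler_norml.
rewrite product_measure1E//=; try exact: measurable_itv.
rewrite !lebesgue_measure_itv/=; case: ifP => _; case: ifP => _; rewrite ?mule0 ?mul0e ?ltry//.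
Qed.

Section Fundamental.
Variable F' : set plane.
Hypotheses (mF' : measurable F')
 (fundF' : forall p : R * R, exists! w : R * R, F' w /\ exists2 g, G g & w = hact g p).

(** Unfold the indicator of a box that meets every orbit: its Poincare series is at least 1 on F',
    and the unfolded integral is twice the finite area of the box. *)
Lemma fund_vol : (L F' < +oo)%E.
Proof.
have [A [T HAT]] := cocompact_box.
have m1 : mfun (\1_(box A T) : plane -> R) by apply: measurable_indic; exact: measurable_box.
have i0 (p : plane) : 0 <= (\1_(box A T) p : R) by rewrite indicE.
have H := poincare_unfolding subG bij_e mF' fundF' m1 i0 (@measurable_cst _ _ plane R setT 1) (fun=> ler01) (fun _ _ _ => erefl).
apply: (@le_lt_trans _ _ (2%:E * \int[L]_p (\1_(box A T) p * 1)%:E)%E); last first.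
 under eq_integral do rewrite mulr1.
 rewrite integral_indic ?setIT//; last exact: measurable_box.
 by apply: lte_mul_pinfty => //; exact: box_vol.
have fB p : (\1_(box A T) p : R) <= 1 * \1_(box A T) p by rewrite mul1r.
have [M [M0 HM HE]] := poincare_bound i0 ler01 fB.
rewrite -H -[leLHS]mul1e -integral_cst//; apply: ge0_le_integral => //.
- under eq_fun do rewrite HE mule1.
 by apply: measurable_funTS; apply/measurable_EFinP; exact: measurable_poincare.
move=> p _; rewrite mule1; have [g Gg Hg] := HAT p.
have [n _ en] : ([set e n | n in setT] : set _) g by rewrite (image_eq bij_e).
have ge0 k : (0 <= (\1_(box A T) (hact (e k) p) : R)%:E)%E by rewrite lee_fin.
rewrite (nneseriesD1 (n := n))//.
rewrite en indicE mem_set//= -[leLHS]adde0; apply: leeD => //.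
by apply: nneseries_ge0 => k _ _.
Qed.

Lemma L2_bounded (f : plane -> R) M : mfun f -> (forall p, `|f p| <= M) -> L2 L F' f.
Proof.
move=> mf fM; split => //.
apply: (@le_lt_trans _ _ (\int[L]_(p in F') (M ^+ 2)%:E)%E).
 apply: ge0_le_integral => //.
 - by move=> p _; rewrite lee_fin sqr_ge0.
 - by apply: measurable_funTS; apply/measurable_EFinP; exact: measurable_funX.
 move=> p _; rewrite lee_fin -real_normK ?num_real// lerXn2r ?nnegrE//.
 exact: le_trans (fM p).
rewrite integral_cst//; apply: lte_mul_pinfty => //; last exact: fund_vol.
by rewrite lee_fin sqr_ge0.
Qed.

Section InnerProduct.
Variables (f : plane -> R) (B A T : R).
Hypotheses (mf : mfun f) (f0 : forall p, 0 <= f p) (B0 : 0 <= B)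
 (fB : forall p, f p <= B * \1_(box A T) p).

Lemma poincare_L2 : L2 L F' (poincare f).
Proof.
have [M [M0 HM _]] := poincare_bound f0 B0 fB.
apply: (@L2_bounded _ M); first exact: measurable_poincare.
by move=> p; have /andP[h1 h2] := HM p; rewrite ger0_norm.
Qed.
Let unfold_ge0 phi : L2 L F' phi -> (forall p, 0 <= phi p) ->
 (forall g p, G g -> phi (hact g p) = phi p) ->
 L.-integrable setT (fun p => (f p * phi p)%:E) /\
 ip L F' (poincare f) phi = 2 * \int[L]_p (f p * phi p).
Proof.
move=> Lphi phi0 iphi; have [mphi _] := Lphi.
have [M [M0 HM HE]] := poincare_bound f0 B0 fB.
have U := poincare_unfolding subG bij_e mF' fundF' mf f0 mphi phi0 iphi.
have E : (\int[L]_(p in F') ((\sum_(0 <= n <oo) (f (hact (e n) p))%:E) * (phi p)%:E) =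
 (ip L F' (poincare f) phi)%:E)%E.
 have I := L2_integrableM mF' poincare_L2 Lphi.
 rewrite /ip /Rintegral fineK; last exact: integrable_fin_num.
 by apply: eq_integral => p _; rewrite HE -EFinM.
rewrite E in U.
have m2 : mfun (fun p : plane => f p * phi p) by exact: measurable_funM.
have fin : (\int[L]_p (f p * phi p)%:E < +oo)%E.
 by rewrite ltey; apply/eqP => I; rewrite I gt0_muley in U; [discriminate|rewrite lte_fin].
have fn : (\int[L]_p (f p * phi p)%:E)%E \is a fin_num.
 by rewrite ge0_fin_numE// integral_ge0// => p _; rewrite lee_fin mulr_ge0.
split.
 apply/integrableP; split; first exact/measurable_EFinP.
 by under eq_integral do rewrite /= ger0_norm ?mulr_ge0//.
by apply: EFin_inj; rewrite U EFinM /Rintegral fineK.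
Qed.

Lemma poincare_ip phi : L2 L F' phi -> (forall g p, G g -> phi (hact g p) = phi p) ->
 L.-integrable setT (fun p => (f p * phi p)%:E) /\
 ip L F' (poincare f) phi = 2 * \int[L]_p (f p * phi p).
Proof.
move=> Lphi iphi; have [mphi _] := Lphi.
pose pp p := Num.max (phi p) 0; pose pn p := Num.max (- phi p) 0.
have sub (h : plane -> R) : mfun h -> (forall p, `|h p| <= `|phi p|) -> L2 L F' h.
 move=> mh hp; split => //; case: Lphi => _; apply: le_lt_trans; apply: ge0_le_integral => //.
 - by move=> p _; rewrite lee_fin sqr_ge0.
 - by apply: measurable_funTS; apply/measurable_EFinP; exact: measurable_funX.
 - by apply: measurable_funTS; apply/measurable_EFinP; exact: measurable_funX.
 by move=> p _; rewrite lee_fin -real_normK ?num_real// -[leRHS]real_normK ?num_real// lerXn2r ?nnegrE.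
have Lp : L2 L F' pp.
 apply: sub; first exact: measurable_maxr.
 by move=> p; rewrite /pp; case: (leP (phi p) 0); rewrite ?normr0.
have Ln : L2 L F' pn.
 apply: sub; first by apply: measurable_maxr => //; exact: measurableT_comp.
 by move=> p; rewrite /pn; case: (leP (- phi p) 0); rewrite ?normr0 ?normrN.
have pp0 p : 0 <= pp p by rewrite le_max lexx orbT.
have pn0 p : 0 <= pn p by rewrite le_max lexx orbT.
have [I1 E1] := unfold_ge0 Lp pp0 (fun g p Gg => congr1 (fun x => Num.max x 0) (iphi g p Gg)).
have [I2 E2] := unfold_ge0 Ln pn0 (fun g p Gg => congr1 (fun x => Num.max (- x) 0) (iphi g p Gg)).
have D p : phi p = pp p - pn p.
 by rewrite /pp /pn; case: (leP (phi p) 0) => h; case: (leP (- phi p) 0) => h'; lra.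
have ED : (fun p => (f p * phi p)%:E) = (fun p => ((f p * pp p)%:E - (f p * pn p)%:E)%E).
 by apply/funext => p; rewrite -EFinB -mulrBr -D.
split; first by rewrite ED; exact: integrableB.
have -> : ip L F' (poincare f) phi = ip L F' (poincare f) pp - ip L F' (poincare f) pn.
 rewrite /ip -RintegralB//; [|exact: (L2_integrableM mF' poincare_L2)..].
 by apply: eq_Rintegral => p _; rewrite -mulrBr -D.
rewrite E1 E2 -mulrBr -RintegralB//; congr (_ * _).
by apply: eq_Rintegral => p _; rewrite -mulrBr -D.
Qed.

End InnerProduct.
End Fundamental.
End PoincareSeries.

(** * The even part of a period as a solution of the differential equation *)

Section Periods.
Context {R : realType}.
Local Notation mu := (leb R).

Lemma segint_reflect (f : R -> R) a : continuous f -> 0 <= a ->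
 \int[mu]_(x in `[- a, a]) f x = \int[mu]_(x in `[0, a]) (f x + f (- x)).
Proof.
move=> cf a0; have cfN : continuous (fun x => f (- x)).
 by apply: contT => x; apply (@cont_comp _ _ f (fun x => - x)); [exact: cf|ctn].
rewrite (@segint_chasles _ (- a) 0 a) ?oppr_le0//; last exact: contW.
rewrite segintD; try exact: contW.
rewrite addrC; congr (_ + _); rewrite /Rintegral.
have := @integration_by_substitution_oppr _ f 0 a a0; rewrite oppr0 => ->//.
by apply: cont_on_within; exact: contW.
Qed.

Variables (u : R * R -> R) (lam m : R).
Local Notation ell := (2 * ln m).
Hypotheses (m1 : 1 < m) (C2u : C2 u).
Hypothesis lapu : forall z, upper_half_plane z -> hyp_laplacian u z = lam * u z.
Hypothesis peru : forall v t, u (hpt (v, t + ell)) = u (hpt (v, t)).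

Let ell0 : 0 < ell. Proof. by rewrite mulr_gt0// ln_gt0. Qed.

(** An even kernel sees only the even part of the period. Its flux vanishes at 0, so the solution is
    determined by its value at 0, the period over the geodesic. *)
Definition even_period x := (hpt_int ell 0 u x + hpt_int ell 0 u (- x)) / 2.
Definition even_flux x := ((1 + x ^+ 2) * hpt_int ell 1 (dx u) x
 - (1 + (- x) ^+ 2) * hpt_int ell 1 (dx u) (- x)) / 2.

Let is_derive_reflect (f : R -> R) (x df : R) : is_derive (- x) (1 : R) f df ->
 is_derive x (1 : R) (fun x => f (- x)) (- df).
Proof.
move=> H; have hN : is_derive x (1 : R) (fun x : R => - x) (- 1) by exact: is_deriveN.
have := @is_derive1_comp _ f (fun x : R => - x) x _ _ H hN.
by rewrite mulrN1.
Qed.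

Lemma is_derive_even_period (x : R) : is_derive x (1 : R) even_period (even_flux x / (1 + x ^+ 2)).
Proof.
have [d1 _] := period_ode C2u ell0 lapu peru x.
have [d2 _] := period_ode C2u ell0 lapu peru (- x).
have := is_derive1M (is_derive1D d1 (is_derive_reflect d2)) (is_derive1_cst (2^-1) x).
rewrite /even_flux => h; apply: is_derive_eq h _.
have := w_gt0 x; move: (hpt_int _ _ _ _) (hpt_int _ _ _ _) (hpt_int _ _ _ _) => A B C w0.
by field; lra.
Qed.

Lemma is_derive_even_flux (x : R) : is_derive x (1 : R) even_flux (- lam * even_period x).
Proof.
have [_ d1] := period_ode C2u ell0 lapu peru x.
have [_ d2] := period_ode C2u ell0 lapu peru (- x).
have := is_derive1M (is_derive1D d1 (is_derive1N (is_derive_reflect d2))) (is_derive1_cst (2^-1) x).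
rewrite /even_period => h; apply: is_derive_eq h _.
by move: (hpt_int _ 0 _ x) (hpt_int _ 0 _ (- x)) (hpt_int _ 1 _ x) (hpt_int _ 1 _ (- x)) => A B C D; field.
Qed.

Lemma even_flux0 : even_flux 0 = 0.
Proof. by rewrite /even_flux oppr0 subrr mul0r. Qed.

Lemma cont_hpt_int : continuous (hpt_int ell 0 u).
Proof. by move=> x; have [d1 _] := period_ode C2u ell0 lapu peru x; exact: is_derive_cont d1. Qed.

Lemma even_period0 : even_period 0 = geodesic_period m u.
Proof.
rewrite /even_period oppr0 (_ : (_ + _) / 2 = hpt_int ell 0 u 0); last by field.
(* This is max(y, 1/2): it agrees with y on the range of integration and makes the integrand
   continuous on the whole line, as the substitution lemma asks. *)
pose M (y : R) := (y + 2^-1 + `|y - 2^-1|) / 2.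
have M0 y : 0 < M y by rewrite /M; have := ler_norm (2^-1 - y); rewrite distrC; lra.
have cM : continuous M by rewrite /M; ctn.
have ME y : 1 <= y -> M y = y by move=> y1; rewrite /M ger0_norm; lra.
have C0u : C0 u by case: C2u => -[].
have cg : continuous (fun y => u (0, M y) / M y).
 apply: contT => y; apply: contM; last by apply: contV; [rewrite gt_eqF|exact: cM].
 have Hp : (fun z => (0 : R, M z)) @ y --> (0 : R, M y) by exact: (cvg_pair (cvg_cst _) (cM y)).
 exact: (cvg_comp _ _ Hp (C0u (0, M y) (M0 y))).
have := @segint_subst _ _ (@expR R) (@expR R) 0 ell 0 (ltW ell0) cg.
rewrite expR0 mulr_natl mulr2n expRD lnK ?posrE; last exact: lt_trans ltr01 m1.
rewrite -expr2 => /(_ _ _ _ _) H.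
rewrite /geodesic_period (_ : \int[mu]_(y in `[1, m ^+ 2]) (u (0, y) / y) =
 \int[mu]_(y in `[1, m ^+ 2]) (u (0, M y) / M y)); last first.
 by apply: segint_eq => y /andP[y1 _]; rewrite ME.
rewrite H.
- rewrite /hpt_int; apply: segint_eq => t /andP[t0 _].
 by rewrite expr0 mul1r /hpt /= mul0r ME -?expR0 ?ler_expR// divfK// gt_eqF// expR_gt0.
- by apply: contW; exact: continuous_expR.
- by move=> x _; exact: expR_gt0.
- by rewrite exprn_ege1// ltW.
Qed.

Lemma segint_even_period (k : R -> R) a : continuous k -> (forall x, k (- x) = k x) -> 0 <= a ->
 \int[mu]_(x in `[- a, a]) (k x * hpt_int ell 0 u x) = 2 * \int[mu]_(x in `[0, a]) (k x * even_period x).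
Proof.
move=> ck kN a0; have cU := cont_hpt_int.
rewrite segint_reflect//; last by apply: contT => x; apply: contM; [exact: ck|exact: cU].
rewrite -segintZ; last first.
 apply: contW; apply: contT => x; apply: contM; first exact: ck.
 by apply: is_derive_cont; exact: is_derive_even_period.
apply: segint_eq => x _; rewrite kN /even_period.
by move: (hpt_int _ _ _ _) (hpt_int _ _ _ _) => A B; field.
Qed.

End Periods.

(** * The even solution near 0 *)

Section EvenSolutionNear.
Context {R : realType}.
Local Notation mu := (leb R).

Lemma deriv_norm_le (f f' g g' : R -> R) (a x : R) : a <= x ->
 (forall y, a <= y <= x -> is_derive y (1 : R) f (f' y)) ->
 (forall y, a <= y <= x -> is_derive y (1 : R) g (g' y)) ->
 (forall y, a <= y <= x -> `|f' y| <= g' y) -> `|f x - f a| <= g x - g a.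
Proof.
move=> ax df dg le.
have cf : cont_on a x f by move=> y yI; exact: is_derive_cont (df y yI).
have cg : cont_on a x g by move=> y yI; exact: is_derive_cont (dg y yI).
have sub y : a < y < x -> a <= y <= x by move=> /andP[/ltW -> /ltW ->].
rewrite ler_norml; apply/andP; split.
- have := @le0_derive_le _ a x (fun y => - f y - g y) (fun y => - f' y - g' y) ax.
 case/(_ _ _ _)/Wrap => [y yI|y yI|y yI|]; last by lra.
 + by apply: contD; [apply: contN; exact: cf|apply: contN; exact: cg].
 + by apply: is_derive1D; apply: is_derive1N; [exact: df (sub y yI)|exact: dg (sub y yI)].
 + by have := le y (sub y yI); rewrite ler_norml => /andP[]; lra.
- have := @le0_derive_le _ a x (fun y => f y - g y) (fun y => f' y - g' y) ax.
 case/(_ _ _ _)/Wrap => [y yI|y yI|y yI|]; last by lra.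
 + by apply: contD; [exact: cf|apply: contN; exact: cg].
 + by apply: is_derive1D; [exact: df (sub y yI)|apply: is_derive1N; exact: dg (sub y yI)].
 + by have := le y (sub y yI); rewrite ler_norml => /andP[]; lra.
Qed.

Variables (V P : R -> R) (lam : R).
Hypothesis dV : forall x : R, is_derive x (1 : R) V (P x / (1 + x ^+ 2)).
Hypothesis dP : forall x : R, is_derive x (1 : R) P (- lam * V x).
Hypothesis P0 : P 0 = 0.
Hypothesis lam0 : 0 <= lam.

Lemma even_solution_near x : 0 <= x -> `|V x - V 0| <= lam * `|V 0| / 2 * x ^+ 2.
Proof.
have PB y : 0 <= y -> `|P y| <= lam * `|V 0| * y.
 move=> y0; have d1 (z : R) : is_derive z (1 : R) (fun z => lam * `|V 0| * z) (lam * `|V 0|).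
 by isd; rewrite ?mulr0 ?mulr1 ?mul0r ?add0r ?addr0.
 have := @deriv_norm_le P _ _ _ 0 y y0 (fun z _ => dP z) (fun z _ => d1 z).
 rewrite P0 mulr0 !subr0; apply => z /andP[z0 _].
 by rewrite normrM normrN (ger0_norm lam0) ler_wpM2l// (even_solution_le dV dP P0 lam0).
move=> x0; have d2 (z : R) : is_derive z (1 : R) (fun z => lam * `|V 0| / 2 * z ^+ 2) (lam * `|V 0| * z).
 by isd; move: (lam * `|V 0|) => K; field.
have := @deriv_norm_le V _ _ _ 0 x x0 (fun z _ => dV z) (fun z _ => d2 z).
rewrite expr0n/= mulr0 subr0; apply => z /andP[z0 _].
rewrite normrM (le_trans _ (PB z z0))// ler_piMr// ger0_norm ?invr_ge0 ?(ltW (w_gt0 z))//.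
by rewrite invf_le1 ?w_gt0// lerDl sqr_ge0.
Qed.

Lemma segint_near d : 0 < d -> `|d^-1 * (\int[mu]_(x in `[0, d]) V x) - V 0| <= lam * `|V 0| / 2 * d ^+ 2.
Proof.
move=> d0; have d0' := ltW d0; have cV := cont_V dV.
have -> : d^-1 * (\int[mu]_(x in `[0, d]) V x) - V 0 = d^-1 * \int[mu]_(x in `[0, d]) (V x - V 0).
 rewrite (@segintB _ 0 d V (fun=> V 0)) ?segint_cst//; try by apply: contW; ctn.
 by rewrite subr0; field; rewrite gt_eqF.
rewrite normrM ger0_norm ?invr_ge0// mulrC ler_pdivrMr//.
rewrite -[leRHS](_ : \int[mu]_(x in `[0, d]) (lam * `|V 0| / 2 * d ^+ 2) = _); last by rewrite segint_cst// subr0.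
apply: segint_norm_le; try by apply: contW; ctn.
move=> x /andP[x0 xd]; apply: (le_trans (even_solution_near x0)).
by rewrite ler_wpM2l ?mulr_ge0// ler_sqr.
Qed.

End EvenSolutionNear.

(** * Functions supported on one period of the axis *)

Section Strips.
Context {R : realType}.
Local Notation plane := (planeT R).
Local Notation mu := (leb R).
Local Notation L := (leb2 R).

Definition hyp_mx (m : R) : 'M[R]_2 := diag_mx (\row_j (if j == 0 then m else m^-1)).

Lemma hyp_mxE m : [/\ hyp_mx m 0 0 = m, hyp_mx m 0 1 = 0, hyp_mx m 1 0 = 0 & hyp_mx m 1 1 = m^-1].
Proof. by rewrite /hyp_mx; split; rewrite !mxE ?eqxx/= ?mulr1n ?mulr0n. Qed.

Lemma hact_hyp_mx m p : 0 < m -> hact (hyp_mx m) p = (p.1, p.2 + 2 * ln m).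
Proof.
move=> m0; have [h00 h01 h10 h11] := hyp_mxE m.
rewrite /hact /mobius_q h00 h01 h10 h11 !mul0r !mulr0 !mul0r !add0r mulfV ?gt_eqF// addr0 mul1r.
by rewrite expr0n/= addr0 lnXn ?invr_gt0// lnV ?posrE// mulNrn opprK mulr_natl.
Qed.

Section Window.
Variables (m : R) (m1 : 1 < m).
Local Notation ell := (2 * ln m).

Let ell0 : 0 < ell. Proof. by rewrite mulr_gt0// ln_gt0. Qed.

(** The generator diag(m, m^-1) acts by t -> t + ell, so the half-open interval [0, ell[ represents
    each point of the axis modulo it exactly once. *)
Definition strip (K : R -> R) (p : plane) : R := K p.1 * \1_(`[0, ell[%classic) p.2.
Definition window A (k : R -> R) (v : R) : R := k v * \1_(`[- A, A]%classic) v.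
Definition slice (phi : plane -> R) v : R := \int[mu]_(t in `[0, ell]) phi (v, t).

Lemma measurable_window A k : continuous k -> mfun (window A k).
Proof.
move=> ck; apply: measurable_funM; first exact: continuous_measurable_fun.
by apply: measurable_indic; exact: measurable_itv.
Qed.

Lemma measurable_strip K : mfun K -> mfun (strip K).
Proof.
move=> mK; apply: measurable_funM; first exact: measurableT_comp.
by apply: (measurableT_comp (f := \1_(`[0, ell[%classic) : R -> R)) => //; apply: measurable_indic; exact: measurable_itv.
Qed.

Lemma window_ge0 A k : (forall v, 0 <= k v) -> forall v, 0 <= window A k v.
Proof. by move=> k0 v; rewrite mulr_ge0// indicE. Qed.

Lemma strip_ge0 K : (forall v, 0 <= K v) -> forall p, 0 <= strip K p.
Proof. by move=> K0 p; rewrite mulr_ge0// indicE. Qed.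

Lemma strip_window_le A k B : (forall v, `|v| <= A -> k v <= B) -> 0 <= B ->
 forall p, strip (window A k) p <= B * \1_(box A ell) p.
Proof.
move=> kB B0 p; rewrite /strip /window !indicE !mem_setE.
have [p1|] := boolP (p.1 \in `[- A, A]); last by rewrite !mulr0 !mul0r mulr_ge0// indicE.
have [p2|] := boolP (p.2 \in `[0, ell[); last by rewrite !mulr0 mulr_ge0// indicE.
rewrite !mulr1; move: p1 p2; rewrite !in_itv/= => p1 /andP[p20 p2l].
rewrite (_ : p \in box A ell) ?mulr1; first by rewrite kB// ler_norml.
by apply/mem_set; split; rewrite /= ?ler_norml// ?(ltW p2l) ?(le_trans _ p20)// oppr_le0 ltW.
Qed.

Lemma strip_integral K (phi : plane -> R) :
 L.-integrable setT (fun p => (strip K p * phi p)%:E) ->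
 (forall v, mu.-integrable `[0, ell] (fun t => (phi (v, t))%:E)) ->
 \int[L]_p (strip K p * phi p) = \int[mu]_v (K v * slice phi v).
Proof.
move=> If Iphi; rewrite /Rintegral -(integral12_prod_meas1 If); congr fine.
apply: eq_integral => v _; rewrite /fubini_F /slice.
have Io : mu.-integrable `[0, ell[ (fun t => (phi (v, t))%:E).
 apply: integrableS (Iphi v) => //; try exact: measurable_itv.
 by apply: subset_itvl; rewrite bnd_simp.
rewrite -Rintegral_itv_bndo_bndc// EFinM.
rewrite /Rintegral fineK; last exact: integrable_fin_num.
rewrite -integralZl//; try exact: measurable_itv.
rewrite [RHS]integral_mkcond; apply: eq_integral => t _.
rewrite /strip patchE /= indicE; case: ifP => _; last by rewrite mulr0 mul0r.
by rewrite mulr1 EFinM.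
Qed.

Lemma line_window A k (f : R -> R) : continuous k -> continuous f ->
 \int[mu]_v (window A k v * f v) = \int[mu]_(v in `[- A, A]) (k v * f v).
Proof.
move=> ck cf; rewrite /Rintegral [in RHS]integral_mkcond; congr fine.
apply: eq_integral => v _; rewrite /window patchE indicE.
by case: ifP => _; rewrite ?mulr1// mulr0 mul0r.
Qed.

End Window.
End Strips.

(** For d = 1 / (2 T) and l <= 1/4 + T^2 the relative deviation l d^2 / 2 is at most 1/2, so the
    mean over [0, d] keeps at least half of c. *)
Lemma period_low {R : realType} (l c I T : R) : 0 < T -> `|(2 * T)^-1^-1 * I - c| <= l * `|c| / 2 * (2 * T)^-1 ^+ 2 ->
 1 <= T -> l <= 4^-1 + T ^+ 2 -> 4 * (2 * T)^-1 ^+ 2 * c ^+ 2 <= (4 * I) ^+ 2.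
Proof.
move=> T0 H T1 lT; pose d := (2 * T)^-1; have dT : d * T = 2^-1 by rewrite /d; field; rewrite gt_eqF.
rewrite -/d in H *; have d0 : 0 < d by rewrite invr_gt0 mulr_gt0.
have lb : l / 2 * d ^+ 2 <= 2^-1.
 have h1 : l * d ^+ 2 <= (4^-1 + T ^+ 2) * d ^+ 2 by rewrite ler_wpM2r// sqr_ge0.
 have h2 : T ^+ 2 * d ^+ 2 = 4^-1 by rewrite -exprMn (mulrC T) dT; field.
 have h3 : d ^+ 2 <= 1 by rewrite expr_le1// ?(ltW d0)//; move: dT d0 T1; nra.
 by move: h1 h2 h3; move: (T ^+ 2) (d ^+ 2) => a b; nra.
have H2 : `|d^-1 * I - c| <= `|c| / 2.
 by apply: (le_trans H); have := normr_ge0 c; move: lb; move: `|c| (d ^+ 2) => a b; nra.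
have H3 : `|c| / 2 <= `|d^-1 * I|.
 have := ler_normB (d^-1 * I) (d^-1 * I - c); rewrite opprB addrC subrK.
 by move: H2; move: `|c| `|_| `|_| => a b e'; lra.
have H4 : d * `|c| / 2 <= `|I|.
 have nd : `|d^-1| = d^-1 by rewrite ger0_norm// invr_ge0 ltW.
 by move: H3; rewrite normrM nd => H3; rewrite -mulrA -(@ler_pdivlMl _ d)//.
rewrite -[X in _ <= X]real_normK ?num_real// -[c ^+ 2]real_normK ?num_real// normrM (ger0_norm (x := 4))//.
rewrite (_ : 4 * d ^+ 2 * `|c| ^+ 2 = 4 ^+ 2 * (d * `|c| / 2) ^+ 2); last by field.
rewrite [leRHS]exprMn ler_wpM2l ?sqr_ge0// ler_sqr ?nnegrE//.
by rewrite divr_ge0// mulr_ge0// ltW.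
Qed.

Lemma cst1_ge0 {R : realType} (v : R) : 0 <= (fun=> 1 : R) v. Proof. by []. Qed.

(** * Tubes around the geodesic and the spectral expansion on it *)

Section SpectralIdentity.
Context {R : realType}.
Local Notation plane := (planeT R).
Local Notation mu := (leb R).
Local Notation L := (leb2 R).
Variables (G : set 'M[R]_2) (m : R).
Hypotheses (subG : psl2_subgroup G) (discG : discrete_subgroup G) (cocG : cocompact G).
Hypotheses (m1 : 1 < m) (Gm : G (hyp_mx m)).
Variable e : nat -> 'M[R]_2.
Hypothesis bij_e : set_bij [set: nat] G e.
Local Notation ell := (2 * ln m).

Let ell0 : 0 < ell. Proof. by rewrite mulr_gt0// ln_gt0. Qed.

Section Kernel.
Variables (A B : R) (k : R -> R).
Hypotheses (ck : continuous k) (k0 : forall v, 0 <= k v) (kB : forall v, `|v| <= A -> k v <= B) (B0 : 0 <= B).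

Definition tube : plane -> R := poincare e (strip m (window A k)).

Lemma tube_bound : exists2 M, 0 <= M & forall p, 0 <= tube p <= M.
Proof.
have [M [M0 HM _]] := poincare_bound subG discG cocG bij_e (strip_ge0 m (window_ge0 A k0)) B0
 (strip_window_le m1 kB B0).
by exists M.
Qed.

Lemma measurable_tube : mfun tube.
Proof.
apply: (measurable_poincare e); last exact: strip_ge0 _ (window_ge0 A k0).
by apply: measurable_strip; exact: measurable_window.
Qed.

Lemma tube_hact g p : G g -> tube (hact g p) = tube p.
Proof. by apply: poincare_hact => //; exact: strip_ge0 _ (window_ge0 A k0). Qed.

Lemma tube_slice_integrable v : mu.-integrable `[0, ell] (fun t => (tube (v, t))%:E).
Proof.
have [M M0 HM] := tube_bound.
apply: (@le_integrable _ _ _ mu _ (measurable_itv _) (fun t => (tube (v, t))%:E) (fun=> M%:E)).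
- apply: measurable_funTS; apply/measurable_EFinP.
 by apply: (measurableT_comp measurable_tube); exact: measurable_pair1.
- by move=> t _; have /andP[h1 h2] := HM (v, t); rewrite !abse_EFin lee_fin !ger0_norm.
- by apply: (@segint_itg _ _ _ (fun=> M)); apply: contW; ctn.
Qed.

End Kernel.

Section System.
Variables (F : set (R * R)) (u : nat -> R * R -> R) (lam : nat -> R).
Hypotheses (fundF : fundamental_set G F) (sysu : complete_orthonormal_system G F u).
Hypothesis eigu : forall j, eigenfunction G (lam j) (u j).
Local Notation F' := ((@hpt R) @^-1` F : set plane).

Let C2u j : C2 (u j). Proof. by case: (eigu j). Qed.
Let lapu j z : upper_half_plane z -> hyp_laplacian (u j) z = lam j * u j z.
Proof. by case: (eigu j) => _ _; apply. Qed.
Let peru j v t : u j (hpt (v, t + ell)) = u j (hpt (v, t)).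
Proof.
have [aut _ _] := eigu j; have m0 : 0 < m by exact: lt_trans m1.
have -> : hpt (v, t + ell) = mobius (hyp_mx m) (hpt (v, t)).
 by rewrite mobius_hpt ?hact_hyp_mx//; exact: psl2_det subG _ Gm.
by apply: aut => //; exact: hpt_gt0.
Qed.
Let mF' : measurable F'. Proof. exact: measurable_fund fundF. Qed.
Let fundF' p := fund_unique subG fundF p.

Definition period_fun j := even_period (u j) m.

Section Kernel.
Variables (A B : R) (k : R -> R).
Hypotheses (ck : continuous k) (k0 : forall v, 0 <= k v) (kB : forall v, `|v| <= A -> k v <= B) (B0 : 0 <= B).
Hypotheses (kN : forall v, k (- v) = k v) (A0 : 0 <= A).

Lemma tube_L2 : L2 L F' (tube A k).
Proof.
apply: (poincare_L2 subG discG cocG bij_e mF' fundF' _ _ B0 (strip_window_le m1 kB B0)).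
 by apply: measurable_strip; exact: measurable_window.
by exact: strip_ge0 _ (window_ge0 A k0).
Qed.

Lemma tube_ip (phi : plane -> R) : L2 L F' phi -> (forall g p, G g -> phi (hact g p) = phi p) ->
 (forall v, mu.-integrable `[0, ell] (fun t => (phi (v, t))%:E)) ->
 ip L F' (tube A k) phi = 2 * \int[mu]_v (window A k v * slice m phi v).
Proof.
move=> Lphi iphi Iphi.
have mK : mfun (strip m (window A k)) by apply: measurable_strip; exact: measurable_window.
have [If ->] := poincare_ip subG discG cocG bij_e mF' fundF' mK (strip_ge0 m (window_ge0 A k0)) B0
 (strip_window_le m1 kB B0) Lphi iphi.
by rewrite strip_integral.
Qed.

Lemma tube_ip_ue j : ip L F' (tube A k) (ue u j) = 4 * \int[mu]_(x in `[0, A]) (k x * period_fun j x).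
Proof.
have C0u : C0 (u j) by case: (C2u j) => -[].
rewrite tube_ip.
- rewrite (_ : (fun v => _) = (fun v => window A k v * hpt_int ell 0 (u j) v)); last first.
 apply/funext => v; congr (_ * _); rewrite /slice /hpt_int.
 by apply: segint_eq => t _; rewrite expr0 mul1r.
 have cU := cont_hpt_int m1 (C2u j) (@lapu j) (@peru j).
 rewrite line_window// (segint_even_period m1 (C2u j) (@lapu j) (@peru j))// mulrA.
 by congr (_ * _); lra.
- exact: ue_L2 fundF sysu j.
- by move=> g p; exact: (ue_hact subG sysu).
- move=> v; apply: (@segint_itg _ _ _ (fun t => ue u j (v, t))); apply: contW.
 by apply: (cont2_snd (f := ue u j)); exact: cont_comp_hpt.
Qed.

End Kernel.

Hypothesis lam0 : forall j, 0 <= lam j.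

Lemma is_derive_period_fun j (x : R) : is_derive x (1 : R) (period_fun j) (even_flux (u j) m x / (1 + x ^+ 2)).
Proof. exact: (is_derive_even_period m1 (C2u j) (@lapu j) (@peru j)). Qed.
Lemma is_derive_period_flux j (x : R) : is_derive x (1 : R) (even_flux (u j) m) (- lam j * period_fun j x).
Proof. exact: (is_derive_even_flux m1 (C2u j) (@lapu j) (@peru j)). Qed.
Let P0 j : even_flux (u j) m 0 = 0. Proof. exact: even_flux0. Qed.
Let one_le (A : R) (v : R) : `|v| <= A -> (1 : R) <= 1. Proof. by []. Qed.
Local Notation tube1 d := (tube d (fun=> 1)).
Local Notation strip1 d := (strip m (window d (fun=> 1))).

(** The tube grows with its width, so the bound at width 1 serves all smaller widths; this
    uniformity is what [period_sum] rests on. *)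
Lemma tube1_bound : exists2 M, 0 <= M & forall d, d <= 1 -> forall p, 0 <= tube1 d p <= M.
Proof.
have [M [M0 HM HE]] := poincare_bound subG discG cocG bij_e (strip_ge0 m (window_ge0 1 (@cst1_ge0 R))) ler01
 (strip_window_le m1 (@one_le 1) ler01).
exists M => // d d1 p.
have [N [_ HN HNE]] := poincare_bound subG discG cocG bij_e (strip_ge0 m (window_ge0 d (@cst1_ge0 R))) ler01
 (strip_window_le m1 (@one_le d) ler01).
have /andP[-> _] := HN p; have /andP[_ h] := HM p; apply: le_trans h.
rewrite -lee_fin /tube -(HE p) -(HNE p); apply: lee_nneseries => [n _ _|n _]; first by rewrite lee_fin strip_ge0// => v; exact: window_ge0.
rewrite lee_fin /strip ler_wpM2r ?indicE// /window !mul1r !indicE.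
case: (boolP ((hact (e n) p).1 \in `[- d, d]%classic)) => [|//]; rewrite inE/= in_itv/= => /andP[h1 h2].
by rewrite mem_set//= in_itv/= (le_trans _ h1) ?lerN2// (le_trans h2).
Qed.

(** Bessel's inequality for the tube of width d = 1 / (2 T): each relevant coefficient squared is at
    least 4 d^2 times the squared period, while the squared norm of the tube is O(d), because the
    tube is bounded uniformly in d. *)
Lemma period_sum : exists2 C, 0 <= C & forall n T, 1 <= T ->
 \sum_(j < n | lam j <= 4^-1 + T ^+ 2) period_fun j 0 ^+ 2 <= C * T.
Proof.
have [M M0 HM] := tube1_bound; exists (2 * ell * M) => [|n T T1]; first by rewrite mulr_ge0// mulr_ge0// ltW.
have T0 : 0 < T := lt_le_trans ltr01 T1.
pose d := (2 * T)^-1; have d0 : 0 < d by rewrite invr_gt0 mulr_gt0.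
have d1 : d <= 1 by rewrite invf_le1 ?mulr_gt0//; lra.
have ck : continuous (fun _ : R => 1 : R) by ctn.
have mK : mfun (strip1 d) by apply: measurable_strip; exact: measurable_window.
have LM : L2 L F' (fun=> M) by apply: (L2_bounded subG discG cocG bij_e mF' fundF' (M := M)) => // p; rewrite ger0_norm.
have LT := tube_L2 ck (@cst1_ge0 R) (@one_le d) ler01.
have iT g p : G g -> tube1 d (hact g p) = tube1 d p by move=> Gg; exact: tube_hact.
have [I1 E1] := poincare_ip subG discG cocG bij_e mF' fundF' mK (strip_ge0 m (window_ge0 d (@cst1_ge0 R))) ler01
 (strip_window_le m1 (@one_le d) ler01) LT iT.
have [I2 _] := poincare_ip subG discG cocG bij_e mF' fundF' mK (strip_ge0 m (window_ge0 d (@cst1_ge0 R))) ler01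
 (strip_window_le m1 (@one_le d) ler01) LM (fun _ _ _ => erefl).
have bes := bessel mF' (ue_L2 fundF sysu) (ue_orthonormal fundF sysu) n LT.
have up : ip L F' (tube1 d) (tube1 d) <= 4 * d * ell * M.
 rewrite [X in X <= _]E1 (_ : 4 * d * ell * M = 2 * (2 * d * ell * M)); last by ring.
 rewrite ler_wpM2l//; apply: (@le_trans _ _ (\int[L]_p (strip1 d p * M))).
 apply: le_Rintegral => // p _; rewrite ler_wpM2l ?strip_ge0// => [v|]; first exact: window_ge0.
 by have /andP[] := HM d d1 p.
 have Ic (v : R) : mu.-integrable `[0, ell] (fun t => M%:E).
 by apply: (@segint_itg _ _ _ (fun=> M)); apply: contW; ctn.
 have sl v : slice m (fun=> M) v = M * ell by rewrite /slice segint_cst ?subr0// ltW.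
 rewrite (strip_integral I2 Ic); under eq_Rintegral => v _ do rewrite sl.
 rewrite (@line_window _ d (fun=> 1) (fun=> M * ell))//; last by ctn.
 rewrite mul1r segint_cst; last by rewrite (le_trans _ (ltW d0))// oppr_le0 ltW.
 by apply: eq_ler; ring.
have low j : lam j <= 4^-1 + T ^+ 2 -> 4 * d ^+ 2 * period_fun j 0 ^+ 2 <= ip L F' (tube1 d) (ue u j) ^+ 2.
 move=> lj; rewrite (tube_ip_ue ck (@cst1_ge0 R) (@one_le d) ler01)//; last exact: ltW.
 move: lj; have := segint_near (is_derive_period_fun j) (is_derive_period_flux j) (P0 j) (lam0 j) d0.
 under [X in _ -> _ <= (_ * X) ^+ 2]eq_Rintegral do rewrite mul1r.
 move: (\int[mu]_(x in _) _) (period_fun j 0) => I c H lj.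
 exact: (period_low T0 H T1 lj).
have : 4 * d ^+ 2 * \sum_(j < n | lam j <= 4^-1 + T ^+ 2) period_fun j 0 ^+ 2 <= 4 * d * ell * M.
 apply: le_trans up; apply: le_trans bes; rewrite mulr_sumr big_mkcond; apply: ler_sum => j _.
 by case: ifP => [/low//|_]; exact: sqr_ge0.
have -> : 4 * d * ell * M = 4 * d ^+ 2 * (2 * ell * M * T) by rewrite /d; field; rewrite gt_eqF.
by rewrite ler_pM2l// mulr_gt0// exprn_gt0.
Qed.

(** Parseval between the tube of width d and the tube of [k]: the coefficients are 4 times an
    integral over [0, d] and over [0, A], and the inner product is twice the integral of [S] over
    [- d, d]. Dividing by 16 d and letting d tend to 0 gives S(0) / 4; the assumed bound on absolute
    sums allows the limit to be taken term by term. *)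
Lemma tube_spectral_series (A B : R) (k S : R -> R) : continuous k -> (forall v, 0 <= k v) ->
 (forall v, `|v| <= A -> k v <= B) -> 0 <= B -> (forall v, k (- v) = k v) -> 0 <= A ->
 continuous S -> (forall v, `|v| <= 1 -> slice m (tube A k) v = S v) ->
 (exists Bd, forall n, \sum_(j < n)
 `|period_fun j 0 * \int[mu]_(x in `[0, A]) (k x * period_fun j x)| <= Bd) ->
 series (fun j => period_fun j 0 * \int[mu]_(x in `[0, A]) (k x * period_fun j x)) n @[n --> \oo] --> S 0 / 4.
Proof.
move=> ck k0 kB B0 kN A0 cS SE [Bd HBd].
set b := fun j => \int[mu]_(x in `[0, A]) (k x * period_fun j x).
pose c j := period_fun j 0.
have K1 : continuous (fun _ : R => 1 : R) by ctn.
pose a d j := d^-1 * \int[mu]_(x in `[0, d]) period_fun j x.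
have par d : 0 < d <= 1 -> series (fun j => a d j * b j) n @[n --> \oo] --> (8 * d)^-1 * \int[mu]_(v in `[- d, d]) S v.
 move=> /andP[d0 d1]; have d0' := ltW d0.
 have LT := tube_L2 K1 (@cst1_ge0 R) (@one_le d) ler01.
 have LA := tube_L2 ck k0 kB B0.
 have iT : invariant_fun (orbit_eqv G) (tube d (fun=> 1)) by move=> p q [g Gg ->]; rewrite tube_hact.
 have := parseval mF' (ue_L2 fundF sysu) (ue_orthonormal fundF sysu) (ue_invariant subG sysu) (ue_complete subG fundF sysu) LT iT LA.
 rewrite (tube_ip K1 (@cst1_ge0 R) (@one_le d) ler01 LA); last 2 first.
 - by move=> g p Gg; exact: tube_hact.
 - by move=> v; exact: tube_slice_integrable ck k0 kB B0 v.
 have -> : \int[mu]_v (window d (fun=> 1) v * slice m (tube A k) v) = \int[mu]_(v in `[- d, d]) S v.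
 rewrite /Rintegral [in RHS]integral_mkcond; congr fine.
 apply: eq_integral => v _; rewrite /window patchE indicE mul1r.
 case: ifP => [|_]; last by rewrite mul0r.
 by rewrite inE/= in_itv/= -ler_norml => vd; rewrite mul1r SE// (le_trans vd).
 have -> : (fun j => ip L F' (tube d (fun=> 1)) (ue u j) * ip L F' (tube A k) (ue u j)) =
 (fun j => (16 * d) * (a d j * b j)).
 apply/funext => j; rewrite (tube_ip_ue K1 (@cst1_ge0 R) (@one_le d) ler01)// (tube_ip_ue ck k0 kB B0)//.
 rewrite /a /b; under [X in 4 * X * _ = _]eq_Rintegral do rewrite mul1r.
 by move: (\int[mu]_(x in _) _) (\int[mu]_(x in _) _) => I J; field; rewrite gt_eqF.
 move=> H; have : (16 * d)^-1 * series (fun j => 16 * d * (a d j * b j)) n @[n --> \oo] -->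
 (16 * d)^-1 * (2 * \int[mu]_(v in `[- d, d]) S v) by exact: cvgM (cvg_cst _) H.
 have -> : (16 * d)^-1 * (2 * \int[mu]_(v in `[- d, d]) S v) = (8 * d)^-1 * \int[mu]_(v in `[- d, d]) S v.
 by move: (\int[mu]_(x in _) _) => I; field; rewrite gt_eqF.
 have -> // : (fun n => (16 * d)^-1 * series (fun j => 16 * d * (a d j * b j)) n) = series (fun j => a d j * b j).
 apply/funext => n; rewrite !seriesEnat /= -mulr_sumr mulrA mulVf ?mul1r//.
 by rewrite gt_eqF// mulr_gt0.
have cvg_abs : cvgn (series (fun j => `|c j * b j|)).
 apply: nondecreasing_is_cvgn; first by apply: nondecreasing_series.
 by exists Bd => _ [n _ <-]; rewrite seriesEnat/= big_mkord; exact: HBd.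
have cvg_s : cvgn (series (fun j => c j * b j)) by exact: normed_cvg cvg_abs.
suff -> : S 0 / 4 = limn (series (fun j => c j * b j)) by exact: cvg_s.
apply/eqP; rewrite -subr_eq0 -normr_le0; apply/ler_addgt0Pl => eps eps0; rewrite addr0.
set sg := limn (series (fun j => c j * b j)).
have e4 : 0 < eps / 4 by rewrite divr_gt0.
have [N _ HN] : exists2 N, True & forall n, (N <= n)%N -> \sum_(N <= j < n) `|c j * b j| <= eps / 4.
 have := cvg_abs; rewrite -cauchy_cvgP => /cauchy_ballP/(_ _ e4) => -[[P Q]] /= [[N1 _ H1] [N2 _ H2]] H.
 exists (maxn N1 N2) => // n Nn.
 have /= := H (series (fun j => `|c j * b j|) n, series (fun j => `|c j * b j|) (maxn N1 N2)) (conj (H1 n (leq_trans (leq_maxl _ _) Nn)) (H2 _ (leq_maxr _ _))).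
 by rewrite /ball/= seriesEnat/=; rewrite (@big_cat_nat _ _ _ (maxn N1 N2) 0 n)//= addrAC subrr add0r ger0_norm ?sumr_ge0// => /ltW.
pose Q := \sum_(j < N) (lam j * `|c j| / 2 * `|b j|).
have Q0 : 0 <= Q by apply: sumr_ge0 => j _; rewrite !mulr_ge0.
have adiff d j : 0 < d -> `|a d j - c j| <= lam j * `|c j| / 2 * d ^+ 2 by move=> d0; exact: (segint_near (is_derive_period_fun j) (is_derive_period_flux j) (P0 j) (lam0 j) d0).
have ale d j : 0 < d -> `|a d j| <= `|c j|.
 move=> d0; have nd : `|d^-1| = d^-1 by rewrite ger0_norm// invr_ge0 ltW.
 rewrite /a normrM nd ler_pdivrMl// mulrC.
 rewrite -[leRHS](_ : \int[mu]_(x in `[0, d]) (`|c j|) = _); last by rewrite segint_cst ?subr0// ltW.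
 apply: segint_norm_le; [by apply: contW; exact: cont_V (is_derive_period_fun j)|by apply: contW; ctn|].
 by move=> x /andP[x0 _]; exact: (even_solution_le (is_derive_period_fun j) (is_derive_period_flux j) (P0 j)).
(* In the head each mean differs from the value at 0 by O(d^2). In the tail the means are bounded by
   those values, so the difference is at most twice the absolute tail. *)
have part d n : 0 < d -> (N <= n)%N ->
 `|series (fun j => a d j * b j) n - series (fun j => c j * b j) n| <= d ^+ 2 * Q + eps / 2.
 move=> d0 Nn; rewrite !seriesEnat /= -sumrB (@big_cat_nat _ _ _ N 0 n)//=.
 apply: (le_trans (ler_normD _ _)); apply: lerD.
 rewrite big_mkord; apply: (le_trans (ler_norm_sum _ _ _)); rewrite mulr_sumr; apply: ler_sum => j _.
 rewrite -mulrBl normrM mulrA ler_wpM2r// mulrC; exact: adiff.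
 apply: (le_trans (ler_norm_sum _ _ _)).
 apply: (@le_trans _ _ (2 * \sum_(N <= j < n) `|c j * b j|)); last by have := HN n Nn; lra.
 rewrite mulr_sumr; apply: ler_sum => j _; rewrite -mulrBl (normrM (a d j - c j)) (normrM (c j)) mulrA ler_wpM2r//.
 by apply: (le_trans (ler_normB _ _)); rewrite mulr_natl mulr2n lerD2r; exact: ale.
have lims d : 0 < d <= 1 -> `|(8 * d)^-1 * \int[mu]_(v in `[- d, d]) S v - sg| <= d ^+ 2 * Q + eps / 2.
 move=> /andP[d0 d1]; have := par d; rewrite d0 d1 => /(_ isT) H1.
 have H2 : `|series (fun j => a d j * b j) n - series (fun j => c j * b j) n| @[n --> \oo] -->
 `|(8 * d)^-1 * \int[mu]_(v in `[- d, d]) S v - sg| by exact: cvg_norm (cvgB H1 cvg_s).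
 rewrite -(cvg_lim _ H2)//; apply: limr_le; first by apply/cvg_ex; eexists; exact: H2.
 by exists N => // n /= Nn; exact: part.
have [d1 d10 Hd1] : exists2 d1, 0 < d1 & forall v, `|v| <= d1 -> `|S v - S 0| <= eps / 4.
 have /cvgrPdist_le/(_ _ e4) := cS 0; rewrite /= => /nbhs_ballP[r /= r0 Hr].
 exists (r / 2) => [|v vr]; first by rewrite divr_gt0.
 rewrite distrC; apply: Hr; rewrite /ball/= sub0r normrN (le_lt_trans vr)//.
 by rewrite ltr_pdivrMr// mulr_natr mulr2n ltrDl.
pose d := Num.min (Num.min d1 1) (eps / (4 * (Q + eps))).
have Qe : 0 < Q + eps by rewrite ltr_wpDl.
have d0 : 0 < d by rewrite !lt_min d10 ltr01/= divr_gt0// mulr_gt0.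
have dd1 : d <= d1 by rewrite !ge_min lexx.
have dle1 : d <= 1 by rewrite !ge_min lexx orbT.
have dQ : d * (4 * (Q + eps)) <= eps by rewrite -ler_pdivlMr ?mulr_gt0// !ge_min lexx orbT.
have Sd : `|(8 * d)^-1 * \int[mu]_(v in `[- d, d]) S v - S 0 / 4| <= eps / 16.
 have dd : - d <= d by rewrite (le_trans _ (ltW d0))// oppr_le0 ltW.
 have -> : (8 * d)^-1 * \int[mu]_(v in `[- d, d]) S v - S 0 / 4 = (8 * d)^-1 * \int[mu]_(v in `[- d, d]) (S v - S 0).
 rewrite (@segintB _ _ _ S (fun=> S 0)) ?segint_cst//; try by apply: contW; ctn.
 by move: (\int[mu]_(x in _) _) => I; field; rewrite gt_eqF.
 have nd : `|(8 * d)^-1| = (8 * d)^-1 by rewrite ger0_norm// invr_ge0 mulr_ge0// ltW.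
 rewrite normrM nd ler_pdivrMl ?mulr_gt0//.
 apply: (@le_trans _ _ (\int[mu]_(v in `[- d, d]) (eps / 4))); last first.
 by rewrite segint_cst//; apply: eq_ler; field.
 apply: segint_norm_le; try by apply: contW; ctn.
 by move=> v; rewrite -ler_norml => vd; apply: Hd1; exact: le_trans vd dd1.
have h1 : `|(8 * d)^-1 * \int[mu]_(v in `[- d, d]) S v - sg| <= d ^+ 2 * Q + eps / 2 by apply: lims; rewrite d0 dle1.
have h2 : d ^+ 2 * Q <= eps / 4.
 apply: (@le_trans _ _ (d * (Q + eps))); last by rewrite ler_pdivlMr// -mulrA (mulrC _ 4).
 by rewrite expr2 -mulrA ler_pM2l// (le_trans (ler_piMl Q0 dle1))// lerDl ltW.
move: h1 Sd; move: (_ * _) => I h1 h3.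
have := ler_normB (I - sg) (I - S 0 / 4).
rewrite (_ : I - sg - (I - S 0 / 4) = S 0 / 4 - sg); last by ring.
move: h1 h2 h3; move: `|_| `|_| `|_| (d ^+ 2 * Q) => x y z w h1 h2 h3 h4; lra.
Qed.

End System.
End SpectralIdentity.

(** * The stabilizer of the axis and the entries of the remaining group elements *)

Section HyperbolicSubgroup.
Context {R : realType}.
Variables (G : set 'M[R]_2) (m : R).
Hypotheses (subG : psl2_subgroup G) (discG : discrete_subgroup G).
Hypotheses (m1 : 1 < m) (stabG : axis_stabilizer G = hyperbolic_subgroup m).

Let m0 : 0 < m. Proof. exact: lt_trans m1. Qed.
Let mN0 : m != 0. Proof. by rewrite gt_eqF. Qed.

Definition mx2 (a b c d : R) : 'M[R]_2 := \matrix_(i, j)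
 (if i == 0 then (if j == 0 then a else b) else (if j == 0 then c else d)).

Lemma mx2E a b c d : [/\ mx2 a b c d 0 0 = a, mx2 a b c d 0 1 = b, mx2 a b c d 1 0 = c & mx2 a b c d 1 1 = d].
Proof. by split; rewrite mxE. Qed.

Definition hk (k : int) : 'M[R]_2 := mx2 (m ^ k) 0 0 (m ^ (- k)).

Lemma hkE k : [/\ hk k 0 0 = m ^ k, hk k 0 1 = 0, hk k 1 0 = 0 & hk k 1 1 = m ^ (- k)].
Proof. exact: mx2E. Qed.

Lemma hk_mul i (g : 'M[R]_2) j : [/\ (hk i *m g *m hk j) 0 0 = m ^ (i + j) * g 0 0,
 (hk i *m g *m hk j) 0 1 = m ^ (i - j) * g 0 1, (hk i *m g *m hk j) 1 0 = m ^ (j - i) * g 1 0 &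
 (hk i *m g *m hk j) 1 1 = m ^ (- (i + j)) * g 1 1].
Proof.
have [a1 a2 a3 a4] := hkE i; have [b1 b2 b3 b4] := hkE j.
split; rewrite !mulmx2E ?a1 ?a2 ?a3 ?a4 ?b1 ?b2 ?b3 ?b4 ?opprD !expfzDr//; ring.
Qed.

Lemma hkD i j : hk i *m hk j = hk (i + j).
Proof.
have [a1 a2 a3 a4] := hkE i; have [b1 b2 b3 b4] := hkE j; have [c1 c2 c3 c4] := hkE (i + j).
by apply: mx2P; rewrite !mulmx2E ?a1 ?a2 ?a3 ?a4 ?b1 ?b2 ?b3 ?b4 ?c1 ?c2 ?c3 ?c4 ?opprD ?expfzDr//; ring.
Qed.

Lemma hk0 : hk 0 = 1%:M.
Proof. by have [a1 a2 a3 a4] := hkE 0; apply: mx2P; rewrite ?a1 ?a2 ?a3 ?a4 ?oppr0 ?expr0z !mxE. Qed.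

Lemma hk_exp k : hyp_mx m ^ k = hk k.
Proof.
have h1 : hyp_mx m = hk 1.
 have [a1 a2 a3 a4] := hkE 1; have [b1 b2 b3 b4] := hyp_mxE m.
 by apply: mx2P; rewrite ?a1 ?a2 ?a3 ?a4 ?b1 ?b2 ?b3 ?b4 ?expr1z ?exprN1.
have hn (n : nat) : hyp_mx m ^+ n = hk n.
 elim: n => [|n IH]; first by rewrite expr0 hk0.
 by rewrite exprS IH h1 [LHS](hkD 1 n) -intS.
case: k => n; first exact: hn.
rewrite NegzE -[LHS]/((hyp_mx m ^+ n.+1)^-1) hn.
have e1 : hk n.+1 * hk (- (n.+1)%:Z) = 1 by rewrite [LHS]hkD subrr hk0.
have e2 : hk (- (n.+1)%:Z) * hk n.+1 = 1 by rewrite [LHS]hkD addNr hk0.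
have U : hk n.+1 \is a GRing.unit by apply/unitrP; exists (hk (- (n.+1)%:Z)).
by apply: (mulrI U); rewrite mulrV// e1.
Qed.

Lemma hyperbolic_subgroupE (g : 'M[R]_2) : hyperbolic_subgroup m g <-> exists k, g = hk k \/ g = - hk k.
Proof.
by rewrite /hyperbolic_subgroup/=; split => -[k H]; exists k; rewrite -/(hyp_mx m) hk_exp in H *.
Qed.

Lemma hyperbolic_sub g : hyperbolic_subgroup m g -> G g.
Proof. by rewrite -stabG => -[]. Qed.

Lemma Ghk k : G (hk k).
Proof. by apply: hyperbolic_sub; apply/hyperbolic_subgroupE; exists k; left. Qed.

Lemma hyp_mx_hk : hyp_mx m = hk 1. Proof. by rewrite -hk_exp expr1z. Qed.

Lemma hact_hk k p : hact (hk k) p = (p.1, p.2 + k%:~R * (2 * ln m)).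
Proof.
have [h00 h01 h10 h11] := hkE k.
rewrite /hact /mobius_q h00 h01 h10 h11 !mul0r !mulr0 !mul0r !add0r expr0n/= ?mulr0 ?addr0.
have mk0 : 0 < m ^ k by rewrite exprz_gt0.
rewrite -invr_expz mulfV ?gt_eqF// mul1r lnXn ?invr_gt0// lnV ?posrE// mulNrn opprK.
congr (_, _ + _); have -> : ln (m ^ k) = k%:~R * ln m; last by rewrite mulr2n; ring.
case: (k) => n; first by rewrite lnXn// -mulr_natl.
rewrite NegzE -invr_expz lnV ?posrE ?exprz_gt0// [in ln _]/exprz lnXn// mulrNz mulNr.
by rewrite -mulr_natl.
Qed.

Lemma infinite_bounded (g : nat -> 'M[R]_2) (M : R) : (forall n, G (g n)) -> injective g ->
 (forall n i j, `|g n i j| <= M) -> False.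
Proof.
move=> Gg injg gM; have fin := finite_bounded subG discG M.
apply: infinite_nat; apply: (finite_set_injective_image (f := g) (B := [set g | G g /\ forall i j, `|g i j| <= M])) => //.
- by move=> x y _ _; exact: injg.
- by move=> _ [n _ <-]; split.
Qed.
Let Mbd (g : 'M[R]_2) := `|g 0 0| + `|g 0 1| + `|g 1 0| + `|g 1 1|.

Let small (k : int) (a M : R) : (k <= 0) -> `|a| <= M -> `|m ^ k * a| <= M.
Proof.
move=> k0 aM; apply: le_trans aM; rewrite normrM ler_piMl// ger0_norm ?exprz_ge0 ?(ltW m0)//.
by have := ler_weXz2l (ltW m1) k0; rewrite expr0z.
Qed.

Lemma diag_stable (g : 'M[R]_2) : G g -> g 0 1 = 0 -> g 1 0 = 0 -> hyperbolic_subgroup m g.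
Proof.
move=> Gg b0 c0; rewrite -stabG; split => //.
have := psl2_det subG Gg; rewrite det_mx2 b0 mul0r subr0 => ad.
have d0 : g 1 1 != 0 by apply/eqP => d0; move: ad; rewrite d0 mulr0 => /eqP; rewrite eq_sym oner_eq0.
have mob y : mobius g (0, y) = (0, g 0 0 ^+ 2 * y).
 rewrite /mobius b0 c0 /=; have -> : g 1 1 = (g 0 0)^-1 by rewrite -[LHS](mulKf (x := g 0 0)) ?ad ?mulr1//; apply/eqP => a0; move: ad; rewrite a0 mul0r => /eqP; rewrite eq_sym oner_eq0.
 have a0 : g 0 0 != 0 by apply/eqP => a0; move: ad; rewrite a0 mul0r => /eqP; rewrite eq_sym oner_eq0.
 by simpc; rewrite /= ?(mulr0, mul0r, addr0, oppr0, add0r, expr0n, sub0r) /=; congr (_, _); field.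
have a20 : 0 < g 0 0 ^+ 2.
 by rewrite exprn_even_gt0//=; apply/eqP => a0; move: ad; rewrite a0 mul0r => /eqP; rewrite eq_sym oner_eq0.
apply/seteqP; split => [_ [[x y] [/= x0 y0] <-]|[x y] [/= x0 y0]]; rewrite x0.
 by rewrite mob; split => //=; rewrite mulr_gt0.
exists (0, (g 0 0 ^+ 2)^-1 * y); first by split => //=; rewrite mulr_gt0// invr_gt0.
by rewrite mob mulrA mulfV ?mul1r// gt_eqF.
Qed.

(** An antidiagonal element reverses the axis, so it would belong to the stabilizer, all of whose
    elements are diagonal. *)
Lemma antidiag_not (g : 'M[R]_2) : G g -> g 0 0 = 0 -> g 1 1 = 0 -> False.
Proof.
move=> Gg a0 d0.
have := psl2_det subG Gg; rewrite det_mx2 a0 mul0r sub0r => bc.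
have b0 : g 0 1 != 0 by apply/eqP => b0; move: bc; rewrite b0 mul0r oppr0 => /eqP; rewrite eq_sym oner_eq0.
have cE : g 1 0 = - (g 0 1)^-1 by apply: (mulfI b0); rewrite mulrN mulfV// -bc opprK.
have mob y : 0 < y -> mobius g (0, y) = (0, g 0 1 ^+ 2 / y).
 move=> y0; have yN : y != 0 by rewrite gt_eqF.
 rewrite /mobius a0 d0 cE /=; simpc.
 by rewrite /= ?(mulr0, mul0r, addr0, oppr0, add0r, expr0n, sub0r) /=; congr (_, _); field; rewrite ?b0 ?yN.
have b20 : 0 < g 0 1 ^+ 2 by rewrite exprn_even_gt0.
have : hyperbolic_subgroup m g.
 rewrite -stabG; split => //; apply/seteqP; split => [_ [[x y] [/= x0 y0] <-]|[x y] [/= x0 y0]]; rewrite x0.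
 by rewrite mob//; split => //=; rewrite divr_gt0.
 exists (0, g 0 1 ^+ 2 / y); first by split => //=; rewrite divr_gt0.
 by rewrite mob ?divr_gt0// invf_div mulrCA mulfV ?mulr1// gt_eqF.
move=> /hyperbolic_subgroupE[k [gE|gE]]; have [hk00 _ _ _] := hkE k; move: a0; rewrite gE ?[(- hk k) 0 0]mxE hk00 => /eqP.
 by rewrite gt_eqF// exprz_gt0.
by rewrite oppr_eq0 gt_eqF// exprz_gt0.
Qed.
(** The elements h^(s n) g h^(t n) have entries scaled by powers of m. If no non-zero entry grows
    and at least one non-zero entry changes with n, this is an infinite bounded family, against
    discreteness. *)
Let conj_family (g : 'M[R]_2) (s t : int) : G g ->
 (s + t <= 0 \/ g 0 0 = 0) -> (s - t <= 0 \/ g 0 1 = 0) -> (t - s <= 0 \/ g 1 0 = 0) -> (- (s + t) <= 0 \/ g 1 1 = 0) ->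
 [\/ s + t != 0 /\ g 0 0 != 0, s - t != 0 /\ g 0 1 != 0, t - s != 0 /\ g 1 0 != 0 | s + t != 0 /\ g 1 1 != 0] -> False.
Proof.
move=> Gg h00 h01 h10 h11 inj.
pose f (n : nat) := hk (s * n%:Z) *m g *m hk (t * n%:Z).
have le00 : `|g 0 0| <= Mbd g by rewrite /Mbd -!addrA lerDl !addr_ge0.
have le01 : `|g 0 1| <= Mbd g by rewrite /Mbd (addrC `|g 0 0|) -!addrA lerDl !addr_ge0.
have le10 : `|g 1 0| <= Mbd g by rewrite /Mbd addrAC lerDr !addr_ge0.
have le11 : `|g 1 1| <= Mbd g by rewrite /Mbd lerDr !addr_ge0.
have M0 : 0 <= Mbd g by rewrite !addr_ge0.
have sm (w : int) (x : R) (n : nat) : (w <= 0 \/ x = 0) -> `|x| <= Mbd g -> `|m ^ (w * n%:Z) * x| <= Mbd g.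
 case=> [w0|->]; last by rewrite mulr0 normr0.
 by apply: small; rewrite mulr_le0_ge0.
have fE n := hk_mul (s * n%:Z) g (t * n%:Z).
apply: (@infinite_bounded f (Mbd g)) => [n|n p fnp|n].
- by apply: psl2M => //; [apply: psl2M => //|]; exact: Ghk.
- have key (w : int) (x : R) : w != 0 /\ x != 0 -> m ^ (w * n%:Z) * x = m ^ (w * p%:Z) * x -> n = p.
 move=> [w0 x0] /(mulIf x0)/(ieexprIz m0 (negbT (gt_eqF m1)))/(mulfI w0)[e]; exact: e.
 have [e1 e2 e3 e4] := fE n; have [d1 d2 d3 d4] := fE p; move: e1 e2 e3 e4; rewrite -/(f n) fnp /f d1 d2 d3 d4.
 rewrite -!mulrDl -!mulrBl -!mulNr => e1 e2 e3 e4.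
 case: inj => H; [exact: key H (esym e1)|exact: key H (esym e2)|exact: key H (esym e3)|].
 apply: (key (- (s + t)) (g 1 1) _ (esym e4)); by rewrite oppr_eq0.
- have [e1 e2 e3 e4] := fE n; apply: ord2P; apply: ord2P; rewrite /f ?e1 ?e2 ?e3 ?e4 -?mulrDl -?mulrBl -?mulNr; exact: sm.
Qed.

(** No element outside the stabilizer maps an endpoint of the axis to an endpoint. A single zero
    entry allows a bounded infinite family, so zeros come in pairs: a diagonal element lies in the
    stabilizer, and an antidiagonal one is excluded. *)
Lemma entries_neq0 (g : 'M[R]_2) : G g -> ~ hyperbolic_subgroup m g ->
 [/\ g 0 0 != 0, g 0 1 != 0, g 1 0 != 0 & g 1 1 != 0].
Proof.
move=> Gg nH.
have bc : g 0 1 = 0 -> g 1 0 = 0.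
 move=> b0; apply/eqP/negPn/negP => c0.
 by apply: (conj_family (s := 1) (t := -1) Gg); [left|right|left|left|apply: Or43].
have cb : g 1 0 = 0 -> g 0 1 = 0.
 move=> c0; apply/eqP/negPn/negP => b0.
 by apply: (conj_family (s := -1) (t := 1) Gg); [left|left|right|left|apply: Or42].
have ad : g 0 0 = 0 -> g 1 1 = 0.
 move=> a0; apply/eqP/negPn/negP => d0.
 by apply: (conj_family (s := 1) (t := 1) Gg); [right|left|left|left|apply: Or44].
have da : g 1 1 = 0 -> g 0 0 = 0.
 move=> d0; apply/eqP/negPn/negP => a0.
 by apply: (conj_family (s := -1) (t := -1) Gg); [left|left|left|right|apply: Or41].
split; apply/eqP => e0.
- exact: (antidiag_not Gg e0 (ad e0)).
- exact: nH (diag_stable Gg e0 (bc e0)).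
- exact: nH (diag_stable Gg (cb e0) e0).
- exact: (antidiag_not Gg (da e0) e0).
Qed.

End HyperbolicSubgroup.

HB.instance Definition _ := isPointed.Build int 0.

(** * Sums over integer translates *)

Section Tiles.
Context {R : realType}.
Local Notation mu := (leb R).

Lemma bool_sign (b b' : bool) : (-1) ^+ nat_of_bool b = (-1) ^+ nat_of_bool b' :> R -> b = b'.
Proof. by case: b; case: b' => //; rewrite ?expr1 ?expr0; lra. Qed.

Lemma int_enum : exists q : nat -> int, set_bij [set: nat] [set: int] q.
Proof.
have inf : infinite_set [set: int].
 move=> fin; apply: infinite_nat; apply: (finite_set_injective_image (f := Posz) (B := setT)) => //.
 by move=> x y _ _ [].
have cnt : countable [set: int] by exact: countableP.
have H : ([set: nat] #= [set: int])%card by rewrite card_eq_sym; exact: eq_card_nat.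
by have [q Hq] := card_set_bijP H; exists q.
Qed.

Lemma esum_bool (F : bool -> \bar R) : (forall b, (0 <= F b)%E) ->
 (\esum_(b in [set: bool]) F b = F true + F false)%E.
Proof.
move=> F0; have -> : [set: bool] = [set true] `|` [set false].
 by apply/seteqP; split => [[] _|//]; [left|right].
rewrite esum_fset// fsbigU0//= ?fsbig_set1//.
by move=> b [->].
Qed.

Lemma esum_single (T : choiceType) (i0 : T) (F : T -> \bar R) : (0 <= F i0)%E -> (forall i, i <> i0 -> F i = 0%E) ->
 (\esum_(i in [set: T]) F i = F i0)%E.
Proof.
move=> F0 Fz; rewrite -(esum_set1 F0) [RHS]esum_mkcond; apply: eq_esum => i _.
case: ifPn; first by rewrite inE => ->.
by move=> /negP H; apply: Fz => e; apply: H; rewrite inE e.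
Qed.

(** Exactly one translate of x falls into [0, ell[, the one given by the floor of x / ell; the sign
    [s] allows both directions of summation. *)
Lemma esum_translate (ell x : R) (s : int) (c : \bar R) : 0 < ell -> s = 1 \/ s = -1 -> (0 <= c)%E ->
 (\esum_(i in [set: int]) (c * (\1_(`[0, ell[%classic) (x + (s * i)%:~R * ell) : R)%:E) = c)%E.
Proof.
move=> ell0 s1 c0; have ss : s * s = 1 by case: s1 => ->.
pose i0 := - (s * Num.floor (x / ell)).
have key i : (x + (s * i)%:~R * ell \in `[0, ell[) = (i == i0).
 have -> : (x + (s * i)%:~R * ell \in `[0, ell[) = ((- (s * i))%:~R <= x / ell < (- (s * i) + 1)%:~R).
 rewrite in_itv/= intrD mulrNz ler_pdivlMr// ltr_pdivrMr// mulNr mulrDl mul1r mulNr.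
 by congr (_ && _); apply/idP/idP; lra.
 apply/idP/eqP => [/floor_def e|->]; first by rewrite /i0 e mulrN opprK mulrA ss mul1r.
 by rewrite /i0 mulrN mulrA ss mul1r opprK; exact: floor_itv.
rewrite (@esum_single _ i0); first by rewrite indicE mem_setE key eqxx mule1.
- by rewrite mule_ge0// lee_fin indicE.
- by move=> i /eqP ne; rewrite indicE mem_setE key (negbTE ne) mule0.
Qed.

Lemma integral_esum_int (D : set R) (f : int -> R -> \bar R) : measurable (D : set (measurableTypeR R)) ->
 (forall i, measurable_fun D (f i : measurableTypeR R -> \bar R)) ->
 (forall i x, (0 <= f i x)%E) ->
 (\esum_(i in [set: int]) \int[mu]_(x in D) f i x = \int[mu]_(x in D) \esum_(i in [set: int]) f i x)%E.
Proof.
move=> mD mf f0; have [q bq] := int_enum.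
rewrite (@reindex_esum R _ _ setT setT q _ bq) -nneseries_esumT; last by move=> n; exact: integral_ge0.
rewrite -integral_nneseries//; last by move=> n; exact: mf.
by apply: eq_integral => x _; rewrite (@reindex_esum R _ _ setT setT q _ bq) nneseries_esumT.
Qed.

Lemma esum_unroll (ell : R) (phi : R -> \bar R) : 0 < ell ->
 mfun (phi : measurableTypeR R -> \bar R) -> (forall t, (0 <= phi t)%E) ->
 (\esum_(j in [set: int]) \int[mu]_(t in `[0%R, ell[) phi (t + j%:~R * ell)%R = \int[mu]_t phi t)%E.
Proof.
move=> ell0 mphi phi0.
have m1 j : mfun (fun t : measurableTypeR R => (\1_(`[0, ell[%classic) (t + (-1 * j)%:~R * ell) : R)%:E).
 apply/measurable_EFinP; apply: (measurableT_comp (f := \1_(`[0, ell[%classic) : R -> R)) => //.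
 by apply: measurable_funD.
have E j : (\int[mu]_(t in `[0%R, ell[) phi (t + j%:~R * ell)%R =
 \int[mu]_t (phi t * (\1_(`[0, ell[%classic) (t + (-1 * j)%:~R * ell)%R : R)%:E))%E.
 rewrite [RHS](@ge0_integral_affine _ 1 (j%:~R * ell)) ?oner_eq0//; last 2 first.
 - by apply: emeasurable_funM => //; exact: m1.
 - by move=> x; rewrite mule_ge0// lee_fin indicE.
 rewrite normr1 mul1e [LHS]integral_mkcond; apply: eq_integral => t _.
 rewrite patchE mul1r mulN1r mulrNz mulNr addrK indicE.
 by case: ifP => _; rewrite ?mule1// mule0.
under eq_esum => j _ do rewrite E.
rewrite integral_esum_int//; last 2 first.
- by move=> j; apply: emeasurable_funM => //; exact: m1.
- by move=> j t; rewrite mule_ge0// lee_fin indicE.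
apply: eq_integral => t _.
exact: (@esum_translate ell t (-1) _ ell0 (or_intror erefl)).
Qed.
End Tiles.

(** * The sum over the group, arranged by double cosets *)

Section DoubleCosets.
Context {R : realType}.
Local Notation plane := (planeT R).
Local Notation mu := (leb R).
Variables (G : set 'M[R]_2) (m : R).
Hypotheses (subG : psl2_subgroup G) (discG : discrete_subgroup G).
Hypotheses (m1 : 1 < m) (stabG : axis_stabilizer G = hyperbolic_subgroup m).
Local Notation ell := (2 * ln m).
Local Notation H := (hyperbolic_subgroup m).
Implicit Types g : 'M[R]_2.

Let m0 : 0 < m. Proof. exact: lt_trans m1. Qed.
Let ell0 : 0 < ell. Proof. by rewrite mulr_gt0// ln_gt0. Qed.

Lemma hyperbolic_mem g : H g <-> exists b k, g = (-1) ^+ nat_of_bool b *: hk m k.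
Proof.
rewrite (hyperbolic_subgroupE m1); split => [[k [->|->]]|[[] [k ->]]].
- by exists false, k; rewrite expr0 scale1r.
- by exists true, k; rewrite expr1 scaleN1r.
- by exists k; right; rewrite expr1 scaleN1r.
- by exists k; left; rewrite expr0 scale1r.
Qed.

Lemma double_cosetP g k : double_coset H g k <->
 exists b i j, k = (-1) ^+ nat_of_bool b *: (hk m i *m g *m hk m j).
Proof.
split.
 move=> [h1 [h2 [/hyperbolic_mem[b1 [i ->]] /hyperbolic_mem[b2 [j ->]] ->]]].
 exists (b1 (+) b2), i, j.
 by case: b1; case: b2; rewrite /= ?expr1 ?expr0 ?scaleN1r ?scale1r ?mulNmx ?mulmxN ?mulNmx ?opprK.
move=> [b [i [j ->]]]; exists ((-1) ^+ nat_of_bool b *: hk m i), (hk m j); split.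
- by apply/hyperbolic_mem; exists b, i.
- by apply/hyperbolic_mem; exists false, j; rewrite expr0 scale1r.
- by rewrite -!scalemxAl.
Qed.

Lemma double_coset_refl g : double_coset H g g.
Proof.
by apply/double_cosetP; exists false, 0, 0; rewrite expr0 scale1r hk0 mul1mx mulmx1.
Qed.

Lemma double_coset_sub g : G g -> double_coset H g `<=` G.
Proof.
move=> Gg k [h1 [h2 [/(hyperbolic_sub stabG) G1 /(hyperbolic_sub stabG) G2 ->]]].
by apply: psl2M => //; exact: psl2M.
Qed.

Lemma double_coset_trans g k : double_coset H g k -> double_coset H g = double_coset H k.
Proof.
move=> /double_cosetP[b [i [j kE]]].
have sgn (c : bool) (M : 'M[R]_2) : (-1) ^+ nat_of_bool c *: ((-1) ^+ nat_of_bool c *: M) = M.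
 by rewrite scalerA; case: c; rewrite ?expr1 ?expr0 ?mulrNN mulr1 scale1r.
have gE : g = (-1) ^+ nat_of_bool b *: (hk m (- i) *m k *m hk m (- j)).
 rewrite kE -!(scalemxAr, scalemxAl) sgn !mulmxA hkD// addNr hk0 mul1mx -mulmxA hkD// subrr hk0 mulmx1//.
have mix (b1 b2 : bool) i1 i2 j1 j2 (M : 'M[R]_2) :
 (-1) ^+ nat_of_bool b1 *: (hk m i1 *m ((-1) ^+ nat_of_bool b2 *: (hk m i2 *m M *m hk m j2)) *m hk m j1) =
 (-1) ^+ nat_of_bool (b1 (+) b2) *: (hk m (i1 + i2) *m M *m hk m (j2 + j1)).
 rewrite -!hkD// !mulmxA.
 by case: b1; case: b2; rewrite /= ?expr1 ?expr0 ?scaleN1r ?scale1r ?mulNmx ?mulmxN ?mulNmx ?opprK ?mulmxA.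
apply/seteqP; split => x /double_cosetP[b' [i' [j' ->]]]; apply/double_cosetP.
 by rewrite gE mix; eexists _, _, _.
by rewrite kE mix; eexists _, _, _.
Qed.

Lemma double_coset1 : double_coset H 1%:M = H.
Proof.
apply/seteqP; split => x.
 move=> /double_cosetP[b [i [j ->]]]; apply/hyperbolic_mem; exists b, (i + j).
 by rewrite mulmx1 hkD.
move=> /hyperbolic_mem[b [k ->]]; apply/double_cosetP; exists b, k, 0.
by rewrite mulmx1 hk0 mulmx1.
Qed.

(** Injectivity needs two non-zero entries: a and b are scaled by m^(i + j) and m^(i - j), which
    determine i and j, and then the sign. *)
Lemma double_coset_param g : G g -> ~ H g ->
 set_bij [set: bool * (int * int)] (double_coset H g)
 (fun x => (-1) ^+ nat_of_bool x.1 *: (hk m x.2.2 *m g *m hk m x.2.1)).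
Proof.
move=> Gg nH; have [a0 b0 c0 d0] := entries_neq0 subG discG m1 stabG Gg nH; split.
- by move=> [b [j i]] _ /=; apply/double_cosetP; exists b, i, j.
- move=> [b [j i]] [b' [j' i']] _ _ /= E.
 have [e1 e2 _ _] := hk_mul m1 i g j; have [f1 f2 _ _] := hk_mul m1 i' g j'.
 have E1 := congr1 (fun M : 'M[R]_2 => M 0 0) E; have E2 := congr1 (fun M : 'M[R]_2 => M 0 1) E.
 have sc (c : R) (M : 'M[R]_2) p l : (c *: M) p l = c * M p l by rewrite mxE.
 move: E1 E2; rewrite !sc e1 e2 f1 f2 !mulrA => /(mulIf a0) E1 /(mulIf b0) E2.
 have n1 := congr1 Num.norm E1; have n2 := congr1 Num.norm E2.
 have nrm (c : bool) (k : int) : `|(-1) ^+ nat_of_bool c * m ^ k| = m ^ k :> R.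
 by rewrite normrM normrX normrN1 expr1n mul1r ger0_norm// exprz_ge0// ltW.
 have mm1 : m != 1 by rewrite gt_eqF.
 move: n1 n2; rewrite !nrm => /(ieexprIz m0 mm1) h1 /(ieexprIz m0 mm1) h2.
 have ii : i = i' by lra.
 have jj : j = j' by lra.
 by move: E1; rewrite ii jj => /mulIf; rewrite gt_eqF ?exprz_gt0// => /(_ isT) /bool_sign ->.
- by move=> x /double_cosetP[b [i [j ->]]]; exists (b, (j, i)).
Qed.

Section Slices.
Variable K : R -> R.
Hypotheses (mK : mfun K) (K0 : forall v, 0 <= K v).

Definition cell g v : \bar R := (\int[mu]_(t in `[0%R, ell[) (strip m K (hact g (v, t)))%:E)%E.
Definition cross g v : \bar R := (\int[mu]_t (K (hact g (v, t)).1)%:E)%E.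

Lemma cell_ge0 g v : (0 <= cell g v)%E.
Proof. by apply: integral_ge0 => t _; rewrite lee_fin strip_ge0. Qed.

Lemma cross_ge0 g v : (0 <= cross g v)%E.
Proof. by apply: integral_ge0 => t _; rewrite lee_fin. Qed.
Let mh g v : mfun (fun t : measurableTypeR R => hact g (v, t) : plane).
Proof. by apply: (measurableT_comp (measurable_hact g)); exact: measurable_pair1. Qed.
Let mcross g v : mfun (fun t : measurableTypeR R => (K (hact g (v, t)).1)%:E).
Proof.
apply/measurable_EFinP; apply: (measurableT_comp mK).
by apply: (measurableT_comp (f := fst : plane -> measurableTypeR R)) => //; exact: mh.
Qed.
Let hact_cell g i j v t : G g -> hact (hk m i *m g *m hk m j) (v, t) =
 ((hact g (v, t + j%:~R * ell)).1, (hact g (v, t + j%:~R * ell)).2 + i%:~R * ell).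
Proof.
move=> Gg; have Gi := Ghk m1 stabG i; have Gj := Ghk m1 stabG j.
rewrite hactM ?(psl2_det subG (psl2M subG Gi Gg)) ?(psl2_det subG Gj)// (hact_hk m1)/=.
by rewrite hactM ?(psl2_det subG Gi) ?(psl2_det subG Gg)// (hact_hk m1).
Qed.

Lemma cellN g v : cell (- g) v = cell g v.
Proof. by apply: eq_integral => t _; rewrite hactN. Qed.

Lemma cell_sign b g v : cell ((-1) ^+ nat_of_bool b *: g) v = cell g v.
Proof. by case: b; rewrite ?expr1 ?scaleN1r ?cellN// expr0 scale1r. Qed.

(** The left exponent i translates the image point and removes the cut-off of the strip in t; the
    right exponent j translates the argument and unrolls one period to the whole line. *)
Lemma cell_sum g v : G g ->
 (\esum_(j in [set: int]) \esum_(i in [set: int]) cell (hk m i *m g *m hk m j) v = cross g v)%E.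
Proof.
move=> Gg; rewrite /cross -(@esum_unroll _ _ (fun t => (K (hact g (v, t)).1)%:E) ell0 (mcross g v)); last by move=> t; rewrite lee_fin.
apply: eq_esum => j _; rewrite integral_esum_int.
- apply: eq_integral => t _.
 rewrite -[RHS](@esum_translate _ ell (hact g (v, t + j%:~R * ell)).2 1 _ ell0 (or_introl erefl)) ?lee_fin//.
 by apply: eq_esum => i _; rewrite hact_cell// /strip /= mul1r EFinM.
- exact: measurable_itv.
- move=> i; apply: measurable_funTS; apply/measurable_EFinP.
 by apply: (measurableT_comp (measurable_strip m mK)); exact: mh.
- by move=> i t; rewrite lee_fin strip_ge0.
Qed.

Lemma coset_sum g v : G g -> ~ H g -> (\esum_(k in double_coset H g) cell k v = 2%:E * cross g v)%E.
Proof.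
move=> Gg nH; rewrite (@reindex_esum _ _ _ _ _ _ _ (double_coset_param Gg nH)).
under eq_esum => x _ do rewrite cell_sign.
have -> : [set: bool * (int * int)] = [set: bool] `*`` (fun=> [set: int * int]) by apply/seteqP; split.
rewrite -(@esum_esum _ _ _ _ _ (fun (b : bool) (x : int * int) => cell (hk m x.2 *m g *m hk m x.1) v)); last first.
 by move=> *; exact: cell_ge0.
have E : (\esum_(x in [set: int * int]) cell (hk m x.2 *m g *m hk m x.1) v = cross g v)%E.
 have -> : [set: int * int] = [set: int] `*`` (fun=> [set: int]) by apply/seteqP; split.
 rewrite -(@esum_esum _ _ _ _ _ (fun (j i : int) => cell (hk m i *m g *m hk m j) v)); last first.
 by move=> *; exact: cell_ge0.
 exact: cell_sum.
rewrite esum_bool => [|b]; last by rewrite E cross_ge0.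
by rewrite E mule_natl mule2n.
Qed.

Lemma trivial_coset_sum v : (\esum_(k in H) cell k v = (2 * ell * K v)%:E)%E.
Proof.
have bij : set_bij [set: bool * int] H (fun x => (-1) ^+ nat_of_bool x.1 *: hk m x.2).
 split; first by move=> [b k] _ /=; apply/hyperbolic_mem; exists b, k.
 - move=> [b k] [b' k'] _ _ /= E.
 have [e1 _ _ _] := hkE m k; have [f1 _ _ _] := hkE m k'.
 have sc (c : R) (M : 'M[R]_2) p l : (c *: M) p l = c * M p l by rewrite mxE.
 have := congr1 (fun M : 'M[R]_2 => M 0 0) E; rewrite !sc e1 f1 => E1.
 have := congr1 Num.norm E1; rewrite !normrM !normrX normrN1 !expr1n !mul1r !ger0_norm ?exprz_ge0 ?(ltW m0)//.
 move=> /(ieexprIz m0) kk; have {}kk : k = k' by apply: kk; rewrite gt_eqF.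
 move: E1; rewrite kk => /mulIf; rewrite gt_eqF ?exprz_gt0// => /(_ isT).
 by move=> /bool_sign ->.
 - by move=> x /hyperbolic_mem[b [k ->]]; exists (b, k).
rewrite (@reindex_esum _ _ _ _ _ _ _ bij); under eq_esum => x _ do rewrite cell_sign.
have -> : [set: bool * int] = [set: bool] `*`` (fun=> [set: int]) by apply/seteqP; split.
rewrite -(@esum_esum _ _ _ _ _ (fun (b : bool) (k : int) => cell (hk m k) v)); last first.
 by move=> *; exact: cell_ge0.
have E : (\esum_(k in [set: int]) cell (hk m k) v = (ell * K v)%:E)%E.
 rewrite integral_esum_int.
 - rewrite (eq_integral (fun=> (K v)%:E)) => [|t _].
 rewrite integral_cst; last exact: measurable_itv.
 have := @lebesgue_measure_itv R `[0, ell[; rewrite /= lte_fin ell0 -EFinB subr0 => E1.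
 by rewrite [X in (_ * X)%E = _]E1 -EFinM mulrC.
 rewrite -[RHS](@esum_translate _ ell t 1 _ ell0 (or_introl erefl)) ?lee_fin//.
 by apply: eq_esum => i _; rewrite (hact_hk m1)// /strip /= mul1r EFinM.
 - exact: measurable_itv.
 - move=> i; apply: measurable_funTS; apply/measurable_EFinP.
 by apply: (measurableT_comp (measurable_strip m mK)); exact: mh.
 - by move=> i t; rewrite lee_fin strip_ge0.
rewrite esum_bool => [|b]; last by rewrite E lee_fin mulr_ge0// ltW.
by rewrite E -EFinD; congr EFin; ring.
Qed.

Definition cosets := [set D : set 'M[R]_2 | exists2 g, G g /\ ~ H g & D = double_coset H g].

Lemma coset_mem D g : cosets D -> D g -> [/\ G g, ~ H g & D = double_coset H g].
Proof.
move=> [k [Gk nHk ->]] kg; have E := double_coset_trans kg; split => //.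
- exact: double_coset_sub Gk _ kg.
- move=> Hg; apply: nHk; have : double_coset H 1%:M g by rewrite double_coset1.
 by move=> /double_coset_trans; rewrite double_coset1 => ->; rewrite -E; exact: double_coset_refl.
Qed.

Definition coset_rep (D : set 'M[R]_2) : 'M[R]_2 := xget 1%:M D.

Lemma coset_repP D : cosets D -> [/\ G (coset_rep D), ~ H (coset_rep D) & D = double_coset H (coset_rep D)].
Proof.
move=> cD; apply: coset_mem => //; rewrite /coset_rep; case: xgetP => // H0.
by have [k _ E] := cD; have := H0 k; rewrite E => /(_ (double_coset_refl k)).
Qed.

Lemma cell_esum v : (\esum_(g in G) cell g v =
 (2 * ell * K v)%:E + \esum_(D in cosets) (2%:E * cross (coset_rep D) v))%E.
Proof.
have c0 g : G g -> (0 <= cell g v)%E by move=> _; exact: cell_ge0.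
rewrite (@esumID _ _ H _ _ c0); congr (_ + _)%E.
 rewrite -trivial_coset_sum; congr (esum _ _); apply/seteqP; split => [g []//|g Hg].
 by split => //; exact: (hyperbolic_sub stabG).
have bij : set_bij (cosets `*`` id) (G `&` ~` H) snd.
 split.
 - by move=> [D g] [/= cD Dg]; have [? ? _] := coset_mem cD Dg.
 - move=> [D g] [D' g'] /set_mem[/= cD Dg] /set_mem[/= cD' Dg'] /= gg; subst g'.
 by have [_ _ ->] := coset_mem cD Dg; have [_ _ ->] := coset_mem cD' Dg'.
 - move=> g [Gg nH]; exists (double_coset H g, g) => //; split => /=; last exact: double_coset_refl.
 by exists g.
rewrite (@reindex_esum _ _ _ _ _ _ _ bij) -(@esum_esum _ _ _ _ id (fun _ g => cell g v)); last by move=> *; exact: cell_ge0.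
apply: eq_esum => D cD; have [Gr nHr DE] := coset_repP cD.
by rewrite {1}DE coset_sum.
Qed.

End Slices.
End DoubleCosets.

(** * The kernel and its integral along a line crossing the axis coordinates *)

Section CrossKernel.
Context {R : realType}.
Local Notation mu := (leb R).

(** The factor 2 / pi normalises the half-disc of radius Z to the value Z^2. *)
Definition ckern (Y v : R) : R := 2 / pi * (`|v| * chord Y v).

Lemma pi_gt0' : 0 < (pi : R). Proof. exact: pi_gt0. Qed.

Lemma ckern_ge0 Y v : 0 <= ckern Y v.
Proof. by rewrite /ckern mulr_ge0// ?mulr_ge0 ?chord_ge0// invr_ge0 pi_ge0. Qed.

Lemma cont_ckern Y : continuous (ckern Y).
Proof. by have cc := @cont_chord R Y; rewrite /ckern; ctn. Qed.

Lemma ckernN Y v : ckern Y (- v) = ckern Y v.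
Proof. by rewrite /ckern /chord normrN sqrrN. Qed.

Lemma ckern_eq0 Y v : 0 <= Y -> Y <= `|v| -> ckern Y v = 0.
Proof.
move=> Y0 Yv; rewrite /ckern chord_eq0 ?mulr0// -(real_normK (num_real v)).
by rewrite ler_sqr// nnegrE.
Qed.

Lemma ckern_le Y1 Y2 v : Y1 ^+ 2 <= Y2 ^+ 2 -> ckern Y1 v <= ckern Y2 v.
Proof.
move=> Y12; rewrite /ckern ler_wpM2l ?ler_wpM2l ?chord_le//.
by rewrite divr_ge0// pi_ge0.
Qed.

Lemma window_ckern Y v : 0 <= Y -> window Y (ckern Y) v = ckern Y v.
Proof.
move=> Y0; rewrite /window indicE mem_setE in_itv/= -ler_norml.
by case: leP => [_|/ltW/(ckern_eq0 Y0) ->]; rewrite ?mulr1// mulr0.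
Qed.

Lemma ckern_bound Y v : 0 <= Y -> `|v| <= Y -> ckern Y v <= 2 / pi * Y ^+ 2.
Proof.
move=> Y0 vY; rewrite /ckern ler_wpM2l ?divr_ge0 ?pi_ge0// expr2 ler_pM ?chord_ge0//.
exact: chord_leY.
Qed.

Lemma chord_sub (Y1 Y2 v : R) : Y1 ^+ 2 <= Y2 ^+ 2 -> chord Y2 v - chord Y1 v <= sqrt (Y2 ^+ 2 - Y1 ^+ 2).
Proof.
move=> Y12; have D0 : 0 <= Y2 ^+ 2 - Y1 ^+ 2 by rewrite subr_ge0.
rewrite lerBlDr -[X in _ <= X]ger0_norm ?addr_ge0 ?sqrtr_ge0//.
rewrite -sqrtr_sqr; apply: ler_wsqrtr; rewrite sqrrD sqr_sqrtr//.
have [h|h] := leP (v ^+ 2) (Y1 ^+ 2).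
 rewrite chord_sqr//; have := mulr_ge0 (sqrtr_ge0 (Y2 ^+ 2 - Y1 ^+ 2)) (chord_ge0 Y1 v).
 by move: (sqrt _ * _) => z; rewrite mulr2n; lra.
by rewrite (chord_eq0 (ltW h)) mulr0 mul0rn expr0n/= !addr0; move: h; lra.
Qed.

Lemma ckern_sub Y1 Y2 v : 0 <= Y1 -> Y1 <= Y2 ->
 ckern Y2 v - ckern Y1 v <= 2 / pi * (Y2 * sqrt (Y2 ^+ 2 - Y1 ^+ 2)).
Proof.
move=> Y10 Y12; have Y20 := le_trans Y10 Y12; have p0 : 0 <= 2 / pi :> R by rewrite divr_ge0// pi_ge0.
rewrite /ckern -mulrBr ler_wpM2l// -mulrBr; have Y12s := sqr_le0l Y10 Y12.
have [h|h] := leP `|v| Y2.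
 by apply: ler_pM => //; [rewrite subr_ge0 chord_le|exact: chord_sub].
have v2 Y : 0 <= Y -> Y <= Y2 -> Y ^+ 2 <= v ^+ 2.
 by move=> Y0 YY; rewrite -(real_normK (num_real v)) ler_sqr ?nnegrE// (le_trans YY)// ltW.
by rewrite !chord_eq0 ?v2// subrr mulr0 mulr_ge0// sqrtr_ge0.
Qed.

Lemma cont_under_integral (q : R * R -> R) a b : continuous q ->
 continuous (fun v => \int[mu]_(t in `[a, b]) q (v, t)).
Proof.
move=> cq v; have [M HM] := rectangle_bounded (v - 1) (v + 1) a b cq.
apply: (@continuity_under_integral _ _ _ mu (fun v t => q (v, t)) `[a, b]%classic (measurable_itv _)
 (v - 1) (v + 1) _ _ (fun=> M)) => [x _|||x xI|]; last by rewrite inE/= in_itv/=; apply/andP; split; lra.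
- by apply: segint_itg; apply: contW; exact: cont2_snd.
- by apply/aeW => t _ x _; exact: continuous2_fst.
- by apply: (@segint_itg _ _ _ (fun=> M)); apply: contW; ctn.
- apply/aeW => t tI; apply: HM; first by move: xI; rewrite /= in_itv/= => /andP[/ltW -> /ltW ->].
 by move: tI; rewrite /= in_itv.
Qed.

Section Crossing.
Variables (al be sg : R).
Hypotheses (al0 : al != 0) (be0 : be != 0).

(** The first coordinate of g (v, t) for al = a c, be = b d and sg = a d + b c. *)
Definition cpos v t := al * (expR t * (1 + v ^+ 2)) + be * expR (- t) + sg * v.
(** For |v| <= 1 and |t| beyond this bound the curve has left the support of the kernel. A square
    root replaces a logarithm: T < e^t once t > 2 T^(1/2), and the resulting loss of Y^(1/2) still
    fits into the final error. *)
Definition ctail Y := 2 * sqrt ((Y + `|sg| + 2 * `|al| + `|be|) / Num.min `|al| `|be|).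

Let ab0 : 0 < Num.min `|al| `|be|. Proof. by rewrite lt_min !normr_gt0 al0. Qed.
Let exp_large (T t : R) : 0 <= T -> 2 * sqrt T < t -> T < expR t.
Proof.
move=> T0 tT; have t0 : 0 <= t by rewrite (le_trans _ (ltW tT))// mulr_ge0// sqrtr_ge0.
have h : sqrt T < expR (t / 2).
 by apply: lt_le_trans (expR_ge1Dx (t / 2)); rewrite ltr_wpDl// ltr_pdivlMr// mulrC.
rewrite -[T]sqr_sqrtr// (_ : expR t = expR (t / 2) ^+ 2); last by rewrite -expRM_natl; congr expR; field.
by rewrite ltr_sqr// nnegrE ?sqrtr_ge0// expR_ge0.
Qed.

Lemma cpos_tail Y v t : 0 <= Y -> `|v| <= 1 -> ctail Y < `|t| -> Y <= `|cpos v t|.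
Proof.
move=> Y0 v1 tT; pose W := Y + `|sg| + 2 * `|al| + `|be|.
have W0 : 0 <= W by rewrite /W !addr_ge0// mulr_ge0.
have e0 : W / Num.min `|al| `|be| < expR `|t| by apply: exp_large => //; rewrite divr_ge0// ltW.
have wal : W <= `|al| * expR `|t|.
 by rewrite -ler_pdivrMl ?normr_gt0// mulrC (le_trans _ (ltW e0))// ler_wpM2l// lef_pV2 ?posrE ?normr_gt0// ge_min lexx.
have wbe : W <= `|be| * expR `|t|.
 by rewrite -ler_pdivrMl ?normr_gt0// mulrC (le_trans _ (ltW e0))// ler_wpM2l// lef_pV2 ?posrE ?normr_gt0// ge_min lexx orbT.
have v2 : v ^+ 2 <= 1 by rewrite -(real_normK (num_real v)) expr_le1.
have sv : `|sg * v| <= `|sg| by rewrite normrM ler_piMr.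
have nE (x y z : R) : `|x| - `|y| - `|z| <= `|x + y + z|.
 have h1 := ler_normB (x + y + z) (y + z); rewrite (_ : x + y + z - (y + z) = x) in h1; last by ring.
 by have h2 := ler_normD y z; lra.
have nE' (x y z : R) : `|y| - `|x| - `|z| <= `|x + y + z| by rewrite (addrC x) nE.
have [t0|t0] := leP 0 t.
 move: wal wbe; rewrite (ger0_norm t0) => wal _; apply: le_trans (nE _ _ _).
 have h1 : `|al| * expR t <= `|al * (expR t * (1 + v ^+ 2))|.
 rewrite normrM ler_wpM2l// ger0_norm ?mulr_ge0 ?expR_ge0 ?(ltW (w_gt0 v))//.
 by rewrite ler_peMr ?expR_ge0// lerDl sqr_ge0.
 have h2 : `|be * expR (- t)| <= `|be|.
 by rewrite normrM ler_piMr// ger0_norm ?expR_ge0// -expR0 ler_expR oppr_le0.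
 have := normr_ge0 al; move: h1 h2 wal sv; rewrite /W; lra.
move: wal wbe; rewrite (ltr0_norm t0) => _ wbe; apply: le_trans (nE' _ _ _).
have h1 : `|be * expR (- t)| = `|be| * expR (- t) by rewrite normrM (ger0_norm (expR_ge0 _)).
have h2 : `|al * (expR t * (1 + v ^+ 2))| <= 2 * `|al|.
 rewrite normrM mulrC ler_wpM2r// ger0_norm ?mulr_ge0 ?expR_ge0 ?(ltW (w_gt0 v))//.
 have e1 : expR t <= 1 by rewrite -expR0 ler_expR ltW.
 have := expR_ge0 t; have := sqr_ge0 v; move: e1 v2; move: (expR t) (v ^+ 2) => x y; nra.
rewrite h1; have := normr_ge0 be; move: h2 wbe sv; rewrite /W; lra.
Qed.

Lemma cont_cpos : continuous (fun p : R * R => cpos p.1 p.2).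
Proof. by rewrite /cpos; ctn. Qed.

Definition crossing Y v := \int[mu]_(t in `[- ctail Y, ctail Y]) ckern Y (cpos v t).

Lemma cont_crossing Y : continuous (crossing Y).
Proof.
apply: (@cont_under_integral (fun p => ckern Y (cpos p.1 p.2))).
by apply: contT => p; apply: (cont_comp (@cont_ckern Y)); exact: cont_cpos.
Qed.

Lemma cont_ckern_cpos Y v : continuous (fun t => ckern Y (cpos v t)).
Proof.
by apply: contT => t; apply: (cont_comp (@cont_ckern Y)); rewrite /cpos; ctn.
Qed.

Lemma crossingE Y v : 0 <= Y -> `|v| <= 1 ->
 (\int[mu]_t (ckern Y (cpos v t))%:E = (crossing Y v)%:E)%E.
Proof.
move=> Y0 v1; have I := segint_itg (@contW _ (- ctail Y) (ctail Y) _ (@cont_ckern_cpos Y v)).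
rewrite /crossing /Rintegral fineK; last exact: integrable_fin_num.
rewrite [RHS]integral_mkcond; apply: eq_integral => t _; rewrite patchE.
case: ifPn => //; rewrite mem_setE in_itv/= -ler_norml -ltNge => h.
by rewrite ckern_eq0//; exact: cpos_tail.
Qed.

Lemma crossing_line Y T : 0 <= Y -> ctail Y <= T -> \int[mu]_(t in `[- T, T]) ckern Y (cpos 0 t) = crossing Y 0.
Proof.
move=> Y0 hT; apply: EFin_inj; rewrite -(crossingE Y0) ?normr0//.
have I := segint_itg (@contW _ (- T) T _ (@cont_ckern_cpos Y 0)).
rewrite /Rintegral fineK; last exact: integrable_fin_num.
rewrite integral_mkcond; apply: eq_integral => t _; rewrite patchE.
case: ifPn => //; rewrite mem_setE in_itv/= -ler_norml -ltNge => h.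
by rewrite ckern_eq0//; apply: cpos_tail; rewrite ?normr0//; exact: le_lt_trans h.
Qed.

Lemma ctail_le Y1 Y2 : Y1 <= Y2 -> ctail Y1 <= ctail Y2.
Proof.
move=> Y12; rewrite ler_wpM2l//; apply: ler_wsqrtr; rewrite ler_wpM2r ?invr_ge0 ?(ltW ab0)//.
by rewrite !lerD2r.
Qed.

Lemma crossing_le Y1 Y2 : 0 <= Y1 -> Y1 <= Y2 -> crossing Y1 0 <= crossing Y2 0.
Proof.
move=> Y10 Y12; rewrite -(crossing_line Y10 (ctail_le Y12)).
apply: segint_le; try by apply: contW; exact: cont_ckern_cpos.
by move=> t _; apply: ckern_le; exact: sqr_le0l.
Qed.

Lemma crossing_sub Y1 Y2 : 0 <= Y1 -> Y1 <= Y2 ->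
 crossing Y2 0 - crossing Y1 0 <= 2 / pi * (Y2 * sqrt (Y2 ^+ 2 - Y1 ^+ 2)) * (2 * ctail Y2).
Proof.
move=> Y10 Y12; rewrite -(crossing_line Y10 (ctail_le Y12)) /crossing.
have T0 : 0 <= ctail Y2 by rewrite mulr_ge0// sqrtr_ge0.
rewrite -segintB; try by apply: contW; exact: cont_ckern_cpos.
have -> : 2 / pi * (Y2 * sqrt (Y2 ^+ 2 - Y1 ^+ 2)) * (2 * ctail Y2) =
 \int[mu]_(t in `[- ctail Y2, ctail Y2]) (2 / pi * (Y2 * sqrt (Y2 ^+ 2 - Y1 ^+ 2))).
 rewrite segint_cst; last by rewrite (le_trans _ T0)// oppr_le0.
 by rewrite opprK; congr (_ * _); ring.
apply: segint_le; last by move=> t _; exact: ckern_sub.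
- by apply: contW; apply: contT => t; apply: contD; [exact: cont_ckern_cpos|apply: contN; exact: cont_ckern_cpos].
- by apply: contW; ctn.
Qed.

Section Same.
Hypothesis alg0 : 0 < al.
Hypothesis beg0 : 0 < be.

(* With [q(t) = al e^t - be e^-t] one has [p^2 = q^2 + 4 al be] and [q' = p] for [p = al e^t + be e^-t]. *)
Lemma crossing_same Y : 0 <= Y -> crossing Y 0 = Num.max 0 (Y ^+ 2 - 4 * (al * be)).
Proof.
move=> Y0; pose q (t : R) := al * expR t - be * expR (- t).
pose p (t : R) := al * expR t + be * expR (- t).
have p0 t : 0 < p t by rewrite addr_gt0// mulr_gt0// expR_gt0.
have cp t : cpos 0 t = p t by rewrite /cpos expr0n/= addr0 mulr1 mulr0 addr0.
have pq t : p t ^+ 2 = q t ^+ 2 + 4 * (al * be).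
 have e1 : expR t * expR (- t) = 1 by rewrite -expRD subrr expR0.
 have -> : al * be = (al * be) * (expR t * expR (- t)) by rewrite e1 mulr1.
 by rewrite /p /q; ring.
have dq (t : R) : is_derive t (1 : R) q (p t) by rewrite /q /p; isd; ring.
have ab : 0 < 4 * (al * be) by rewrite !mulr_gt0.
have [neg|pos] := leP (Y ^+ 2) (4 * (al * be)).
 rewrite max_l ?subr_le0// /crossing (segint_eq (g := fun=> 0)) => [|t _].
 by rewrite /Rintegral integral0.
 by rewrite /ckern cp chord_eq0 ?mulr0// pq (le_trans neg)// lerDr sqr_ge0.
rewrite max_r ?subr_ge0 ?(ltW pos)//; pose Z := sqrt (Y ^+ 2 - 4 * (al * be)).
have Z0 : 0 <= Z by exact: sqrtr_ge0.
have Z2 : Z ^+ 2 = Y ^+ 2 - 4 * (al * be) by rewrite sqr_sqrtr// subr_ge0 ltW.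
have kE t : ckern Y (cpos 0 t) = 2 / pi * (chord Z (q t) * p t).
 rewrite /ckern cp ger0_norm ?(ltW (p0 t))// mulrC [in RHS](mulrC (chord _ _)) [RHS]mulrC.
 by congr (_ * _ * _); rewrite /chord Z2 pq; congr sqrt; ring.
(* Large enough for q to run over all of [- Z, Z], so that the substitution y = q(t) yields the
   whole half-disc. *)
pose T := Num.max (ctail Y) ((Z + al + be) / Num.min al be).
have T1 : ctail Y <= T by rewrite le_max lexx.
have mab : 0 < Num.min al be by rewrite lt_min alg0.
have T0 : 0 <= T by rewrite (le_trans _ T1)// mulr_ge0// sqrtr_ge0.
have T2 : (Z + al + be) <= Num.min al be * T by rewrite mulrC -ler_pdivrMr// le_max lexx orbT.
have eT : T <= expR T by apply: le_trans (expR_ge1Dx T); rewrite lerDr.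
have eNT : expR (- T) <= 1 by rewrite -expR0 ler_expR oppr_le0.
have mal : Num.min al be <= al by rewrite ge_min lexx.
have mbe : Num.min al be <= be by rewrite ge_min lexx orbT.
have qT : Z <= q T.
 have h1 : Num.min al be * T <= al * expR T by rewrite ler_pM// ltW.
 have h2 : be * expR (- T) <= be by rewrite ler_piMr// ltW.
 by rewrite /q; move: h1 h2 T2 alg0; lra.
have qNT : q (- T) <= - Z.
 have h1 : Num.min al be * T <= be * expR T by rewrite ler_pM// ltW.
 have h2 : al * expR (- T) <= al by rewrite ler_piMr// ltW.
 by rewrite /q opprK; move: h1 h2 T2 beg0; lra.
have TT : - T <= T by rewrite (le_trans _ T0)// oppr_le0.
have qmono x y : x <= y -> q x <= q y.
 by move=> xy; rewrite /q lerB// ler_wpM2l ?(ltW alg0) ?(ltW beg0)// ler_expR// lerN2.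
have cZ := @cont_chord R Z.
have cqp : continuous (fun t => chord Z (q t) * p t).
 apply: contT => t; apply: contM; first by apply: (cont_comp cZ); exact: is_derive_cont (dq t).
 by rewrite /p; ctn.
rewrite -(crossing_line Y0 T1) (segint_eq (g := fun t => 2 / pi * (chord Z (q t) * p t))) => [|t _//].
rewrite segintZ; last exact: contW.
rewrite -(@segint_subst _ (chord Z) q p (- T) T (q (- T) - 1) TT cZ (fun t _ => dq t)); last 3 first.
- by apply: contW; rewrite /p; ctn.
- by move=> x /andP[xT _]; rewrite ltrBlDr (le_lt_trans (qmono _ _ xT))// ltrDl.
- exact: qmono.
have out a b : a <= b -> (forall x, a <= x <= b -> Z ^+ 2 <= x ^+ 2) -> \int[mu]_(x in `[a, b]) chord Z x = 0.
 move=> ab' hx; rewrite (segint_eq (g := fun=> 0)) => [|x /hx/chord_eq0//].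
 by rewrite /Rintegral integral0.
have ZZ : - Z <= Z by rewrite (le_trans _ Z0)// oppr_le0.
rewrite (@segint_chasles _ _ (- Z)) ?(le_trans ZZ)//; last exact: contW.
rewrite (@segint_chasles _ (- Z) Z)//; last exact: contW.
rewrite (out (q (- T)))// ?(out Z)//; last 2 first.
- by move=> x /andP[Zx _]; rewrite ler_sqr// nnegrE ?(le_trans Z0).
- by move=> x /andP[_ xZ]; rewrite -(sqrrN x) ler_sqr ?nnegrE//; move: xZ Z0; lra.
rewrite add0r addr0 segint_reflect// segintD; try by apply: contW; ctn.
 rewrite (segint_eq (g := chord Z) (f := fun x => chord Z (- x))) => [|x _]; last by rewrite /chord sqrrN.
 rewrite quarter_disc// Z2; have := @pi_gt0 R; move: (pi : R) => c c0; field.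
 by rewrite gt_eqF.
Qed.

End Same.
End Crossing.
End CrossKernel.

(** * The geometric side as a finite sum over double cosets *)

Section Counting.
Context {R : realType}.
Local Notation plane := (planeT R).
Local Notation mu := (leb R).
Variables (G : set 'M[R]_2) (m : R).
Hypotheses (subG : psl2_subgroup G) (discG : discrete_subgroup G) (cocG : cocompact G).
Hypotheses (m1 : 1 < m) (stabG : axis_stabilizer G = hyperbolic_subgroup m).
Variable e : nat -> 'M[R]_2.
Hypothesis bij_e : set_bij [set: nat] G e.
Local Notation ell := (2 * ln m).
Local Notation H := (hyperbolic_subgroup m).
Implicit Types (g : 'M[R]_2) (D : set 'M[R]_2).

Let ell0 : 0 < ell. Proof. by rewrite mulr_gt0// ln_gt0. Qed.

Lemma slice_cell A B (k : R -> R) v : continuous k -> (forall v, 0 <= k v) ->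
 (forall v, `|v| <= A -> k v <= B) -> 0 <= B ->
 ((slice m (tube m e A k) v)%:E = \esum_(g in G) cell m (window A k) g v)%E.
Proof.
move=> ck k0 kB B0; have I := tube_slice_integrable subG discG cocG m1 bij_e ck k0 kB B0 v.
have Io : mu.-integrable `[0, ell[ (fun t => (tube m e A k (v, t))%:E).
 apply: integrableS I => //; try exact: measurable_itv.
 by apply: subset_itvl; rewrite bnd_simp.
have [M [M0 HM HE]] := poincare_bound subG discG cocG bij_e (strip_ge0 m (window_ge0 A k0)) B0
 (strip_window_le m1 kB B0).
rewrite /slice -Rintegral_itv_bndo_bndc// /Rintegral fineK; last exact: integrable_fin_num.
rewrite -(nneseries_psl2 bij_e); last by move=> g; exact: cell_ge0 (window_ge0 A k0) g v.
rewrite -integral_nneseries.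
- by apply: eq_integral => t _; rewrite -[LHS]HE.
- exact: measurable_itv.
- move=> n; apply: measurable_funTS; apply/measurable_EFinP.
 apply: (measurableT_comp (measurable_strip m (measurable_window A ck))).
 by apply: (measurableT_comp (measurable_hact (e n))); exact: measurable_pair1.
- by move=> n t _; rewrite lee_fin strip_ge0// => w; exact: window_ge0.
Qed.

(** A finite set containing every coset that can contribute to a slice at |v| <= 1 for a kernel
    supported in |v| <= Y: some member maps a point of the box to a point of the same box, so
    [finite_return] applies. *)
Definition active Y : set (set 'M[R]_2) := [set D | cosets G m D /\ exists2 g, D g &
 exists p : R * R, [/\ `|p.1| <= Num.max 1 Y, `|p.2| <= ell, `|(hact g p).1| <= Num.max 1 Y & `|(hact g p).2| <= ell]].

Lemma finite_active Y : finite_set (active Y).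
Proof.
have fS := finite_return subG discG (Num.max 1 Y) ell.
apply: sub_finite_set (finite_image (double_coset H) fS) => D [cD [g Dg Hg]].
have [Gg _ DE] := coset_mem subG m1 stabG cD Dg.
by exists g.
Qed.

Section Kernel.
Variable Y : R.
Hypothesis Y0 : 0 <= Y.
Local Notation K := (window Y (@ckern R Y)).

Let fin := finite_active Y.
Let mK : mfun K. Proof. by apply: measurable_window; exact: cont_ckern. Qed.
Let K0 v : 0 <= K v. Proof. by apply: window_ge0 => w; exact: ckern_ge0. Qed.

Lemma cross_inactive D v : `|v| <= 1 -> cosets G m D -> ~ active Y D -> cross K (coset_rep D) v = 0%E.
Proof.
move=> v1 cD nD; have [Gr nHr DE] := coset_repP subG m1 stabG cD.
have := coset_sum subG discG m1 stabG mK K0 v Gr nHr.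
rewrite -DE esum1 => [|g Dg].
 by move=> /esym/eqP; rewrite mule_eq0 eqe pnatr_eq0/= => /eqP.
rewrite /cell integral0_eq// => t /=; rewrite in_itv/= => /andP[t0 tl].
apply/eqP; rewrite eqe; apply/eqP; apply: contrapT => /eqP.
rewrite /strip /window /= mulf_eq0 mulf_eq0 !negb_or !indicE.
move=> /andP[/andP[_ h1] h2]; apply: nD; split => //; exists g => //; exists (v, t); split => /=.
- by rewrite le_max v1.
- by rewrite ger0_norm// ltW.
- move: h1; case: (boolP (_ \in _)) => [|_]; last by rewrite eqxx.
 by rewrite mem_setE in_itv/= -ler_norml => h _; rewrite le_max h orbT.
- move: h2; case: (boolP (_ \in _)) => [|_]; last by rewrite eqxx.
 by rewrite mem_setE in_itv/= => /andP[a b] _; rewrite ger0_norm// ltW.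
Qed.

Definition rep_crossing D v := let g := coset_rep D in
 crossing (g 0 0 * g 1 0) (g 0 1 * g 1 1) (g 0 0 * g 1 1 + g 0 1 * g 1 0) Y v.

Lemma cross_rep D v : `|v| <= 1 -> cosets G m D -> cross K (coset_rep D) v = (rep_crossing D v)%:E.
Proof.
move=> v1 cD; have [Gr nHr DE] := coset_repP subG m1 stabG cD.
have [a0 b0 c0 d0] := entries_neq0 subG discG m1 stabG Gr nHr.
rewrite /rep_crossing /= -crossingE ?mulf_neq0//.
by apply: eq_integral => t _; rewrite window_ckern.
Qed.

Definition slice_sum v := 2 * ell * ckern Y v + \sum_(D <- finmap.enum_fset (fset_set (active Y))) (2 * rep_crossing D v).

Lemma cont_slice_sum : continuous slice_sum.
Proof.
apply: contT => v; apply: contD.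
 by apply: contM; [exact: cont_cst|exact: cont_ckern].
move: (finmap.enum_fset _) => s; elim: s => [|D s IH].
 rewrite (_ : (fun y => _) = fun=> 0); first exact: cont_cst.
 by apply/funext => w; rewrite big_nil.
rewrite (_ : (fun y => _) = fun y => 2 * rep_crossing D y + \sum_(D <- s) (2 * rep_crossing D y)).
 apply: contD; last exact: IH.
 by apply: contM; [exact: cont_cst|exact: cont_crossing].
by apply/funext => w; rewrite big_cons.
Qed.

Lemma active_esum (F : set 'M[R]_2 -> R) : (forall D, 0 <= F D) -> (forall D, cosets G m D -> ~ active Y D -> F D = 0) ->
 (\esum_(D in cosets G m) (F D)%:E = (\sum_(D <- finmap.enum_fset (fset_set (active Y))) F D)%:E)%E.
Proof.
move=> F0 Fz.
have -> : \sum_(D <- finmap.enum_fset (fset_set (active Y))) F D = \sum_(D \in active Y) F D.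
 by rewrite fsbig_finite.
rewrite -fsumEFin// -esum_fset//; last first.
 by move=> D _; rewrite lee_fin.
rewrite esum_mkcond [RHS]esum_mkcond; apply: eq_esum => D _.
case: ifPn => [|/negP nc].
 rewrite inE => cD; case: ifPn => // /negP na; rewrite Fz// => aD.
 by apply: na; rewrite inE.
by case: ifPn => //; rewrite inE => -[cD _]; exfalso; apply: nc; rewrite inE.
Qed.

Lemma slice_ckern v : `|v| <= 1 -> slice m (tube m e Y (ckern Y)) v = slice_sum v.
Proof.
move=> v1; apply: EFin_inj.
rewrite (slice_cell (B := 2 / pi * Y ^+ 2) v (@cont_ckern R Y)); last 3 first.
- exact: ckern_ge0.
- by move=> w; exact: ckern_bound.
- by rewrite !mulr_ge0 ?invr_ge0 ?pi_ge0 ?sqr_ge0.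
rewrite (cell_esum subG discG m1 stabG mK K0) window_ckern// /slice_sum [RHS]EFinD; congr (_ + _)%E.
have c0 D : 0 <= 2 * fine (cross K (coset_rep D) v) by rewrite mulr_ge0// fine_ge0// cross_ge0.
have fE D : cosets G m D -> 2 * fine (cross K (coset_rep D) v) = 2 * rep_crossing D v.
 by move=> cD; rewrite (cross_rep v1 cD).
transitivity (\esum_(D in cosets G m) (2 * fine (cross K (coset_rep D) v))%:E)%E.
 by apply: eq_esum => D cD; rewrite (fE D cD) (cross_rep v1 cD).
rewrite active_esum//; last first.
 by move=> D cD nD; rewrite (cross_inactive v1 cD nD) mulr0.
congr EFin; apply: eq_big_seq => D; rewrite in_fset_set// => /set_mem[cD _].
exact: fE.
Qed.
Let ckern0 : ckern Y (0 : R) = 0. Proof. by rewrite /ckern normr0 mul0r mulr0. Qed.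

End Kernel.
End Counting.

(** * The Poincare inequality on segments and grids *)

Section Poincare1D.
Context {R : realType}.
Local Notation mu := (leb R).

Lemma segint_ge0 (a b : R) (g : R -> R) : (forall x, a <= x <= b -> 0 <= g x) -> 0 <= \int[mu]_(x in `[a, b]) g x.
Proof. by move=> g0; apply: Rintegral_ge0 => x; rewrite /= in_itv/=; exact: g0. Qed.

Lemma segint_sqr_shift (a b c : R) (g : R -> R) : a <= b -> continuous g ->
 \int[mu]_(x in `[a, b]) ((g x - c) ^+ 2) =
 \int[mu]_(x in `[a, b]) (g x ^+ 2) - 2 * c * \int[mu]_(x in `[a, b]) g x + c ^+ 2 * (b - a).
Proof.
move=> ab cg; rewrite -segint_cst// -segintZ; last exact: contW.
rewrite -segintB; try by apply: contW; ctn.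
rewrite -segintD; try by apply: contW; ctn.
by apply: segint_eq => x _; ring.
Qed.

Lemma segint_cauchy_schwarz (a b : R) (g : R -> R) : a < b -> continuous g ->
 (\int[mu]_(x in `[a, b]) g x) ^+ 2 <= (b - a) * \int[mu]_(x in `[a, b]) (g x ^+ 2).
Proof.
move=> ab cg; have d0 : 0 < b - a by rewrite subr_gt0.
pose c := (b - a)^-1 * \int[mu]_(x in `[a, b]) g x.
have : 0 <= \int[mu]_(x in `[a, b]) ((g x - c) ^+ 2) by apply: segint_ge0 => x _; exact: sqr_ge0.
rewrite segint_sqr_shift ?(ltW ab)// /c; move: (\int[mu]_(x in _) g x) (\int[mu]_(x in _) _) d0 => I J; move: (b - a) => d d0.
have -> : J - 2 * (d^-1 * I) * I + (d^-1 * I) ^+ 2 * d = d^-1 * (d * J - I ^+ 2) by field; rewrite gt_eqF.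
by rewrite pmulr_rge0 ?invr_gt0// subr_ge0.
Qed.

(** The mean square deviation from g(a) is bounded through the fundamental theorem and
    Cauchy-Schwarz; replacing g(a) by the mean value can only decrease it. *)
Lemma segint_poincare (a b : R) (g g' : R -> R) : a < b -> (forall x : R, is_derive x (1 : R) g (g' x)) -> continuous g' ->
 \int[mu]_(x in `[a, b]) (g x ^+ 2) <= (b - a)^-1 * (\int[mu]_(x in `[a, b]) g x) ^+ 2 +
 (b - a) ^+ 2 * \int[mu]_(x in `[a, b]) (g' x ^+ 2).
Proof.
move=> ab dg cg'; have d0 : 0 < b - a by rewrite subr_gt0.
have cg : continuous g by move=> x; exact: is_derive_cont (dg x).
have ab' := ltW ab; have cg2 : continuous (fun x => g' x ^+ 2) by ctn.
have h1 : \int[mu]_(x in `[a, b]) ((g x - g a) ^+ 2) <= (b - a) ^+ 2 * \int[mu]_(x in `[a, b]) (g' x ^+ 2).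
 apply: (@le_trans _ _ (\int[mu]_(x in `[a, b]) ((b - a) * \int[mu]_(x in `[a, b]) (g' x ^+ 2)))); last first.
 by rewrite segint_cst//; apply: eq_ler; ring.
 apply: segint_le; try by apply: contW; ctn.
 move=> x /andP[ax xb]; have := ax; rewrite le_eqVlt => /orP[/eqP <-|ax'].
 by rewrite subrr expr0n/= mulr_ge0 ?(ltW d0)//; apply: segint_ge0 => y _; exact: sqr_ge0.
 rewrite -(@segint_FTC _ a x g g' ax (@contW _ a x g' cg') (@contW _ a x g cg) (fun y _ => dg y)).
 apply: (le_trans (segint_cauchy_schwarz ax' cg')).
 rewrite ler_pM// ?subr_ge0//; first by apply: segint_ge0 => y _; exact: sqr_ge0.
 by rewrite lerD2r.
 rewrite (@segint_chasles _ a x b)//; last exact: contW.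
 by rewrite lerDl; apply: segint_ge0 => y _; exact: sqr_ge0.
move: h1; rewrite segint_sqr_shift//.
have : 0 <= (b - a) * (g a - (b - a)^-1 * \int[mu]_(x in `[a, b]) g x) ^+ 2 by rewrite mulr_ge0 ?sqr_ge0 ?ltW.
move: (\int[mu]_(x in `[a, b]) g x) (\int[mu]_(x in `[a, b]) (g x ^+ 2)) (g a) (\int[mu]_(x in `[a, b]) (g' x ^+ 2)) d0 => I J c K.
move: (b - a) => d d0; have -> : d * (c - d^-1 * I) ^+ 2 = d * c ^+ 2 - 2 * c * I + d^-1 * I ^+ 2 by field; rewrite gt_eqF.
by rewrite (mulrC (c ^+ 2)); move: (d^-1 * I ^+ 2) (2 * c * I) (d * c ^+ 2) (d ^+ 2 * K) => z w y k; lra.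
Qed.

Lemma cont_sum n (g : nat -> R -> R) : (forall k, continuous (g k)) -> continuous (fun v => \sum_(k < n) g k v).
Proof.
move=> cg; apply: contT => v; elim: n => [|n IH].
 by rewrite (_ : (fun y => _) = fun=> 0); [exact: cont_cst|apply/funext => w; rewrite big_ord0].
rewrite (_ : (fun y => _) = fun y => \sum_(k < n) g k y + g n y); last by apply/funext => w; rewrite big_ord_recr.
by apply: contD; [exact: IH|exact: cg].
Qed.

Lemma segint_sum (a b : R) n (g : nat -> R -> R) : (forall k, continuous (g k)) ->
 \int[mu]_(v in `[a, b]) (\sum_(k < n) g k v) = \sum_(k < n) \int[mu]_(v in `[a, b]) g k v.
Proof.
move=> cg; elim: n => [|n IH].
 rewrite big_ord0 (segint_eq (g := fun=> 0)); first by rewrite /Rintegral integral0.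
 by move=> v _; rewrite big_ord0.
rewrite big_ord_recr/= -IH -segintD; try by apply: contW.
 by apply: segint_eq => v _; rewrite big_ord_recr.
by apply: contW; exact: cont_sum.
Qed.

Definition grid (a d : R) (i : nat) : R := a + i%:R * d.

Lemma grid_lt (a d : R) i : 0 < d -> grid a d i < grid a d i.+1.
Proof. by move=> d0; rewrite /grid ltrD2l ltr_pM2r// ltr_nat. Qed.

Lemma segint_grid (a d : R) n (g : R -> R) : 0 < d -> continuous g ->
 \int[mu]_(x in `[a, grid a d n]) g x = \sum_(i < n) \int[mu]_(x in `[grid a d i, grid a d i.+1]) g x.
Proof.
move=> d0 cg; elim: n => [|n IH].
 by rewrite big_ord0 /grid mul0r addr0 set_itv1 Rintegral_set1.
rewrite big_ord_recr/= -IH; apply: segint_chasles; last exact: contW.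
- by rewrite /grid lerDl mulr_ge0// ltW.
- exact/ltW/grid_lt.
Qed.

Lemma grid_poincare (a d : R) n (g g' : R -> R) : 0 < d -> (forall x : R, is_derive x (1 : R) g (g' x)) -> continuous g' ->
 \int[mu]_(x in `[a, grid a d n]) (g x ^+ 2) <=
 d^-1 * \sum_(i < n) (\int[mu]_(x in `[grid a d i, grid a d i.+1]) g x) ^+ 2 +
 d ^+ 2 * \int[mu]_(x in `[a, grid a d n]) (g' x ^+ 2).
Proof.
move=> d0 dg cg'; have cg : continuous g by move=> x; exact: is_derive_cont (dg x).
rewrite !segint_grid//; try by ctn.
rewrite !mulr_sumr -big_split/=; apply: ler_sum => i _.
have dE : grid a d i.+1 - grid a d i = d by rewrite /grid -natr1; ring.
by have := segint_poincare (grid_lt a i d0) dg cg'; rewrite dE.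
Qed.
End Poincare1D.

Lemma gradient_le {R : realType} (S v x1 x2 : R) : 0 < S -> - (S / 2) <= v -> v <= S / 2 ->
 x1 ^+ 2 + (v * x1 + x2) ^+ 2 <= (2 + S ^+ 2) * (x1 ^+ 2 + x2 ^+ 2).
Proof.
move=> S0 v1 v2; have hv : v ^+ 2 <= S ^+ 2 / 4.
 have hx : `|v| <= S / 2 by rewrite ler_norml v1.
 have hS : 0 <= S / 2 by rewrite divr_ge0 ?(ltW S0).
 have h2 : `|v| ^+ 2 <= (S / 2) ^+ 2 by rewrite ler_sqr ?nnegrE.
 rewrite real_normK ?num_real// expr_div_n in h2.
 by move: h2; move: (S ^+ 2) (v ^+ 2) => z w; lra.
have h1 := sqr_ge0 (v * x1 - x2).
have h3 : v ^+ 2 * x1 ^+ 2 <= S ^+ 2 / 4 * x1 ^+ 2 by rewrite ler_wpM2r ?sqr_ge0.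
have h4 := mulr_ge0 (sqr_ge0 S) (sqr_ge0 x1); have h5 := mulr_ge0 (sqr_ge0 S) (sqr_ge0 x2).
have h6 := sqr_ge0 x1; have h7 := sqr_ge0 x2.
rewrite -subr_ge0 in h3; rewrite -subr_ge0.
have -> : (2 + S ^+ 2) * (x1 ^+ 2 + x2 ^+ 2) - (x1 ^+ 2 + (v * x1 + x2) ^+ 2) =
 (v * x1 - x2) ^+ 2 + 2 * (S ^+ 2 / 4 * x1 ^+ 2 - v ^+ 2 * x1 ^+ 2) + 2^-1 * (S ^+ 2 * x1 ^+ 2) + S ^+ 2 * x2 ^+ 2 + x1 ^+ 2 by field.
by move: h1 h3 h4 h5 h6; move: ((v * x1 - x2) ^+ 2) (_ - _) (S ^+ 2 * x1 ^+ 2) (S ^+ 2 * x2 ^+ 2) (x1 ^+ 2) => A B C D E; lra.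
Qed.

Lemma grid_algebra {R : realType} (d S C M X Z W E Q : R) : 0 < d -> M <= d * X -> X + Z <= (2 + S ^+ 2) * E -> E <= C * Q ->
 d^-1 * (d^-1 * W + d ^+ 2 * M) + d ^+ 2 * Z <= d ^- 2 * W + d ^+ 2 * (2 + S ^+ 2) * C * Q.
Proof.
move=> d0 h3 h4 h5; have d2 : 0 < d ^+ 2 by rewrite exprn_gt0.
have -> : d^-1 * (d^-1 * W + d ^+ 2 * M) + d ^+ 2 * Z = d ^- 2 * W + (d * M + d ^+ 2 * Z) by field; rewrite gt_eqF.
have -> : d ^+ 2 * (2 + S ^+ 2) * C * Q = d ^+ 2 * ((2 + S ^+ 2) * (C * Q)) by ring.
rewrite lerD2l; apply: (@le_trans _ _ (d ^+ 2 * (X + Z))).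
 by rewrite mulrDr lerD2r expr2 -mulrA ler_pM2l.
by rewrite ler_pM2l// (le_trans h4)// ler_wpM2l// addr_ge0// sqr_ge0.
Qed.

(** * Double integrals over rectangles and the Caccioppoli inequality *)

Section Rectangles.
Context {R : realType}.
Local Notation mu := (leb R).
Implicit Types h : R * R -> R.

Definition dint (a b c d : R) h := \int[mu]_(v in `[a, b]) \int[mu]_(t in `[c, d]) h (v, t).

Lemma cont_inner c d h : continuous h -> continuous (fun v => \int[mu]_(t in `[c, d]) h (v, t)).
Proof. exact: cont_under_integral. Qed.

Lemma dintD a b c d h k : continuous h -> continuous k ->
 dint a b c d (fun p => h p + k p) = dint a b c d h + dint a b c d k.
Proof.
move=> ch ck; rewrite /dint -segintD; try by apply: contW; exact: cont_inner.
by apply: segint_eq => v _; rewrite segintD//; apply: contW; exact: cont2_snd.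
Qed.

Lemma dintZ a b c d (r : R) h : continuous h -> dint a b c d (fun p => r * h p) = r * dint a b c d h.
Proof.
move=> ch; rewrite /dint -segintZ; last by apply: contW; exact: cont_inner.
by apply: segint_eq => v _; rewrite segintZ//; apply: contW; exact: cont2_snd.
Qed.

Lemma dint_le a b c d h k : continuous h -> continuous k ->
 (forall v t, a <= v <= b -> c <= t <= d -> h (v, t) <= k (v, t)) -> dint a b c d h <= dint a b c d k.
Proof.
move=> ch ck le; apply: segint_le; try by apply: contW; exact: cont_inner.
by move=> v vI; apply: segint_le; [apply: contW; exact: cont2_snd|
 apply: contW; exact: cont2_snd|move=> t; exact: le].
Qed.

Lemma dint_ge0 a b c d h : (forall p, 0 <= h p) -> 0 <= dint a b c d h.
Proof. by move=> h0; apply: segint_ge0 => v _; apply: segint_ge0. Qed.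

Lemma segint_sub_le (a b a' b' : R) (g : R -> R) : a' <= a -> a <= b -> b <= b' -> continuous g -> (forall x, 0 <= g x) ->
 \int[mu]_(x in `[a, b]) g x <= \int[mu]_(x in `[a', b']) g x.
Proof.
move=> aa ab bb cg g0.
rewrite (@segint_chasles _ a' a b') ?(le_trans ab)//; last exact: contW.
rewrite (@segint_chasles _ a b b')//; last exact: contW.
by rewrite addrA addrAC -[leLHS]add0r lerD// addr_ge0//; apply: segint_ge0.
Qed.

Lemma dint_sub_le a b c d a' b' c' d' h : a' <= a -> a <= b -> b <= b' -> c' <= c -> c <= d -> d <= d' ->
 continuous h -> (forall p, 0 <= h p) -> dint a b c d h <= dint a' b' c' d' h.
Proof.
move=> aa ab bb cc cd dd ch h0.
apply: (@le_trans _ _ (dint a b c' d' h)).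
 apply: segint_le; try by apply: contW; exact: cont_inner.
 by move=> v _; apply: segint_sub_le => //; exact: cont2_snd.
by apply: segint_sub_le => //; [exact: cont_inner|move=> v; apply: segint_ge0].
Qed.

Section Caccioppoli.
Variables (f X1 X2 b1 b2 : R * R -> R) (lam S : R).
Hypotheses (cf : continuous f) (cX1 : continuous X1) (cX2 : continuous X2) (cb1 : continuous b1) (cb2 : continuous b2).
Hypothesis dfv : forall v t : R, is_derive v (1 : R) (fun v => f (v, t)) (X1 (v, t)).
Hypothesis dft : forall v t : R, is_derive t (1 : R) (fun t => f (v, t)) (v * X1 (v, t) + X2 (v, t)).
Hypothesis da1 : forall v t : R, is_derive v (1 : R) (fun v => X1 (v, t) - v * X2 (v, t)) (b1 (v, t)).
Hypothesis da2 : forall v t : R, is_derive t (1 : R) (fun t => X2 (v, t)) (b2 (v, t)).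
Hypothesis bE : forall p, b1 p + b2 p = - lam * f p.
Hypotheses (S0 : 0 < S) (lam0 : 0 <= lam) (lam1 : lam <= 1).

Let al (x : R) := S ^+ 2 - x ^+ 2.
Let phi (p : R * R) := al p.1 * al p.2.
Let Phi (p : R * R) := (al p.1 * al p.2) ^+ 2 * f p * (X1 p - p.1 * X2 p).
Let Phi' (p : R * R) := 2 * phi p * (- (2 * p.1) * al p.2) * f p * (X1 p - p.1 * X2 p)
 + phi p ^+ 2 * X1 p * (X1 p - p.1 * X2 p) + phi p ^+ 2 * f p * b1 p.
Let Psi' (p : R * R) := 2 * phi p * (al p.1 * (- (2 * p.2))) * f p * X2 p
 + phi p ^+ 2 * (p.1 * X1 p + X2 p) * X2 p + phi p ^+ 2 * f p * b2 p.

Let cal (x : R) : {for x, continuous al}. Proof. by rewrite /al; ctn. Qed.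
Let cphi : continuous phi.
Proof. by rewrite /phi /al; ctn. Qed.
Let cPhi : continuous Phi.
Proof. by rewrite /Phi /al; ctn. Qed.
Let cPhi' : continuous Phi'.
Proof. by rewrite /Phi' /phi /al; ctn. Qed.
Let cPsi' : continuous Psi'.
Proof. by rewrite /Psi' /phi /al; ctn. Qed.
Let dPhi (v t : R) : is_derive v (1 : R) (fun v => Phi (v, t)) (Phi' (v, t)).
Proof.
rewrite /Phi /al /=; apply: is_derive_eq; rewrite /Phi' /phi /al /= /GRing.scale /=; ring.
Qed.
Let dPsi (v t : R) : is_derive t (1 : R) (fun t => (al v * al t) ^+ 2 * f (v, t) * X2 (v, t)) (Psi' (v, t)).
Proof.
rewrite /al /=; apply: is_derive_eq; rewrite /Psi' /phi /al /= /GRing.scale /=; ring.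
Qed.
Let al_end : al S = 0 /\ al (- S) = 0.
Proof. by rewrite /al sqrrN subrr. Qed.
Let SS : - S <= S. Proof. by rewrite (le_trans _ (ltW S0))// oppr_le0 ltW. Qed.
Let int_Phi' : dint (- S) S (- S) S Phi' = 0.
Proof.
have [e1 e2] := al_end.
rewrite /dint (@segint_FTC _ (- S) S (fun v => \int[mu]_(t in `[- S, S]) Phi (v, t)))//.
- have z v : al v = 0 -> \int[mu]_(t in `[- S, S]) Phi (v, t) = 0.
 move=> v0; rewrite (@segint_eq _ _ _ (fun t => Phi (v, t)) (fun=> 0)); first by rewrite /Rintegral integral0.
 by move=> t _; rewrite /Phi /= v0 mul0r expr0n/= !mul0r.
 by rewrite !z// subrr.
- by apply: contW; exact: cont_inner.
- by apply: contW; exact: cont_inner.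
- by move=> v _; exact: is_derive_under_integral.
Qed.
Let int_Psi' : dint (- S) S (- S) S Psi' = 0.
Proof.
have [e1 e2] := al_end.
rewrite /dint (segint_eq (g := fun=> 0)) => [|v _]; first by rewrite /Rintegral integral0.
rewrite (@segint_FTC _ (- S) S (fun t => (al v * al t) ^+ 2 * f (v, t) * X2 (v, t)))//.
- by rewrite e1 e2 mulr0 expr0n/= !mul0r subrr.
- by apply: contW; exact: cont2_snd.
- by apply: contW => t; exact: is_derive_cont (dPsi v t).
Qed.

(** The three summands bound the two gradient terms of the cut-off and lam times its square, for lam
    <= 1. *)
Definition cac_const (S : R) := 8 * S ^+ 6 + 2 * (2 * S ^+ 3 + 2 * S ^+ 4) ^+ 2 + S ^+ 8.

(** The field (X1 - v X2, X2) has divergence - lam f. Multiplied by phi^2 f, with phi zero on the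
    boundary of the square, its divergence integrates to 0 and contains phi^2 (X1^2 + X2^2), since
    the cross terms v X1 X2 cancel. The other terms are absorbed by completing squares. *)
Lemma caccioppoli_weighted : dint (- S) S (- S) S (fun p => phi p ^+ 2 * (X1 p ^+ 2 + X2 p ^+ 2)) <=
 2 * cac_const S * dint (- S) S (- S) S (fun p => f p ^+ 2).
Proof.
have c1 : continuous (fun p => phi p ^+ 2 * (X1 p ^+ 2 + X2 p ^+ 2)) by ctn.
have c2 : continuous (fun p => f p ^+ 2) by ctn.
have c3 : continuous (fun p => Phi' p + Psi' p) by apply: contT => p; apply: contD; [exact: cPhi'|exact: cPsi'].
have c4 : continuous (fun p => cac_const S * f p ^+ 2) by ctn.
have c5 : continuous (fun p => 2^-1 * (phi p ^+ 2 * (X1 p ^+ 2 + X2 p ^+ 2))).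
 by apply: contT => p; apply: contM; [exact: cont_cst|exact: c1].
have : dint (- S) S (- S) S (fun p => 2^-1 * (phi p ^+ 2 * (X1 p ^+ 2 + X2 p ^+ 2))) <=
 dint (- S) S (- S) S (fun p => (Phi' p + Psi' p) + cac_const S * f p ^+ 2).
 apply: dint_le => //; first by apply: contT => p; apply: contD; [exact: c3|exact: c4].
 move=> v t vI tI; have v1 : `|v| <= S by rewrite ler_norml.
 have t1 : `|t| <= S by rewrite ler_norml.
 have a1 : 0 <= al v <= S ^+ 2.
 by rewrite /al subr_ge0 gerBl sqr_ge0 andbT -(real_normK (num_real v)) ler_sqr ?nnegrE// ltW.
 have a2 : 0 <= al t <= S ^+ 2.
 by rewrite /al subr_ge0 gerBl sqr_ge0 andbT -(real_normK (num_real t)) ler_sqr ?nnegrE// ltW.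
 have := bE (v, t); rewrite /Phi' /Psi' /phi /=.
 set pv := - (2 * v) * al t; set pt := al v * - (2 * t).
 have S30 := ltW S0.
 have pvB : `|pv| <= 2 * S ^+ 3.
 rewrite /pv normrM normrN normrM (ger0_norm (x := 2))// (ger0_norm (x := al t)); last by case/andP: a2.
 by rewrite (_ : 2 * S ^+ 3 = 2 * S * S ^+ 2); [rewrite ler_pM ?mulr_ge0// ?ler_wpM2l//; case/andP: a2|ring].
 have ptB : `|pt| <= 2 * S ^+ 3.
 rewrite /pt normrM normrN normrM (ger0_norm (x := 2))// (ger0_norm (x := al v)); last by case/andP: a1.
 by rewrite (_ : 2 * S ^+ 3 = S ^+ 2 * (2 * S)); [rewrite ler_pM ?mulr_ge0// ?ler_wpM2l//; case/andP: a1|ring].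
 have qB : `|pt - v * pv| <= 2 * S ^+ 3 + 2 * S ^+ 4.
 apply: (le_trans (ler_normB _ _)); apply: lerD => //; rewrite normrM.
 by rewrite (_ : 2 * S ^+ 4 = S * (2 * S ^+ 3)); [rewrite ler_pM|ring].
 have pv2 : pv ^+ 2 <= 4 * S ^+ 6.
 rewrite -(real_normK (num_real pv)) (_ : 4 * S ^+ 6 = (2 * S ^+ 3) ^+ 2); last by ring.
 by rewrite ler_sqr// nnegrE mulr_ge0// exprn_ge0.
 have q2 : (pt - v * pv) ^+ 2 <= (2 * S ^+ 3 + 2 * S ^+ 4) ^+ 2.
 rewrite -(real_normK (num_real (pt - v * pv))).
 by rewrite ler_sqr// nnegrE addr_ge0// mulr_ge0// exprn_ge0.
 have ph2 : (al v * al t) ^+ 2 <= S ^+ 8.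
 case/andP: a1 => a10 a11; case/andP: a2 => a20 a21.
 rewrite (_ : S ^+ 8 = (S ^+ 2 * S ^+ 2) ^+ 2); last by ring.
 by rewrite ler_sqr ?nnegrE ?mulr_ge0 ?sqr_ge0// ler_pM.
 move: (al v * al t) ph2 pv2 q2 => F ph2 pv2 q2 {pvB ptB qB}.
 rewrite /cac_const; move: (f (v, t)) (X1 (v, t)) (X2 (v, t)) (b1 (v, t)) (b2 (v, t)) => z x1 x2 c1' c2' E.
 have -> : F ^+ 2 * z * c1' = - lam * (F ^+ 2 * z ^+ 2) - F ^+ 2 * z * c2'.
 by rewrite (_ : - lam * (F ^+ 2 * z ^+ 2) = F ^+ 2 * z * (c1' + c2')); [ring|rewrite E; ring].
 have l1 : lam * (F ^+ 2 * z ^+ 2) <= S ^+ 8 * z ^+ 2.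
 by rewrite mulrA ler_wpM2r ?sqr_ge0// (le_trans _ ph2)// ler_piMl// sqr_ge0.
 have l2 : pv ^+ 2 * z ^+ 2 <= 4 * S ^+ 6 * z ^+ 2 by rewrite ler_wpM2r// sqr_ge0.
 have l3 : (pt - v * pv) ^+ 2 * z ^+ 2 <= (2 * S ^+ 3 + 2 * S ^+ 4) ^+ 2 * z ^+ 2 by rewrite ler_wpM2r// sqr_ge0.
 have n1 := sqr_ge0 (F * x1 + 2 * (pv * z)); have n2 := sqr_ge0 (F * x2 + 2 * ((pt - v * pv) * z)).
 rewrite -subr_ge0.
 have -> : 2 * F * pv * z * (x1 - v * x2) + F ^+ 2 * x1 * (x1 - v * x2) +
 (- lam * (F ^+ 2 * z ^+ 2) - F ^+ 2 * z * c2') +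
 (2 * F * pt * z * x2 + F ^+ 2 * (v * x1 + x2) * x2 + F ^+ 2 * z * c2') +
 (8 * S ^+ 6 + 2 * (2 * S ^+ 3 + 2 * S ^+ 4) ^+ 2 + S ^+ 8) * z ^+ 2 - 2^-1 * (F ^+ 2 * (x1 ^+ 2 + x2 ^+ 2)) =
 2^-1 * (F * x1 + 2 * (pv * z)) ^+ 2 + 2^-1 * (F * x2 + 2 * ((pt - v * pv) * z)) ^+ 2
 + (S ^+ 8 * z ^+ 2 - lam * (F ^+ 2 * z ^+ 2)) + 2 * (4 * S ^+ 6 * z ^+ 2 - pv ^+ 2 * z ^+ 2)
 + 2 * ((2 * S ^+ 3 + 2 * S ^+ 4) ^+ 2 * z ^+ 2 - (pt - v * pv) ^+ 2 * z ^+ 2) by field.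
 have h1 : 0 <= 2^-1 :> R by rewrite invr_ge0.
 have h2 : 0 <= 2 :> R by [].
 rewrite -subr_ge0 in l1; rewrite -subr_ge0 in l2; rewrite -subr_ge0 in l3.
 exact: (addr_ge0 (addr_ge0 (addr_ge0 (addr_ge0 (mulr_ge0 h1 n1) (mulr_ge0 h1 n2)) l1) (mulr_ge0 h2 l2)) (mulr_ge0 h2 l3)).
rewrite (@dintZ _ _ _ _ _ _ c1) (@dintD _ _ _ _ _ _ c3 c4) (@dintD _ _ _ _ _ _ cPhi' cPsi') int_Phi' int_Psi' !add0r (@dintZ _ _ _ _ _ _ c2).
by move: (dint _ _ _ _ _) (dint _ _ _ _ _) => I J; rewrite -(mulrA 2); lra.
Qed.

Lemma caccioppoli : dint (- (S / 2)) (S / 2) (- (S / 2)) (S / 2) (fun p => X1 p ^+ 2 + X2 p ^+ 2) <=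
 8 * cac_const S / S ^+ 8 * dint (- S) S (- S) S (fun p => f p ^+ 2).
Proof.
have c0 : continuous (fun p => X1 p ^+ 2 + X2 p ^+ 2) by ctn.
have c1 : continuous (fun p => phi p ^+ 2 * (X1 p ^+ 2 + X2 p ^+ 2)) by ctn.
have S8 : 0 < S ^+ 8 by rewrite exprn_gt0.
have h : dint (- (S / 2)) (S / 2) (- (S / 2)) (S / 2) (fun p => 4^-1 * S ^+ 8 * (X1 p ^+ 2 + X2 p ^+ 2)) <=
 dint (- S) S (- S) S (fun p => phi p ^+ 2 * (X1 p ^+ 2 + X2 p ^+ 2)).
 apply: (@le_trans _ _ (dint (- (S / 2)) (S / 2) (- (S / 2)) (S / 2) (fun p => phi p ^+ 2 * (X1 p ^+ 2 + X2 p ^+ 2)))).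
 apply: dint_le => //; first by ctn.
 move=> v t vI tI; rewrite ler_wpM2r ?addr_ge0 ?sqr_ge0// /phi /=.
 have key x : - (S / 2) <= x <= S / 2 -> 3 / 4 * S ^+ 2 <= al x.
 move=> /andP[x1 x2]; rewrite /al; have hx : `|x| <= S / 2 by rewrite ler_norml x1.
 have hS : 0 <= S / 2 by rewrite divr_ge0 ?(ltW S0).
 have h2 : `|x| ^+ 2 <= (S / 2) ^+ 2 by rewrite ler_sqr ?nnegrE.
 rewrite real_normK ?num_real// expr_div_n in h2.
 by move: h2; move: (S ^+ 2) (x ^+ 2) => z w; lra.
 have k1 := key v vI; have k2 := key t tI; have S2 : 0 <= 3 / 4 * S ^+ 2 by rewrite mulr_ge0 ?sqr_ge0.
 have : 9 / 16 * S ^+ 4 <= al v * al t.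
 by rewrite (_ : 9 / 16 * S ^+ 4 = (3 / 4 * S ^+ 2) * (3 / 4 * S ^+ 2)); [rewrite ler_pM|field].
 have S4 : 0 <= 9 / 16 * S ^+ 4 by rewrite mulr_ge0 ?exprn_ge0// ltW.
 have al1 := le_trans S2 k1; have al2 := le_trans S2 k2.
 move=> H; have {H} : (9 / 16 * S ^+ 4) ^+ 2 <= (al v * al t) ^+ 2 by rewrite ler_sqr// nnegrE// mulr_ge0.
 apply: le_trans; rewrite (_ : (9 / 16 * S ^+ 4) ^+ 2 = 81 / 256 * S ^+ 8); last by field.
 by rewrite ler_wpM2r ?(ltW S8)//; lra.
 apply: dint_sub_le => //; try by have := S0; lra.
 by move=> p; rewrite mulr_ge0 ?addr_ge0 ?sqr_ge0.
have := le_trans h caccioppoli_weighted; rewrite dintZ//.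
rewrite -(ler_pM2l (x := (4^-1 * S ^+ 8)^-1)) ?invr_gt0 ?mulr_gt0//.
rewrite mulrA mulVf ?mul1r ?gt_eqF ?mulr_gt0//.
move=> H; apply: (le_trans H); apply: eq_ler.
by move: (dint _ _ _ _ _) (cac_const S) => I J; field; rewrite gt_eqF.
Qed.


(** The Poincare inequality in both directions on n^2 cells, with the gradient bounded by
    Caccioppoli: up to a term of order d^2, the norm on the inner square is controlled by the cell
    integrals. *)
Lemma grid_lower (n : nat) (d : R) : (0 < n)%N -> d = S / n%:R ->
 dint (- (S / 2)) (S / 2) (- (S / 2)) (S / 2) (fun p => f p ^+ 2) <=
 d ^- 2 * (\sum_(k < n) \sum_(i < n) (dint (grid (- (S / 2)) d i) (grid (- (S / 2)) d i.+1)
 (grid (- (S / 2)) d k) (grid (- (S / 2)) d k.+1) f) ^+ 2) +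
 d ^+ 2 * (2 + S ^+ 2) * (8 * cac_const S / S ^+ 8) * dint (- S) S (- S) S (fun p => f p ^+ 2).
Proof.
move=> n0 dE; have d0 : 0 < d by rewrite dE divr_gt0// ltr0n.
have gE : grid (- (S / 2)) d n = S / 2.
 by rewrite /grid dE; field; rewrite pnatr_eq0 -lt0n.
set a := - (S / 2); set b := S / 2; rewrite -/a -/b in gE.
have cf2 : continuous (fun p => f p ^+ 2) by ctn.
have cft : continuous (fun p : R * R => (p.1 * X1 p + X2 p) ^+ 2) by ctn.
have cX1s : continuous (fun p => X1 p ^+ 2) by ctn.
pose mk (k : nat) (v : R) := \int[mu]_(t in `[grid a d k, grid a d k.+1]) f (v, t).
pose mk' (k : nat) (v : R) := \int[mu]_(t in `[grid a d k, grid a d k.+1]) X1 (v, t).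
have dmk k (v : R) : is_derive v (1 : R) (mk k) (mk' k v) by exact: is_derive_under_integral.
have cmk k : continuous (mk k) by exact: cont_inner.
have cmk' k : continuous (mk' k) by exact: cont_inner.
have gpos k : grid a d k.+1 - grid a d k = d by rewrite /grid -natr1; ring.
have step1 : dint a b a b (fun p => f p ^+ 2) <= d^-1 * (\sum_(k < n) \int[mu]_(v in `[a, b]) (mk k v ^+ 2)) +
 d ^+ 2 * dint a b a b (fun p => (p.1 * X1 p + X2 p) ^+ 2).
 have cs : continuous (fun v => \sum_(k < n) mk k v ^+ 2).
 by apply: (@cont_sum _ n (fun k v => mk k v ^+ 2)) => k; apply: contT => v; apply: contX; exact: cmk.
 have ci : continuous (fun v : R => \int[mu]_(t in `[a, b]) ((v * X1 (v, t) + X2 (v, t)) ^+ 2)).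
 exact: (@cont_under_integral _ (fun p : R * R => (p.1 * X1 p + X2 p) ^+ 2) a b cft).
 rewrite -(@segint_sum _ a b n (fun k v => mk k v ^+ 2)) => [|k]; last by apply: contT => v; apply: contX; exact: cmk.
 rewrite {2}/dint -(segintZ _ (@contW _ a b _ cs)) -(segintZ _ (@contW _ a b _ ci)) -segintD; last 2 first.
 - by apply: contW; apply: contT => v; apply: contM; [exact: cont_cst|exact: cs].
 - by apply: contW; apply: contT => v; apply: contM; [exact: cont_cst|exact: ci].
 apply: segint_le.
 - by apply: contW; exact: (@cont_under_integral _ (fun p : R * R => f p ^+ 2) _ _ cf2).
 - apply: contW; apply: contT => v; apply: contD.
 by apply: contM; [exact: cont_cst|exact: cs].
 by apply: contM; [exact: cont_cst|exact: ci].
 move=> v _; have := @grid_poincare _ a d n (fun t => f (v, t)) _ d0 (dft v).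
 rewrite gE => H; apply: H.
 by apply: (@cont2_snd _ (fun p : R * R => p.1 * X1 p + X2 p)); ctn.
have step2 k : \int[mu]_(v in `[a, b]) (mk k v ^+ 2) <=
 d^-1 * (\sum_(i < n) (dint (grid a d i) (grid a d i.+1) (grid a d k) (grid a d k.+1) f) ^+ 2)
 + d ^+ 2 * \int[mu]_(v in `[a, b]) (mk' k v ^+ 2).
 by have := @grid_poincare _ a d n (mk k) (mk' k) d0 (dmk k) (cmk' k); rewrite gE.
have step3 : \sum_(k < n) \int[mu]_(v in `[a, b]) (mk' k v ^+ 2) <= d * dint a b a b (fun p => X1 p ^+ 2).
 have cJ (k : nat) : continuous (fun v => \int[mu]_(t in `[grid a d k, grid a d k.+1]) (X1 (v, t) ^+ 2)).
 exact: (@cont_under_integral _ (fun p : R * R => X1 p ^+ 2) _ _ cX1s).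
 have -> : dint a b a b (fun p => X1 p ^+ 2) =
 \sum_(k < n) \int[mu]_(v in `[a, b]) \int[mu]_(t in `[grid a d k, grid a d k.+1]) (X1 (v, t) ^+ 2).
 rewrite -(@segint_sum _ a b n (fun k v => \int[mu]_(t in `[grid a d k, grid a d k.+1]) (X1 (v, t) ^+ 2)))//.
 apply: segint_eq => v _; rewrite -segint_grid ?gE//.
 exact: (@cont2_snd _ (fun p => X1 p ^+ 2)).
 rewrite mulr_sumr; apply: ler_sum => k _; rewrite -segintZ; last exact: contW.
 apply: segint_le; first by apply: contW; apply: contT => v; apply: contX; exact: cmk'.
 by apply: contW; apply: contT => v; apply: contM; [exact: cont_cst|exact: cJ].
 move=> v _; have := segint_cauchy_schwarz (grid_lt a k d0) (@cont2_snd _ X1 v cX1).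
 by rewrite gpos.
have cac := caccioppoli.
have c0 : continuous (fun p => X1 p ^+ 2 + X2 p ^+ 2) by ctn.
have step4 : dint a b a b (fun p => X1 p ^+ 2) + dint a b a b (fun p => (p.1 * X1 p + X2 p) ^+ 2) <=
 (2 + S ^+ 2) * dint a b a b (fun p => X1 p ^+ 2 + X2 p ^+ 2).
 rewrite -dintD// -dintZ//; apply: dint_le.
 - by ctn.
 - by ctn.
 by move=> v t /andP[v1 v2] _ /=; exact: gradient_le S0 v1 v2.
have d2 : 0 < d ^+ 2 by rewrite exprn_gt0.
apply: (le_trans step1).
apply: (@le_trans _ _ (d^-1 * (\sum_(k < n) (d^-1 * (\sum_(i < n) (dint (grid a d i) (grid a d i.+1) (grid a d k) (grid a d k.+1) f) ^+ 2)
 + d ^+ 2 * \int[mu]_(v in `[a, b]) (mk' k v ^+ 2))) + d ^+ 2 * dint a b a b (fun p => (p.1 * X1 p + X2 p) ^+ 2))).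
 by rewrite lerD2r ler_wpM2l ?invr_ge0 ?(ltW d0)//; apply: ler_sum => k _; exact: step2.
rewrite big_split/= -!mulr_sumr.
exact: (grid_algebra _ d0 step3 step4 cac).
Qed.


End Caccioppoli.
End Rectangles.

Lemma small_algebra {R : realType} (a W X : R) : X <= 4^-1 -> 1 <= 2 * a -> a <= W + X -> 4^-1 <= W.
Proof. lra. Qed.

(** * Finiteness of the set of small eigenvalues *)

Section SmallEigenvalues.
Context {R : realType}.
Local Notation plane := (planeT R).
Local Notation mu := (leb R).
Local Notation L := (leb2 R).

Lemma cac_const_ge0 (S : R) : 0 < S -> 0 <= cac_const S.
Proof.
move=> S0; have h n : 0 <= S ^+ n by rewrite exprn_ge0// ltW.
rewrite /cac_const; apply: addr_ge0; last exact: h.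
by apply: addr_ge0; apply: mulr_ge0 => //; exact: sqr_ge0.
Qed.

Definition rect (a b c d : R) : set plane := `[a, b]%classic `*` `[c, d]%classic.

Lemma measurable_rect a b c d : measurable (rect a b c d).
Proof. by apply: measurableX; exact: measurable_itv. Qed.

Lemma rect_vol a b c d : (L (rect a b c d) < +oo)%E.
Proof.
rewrite /rect product_measure1E//=; try exact: measurable_itv.
by rewrite !lebesgue_measure_itv/=; case: ifP => _; case: ifP => _; rewrite ?mule0 ?mul0e ?ltry//.
Qed.

Lemma rect_integral a b c d (h : plane -> R) : continuous (h : R * R -> R) -> mfun h ->
 (\int[L]_p (\1_(rect a b c d) p * h p)%:E = (dint a b c d h)%:E)%E.
Proof.
move=> ch mh; have [M HM] := rectangle_bounded a b c d ch.
have mf : mfun (fun p : plane => \1_(rect a b c d) p * h p : R).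
 by apply: measurable_funM => //; apply: measurable_indic; exact: measurable_rect.
have I : L.-integrable setT (fun p => (\1_(rect a b c d) p * h p)%:E).
 apply: (@le_integrable _ _ _ L setT measurableT _ (fun p => (\1_(rect a b c d) p * `|M|)%:E)).
 - exact/measurable_EFinP.
 - move=> p _; rewrite !abse_EFin lee_fin !normrM normr_id !indicE.
 case: (boolP (p \in rect a b c d)) => [|_]; last by rewrite normr0 !mul0r.
 rewrite inE => -[/= p1 p2]; rewrite normr1 !mul1r; move: p1 p2; rewrite !in_itv/= => p1 p2.
 by case: p p1 p2 => v t /= p1 p2; rewrite (le_trans (HM v t p1 p2))// ler_norm.
 - have -> : (fun p => (\1_(rect a b c d) p * `|M|)%:E) = (fun p : plane => (`|M|%:E * (\1_(rect a b c d) p : R)%:E)%E).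
 by apply/funext => p; rewrite -EFinM mulrC.
 have I1 : L.-integrable setT (fun p : plane => (\1_(rect a b c d) p : R)%:E).
 apply/integrableP; split; first by apply/measurable_EFinP; apply: measurable_indic; exact: measurable_rect.
 under eq_integral => p _ do rewrite abse_EFin ger0_norm ?indicE//.
 rewrite integral_indic//; last exact: measurable_rect.
 by rewrite setIT; exact: rect_vol.
 exact: integrableZl.
rewrite -(integral12_prod_meas1 I) /dint.
have ci := @cont_under_integral _ h c d ch.
have Iv := segint_itg (@contW _ a b _ ci).
rewrite {2}/Rintegral fineK; last exact: integrable_fin_num Iv.
rewrite [RHS]integral_mkcond; apply: eq_integral => v _; rewrite /fubini_F patchE.
have It := segint_itg (@contW _ c d _ (@cont2_snd _ h v ch)).
case: ifPn => [vI|vI].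
 rewrite /= /Rintegral fineK; last exact: integrable_fin_num It.
 rewrite [RHS]integral_mkcond; apply: eq_integral => t _; rewrite patchE indicE.
 have -> : ((v, t) \in rect a b c d) = (t \in `[c, d]%classic).
 by apply/idP/idP; rewrite !inE; [case|move=> tI; split => //; move: vI; rewrite inE].
 by case: ifP; rewrite ?mul1r// mul0r.
rewrite integral0_eq// => t _; rewrite indicE (_ : (v, t) \in _ = false) ?mul0r//.
by apply/negbTE; apply/negP; rewrite inE => -[/= v1 _]; move/negP: vI; apply; rewrite inE.
Qed.

Variables (G : set 'M[R]_2).
Hypotheses (subG : psl2_subgroup G) (discG : discrete_subgroup G) (cocG : cocompact G).
Variable e : nat -> 'M[R]_2.
Hypothesis bij_e : set_bij [set: nat] G e.
Variables (F : set (R * R)) (u : nat -> R * R -> R) (lam : nat -> R).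
Hypotheses (fundF : fundamental_set G F) (sysu : complete_orthonormal_system G F u).
Hypothesis eigu : forall j, eigenfunction G (lam j) (u j).
Hypothesis lam0 : forall j, 0 <= lam j.
Local Notation F' := ((@hpt R) @^-1` F : set plane).

Let C2u j : C2 (u j). Proof. by case: (eigu j). Qed.
Let mF' : measurable F'. Proof. exact: measurable_fund fundF. Qed.
Let fundF' p := fund_unique subG fundF p.

Let cue j : continuous (ue u j : R * R -> R).
Proof. by apply: cont_comp_hpt; case: (C2u j) => -[]. Qed.
Let mue j : mfun (ue u j).
Proof. by have [] := ue_L2 fundF sysu j. Qed.
Let cue2 j : continuous (fun p : R * R => ue u j p ^+ 2).
Proof. by have := @cue j => c; ctn. Qed.
Let mue2 j : mfun (fun p : plane => ue u j p ^+ 2).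
Proof. exact: measurable_funX. Qed.
Let norm_ue j : (\int[L]_(p in F') (ue u j p ^+ 2)%:E = 1)%E.
Proof. by rewrite (integral_sqE mF' (ue_L2 fundF sysu j)) (ue_orthonormal fundF sysu) eqxx. Qed.

(** The data are X1 = y u_x and X2 = y u_y; the divergence identity is the eigenvalue equation
    written in (v, t). *)
Lemma grid_lower_ue S n (d : R) j : 0 < S -> lam j <= 1 -> (0 < n)%N -> d = S / n%:R ->
 dint (- (S / 2)) (S / 2) (- (S / 2)) (S / 2) (fun p => ue u j p ^+ 2) <=
 d ^- 2 * (\sum_(k < n) \sum_(i < n) (dint (grid (- (S / 2)) d i) (grid (- (S / 2)) d i.+1)
 (grid (- (S / 2)) d k) (grid (- (S / 2)) d k.+1) (ue u j)) ^+ 2) +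
 d ^+ 2 * (2 + S ^+ 2) * (8 * cac_const S / S ^+ 8) * dint (- S) S (- S) S (fun p => ue u j p ^+ 2).
Proof.
move=> S0 lam1 n0 dE; have [C1u C1x C1y] := C2u j.
have [c0 _ cx cy] := C1u; have [_ _ cxx cxy'] := C1x; have [_ _ cyx cyy] := C1y.
have C h : C0 h -> continuous (fun p : R * R => h (hpt p)) by exact: cont_comp_hpt.
have fE h : C0 h -> exists2 k : R * R -> R, continuous k & forall v t, k (v, t) = h (hpt (v, t)).
 by move=> ch; exists (fun p => h (hpt p)) => //; exact: C.
have [ux k1 uxE] := fE _ cx; have [uy k2 uyE] := fE _ cy; have [uxx k3 uxxE] := fE _ cxx.
have [uxy k4 uxyE] := fE _ cyx; have [uyy k5 uyyE] := fE _ cyy.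
have R1 (E v a xx b xy : R) : 0 * a + E * (E * xx) - (1 * (E * b) + v * (0 * b + E * (E * xy))) =
 E * (E * xx) - (E * b + v * (E * (E * xy))) by ring.
have R2 (E v b xy yy : R) : E * b + E * (E * (v * xy + yy)) = E * b + E * (E * (v * xy + yy)) by [].
have R3 (E v xx b xy yy : R) : E * (E * xx) - (E * b + v * (E * (E * xy))) + (E * b + E * (E * (v * xy + yy))) =
 - (- E ^+ 2 * (xx + yy)) by ring.
pose X1 (p : R * R) := expR p.2 * ux p.
pose X2 (p : R * R) := expR p.2 * uy p.
pose b1 (p : R * R) := expR p.2 * (expR p.2 * uxx p) - (expR p.2 * uy p + p.1 * (expR p.2 * (expR p.2 * uxy p))).
pose b2 (p : R * R) := expR p.2 * uy p + expR p.2 * (expR p.2 * (p.1 * uxy p + uyy p)).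
have cX1 : continuous X1 by rewrite /X1; ctn.
have cX2 : continuous X2 by rewrite /X2; ctn.
have cb1 : continuous b1 by rewrite /b1; ctn.
have cb2 : continuous b2 by rewrite /b2; ctn.
apply: (@grid_lower R (ue u j) X1 X2 b1 b2 (lam j) S (@cue j) cX1 cX2 cb1 cb2) => //.
- by move=> v t; rewrite /X1 /= uxE; exact: is_derive_hpt_fst.
- move=> v t; have := @is_derive_hpt_snd _ (u j) v t C1u => H; apply: is_derive_eq H _.
 by rewrite /X1 /X2 /= uxE uyE; ring.
- move=> v t; have h1 := @is_derive_hpt_fst _ (dx (u j)) v t C1x; have h2 := @is_derive_hpt_fst _ (dy (u j)) v t C1y.
 have e1 : (fun v => X1 (v, t) - v * X2 (v, t)) = (fun v => expR t * dx (u j) (hpt (v, t)) + - (v * (expR t * dy (u j) (hpt (v, t))))).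
 by apply/funext => w; rewrite /X1 /X2 /= uxE uyE.
 have := is_derive1D (is_derive1M (is_derive1_cst (expR t) v) h1)
 (is_derive1N (is_derive1M (is_derive1_id v) (is_derive1M (is_derive1_cst (expR t) v) h2))).
 by rewrite e1 => H; apply: is_derive_eq H _; rewrite R1 /b1 /= uxxE uxyE uyE.
- move=> v t; have h2 := @is_derive_hpt_snd _ (dy (u j)) v t C1y.
 have e1 : (fun t => X2 (v, t)) = (fun t => expR t * dy (u j) (hpt (v, t))).
 by apply/funext => w; rewrite /X2 /= uyE.
 have := is_derive1M (is_derive_expR t) h2.
 by rewrite e1 => H; apply: is_derive_eq H _; rewrite /b2 /= uyE uxyE uyyE.
- move=> [v t]; have [_ _ lapu] := eigu j; have := lapu _ (hpt_gt0 (v, t)); rewrite /hyp_laplacian => E.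
 by rewrite [- lam j * _]mulNr -[lam j * _]E /b1 /b2 /= uxxE uxyE uyE uyyE R3.
Qed.
Let indic0 a b c d (p : plane) : 0 <= (\1_(rect a b c d) p : R). Proof. by rewrite indicE. Qed.
Let mrect a b c d : mfun (\1_(rect a b c d) : plane -> R).
Proof. by apply: measurable_indic; exact: measurable_rect. Qed.
Let unfold_rect a b c d j :
 (\int[L]_(p in F') ((\sum_(n <oo) (\1_(rect a b c d) (hact (e n) p) : R)%:E) * (ue u j p ^+ 2)%:E) =
 2%:E * (dint a b c d (fun p => ue u j p ^+ 2))%:E)%E.
Proof.
rewrite -(rect_integral a b c d (@cue2 j) (@mue2 j)).
apply: (poincare_unfolding subG bij_e mF' fundF') => //.
- by move=> p; exact: sqr_ge0.
- by move=> g p Gg; rewrite (ue_hact subG sysu j p Gg).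
Qed.

(** The inner square contains a box meeting every orbit, so a normalised eigenfunction has mass at
    least 1/2 there; on the outer square its mass is at most M. For a fine enough grid the gradient
    term is at most 1/4, so d^-2 times the sum of the squared cell integrals is at least 1/4 for
    each such eigenfunction. Bessel's inequality for the Poincare series of the cells bounds the
    total over all eigenfunctions. *)
Lemma finite_small_eigenvalues : finite_set [set j | lam j <= 4^-1].
Proof.
have [A [T HAT]] := cocompact_box subG cocG.
pose S := 2 * Num.max 1 (Num.max A T).
have S20 : 0 < S / 2 by rewrite mulrAC mulfV// mul1r lt_max ltr01.
have S0 : 0 < S by move: S20; rewrite pmulr_lgt0 ?invr_gt0.
have AS : A <= S / 2 by rewrite mulrAC mulfV// mul1r !le_max lexx !orbT.
have TS : T <= S / 2 by rewrite mulrAC mulfV// mul1r !le_max lexx !orbT.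
have [M M0 HM] := box_overlap subG discG cocG S S.
have low j : 1 <= 2 * dint (- (S / 2)) (S / 2) (- (S / 2)) (S / 2) (fun p => ue u j p ^+ 2).
 rewrite -lee_fin EFinM -unfold_rect -(norm_ue j).
 apply: ge0_le_integral => //.
 - by move=> p _; rewrite lee_fin sqr_ge0.
 - by apply: measurable_funTS; apply/measurable_EFinP.
 - apply: measurable_funTS; apply: emeasurable_funM; last exact/measurable_EFinP.
 apply: ge0_emeasurable_sum => n; first by move=> p _; rewrite lee_fin.
 by move=> _; apply/measurable_EFinP; apply: (measurableT_comp (mrect _ _ _ _)); exact: measurable_hact.
 move=> p _; rewrite -[leLHS]mul1e lee_wpmul2r ?lee_fin ?sqr_ge0//.
 have [g Gg [h1 h2]] := HAT p; have [k _ ek] : [set e n | n in setT] g by case: bij_e => _ _; apply.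
 rewrite (nneseriesD1 (n := k))//.
 rewrite ek indicE mem_set ?leeDl ?nneseries_ge0//.
 by split; rewrite /= in_itv/= -ler_norml; [exact: le_trans h1 AS|exact: le_trans h2 TS].
have up j : dint (- S) S (- S) S (fun p => ue u j p ^+ 2) <= M.
 have : 2 * dint (- S) S (- S) S (fun p => ue u j p ^+ 2) <= M.
 rewrite -lee_fin EFinM -unfold_rect -[leRHS]mule1 -(norm_ue j) -ge0_integralZl//; last 2 first.
 - by apply: measurable_funTS; apply/measurable_EFinP.
 - by move=> p _; rewrite lee_fin sqr_ge0.
 apply: ge0_le_integral => //.
 - by move=> p _; rewrite mule_ge0 ?lee_fin ?sqr_ge0//; apply: nneseries_ge0 => n _ _; rewrite lee_fin.
 - apply: measurable_funTS; apply: emeasurable_funM; last exact/measurable_EFinP.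
 apply: ge0_emeasurable_sum => n; first by move=> p _; rewrite lee_fin.
 by move=> _; apply/measurable_EFinP; apply: (measurableT_comp (mrect _ _ _ _)); exact: measurable_hact.
 - apply: measurable_funTS; apply: emeasurable_funM; first exact: measurable_cst.
 exact/measurable_EFinP.
 move=> p _; rewrite lee_wpmul2r ?lee_fin ?sqr_ge0//; apply: le_trans (HM p).
 rewrite (nneseries_psl2 bij_e (f := fun h => (\1_(rect (- S) S (- S) S) (hact h p) : R)%:E)); last by move=> g; rewrite lee_fin.
 apply: le_esum => g _; rewrite lee_fin !indicE ler_nat.
 case: (boolP (hact g p \in rect _ _ _ _)) => // ; rewrite inE => -[/=]; rewrite !in_itv/= -!ler_norml => h1 h2.
 by rewrite mem_set.
 have := @dint_ge0 R (- S) S (- S) S (fun p => ue u j p ^+ 2) (fun p => sqr_ge0 _); lra.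
pose C := (2 + S ^+ 2) * (8 * cac_const S / S ^+ 8) * M.
have C0 : 0 <= C.
 have cc : 0 <= cac_const S by exact: cac_const_ge0.
 by rewrite /C !mulr_ge0// ?addr_ge0 ?sqr_ge0// invr_ge0 exprn_ge0// ltW.
pose n := (Num.truncn (S ^+ 2 * C * 4)).+1.
pose d := S / n%:R; have n0 : (0 < n)%N by [].
have n0R : 0 < n%:R :> R by rewrite ltr0n.
have d0 : 0 < d by rewrite divr_gt0.
have nbig : S ^+ 2 * C * 4 <= n%:R.
 have /truncn_itv/andP[_ h] : 0 <= S ^+ 2 * C * 4.
 by apply: mulr_ge0 => //; apply: mulr_ge0 => //; exact: sqr_ge0.
 exact: ltW.
have dC : d ^+ 2 * C <= 4^-1.
 have n1 : 1 <= n%:R :> R by rewrite ler1n.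
 have : S ^+ 2 * C * 4 <= n%:R ^+ 2 by rewrite (le_trans nbig)// expr2 ler_peMl// ltW.
 move=> hS; have -> : d ^+ 2 * C = 4^-1 * ((S ^+ 2 * C * 4) / n%:R ^+ 2).
 by rewrite /d; move: (C) (n%:R : R) n0R => c x x0; field; rewrite gt_eqF.
 by rewrite -[leRHS]mulr1 ler_pM2l ?invr_gt0// ler_pdivrMr ?exprn_gt0// mul1r.
pose cell (k i : nat) := rect (grid (- (S / 2)) d i) (grid (- (S / 2)) d i.+1) (grid (- (S / 2)) d k) (grid (- (S / 2)) d k.+1).
have gE : grid (- (S / 2)) d n = S / 2 by rewrite /grid /d; field; rewrite gt_eqF.
have cell_sub k i : (k < n)%N -> (i < n)%N -> forall p, (\1_(cell k i) p : R) <= 1 * \1_(box S S) p.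
 move=> kn im p; rewrite mul1r !indicE ler_nat.
 case: (boolP (p \in cell k i)) => // ; rewrite inE => -[/=]; rewrite !in_itv/= => /andP[a1 a2] /andP[b1 b2].
 have gl x : - (S / 2) <= grid (- (S / 2)) d x by rewrite /grid lerDl mulr_ge0// ltW.
 have gu x : (x < n)%N -> grid (- (S / 2)) d x.+1 <= S / 2.
 by move=> xn; rewrite -[leRHS]gE /grid lerD2l ler_wpM2r ?(ltW d0)// ler_nat.
 have h1 := gl i; have h2 := gl k; have h3 := gu i im; have h4 := gu k kn.
 by rewrite mem_set//; split; rewrite ler_norml; apply/andP; split; lra.
pose q k i := ip L F' (poincare e (\1_(cell k i))) (poincare e (\1_(cell k i))).
have bes k i N : (k < n)%N -> (i < n)%N ->
 \sum_(j < N) (dint (grid (- (S / 2)) d i) (grid (- (S / 2)) d i.+1) (grid (- (S / 2)) d k) (grid (- (S / 2)) d k.+1) (ue u j)) ^+ 2 <= q k i.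
 move=> kn im; have i0 p : 0 <= (\1_(cell k i) p : R) by rewrite indicE.
 have mi : mfun (\1_(cell k i) : plane -> R) by exact: mrect.
 have LP := poincare_L2 subG discG cocG bij_e mF' fundF' mi i0 ler01 (cell_sub k i kn im).
 apply: le_trans (bessel mF' (ue_L2 fundF sysu) (ue_orthonormal fundF sysu) N LP).
 apply: ler_sum => j _.
 have [_ ->] := poincare_ip subG discG cocG bij_e mF' fundF' mi i0 ler01 (cell_sub k i kn im) (ue_L2 fundF sysu j) (fun g p Gg => ue_hact subG sysu j p Gg).
 rewrite /Rintegral (rect_integral _ _ _ _ (@cue j) (@mue j)) /= exprMn.
 by rewrite ler_peMl ?sqr_ge0//; lra.
pose Q := \sum_(k < n) \sum_(i < n) q k i.
have card N : (\sum_(j < N | lam j <= 4^-1) (4^-1 : R)) <= d ^- 2 * Q.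
 apply: (@le_trans _ _ (d ^- 2 * \sum_(k < n) \sum_(i < n) \sum_(j < N) (dint (grid (- (S / 2)) d i) (grid (- (S / 2)) d i.+1) (grid (- (S / 2)) d k) (grid (- (S / 2)) d k.+1) (ue u j)) ^+ 2)); last first.
 by rewrite ler_wpM2l ?invr_ge0 ?sqr_ge0//; apply: ler_sum => k _; apply: ler_sum => i _; exact: bes.
 rewrite (eq_bigr (fun k : 'I_n => \sum_(j < N) \sum_(i < n) (dint (grid (- (S / 2)) d i) (grid (- (S / 2)) d i.+1) (grid (- (S / 2)) d k) (grid (- (S / 2)) d k.+1) (ue u j)) ^+ 2)); last by move=> k _; rewrite exchange_big.
 rewrite exchange_big mulr_sumr big_mkcond; apply: ler_sum => j _.
 have nn : 0 <= d ^- 2 * \sum_(k < n) \sum_(i < n) (dint (grid (- (S / 2)) d i) (grid (- (S / 2)) d i.+1) (grid (- (S / 2)) d k) (grid (- (S / 2)) d k.+1) (ue u j)) ^+ 2.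
 by rewrite mulr_ge0 ?invr_ge0 ?sqr_ge0//; apply: sumr_ge0 => k _; apply: sumr_ge0 => i _; exact: sqr_ge0.
 case: ifPn => // lj; have lj1 : lam j <= 1 by lra.
 have := grid_lower_ue S0 lj1 n0 (erefl d); have := low j; have := up j.
 have : d ^+ 2 * (2 + S ^+ 2) * (8 * cac_const S / S ^+ 8) * dint (- S) S (- S) S (fun p => ue u j p ^+ 2) <= 4^-1.
 have nnE : 0 <= d ^+ 2 * (2 + S ^+ 2) * (8 * cac_const S / S ^+ 8).
 apply: mulr_ge0; first by apply: mulr_ge0; [exact: sqr_ge0|rewrite addr_ge0 ?sqr_ge0].
 by apply: divr_ge0; [rewrite mulr_ge0 ?cac_const_ge0|rewrite exprn_ge0 ?(ltW S0)].
 apply: (@le_trans _ _ (d ^+ 2 * (2 + S ^+ 2) * (8 * cac_const S / S ^+ 8) * M)).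
 by apply: ler_wpM2l => //; exact: up.
 by apply: le_trans dC; rewrite /C !mulrA.
 by move=> h1 _ h3 h4; exact: small_algebra h1 h3 h4.
apply: contrapT => inf.
pose B := (Num.truncn (4 * (d ^- 2 * Q))).+1.
have [X XJ XB] := infinite_set_fset B inf.
pose s := finmap.enum_fset X; have us : uniq s by exact: finmap.fset_uniq.
have sJ j : j \in s -> lam j <= 4^-1 by move=> js; exact: XJ.
pose N := (\max_(j <- s) j).+1.
have := card N; rewrite -(big_mkord (fun j => lam j <= 4^-1) (fun=> 4^-1)) -big_filter big_const_seq count_predT iter_addr_0.
set r := [seq _ <- _ | _] => H.
have sr : (size s <= size r)%N.
 apply: uniq_leq_size => // j js; rewrite mem_filter sJ//= mem_index_iota /= ltnS.
 by rewrite (bigD1_seq j)//= leq_maxl.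
have hB : B%:R <= 4 * (d ^- 2 * Q).
 have hR : B%:R <= (size r)%:R :> R by rewrite ler_nat (leq_trans XB).
 have e4 : 4^-1 *+ size r = (size r)%:R / 4 :> R by rewrite -(mulr_natl (4^-1)).
 by move: H; rewrite e4 ler_pdivrMr// mulrC => H; apply: le_trans hR H.
have /truncn_itv/andP[_ h] : 0 <= 4 * (d ^- 2 * Q) by apply: le_trans hB.
by have := lt_le_trans h hB; rewrite ltxx.
Qed.

End SmallEigenvalues.

(** * Dyadic summation *)

Section DyadicSums.
Context {R : realType}.

Lemma pow4 k : 4 ^+ k = (2 ^+ k) ^+ 2 :> R.
Proof. by rewrite -exprM mulnC exprM; congr (_ ^+ k); rewrite expr2; lra. Qed.

Lemma pow8 k : 8 ^+ k = (2 ^+ k) ^+ 3 :> R.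
Proof. by rewrite -exprM mulnC exprM; congr (_ ^+ k); rewrite !exprS expr0; lra. Qed.

Lemma log4 (t : R) : 1 <= t -> exists k : nat, 4 ^+ k <= t < 4 ^+ k.+1.
Proof.
move=> t1; have /truncn_itv/andP[h1 h2] := le_trans ler01 t1.
have n0 : (0 < Num.truncn t)%N by rewrite truncn_gt0.
exists (trunc_log 4 (Num.truncn t)); apply/andP; split.
 by apply: le_trans h1; rewrite -natrX ler_nat trunc_logP.
by apply: lt_le_trans h2 _; rewrite -natrX ler_nat trunc_log_ltn.
Qed.

(** The block 4^k <= t < 4^(k + 1) carries weight at most C 4^(k + 1). Base 4 makes the square roots
    of t powers of 2. *)
Lemma dyadic_sum (w t f : nat -> R) (C Bm : R) (m : nat -> R) :
 (forall j, 0 <= w j) -> (forall n T, 1 <= T -> \sum_(j < n | t j <= T) w j <= C * T) ->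
 (forall k, 0 <= m k) -> 0 <= C -> (forall N, \sum_(k < N) 4 ^+ k.+1 * m k <= Bm) ->
 (forall j k, 4 ^+ k <= t j < 4 ^+ k.+1 -> f j <= w j * m k) ->
 forall n, \sum_(j < n | 1 <= t j) f j <= C * Bm.
Proof.
move=> w0 wC m0 C0 mB fm n.
have [kf kfP] : exists kf : nat -> nat, forall j, 1 <= t j -> 4 ^+ kf j <= t j < 4 ^+ (kf j).+1.
 have H j : exists k : nat, 1 <= t j -> 4 ^+ k <= t j < 4 ^+ k.+1.
 case: (boolP (1 <= t j)) => [/log4[k hk]|_]; last by exists 0%N.
 by exists k.
 by have [kf kfP] := choice H; exists kf.
pose N := (\max_(j < n) kf j).+1.
apply: (@le_trans _ _ (\sum_(j < n | 1 <= t j) \sum_(k < N) (if t j <= 4 ^+ k.+1 then w j * m k else 0))).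
 apply: ler_sum => j tj; have /andP[h1 h2] := kfP j tj.
 have kN : (kf j < N)%N by rewrite ltnS (@leq_bigmax _ (fun j : 'I_n => kf j)).
 rewrite (bigD1 (Ordinal kN))//= (ltW h2) -[leLHS]addr0; apply: lerD.
 by rewrite fm// h1.
 by apply: sumr_ge0 => k _; case: ifP => // _; rewrite mulr_ge0.
rewrite exchange_big/=; apply: (@le_trans _ _ (C * \sum_(k < N) 4 ^+ k.+1 * m k)); last by rewrite ler_wpM2l.
rewrite mulr_sumr; apply: ler_sum => k _.
have k1 : 1 <= 4 ^+ k.+1 :> R by rewrite exprn_ege1// ler1n.
apply: (@le_trans _ _ ((\sum_(j < n | t j <= 4 ^+ k.+1) w j) * m k)); last by rewrite mulrA ler_wpM2r// wC.
rewrite mulr_suml -big_mkcondr/= [leLHS]big_mkcond [leRHS]big_mkcond; apply: ler_sum => j _.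
by case: (t j <= _); rewrite ?andbT ?andbF//; case: ifP => // _; rewrite mulr_ge0.
Qed.

(** The minimum switches where 4^k is near K, and on both sides the sum is geometric of size
    K^(1/2). The two-case bound [H] is the form that passes through the induction. *)
Lemma min_sum (K : R) : 1 <= K -> forall N, \sum_(k < N) Num.min (2 ^+ k) (K / 2 ^+ k) <= 4 * sqrt K.
Proof.
move=> K1 N; have [k0 /andP[h1 h2]] := log4 K1; have K0 := le_trans ler01 K1.
have four := @pow4.
have p0 k : 0 < 2 ^+ k :> R by rewrite exprn_gt0.
have s1 : 2 ^+ k0 <= sqrt K.
 by rewrite -(ger0_norm (ltW (p0 k0))) -sqrtr_sqr ler_wsqrtr// -four.
have s2 : sqrt K <= 2 ^+ k0.+1.
 by rewrite -[leRHS](ger0_norm (ltW (p0 k0.+1))) -sqrtr_sqr ler_wsqrtr// -four ltW.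
have e1 : 2 ^+ k0.+1 = 2 * 2 ^+ k0 :> R by rewrite exprS.
have s3 : K / 2 ^+ k0 <= 2 * sqrt K.
 rewrite ler_pdivrMr// -{1}(sqr_sqrtr K0) expr2 -mulrA mulrCA ler_wpM2l ?sqrtr_ge0//; rewrite -e1; exact: s2.
suff H : \sum_(k < N) Num.min (2 ^+ k) (K / 2 ^+ k) <=
 (if (N <= k0.+1)%N then 2 ^+ N else 2 ^+ k0.+1 + (K / 2 ^+ k0 - K / 2 ^+ N.-1)).
 apply: (le_trans H); case: ifP => [Nk|_].
 have : 2 ^+ N <= 2 ^+ k0.+1 :> R by rewrite ler_weXn2l// ler1n.
 by rewrite e1; have := sqrtr_ge0 K; lra.
 have : 0 <= K / 2 ^+ N.-1 by rewrite divr_ge0// ltW.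
 by rewrite e1; lra.
elim: N => [|N IH]; first by rewrite big_ord0.
rewrite big_ord_recr/=; have m1 : Num.min (2 ^+ N) (K / 2 ^+ N) <= 2 ^+ N by rewrite ge_min lexx.
have m2 : Num.min (2 ^+ N) (K / 2 ^+ N) <= K / 2 ^+ N by rewrite ge_min lexx orbT.
have e2 : 2 ^+ N.+1 = 2 * 2 ^+ N :> R by rewrite exprS.
move: IH; case: (ltngtP N k0.+1) => [Nk|Nk|Nk] IH.
- by rewrite e2; lra.
- move: Nk IH m2; case: N m1 e2 => // N m1 e2 Nk IH m2 /=.
 have : K / 2 ^+ N = 2 * (K / 2 ^+ N.+1) by rewrite exprS; field; rewrite gt_eqF.
 by move: IH; rewrite /=; lra.
- rewrite Nk in IH m1 m2 *.
 have : K / 2 ^+ k0 = 2 * (K / 2 ^+ k0.+1) by rewrite exprS; field; rewrite gt_eqF.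
 by move: IH m2; rewrite ?leqnn /=; lra.
Qed.

End DyadicSums.

Lemma norm_scaled_le {R : realType} (v p I A : R) : 0 <= p -> p <= 1 -> `|I| <= `|v| * A -> `|v * (p * I)| <= v ^+ 2 * A.
Proof.
move=> p0 p1 IA; rewrite normrM normrM (ger0_norm p0) -[v ^+ 2]real_normK ?num_real// expr2 -mulrA ler_wpM2l//.
by apply: le_trans IA; rewrite -[leRHS]mul1r ler_wpM2r.
Qed.

(** * The error of the spectral side over a window *)

Section SpectralError.
Context {R : realType}.
Local Notation mu := (leb R).
Variables (V P : nat -> R -> R) (lam sg : nat -> R).
Hypothesis dV : forall j (x : R), is_derive x (1 : R) (V j) (P j x / (1 + x ^+ 2)).
Hypothesis dP : forall j (x : R), is_derive x (1 : R) (P j) (- lam j * V j x).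
Hypothesis P0 : forall j, P j 0 = 0.
Hypothesis lam0 : forall j, 0 <= lam j.
Hypothesis finl : finite_set [set j | lam j <= 4^-1].
Hypothesis sgP : forall j, lam j < 4^-1 -> 2^-1 < sg j <= 1 /\ lam j = sg j * (1 - sg j).
Variable C0 : R.
Hypothesis C00 : 0 <= C0.
Hypothesis sumC : forall n T, 1 <= T -> \sum_(j < n | lam j <= 4^-1 + T ^+ 2) V j 0 ^+ 2 <= C0 * T.

Let cV j : continuous (V j). Proof. by move=> x; exact: is_derive_cont (dV j x). Qed.

Definition pairing Y j := \int[mu]_(x in `[0, Y]) (ckern Y x * V j x).
Definition main_term Y j := V j 0 ^+ 2 * (main_const (sg j) / 2) * Y `^ (sg j + 2).
Definition spectral_error Y1 Y2 j := V j 0 * (pairing Y2 j - pairing Y1 j)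
 - (if lam j < 4^-1 then main_term Y2 j - main_term Y1 j else 0).

Lemma pairingE Y j : 0 <= Y -> pairing Y j = 2 / pi * \int[mu]_(x in `[0, Y]) (chord Y x * (x * V j x)).
Proof.
move=> Y0; rewrite -segintZ; last by apply: contW; have cc := @cont_chord R Y; have cj := @cV j; ctn.
apply: segint_eq => x /andP[x0 _]; rewrite /ckern ger0_norm//.
by move: (2 / pi) (chord Y x) (V j x) => a b c; ring.
Qed.
Let cxV j : continuous (fun x : R => x * V j x). Proof. by have cj := @cV j; ctn. Qed.

Let cCV Y j : continuous (fun x : R => chord Y x * (x * V j x)).
Proof. by apply: contT => x; apply: contM; [exact: cont_chord|exact: cxV]. Qed.

Lemma pairing_sub Y1 Y2 j : 0 <= Y1 -> Y1 <= Y2 ->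
 pairing Y2 j - pairing Y1 j = 2 / pi * \int[mu]_(x in `[0, Y2]) ((chord Y2 x - chord Y1 x) * (x * V j x)).
Proof.
move=> Y10 Y12; have Y20 := le_trans Y10 Y12; have c1 := @cont_chord R Y1; have c2 := @cont_chord R Y2.
have cj := @cxV j; rewrite !pairingE// -(segint_chord_tail (lexx 0) Y10 Y12 (@contW _ 0 Y2 _ cj)) -mulrBr.
have k1 := @cCV Y1 j.
have k2 := @cCV Y2 j.
rewrite -(@segintB _ 0 Y2 _ _ (@contW _ 0 Y2 _ k2) (@contW _ 0 Y2 _ k1)).
by congr (_ * _); apply: segint_eq => x _; rewrite mulrBl.
Qed.
Let pi2 : 0 <= 2 / pi :> R. Proof. by rewrite divr_ge0// pi_ge0. Qed.
Let pi2' : 2 / pi <= 1 :> R. Proof. by rewrite ler_pdivrMr ?pi_gt0// mul1r pi_ge2. Qed.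

Lemma error_small j : lam j < 4^-1 -> exists2 C, 0 <= C & forall Y1 Y2, 0 <= Y1 -> Y1 <= Y2 ->
 `|spectral_error Y1 Y2 j| <= V j 0 ^+ 2 * ((Y2 ^+ 2 - Y1 ^+ 2) * sqrt Y2 * C).
Proof.
move=> lj; have [/andP[s1 s2] lE] := sgP lj; have [C C1 HC] := real_asymptotic s1 s2.
exists C => // Y1 Y2 Y10 Y12; have Y20 := le_trans Y10 Y12.
have dPj (x : R) : is_derive x (1 : R) (P j) (- (sg j * (1 - sg j)) * V j x) by rewrite -lE.
have as1 := HC (V j) (P j) (dV j) dPj (P0 j).
have s2' : 2^-1 <= sg j by exact: ltW.
have cp := cont_ppow s2'; have c1 := @cont_chord R Y1; have c2 := @cont_chord R Y2.
have cj := @cxV j; pose al0 := V j 0 * alpha (sg j).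
pose Bq := Gamma_function ((sg j + 1) / 2) * Gamma_function (3 / 2) / Gamma_function (sg j / 2 + 2).
have mE Y : 0 <= Y -> \int[mu]_(x in `[0, Y]) (chord Y x * ppow (sg j) x) = Y `^ (sg j + 2) / 2 * Bq.
 rewrite le_eqVlt => /orP[/eqP <-|Ygt]; last by rewrite chord_ppow// /powR gt_eqF.
 by rewrite set_itv1 Rintegral_set1 powR0 ?mul0r// gt_eqF//; lra.
have mainE Y : 0 <= Y -> main_term Y j = V j 0 * (2 / pi * (al0 * \int[mu]_(x in `[0, Y]) (chord Y x * ppow (sg j) x))).
 move=> /mE ->; rewrite /main_term /main_const -/Bq /al0; have := @pi_gt0 R.
 by move: (pi : R) (Y `^ _) (alpha _) (V j 0) => c y a v c0; field; rewrite gt_eqF.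
rewrite /spectral_error lj pairing_sub// !mainE//.
rewrite -(segint_chord_tail (lexx 0) Y10 Y12 (@contW _ 0 Y2 _ cp)).
have cG : continuous (fun x : R => x * V j x - al0 * ppow (sg j) x).
 by apply: contT => x; apply: contD; [exact: cj|apply: contN; apply: contM; [exact: cont_cst|exact: cp]].
have := @chord_diff_generic _ (fun x => x * V j x - al0 * ppow (sg j) x) Y1 Y2 (`|V j 0| * C) Y10 Y12.
rewrite mulr_ge0// => /(_ isT (@contW _ 0 Y2 _ cG)).
case/(_ _)/Wrap => [x /andP[x0 _]|]; first exact: as1.
have -> : \int[mu]_(x in `[0, Y2]) ((chord Y2 x - chord Y1 x) * (x * V j x - al0 * ppow (sg j) x)) =
 \int[mu]_(x in `[0, Y2]) ((chord Y2 x - chord Y1 x) * (x * V j x)) -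
 al0 * (\int[mu]_(x in `[0, Y2]) (chord Y2 x * ppow (sg j) x) - \int[mu]_(x in `[0, Y2]) (chord Y1 x * ppow (sg j) x)).
 have k1 : continuous (fun x : R => chord Y2 x * ppow (sg j) x) by apply: contT => x; apply: contM; [exact: c2|exact: cp].
 have k2 : continuous (fun x : R => chord Y1 x * ppow (sg j) x) by apply: contT => x; apply: contM; [exact: c1|exact: cp].
 have k3 : continuous (fun x : R => chord Y2 x * ppow (sg j) x - chord Y1 x * ppow (sg j) x).
 by apply: contT => x; apply: contD; [exact: k1|apply: contN; exact: k2].
 have k4 : continuous (fun x : R => (chord Y2 x - chord Y1 x) * (x * V j x)) by apply: contT => x; apply: contM; [ctn|exact: cj].
 have k5 : continuous (fun x : R => al0 * (chord Y2 x * ppow (sg j) x - chord Y1 x * ppow (sg j) x)).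
 by apply: contT => x; apply: contM; [exact: cont_cst|exact: k3].
 rewrite -(@segintB _ 0 Y2 _ _ (@contW _ 0 Y2 _ k1) (@contW _ 0 Y2 _ k2)) -(@segintZ _ 0 Y2 _ _ (@contW _ 0 Y2 _ k3)).
 rewrite -(@segintB _ 0 Y2 _ _ (@contW _ 0 Y2 _ k4) (@contW _ 0 Y2 _ k5)).
 by apply: segint_eq => x _; ring.
move: (\int[mu]_(x in _) _) (\int[mu]_(x in _) _) (\int[mu]_(x in _) _) => I3 I2 I1 H.
have -> : V j 0 * (2 / pi * I1) - (V j 0 * (2 / pi * (al0 * I2)) - V j 0 * (2 / pi * (al0 * I3))) =
 V j 0 * (2 / pi * (I1 - al0 * (I2 - I3))) by ring.
apply: norm_scaled_le => //; apply: (le_trans H); apply: eq_ler.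
by move: (`|V j 0|) => v; ring.
Qed.

(** Here lam - 1/4 may vanish. Adding q = (2 eps)^2 to it keeps k >= 2 eps in the energy estimate,
    at the price of a factor Y^eps, uniformly in lam. *)
Lemma error_mid eps : 0 < eps -> exists2 C, 0 <= C & forall j, 4^-1 <= lam j <= 4^-1 + 1 ^+ 2 ->
 forall Y1 Y2, 0 <= Y1 -> Y1 <= Y2 -> 1 <= Y2 ->
 `|spectral_error Y1 Y2 j| <= V j 0 ^+ 2 * ((Y2 ^+ 2 - Y1 ^+ 2) * sqrt Y2 * (C * Y2 `^ eps)).
Proof.
move=> e0; exists (expR (eps * ln 3 + (16 * eps)^-1)); first exact: expR_ge0.
move=> j /andP[l1 l2] Y1 Y2 Y10 Y12 Y21; have Y20 : 0 < Y2 := lt_le_trans ltr01 Y21.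
rewrite /spectral_error ltNge l1/= subr0 pairing_sub//.
have powE : expR (eps * ln 3 + (16 * eps)^-1) * Y2 `^ eps = expR (eps * ln (3 * Y2) + (16 * eps)^-1).
 by rewrite /powR gt_eqF// -expRD lnM ?posrE//; congr expR; ring.
rewrite powE; set BB := expR _; have B0 : 0 <= BB := expR_ge0 _.
pose q := (2 * eps) ^+ 2; pose k := sqrt (lam j - 4^-1 + q).
have q0 : 0 < q by rewrite exprn_gt0// mulr_gt0.
have k2 : k ^+ 2 = lam j - 4^-1 + q by rewrite sqr_sqrtr// addr_ge0 ?(ltW q0)// subr_ge0.
have ke : 2 * eps <= k.
 have h : 0 <= 2 * eps by rewrite mulr_ge0// ltW.
 by rewrite -(ger0_norm h) -sqrtr_sqr ler_wsqrtr// lerDr subr_ge0.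
have k0 : 0 < k by apply: lt_le_trans ke; rewrite mulr_gt0.
have bnd x : 0 <= x <= Y2 -> `|x * V j x| <= `|V j 0| * BB * sqrt x.
 move=> /andP[x0 xY]; have lE : lam j = 4^-1 + k ^+ 2 - q by rewrite k2; ring.
 have := even_solution_bound (dV j) (dP j) (P0 j) k0 (ltW q0) lE x0 => H.
 have jg := jb_gt0 x; have xj := jb_gex x; have j1 := jb_ge1 x.
 have jY : jb x <= 2 * Y2.
 have : jb x ^+ 2 <= (1 + x) ^+ 2 by rewrite jb_sqr sqrrD expr1n mul1r; have := x0; rewrite mulr2n; lra.
 by rewrite ler_sqr ?nnegrE ?(ltW jg) ?addr_ge0//; move: xY Y21; lra.
 have rate : energy_rate k q x <= 2 * (eps * ln (3 * Y2) + (16 * eps)^-1).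
 rewrite /energy_rate ler_pdivrMr//.
 have h1 : ln (x + jb x) <= ln (3 * Y2).
 by rewrite ler_ln ?posrE ?mulr_gt0// ?ltr_wpDl//; move: xY jY; lra.
 have h2 : 0 <= ln (3 * Y2) by rewrite ln_ge0//; move: Y21; lra.
 have h3 : x / (4 * jb x) <= 4^-1.
 by rewrite ler_pdivrMr ?mulr_gt0//; move: xj; lra.
 have h4 : q * ln (x + jb x) <= q * ln (3 * Y2) by rewrite ler_wpM2l// ltW.
 have h5 : q * ln (3 * Y2) <= 2 * eps * ln (3 * Y2) * k.
 by rewrite /q expr2 -!mulrA ler_wpM2l// ler_wpM2l ?(ltW e0)// mulrA mulrC ler_wpM2l.
 have h6 : 4^-1 <= 2 * (16 * eps)^-1 * k.
 have -> : 4^-1 = 2 * (16 * eps)^-1 * (2 * eps) by field; rewrite gt_eqF.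
 by rewrite ler_wpM2l// mulr_ge0// invr_ge0 mulr_ge0// ltW.
 apply: (le_trans (lerD h4 h3)); apply: (le_trans (lerD h5 h6)); apply: eq_ler.
 by move: (ln _) ((16 * eps)^-1) => a b; ring.
 have V2 : (x * V j x) ^+ 2 <= (`|V j 0| * BB * sqrt x) ^+ 2.
 rewrite !exprMn sqr_sqrtr// real_normK ?num_real// expr2 -mulrA (mulrC _ x) ler_wpM2l//.
 apply: (@le_trans _ _ (x * (V j 0 ^+ 2 * expR (energy_rate k q x) / jb x))); first by rewrite ler_wpM2l.
 rewrite mulrCA -[leRHS]mulr1; apply: ler_pM.
 - by rewrite mulr_ge0 ?expR_ge0 ?sqr_ge0.
 - by rewrite divr_ge0 ?(ltW jg).
 - by rewrite ler_wpM2l ?sqr_ge0// /BB -expRM_natl ler_expR.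
 - by rewrite ler_pdivrMr// mul1r.
 have nn : 0 <= `|V j 0| * BB * sqrt x by rewrite mulr_ge0 ?sqrtr_ge0// mulr_ge0.
 by have := ler_wsqrtr V2; rewrite !sqrtr_sqr (ger0_norm nn).
have cj := @cxV j.
have := @chord_diff_generic _ (fun x => x * V j x) Y1 Y2 (`|V j 0| * BB) Y10 Y12 (mulr_ge0 (normr_ge0 _) B0) (@contW _ 0 Y2 _ cj) bnd.
move: (\int[mu]_(x in _) _) => I H.
apply: norm_scaled_le => //; apply: (le_trans H); apply: eq_ler.
by move: (`|V j 0|) => v; ring.
Qed.

(** Up to a generous numerical constant, min(t^(-1/2), eta^-1 t^(-3/2)) for t of size 4^k. *)
Definition level (eta : R) (k : nat) : R := (10 * 40 * 40) * Num.min ((2 ^+ k)^-1) (eta^-1 / 8 ^+ k).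

(** For eta < 1 / (2 t) the window lies beyond the splitting point and the estimate for differences
    applies. Otherwise the two radii are estimated separately, and dividing by the window length
    costs eta^-1. The case Y1 = 0 serves to prove convergence of the spectral series. *)
Lemma error_large j k Y1 Y2 eta : 4^-1 <= lam j -> 0 < eta <= 1 -> 4 ^+ k <= sqrt (lam j - 4^-1) < 4 ^+ k.+1 ->
 Y1 = 0 \/ 1 <= Y1 -> Y1 <= Y2 -> 1 <= Y2 -> Y1 ^+ 2 = Y2 ^+ 2 * (1 - eta) ->
 `|spectral_error Y1 Y2 j| <= V j 0 ^+ 2 * ((Y2 ^+ 2 - Y1 ^+ 2) * sqrt Y2 * level eta k).
Proof.
move=> l1 /andP[eta0 eta1]; set t := sqrt _ => /andP[tk tk'] Y1P Y12 Y21 YE.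
have Y10 : 0 <= Y1 by case: Y1P => [->|/(le_trans ler01)].
have Y20 : 0 < Y2 := lt_le_trans ltr01 Y21.
have fk1 : 1 <= 4 ^+ k :> R by rewrite exprn_ege1// ler1n.
have t1 : 1 <= t := le_trans fk1 tk; have t0 : 0 < t := lt_le_trans ltr01 t1.
have lE : lam j = 4^-1 + t ^+ 2 by rewrite sqr_sqrtr ?subr_ge0//; ring.
rewrite /spectral_error ltNge l1/= subr0 pairing_sub//.
have p2 : 0 < 2 ^+ k :> R by rewrite exprn_gt0.
have e4 : 4 ^+ k = (2 ^+ k) ^+ 2 :> R by exact: pow4.
have e8 : 8 ^+ k = (2 ^+ k) ^+ 3 :> R by exact: pow8.
pose r := sqrt (2 * t); have r2 : r ^+ 2 = 2 * t by rewrite sqr_sqrtr// mulr_ge0// ltW.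
have r0 : 0 < r by rewrite sqrtr_gt0 mulr_gt0.
have rk : 2 ^+ k <= r.
 rewrite -(ger0_norm (ltW p2)) -sqrtr_sqr ler_wsqrtr// -e4 (le_trans tk)//; move: t0; lra.
have rt : r / t = 2 / r by apply/eqP; rewrite eqr_div ?(gt_eqF t0) ?(gt_eqF r0)//; apply/eqP; rewrite -expr2 r2.
have rt1 : r / t <= 2 / 2 ^+ k by rewrite rt ler_wpM2l// lef_pV2 ?posrE.
have rt2 : r / t ^+ 2 <= 2 / 8 ^+ k.
 have -> : r / t ^+ 2 = r / t * t^-1 by rewrite expr2 invfM mulrA.
 have -> : 2 / 8 ^+ k = 2 / 2 ^+ k * (4 ^+ k)^-1 :> R by rewrite e8 e4; field; rewrite gt_eqF.
 apply: ler_pM => //; [by rewrite divr_ge0 ?(ltW r0) ?(ltW t0)|by rewrite invr_ge0 ltW|].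
 by rewrite lef_pV2 ?posrE ?exprn_gt0.
have lev0 : 0 <= (2 * t)^-1 <= 1 by rewrite invr_ge0 mulr_ge0 ?(ltW t0)//= invf_le1 ?mulr_gt0//; move: t1; lra.
pose a := Y2 * sqrt (1 - (2 * t)^-1).
have a0 : 0 <= a by rewrite mulr_ge0 ?sqrtr_ge0 ?(ltW Y20).
have a2 : a ^+ 2 = Y2 ^+ 2 * (1 - (2 * t)^-1) by rewrite exprMn sqr_sqrtr// subr_ge0; case/andP: lev0.
have DE : Y2 ^+ 2 - Y1 ^+ 2 = Y2 ^+ 2 * eta by rewrite YE; ring.
have D0 : 0 <= Y2 ^+ 2 - Y1 ^+ 2 by rewrite DE mulr_ge0 ?sqr_ge0 ?(ltW eta0).
have sY0 := sqrtr_ge0 Y2; have v0 := normr_ge0 (V j 0).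
suff H : `|\int[mu]_(x in `[0, Y2]) ((chord Y2 x - chord Y1 x) * (x * V j x))| <=
 `|V j 0| * ((Y2 ^+ 2 - Y1 ^+ 2) * sqrt Y2 * level eta k).
 exact: norm_scaled_le.
have [small|big] := ltP eta (2 * t)^-1.
 have aY : a < Y1.
 rewrite -(ltr_sqr (x := a)) ?nnegrE// a2 YE ltr_pM2l ?exprn_gt0//; move: small; lra.
 have := large_period_diff (dV j) (dP j) (P0 j) t1 lE Y21 a0 a2 (erefl r) Y10 Y12 aY.
 move/le_trans; apply.
 have -> : 26 * `|V j 0| * sqrt Y2 * (Y2 ^+ 2 - Y1 ^+ 2) * r / t =
 `|V j 0| * ((Y2 ^+ 2 - Y1 ^+ 2) * sqrt Y2 * (26 * (r / t))) by ring.
 rewrite ler_wpM2l// ler_wpM2l ?mulr_ge0// /level.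
 apply: (@le_trans _ _ (52 * (2 ^+ k)^-1)); first by move: rt1; move: (r / t) ((2 ^+ k)^-1) => x y; lra.
 apply: (@le_trans _ _ ((10 * 40 * 40) * (2 ^+ k)^-1)); first by rewrite ler_wpM2r ?invr_ge0 ?(ltW p2)//; lra.
 rewrite ler_wpM2l// le_min lexx/= e8 ler_pdivlMr ?exprn_gt0//.
 rewrite exprS mulrA mulVf ?gt_eqF// mul1r -e4 (le_trans tk)// -[leLHS]invrK lef_pV2 ?posrE ?invr_gt0// ltW// (lt_le_trans small)//.
 by rewrite lef_pV2 ?posrE ?mulr_gt0//; move: t0; lra.
have lp2 := large_period (dV j) (dP j) (P0 j) t1 lE Y21 a0 a2 (erefl r).
have lp1 : `|\int[mu]_(x in `[0, Y2]) (chord Y1 x * (x * V j x))| <= 441 * `|V j 0| * sqrt Y2 * Y2 ^+ 2 * r / t ^+ 2.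
 rewrite (segint_chord_tail (lexx 0) Y10 Y12 (@contW _ 0 Y2 _ (@cxV j))).
 have nn : 0 <= 441 * `|V j 0| by exact: (mulr_ge0 (ler0n _ 441) v0).
 case: Y1P => [->|Y11].
 by rewrite set_itv1 Rintegral_set1 normr0; exact: le_trans (normr_ge0 _) lp2.
 pose a' := Y1 * sqrt (1 - (2 * t)^-1).
 have a'0 : 0 <= a' by rewrite mulr_ge0 ?sqrtr_ge0.
 have a'2 : a' ^+ 2 = Y1 ^+ 2 * (1 - (2 * t)^-1) by rewrite exprMn sqr_sqrtr// subr_ge0; case/andP: lev0.
 apply: (le_trans (large_period (dV j) (dP j) (P0 j) t1 lE Y11 a'0 a'2 (erefl r))).
 rewrite ler_wpM2r ?invr_ge0 ?sqr_ge0// ler_wpM2r ?(ltW r0)//.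
 by rewrite ler_pM ?mulr_ge0 ?sqrtr_ge0 ?sqr_ge0// ?ler_wpM2l ?ler_wsqrtr// sqr_le0l.
have c1 := @cont_chord R Y1; have c2 := @cont_chord R Y2; have cj := @cxV j.
have -> : \int[mu]_(x in `[0, Y2]) ((chord Y2 x - chord Y1 x) * (x * V j x)) =
 \int[mu]_(x in `[0, Y2]) (chord Y2 x * (x * V j x)) - \int[mu]_(x in `[0, Y2]) (chord Y1 x * (x * V j x)).
 have k1 := @cCV Y1 j.
 have k2 := @cCV Y2 j.
 rewrite -(@segintB _ 0 Y2 _ _ (@contW _ 0 Y2 _ k2) (@contW _ 0 Y2 _ k1)).
 by apply: segint_eq => x _; rewrite mulrBl.
apply: (le_trans (ler_normB _ _)); apply: (le_trans (lerD lp2 lp1)).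
have -> : 441 * `|V j 0| * sqrt Y2 * Y2 ^+ 2 * r / t ^+ 2 + 441 * `|V j 0| * sqrt Y2 * Y2 ^+ 2 * r / t ^+ 2 =
 `|V j 0| * ((Y2 ^+ 2 - Y1 ^+ 2) * sqrt Y2 * (882 * (eta^-1 * (r / t ^+ 2)))).
 by rewrite DE; field; rewrite !gt_eqF.
rewrite ler_wpM2l// ler_wpM2l ?mulr_ge0// /level.
have ei0 : 0 < eta^-1 by rewrite invr_gt0.
have h1 : eta^-1 * (r / t ^+ 2) <= 2 * (eta^-1 / 8 ^+ k) by rewrite [leRHS]mulrCA ler_wpM2l ?(ltW ei0).
have h2 : eta^-1 / 8 ^+ k <= 8 * (2 ^+ k)^-1.
 rewrite ler_pdivrMr ?exprn_gt0// e8 exprS -!mulrA [(2 ^+ k)^-1 * _]mulrA mulVf ?gt_eqF// mul1r -e4.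
 have : eta^-1 <= 2 * t by rewrite -[leRHS]invrK lef_pV2 ?posrE ?invr_gt0 ?mulr_gt0.
 by move: tk'; rewrite exprS; lra.
have h3 : 0 <= eta^-1 / 8 ^+ k by rewrite divr_ge0 ?(ltW ei0) ?exprn_ge0.
rewrite minr_pMr// le_min; apply/andP; split; move: h1 h2 h3; move: (eta^-1 * _) (eta^-1 / _) ((2 ^+ k)^-1) => x y z; lra.
Qed.

Lemma finite_nat_bound (S : set nat) : finite_set S -> exists N, forall j, S j -> (j < N)%N.
Proof.
move=> fS; exists (\max_(j <- finmap.enum_fset (fset_set S)) j).+1 => j Sj.
by rewrite ltnS; apply: (@leq_bigmax_seq _ _ xpredT (fun j : nat => j)) => //; rewrite in_fset_set// inE.
Qed.

(** Three ranges: finitely many lam < 1/4, the range up to 5/4, and dyadic blocks. As the squared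
    periods up to T sum to O(T), the blocks contribute sum_k min(2^k, eta^-1 2^-k), which is
    O(eta^(-1/2)). *)
Lemma spectral_error_sum eps : 0 < eps -> exists2 C, 0 <= C & forall Y1 Y2 eta n, 0 < eta <= 1 ->
 Y1 = 0 \/ 1 <= Y1 -> Y1 <= Y2 -> 1 <= Y2 -> Y1 ^+ 2 = Y2 ^+ 2 * (1 - eta) ->
 \sum_(j < n) `|spectral_error Y1 Y2 j| <=
 C * ((Y2 ^+ 2 - Y1 ^+ 2) * sqrt Y2 * (Y2 `^ eps + sqrt eta^-1)).
Proof.
move=> e0; have [Cmid Cmid0 Hmid] := error_mid e0.
have [Cs CsP] : exists Cs : nat -> R, forall j, lam j < 4^-1 -> 0 <= Cs j /\ forall Y1 Y2, 0 <= Y1 -> Y1 <= Y2 ->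
 `|spectral_error Y1 Y2 j| <= V j 0 ^+ 2 * ((Y2 ^+ 2 - Y1 ^+ 2) * sqrt Y2 * Cs j).
 have H j : exists c : R, lam j < 4^-1 -> 0 <= c /\ forall Y1 Y2, 0 <= Y1 -> Y1 <= Y2 ->
 `|spectral_error Y1 Y2 j| <= V j 0 ^+ 2 * ((Y2 ^+ 2 - Y1 ^+ 2) * sqrt Y2 * c).
 case: (boolP (lam j < 4^-1)) => [/error_small[c c0 hc]|_]; last by exists 0.
 by exists c.
 by have [Cs CsP] := choice H; exists Cs.
have [N HN] := finite_nat_bound finl.
pose Cm := \sum_(i < N) `|Cs i|; have Cm0 : 0 <= Cm by apply: sumr_ge0.
have CsM j : lam j < 4^-1 -> Cs j <= Cm.
 move=> lj; have jN : (j < N)%N by apply: HN; rewrite /= ltW.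
 rewrite /Cm (bigD1 (Ordinal jN))//= (le_trans (ler_norm _))// lerDl; exact: sumr_ge0.
have cc0 : 0 <= C0 * (Cm + Cmid + (16 * (10 * 40 * 40))) by rewrite mulr_ge0 ?addr_ge0 ?mulr_ge0.
exists (C0 * (Cm + Cmid + (16 * (10 * 40 * 40)))) => // Y1 Y2 eta n etaP Y1P Y12 Y21 YE.
have Y10 : 0 <= Y1 by case: Y1P => [->|/(le_trans ler01)].
set D := (Y2 ^+ 2 - Y1 ^+ 2) * sqrt Y2; have D0 : 0 <= D by rewrite mulr_ge0 ?sqrtr_ge0// subr_ge0 sqr_le0l.
have p1 : 1 <= Y2 `^ eps by rewrite -(powRr0 Y2) ler_powR// ltW.
have s0 := sqrtr_ge0 eta^-1; have [eta0 eta1] := andP etaP.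
pose t j := sqrt (lam j - 4^-1).
have tT j T : 0 <= T -> t j <= T -> lam j <= 4^-1 + T ^+ 2.
 move=> T0; apply: contraTT; rewrite -!ltNge => h.
 rewrite -(ger0_norm T0) -sqrtr_sqr ltr_sqrt; last by move: h (sqr_ge0 T); move: (T ^+ 2) => z; lra.
 by move: h; move: (T ^+ 2) => z; lra.
have w0 j : 0 <= V j 0 ^+ 2 by exact: sqr_ge0.
have wC n' T : 1 <= T -> \sum_(j < n' | t j <= T) V j 0 ^+ 2 <= C0 * T.
 move=> T1; apply: le_trans (sumC n' T1); rewrite [leLHS]big_mkcond [leRHS]big_mkcond; apply: ler_sum => j _.
 case: ifP => [/(tT j _ (le_trans ler01 T1)) ->//|_]; by case: ifP.
have lev0 k : 0 <= level eta k.
 apply: mulr_ge0; [by rewrite !mulr_ge0|by rewrite le_min invr_ge0 exprn_ge0//= divr_ge0 ?exprn_ge0 ?invr_ge0 ?(ltW eta0)].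
have mB N' : \sum_(k < N') 4 ^+ k.+1 * (D * level eta k) <= D * ((4 * (10 * 40 * 40)) * (4 * sqrt eta^-1)).
 have e1 : 1 <= eta^-1 by rewrite invf_ge1.
 apply: le_trans (ler_wpM2l D0 (ler_wpM2l _ (min_sum e1 N'))) => //.
 rewrite !mulr_sumr; apply: ler_sum => k _; rewrite /level.
 have p2 : 0 < 2 ^+ k :> R by rewrite exprn_gt0.
 have e4 : 4 ^+ k = (2 ^+ k) ^+ 2 :> R by exact: pow4.
 have e8 : 8 ^+ k = (2 ^+ k) ^+ 3 :> R by exact: pow8.
 rewrite exprS e4 e8.
 have -> : Num.min (2 ^+ k) (eta^-1 / 2 ^+ k) = (2 ^+ k) ^+ 2 * Num.min (2 ^+ k)^-1 (eta^-1 / (2 ^+ k) ^+ 3).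
 rewrite minr_pMr ?exprn_ge0 ?(ltW p2)//; congr Num.min; first by field; rewrite gt_eqF.
 by field; rewrite !gt_eqF.
 by move: (Num.min _ _) => a; move: (2 ^+ k : R) => b; apply: eq_ler; ring.
have large := @dyadic_sum _ (fun j => V j 0 ^+ 2) t (fun j => `|spectral_error Y1 Y2 j|) C0 _ (fun k => D * level eta k) w0 wC
 (fun k => mulr_ge0 D0 (lev0 k)) C00 mB.
rewrite (bigID (fun j : 'I_n => 1 <= t j))/=.
apply: (@le_trans _ _ (C0 * (D * ((4 * (10 * 40 * 40)) * (4 * sqrt eta^-1))) + C0 * 1 * (D * (Cm + Cmid * Y2 `^ eps)))).
 apply: lerD; first apply: large => j k htk.
 have l1 : 4^-1 <= lam j.
 rewrite leNgt; apply/negP => lt; move: htk; rewrite /t ler0_sqrtr ?subr_le0 ?(ltW lt)//.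
 by rewrite leNgt exprn_gt0.
 exact: (@error_large j k Y1 Y2 eta l1 etaP htk Y1P Y12 Y21 YE).
 have c0 : 0 <= D * (Cm + Cmid * Y2 `^ eps) by rewrite mulr_ge0// addr_ge0// mulr_ge0// (le_trans ler01 p1).
 apply: le_trans (ler_wpM2r c0 (wC n 1 (lexx 1))); rewrite mulr_suml [leLHS]big_mkcond [leRHS]big_mkcond.
 apply: ler_sum => j _; case: ifP => [tj|_]; last by case: ifP => // _; rewrite mulr_ge0.
 have tj1 : t j <= 1 by rewrite ltW// ltNge.
 rewrite tj1; have l2 := tT j _ ler01 tj1; have [lj|lj] := ltP (lam j) 4^-1.
 have [cs0 H] := CsP j lj; apply: (le_trans (H _ _ Y10 Y12)); rewrite ler_wpM2l// ler_wpM2l//.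
 by apply: (le_trans (CsM j lj)); rewrite lerDl mulr_ge0// (le_trans ler01 p1).
 have lj2 : 4^-1 <= lam j <= 4^-1 + 1 ^+ 2 by rewrite lj.
 by apply: (le_trans (Hmid j lj2 _ _ Y10 Y12 Y21)); rewrite ler_wpM2l// ler_wpM2l// lerDr.
rewrite mulr1 -mulrDr -[leRHS]mulrA ler_wpM2l//; move: D0 p1 s0 Cm0 Cmid0; clear.
move: D (Y2 `^ eps) (sqrt _) => d p s d0 p1 s0 c1 c2.
rewrite -mulrDr [leRHS]mulrCA ler_wpM2l//; have K0 : 0 <= (10 * 40 * 40) :> R by rewrite !mulr_ge0.
move: ((10 * 40 * 40) : R) K0 => K K0.
have -> : (Cm + Cmid + 16 * K) * (p + s) = 4 * K * (4 * s) + (Cm + Cmid * p) +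
 (Cm * (p - 1) + Cm * s + Cmid * s + 16 * (K * p)) by ring.
rewrite lerDl; apply: addr_ge0; last by rewrite !mulr_ge0// (le_trans ler01 p1).
by apply: addr_ge0; [apply: addr_ge0|]; rewrite mulr_ge0// subr_ge0.
Qed.

End SpectralError.

(** * Sums of real powers: uniqueness and increments *)

Section ExponentialSums.
Context {R : realType}.

Lemma seq_argmax (T : eqType) (g : T -> R) x0 (l : seq T) :
 exists2 x1, x1 \in x0 :: l & forall x, x \in x0 :: l -> g x <= g x1.
Proof.
elim: l x0 => [|y l IH] x0; first by exists x0; rewrite ?mem_head// => x; rewrite inE => /eqP ->.
have [x1 x1l H] := IH y; have [le|lt] := leP (g x0) (g x1).
 by exists x1 => [|x]; rewrite inE ?x1l ?orbT// => /orP[/eqP ->|/H].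
exists x0; rewrite ?mem_head// => x; rewrite inE => /orP[/eqP ->|/H h]//.
exact: le_trans h (ltW lt).
Qed.

Lemma exponent_gap (l : seq (R * R)) b q : b < q ->
 exists p, [/\ b <= p, p < q & forall x, x \in l -> x.2 < q -> x.2 <= p].
Proof.
move=> bq; elim: l => [|y l [p [bp pq H]]]; first by exists b.
have [yq|yq] := ltP y.2 q.
 exists (Num.max p y.2); split; rewrite ?le_max ?bp ?gt_max ?pq ?yq// => x.
 by rewrite inE le_max => /orP[/eqP ->|xl xq]; rewrite ?lexx ?orbT// (H _ xl xq).
by exists p; split => // x; rewrite inE => /orP[/eqP ->|/H//]; rewrite ltNge yq.
Qed.

(** The largest exponent would dominate, so its total coefficient is 0; induct on the remaining
    terms. The conclusion is tested against an arbitrary f because exponents may repeat: only the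
    coefficients grouped by exponent vanish. *)
Lemma exponential_sum_unique b C (l : seq (R * R)) : (forall x, x \in l -> b < x.2) ->
 (forall Y, 1 <= Y -> `|\sum_(x <- l) x.1 * Y `^ x.2| <= C * Y `^ b) ->
 forall f : R -> R, \sum_(x <- l) x.1 * f x.2 = 0.
Proof.
move: {2}(size l).+1 (ltnSn (size l)) => n; elim: n l => // n IH [|x0 l'] sz lb lC f; first by rewrite big_nil.
move: (seq_argmax (fun x : R * R => x.2) x0 l') sz lb lC; set l := x0 :: l' => -[x1 x1l qmax] sz lb lC.
set q := x1.2 in qmax; pose A := \sum_(x <- l | x.2 == q) x.1.
have split_l (g : R -> R) : \sum_(x <- l) x.1 * g x.2 = A * g q + \sum_(x <- l | x.2 != q) x.1 * g x.2.
 by rewrite (bigID (fun x : R * R => x.2 == q))/= mulr_suml; congr (_ + _); apply: eq_bigr => x /eqP ->.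
have [p [bp pq Hp]] := exponent_gap l (lb _ x1l).
pose K := `|C| + \sum_(x <- l | x.2 != q) `|x.1|.
have K0 : 0 <= K by rewrite addr_ge0 ?sumr_ge0.
have bnd Y : 1 <= Y -> `|A| * Y `^ q <= K * Y `^ p.
 move=> Y1; have -> : `|A| * Y `^ q = `|\sum_(x <- l) x.1 * Y `^ x.2 - \sum_(x <- l | x.2 != q) x.1 * Y `^ x.2|.
 by rewrite (split_l (fun z => Y `^ z)) addrK normrM (ger0_norm (powR_ge0 _ _)).
 apply: (le_trans (ler_normB _ _)); rewrite /K mulrDl; apply: lerD.
 apply: (le_trans (lC Y Y1)); apply: (@le_trans _ _ (`|C| * Y `^ b)).
 by rewrite ler_wpM2r ?powR_ge0// ler_norm.
 by rewrite ler_wpM2l// ler_powR.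
 apply: (le_trans (ler_norm_sum _ _ _)); rewrite mulr_suml big_seq_cond [leRHS]big_seq_cond.
 apply: ler_sum => x /andP[xl xq]; rewrite normrM (ger0_norm (powR_ge0 _ _)) ler_wpM2l// ler_powR//.
 by apply: Hp => //; rewrite lt_neqAle xq qmax.
have A0 : A = 0.
 apply/eqP; apply: contraT => An; have A0 : 0 < `|A| by rewrite normr_gt0.
 pose z := K / `|A| + 1; have z1 : 1 <= z by rewrite lerDr divr_ge0// ltW.
 have d0 : 0 < q - p by rewrite subr_gt0.
 have [Y [Y1 Yz]] : exists Y, 1 <= Y /\ Y `^ (q - p) = z.
 exists (z `^ (q - p)^-1); rewrite -powRrM mulVf ?gt_eqF// powRr1 ?(le_trans ler01 z1)//; split => //.
 by rewrite -(powRr0 z) ler_powR// invr_ge0 ltW.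
 have Yp := lt_le_trans ltr01 Y1; have := bnd _ Y1; have -> : Y `^ q = Y `^ p * z.
 by rewrite -Yz -powRD ?(gt_eqF Yp) ?implybT//; congr powR; ring.
 rewrite mulrCA mulrC ler_pM2r ?powR_gt0// /z mulrDr mulr1 mulrCA mulfV ?gt_eqF// mulr1.
 by rewrite leNgt ltrDl A0.
rewrite split_l A0 mul0r add0r -big_filter; apply: IH => [|x|Y Y1].
- rewrite -ltnS; apply: leq_trans sz; rewrite ltnS size_filter -(count_predC (fun x : R * R => x.2 == q) l).
 rewrite -[X in (X < _)%N]add0n ltn_add2r -has_count; apply/hasP; exists x1 => //; exact: eqxx.
- by rewrite mem_filter => /andP[_ /lb].
- by rewrite big_filter; have := lC Y Y1; rewrite (split_l (fun z => Y `^ z)) A0 mul0r add0r.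
Qed.

Lemma powR_ratio (r a : R) : 0 < r -> 0 <= a <= 1 -> `|r `^ a - 1| <= `|r - 1|.
Proof.
move=> r0 /andP[a0 a1]; have [r1|r1] := leP 1 r.
 have h1 : 1 <= r `^ a by rewrite -(powRr0 r) ler_powR.
 have h2 : r `^ a <= r by rewrite -[leRHS](powRr1 (ltW r0)) ler_powR.
 by rewrite !ger0_norm ?subr_ge0// lerD2r.
have h1 : r `^ a <= 1 
 by have := @ge0_ler_powR R a a0 r 1; rewrite !nnegrE powR1; apply; [exact: ltW|exact: ler01|exact: ltW].
have h2 : r <= r `^ a.
 have := ler_powR (a := r^-1) _ a1; rewrite invf_ge1// => /(_ (ltW r1)).
 by rewrite -!powR_inv1 ?(ltW r0)// -!powRrM !mulN1r !powRN powRr1 ?(ltW r0)// lef_pV2 ?posrE ?powR_gt0.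
by rewrite !ler0_norm ?subr_le0 ?(ltW r1)// lerN2 lerD2r.
Qed.

(** The mean value theorem in the variable Y^2, where the derivative is (s + 2) / 2 w^(s/2),
    followed by a comparison of the intermediate point w with X^2. *)
Lemma powR_mean (s Y1 Y2 X eta : R) : 0 < s <= 1 -> 0 < X -> 0 < Y1 -> Y1 <= Y2 ->
 `|Y1 ^+ 2 - X ^+ 2| <= 2 * eta * X ^+ 2 -> `|Y2 ^+ 2 - X ^+ 2| <= 2 * eta * X ^+ 2 ->
 `|Y2 `^ (s + 2) - Y1 `^ (s + 2) - (s + 2) / 2 * X `^ s * (Y2 ^+ 2 - Y1 ^+ 2)| <=
 (s + 2) / 2 * (X `^ s * (2 * eta)) * (Y2 ^+ 2 - Y1 ^+ 2).
Proof.
move=> /andP[s0 s1] X0 Y10 Y12 h1 h2; have Y20 := lt_le_trans Y10 Y12.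
have sq (Y a : R) : 0 < Y -> Y `^ (a * 2) = (Y ^+ 2) `^ a.
 by move=> Y0; rewrite mulrC powRrM -powR_mulrn ?(ltW Y0).
have sqE (Y : R) : 0 < Y -> Y `^ (s + 2) = (Y ^+ 2) `^ ((s + 2) / 2) by move=> Y0; rewrite -sq// divfK.
have Y12' : Y1 ^+ 2 <= Y2 ^+ 2 by rewrite ler_sqr ?nnegrE ?(ltW Y10) ?(ltW Y20).
have D0 : 0 <= Y2 ^+ 2 - Y1 ^+ 2 by rewrite subr_ge0.
have Ypos x : Y1 ^+ 2 <= x -> 0 < x by apply: lt_le_trans; rewrite exprn_gt0.
have isd x : Y1 ^+ 2 <= x -> is_derive x (1 : R) (fun w => w `^ ((s + 2) / 2)) ((s + 2) / 2 * x `^ ((s + 2) / 2 - 1)).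
 by move=> /Ypos x0; exact: exp.is_derive1_powR.
have H1 x : x \in `](Y1 ^+ 2), (Y2 ^+ 2)[%R -> is_derive x (1 : R) (fun w => w `^ ((s + 2) / 2)) ((s + 2) / 2 * x `^ ((s + 2) / 2 - 1)).
 by rewrite in_itv/= => /andP[/ltW/isd].
have H2 : {within `[(Y1 ^+ 2), (Y2 ^+ 2)], continuous (fun w => w `^ ((s + 2) / 2))}.
 by apply: derivable_within_continuous => x; rewrite in_itv/= => /andP[/isd[]].
have [w] := MVT_segment Y12' H1 H2.
rewrite in_itv/= => /andP[w1 w2]; rewrite !sqE// => ->.
rewrite (_ : (s + 2) / 2 - 1 = s / 2); last by field.
rewrite (_ : (s + 2) / 2 * w `^ (s / 2) * (Y2 ^+ 2 - Y1 ^+ 2) - (s + 2) / 2 * X `^ s * (Y2 ^+ 2 - Y1 ^+ 2) =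
 (s + 2) / 2 * (w `^ (s / 2) - X `^ s) * (Y2 ^+ 2 - Y1 ^+ 2)); last by ring.
have c0 : 0 <= (s + 2) / 2 by rewrite divr_ge0// addr_ge0// ltW.
rewrite normrM normrM (ger0_norm D0) (ger0_norm c0) ler_wpM2r// ler_wpM2l//.
have w0 := Ypos _ w1; have X20 : 0 < X ^+ 2 by rewrite exprn_gt0.
have -> : X `^ s = (X ^+ 2) `^ (s / 2) by rewrite -sq// divfK.
have -> : w = X ^+ 2 * (w / X ^+ 2) by rewrite mulrC divfK// gt_eqF.
rewrite powRM ?(ltW X20) ?divr_ge0 ?(ltW w0) ?(ltW X20)// -[X in _ - X]mulr1 -mulrBr normrM (ger0_norm (powR_ge0 _ _)).
rewrite ler_wpM2l ?powR_ge0//; have a01 : 0 <= s / 2 <= 1 by rewrite divr_ge0 ?(ltW s0)//=; move: s1; lra.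
apply: (le_trans (powR_ratio _ a01)); first by rewrite divr_gt0.
rewrite (_ : w / X ^+ 2 - 1 = (w - X ^+ 2) / X ^+ 2); last by rewrite mulrBl mulfV// gt_eqF.
rewrite normrM normfV (gtr0_norm X20) ler_pdivrMr//.
move: h1 h2; rewrite !ler_norml => /andP[a1 a2] /andP[b1 b2].
by rewrite (le_trans a1) ?lerD2r//= (le_trans _ b2)// lerD2r.
Qed.

End ExponentialSums.

Lemma floor_multiple {R : realType} (t L : R) : 0 < L -> exists j : int, 0 <= t - j%:~R * L < L.
Proof.
move=> L0; exists (Num.floor (t / L)); have /andP[] := floor_itv (t / L).
by rewrite ler_pdivlMr// ltr_pdivrMr// intrD mulrDl mul1r => f1 f2; rewrite subr_ge0 f1 ltrBlDl.
Qed.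

(** * The counting function squeezed between increments of the crossing sum *)

Section CrossingSums.
Context {R : realType}.
Local Notation mu := (leb R).
Variables (G : set 'M[R]_2) (m : R).
Hypotheses (subG : psl2_subgroup G) (discG : discrete_subgroup G).
Hypotheses (m1 : 1 < m) (stabG : axis_stabilizer G = hyperbolic_subgroup m).
Local Notation ell := (2 * ln m).
Local Notation H := (hyperbolic_subgroup m).
Local Notation actives Y := (finmap.enum_fset (fset_set (active G m Y))).
Local Notation ac D := (coset_rep D 0 0 * coset_rep D 1 0).
Local Notation bd D := (coset_rep D 0 1 * coset_rep D 1 1).

Lemma crossingN (al be sg Y : R) : crossing (- al) (- be) (- sg) Y 0 = crossing al be sg Y 0.
Proof.
rewrite /crossing /ctail !normrN; apply: segint_eq => t _; rewrite -[LHS]ckernN; congr ckern.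
by rewrite /cpos; ring.
Qed.

Lemma crossing_same_sign (al be sg Y : R) : 0 < al * be -> 0 <= Y ->
 crossing al be sg Y 0 = Num.max 0 (Y ^+ 2 - 4 * (al * be)).
Proof.
move=> ab Y0; have al0 : al != 0 by apply: contraTneq ab => ->; rewrite mul0r ltxx.
have be0 : be != 0 by apply: contraTneq ab => ->; rewrite mulr0 ltxx.
have [alp|aln] := ltP 0 al.
 by apply: crossing_same => //; move: ab; rewrite pmulr_rgt0.
have al' : 0 < - al by rewrite oppr_gt0 lt_neqAle al0.
have be' : 0 < - be by move: ab; rewrite -mulrNN pmulr_rgt0.
by rewrite -crossingN crossing_same ?oppr_eq0// mulrNN.
Qed.

(** For cosets with abcd < 0 an upper bound suffices; the constant is separated from Y so that it
    depends on the coset only. *)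
Lemma crossing_sub_le (al be sg Y1 Y2 : R) : al != 0 -> be != 0 -> 0 <= Y1 -> Y1 <= Y2 -> 1 <= Y2 ->
 crossing al be sg Y2 0 - crossing al be sg Y1 0 <=
 sqrt ((1 + `|sg| + 2 * `|al| + `|be|) / Num.min `|al| `|be|) * 4 * (Y2 * sqrt (Y2 ^+ 2 - Y1 ^+ 2) * sqrt Y2).
Proof.
move=> al0 be0 Y10 Y12 Y21; have Y20 := le_trans ler01 Y21.
apply: (le_trans (crossing_sub sg al0 be0 Y10 Y12)).
have d0 : 0 < Num.min `|al| `|be| by rewrite lt_min !normr_gt0 al0.
have w0 : 0 <= Y2 * sqrt (Y2 ^+ 2 - Y1 ^+ 2) by rewrite mulr_ge0 ?sqrtr_ge0.
have ct : ctail al be sg Y2 <= 2 * (sqrt Y2 * sqrt ((1 + `|sg| + 2 * `|al| + `|be|) / Num.min `|al| `|be|)).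
 rewrite /ctail ler_wpM2l// -sqrtrM// ler_wsqrtr// mulrA ler_wpM2r ?invr_ge0 ?(ltW d0)//.
 rewrite !mulrDr mulr1 -!addrA lerD2l; apply: lerD; first by rewrite -[leLHS]mul1r ler_wpM2r.
 by apply: lerD; rewrite -[leLHS]mul1r ler_wpM2r// mulr_ge0.
have q0 := sqrtr_ge0 ((1 + `|sg| + 2 * `|al| + `|be|) / Num.min `|al| `|be|); have y0 := sqrtr_ge0 Y2.
move: ct w0 q0 y0; move: (ctail _ _ _ _) => c; move: (sqrt (_ / _)) => q; move: (Y2 * _) => w; move: (sqrt Y2) => y ct w0 q0 y0.
have p1 : 2 / pi <= 1 :> R by rewrite ler_pdivrMr ?pi_gt0// mul1r pi_ge2.
have p0 : 0 <= 2 / pi :> R by rewrite divr_ge0// pi_ge0.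
apply: (@le_trans _ _ (2 / pi * w * (2 * (2 * (y * q))))).
 by apply: ler_wpM2l; [exact: mulr_ge0|exact: ler_wpM2l].
apply: (@le_trans _ _ (1 * w * (2 * (2 * (y * q))))).
 by apply: ler_wpM2r; [rewrite !mulr_ge0|exact: ler_wpM2r].
by rewrite mul1r; apply: eq_ler; ring.
Qed.

Lemma rep_crossing_ge0 Y (D : set 'M[R]_2) : 0 <= rep_crossing Y D 0.
Proof. by apply: Rintegral_ge0 => t _; exact: ckern_ge0. Qed.

Lemma rep_crossing_inactive Y (D : set 'M[R]_2) : 0 <= Y -> cosets G m D -> ~ active G m Y D -> rep_crossing Y D 0 = 0.
Proof.
move=> Y0 cD nD; have n1 : `|0 : R| <= 1 by rewrite normr0.
have := cross_rep subG discG m1 stabG Y0 n1 cD; rewrite (cross_inactive subG discG m1 stabG n1 cD nD).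
by move=> /esym[].
Qed.

Definition crossing_sum Y := \sum_(D <- actives Y) rep_crossing Y D 0.

Lemma slice_sum_crossing Y : slice_sum G m Y 0 = 2 * crossing_sum Y.
Proof. by rewrite /slice_sum /ckern normr0 mul0r !mulr0 add0r mulr_sumr. Qed.

Lemma active_le Y Z : Y <= Z -> active G m Y `<=` active G m Z.
Proof.
move=> YZ D [cD [g Dg [p [p1 p2 p3 p4]]]]; split => //; exists g => //; exists p.
have h : Num.max 1 Y <= Num.max 1 Z by rewrite ge_max !le_max lexx YZ orbT.
by split => //; exact: le_trans h.
Qed.

(** The finite index set depends on the radius; widening it puts the sums for two radii over the
    same cosets. *)
Lemma active_sum_widen Y Z (F : set 'M[R]_2 -> R) : Y <= Z -> (forall D, 0 <= F D) ->
 (forall D, cosets G m D -> ~ active G m Y D -> F D = 0) ->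
 \sum_(D <- actives Y) F D =
 \sum_(D <- actives Z) F D.
Proof.
move=> YZ F0 FY; have e1 := active_esum subG discG m1 stabG F0 FY.
have FZ D : cosets G m D -> ~ active G m Z D -> F D = 0 by move=> cD nD; apply: FY => // /(active_le YZ).
by have := active_esum subG discG m1 stabG F0 FZ; rewrite e1 => -[].
Qed.

Lemma crossing_sum_widen Y Z : 0 <= Y -> Y <= Z ->
 crossing_sum Y = \sum_(D <- actives Z) rep_crossing Y D 0.
Proof.
move=> Y0 YZ; apply: active_sum_widen => //; first by move=> D; exact: rep_crossing_ge0.
by move=> D cD nD; exact: rep_crossing_inactive.
Qed.

Lemma mem_active Z D : (D \in actives Z) -> active G m Z D.
Proof. by have fin := finite_active subG discG m1 stabG Z; rewrite in_fset_set// => /set_mem. Qed.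

Lemma coset_entries D : cosets G m D -> [/\ ac D != 0, bd D != 0 &
 Bcoef (coset_rep D) ^+ 2 = 1 + 4 * (ac D * bd D)].
Proof.
move=> cD; have [Gr nHr DE] := coset_repP subG m1 stabG cD.
have [a0 b0 c0 d0] := entries_neq0 subG discG m1 stabG Gr nHr.
split; rewrite ?mulf_neq0// /Bcoef real_normK ?num_real//.
have := psl2_det subG Gr; rewrite det_mx2 => dt; rewrite -[1 in RHS](expr1n R 2) -[X in X ^+ 2 + _]dt; ring.
Qed.

(** When ac and bd have opposite signs, ac e^t + bd e^-t vanishes at some t0, so g maps a point of
    the axis to the axis. Powers of the generator on both sides bring the two points into one
    period; hence such cosets are active already for Y = 0, and finite in number. *)
Lemma opposite_active D : cosets G m D -> ac D * bd D < 0 -> active G m 0 D.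
Proof.
move=> cD ab; have [Gr nHr DE] := coset_repP subG m1 stabG cD; set g := coset_rep D in ab Gr nHr DE *.
have l0 : 0 < ell by rewrite mulr_gt0// ln_gt0.
have split_ell (t : R) := floor_multiple t l0.
have [t0 tE] : exists t0, (hact g (0, t0)).1 = 0.
 have al0 : g 0 0 * g 1 0 != 0 by apply: contraTneq ab => ->; rewrite mul0r ltxx.
 set al := g 0 0 * g 1 0 in ab al0; set be := g 0 1 * g 1 1 in ab.
 have r0 : 0 < - be / al.
 rewrite (_ : - be / al = - (al * be) / al ^+ 2); last by rewrite expr2; field.
 by rewrite divr_gt0 ?oppr_gt0// exprn_even_gt0.
 exists (ln (- be / al) / 2); have : cpos al be (g 0 0 * g 1 1 + g 0 1 * g 1 0) 0 (ln (- be / al) / 2) = 0; last by [].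
 have eE : expR (ln (- be / al) / 2) = expR (- (ln (- be / al) / 2)) * (- be / al).
 by rewrite -{3}(lnK r0) -expRD; congr expR; field.
 by rewrite /cpos eE; move: (expR _) => w; field.
have [j /andP[j0 j1]] := split_ell t0; have [i /andP[i0 i1]] := split_ell (hact g (0, t0)).2.
have [dg di dj] : [/\ \det g = 1, \det (hk m (- i)) = 1 & \det (hk m j) = 1].
 by split; apply: (psl2_det subG) => //; exact: Ghk.
split => //; exists (hk m (- i) *m g *m hk m j).
 rewrite DE; apply/double_cosetP => //; exists false, (- i), j; by rewrite expr0 scale1r.
exists (0, t0 - j%:~R * ell); have hE : hact (hk m (- i) *m g *m hk m j) (0, t0 - j%:~R * ell) = (0, (hact g (0, t0)).2 - i%:~R * ell).
 have e0 : hact (hk m j) (0, t0 - j%:~R * ell) = (0, t0) by rewrite hact_hk//; congr (_, _); exact: subrK.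
 rewrite hactM ?det_mulmx ?di ?dg ?mulr1// hactM// e0 hact_hk// tE.
 by congr (_, _ + _); rewrite mulrNz mulNr.
by rewrite hE /= !ger0_norm ?normr0 ?le_max ?ler01 ?(ltW j1) ?(ltW i1).
Qed.

(** The leading 1 is the coset of the identity, with B = 1. Any other coset with B < X is active for
    Z >= X: by [opposite_active] when abcd < 0, and otherwise because Z^2 > 4abcd makes its crossing
    integral positive. *)
Lemma Ncount_active X Z : 1 < X -> X <= Z -> Ncount G m X =
 (1 + \sum_(D <- actives Z) (Bcoef (coset_rep D) < X)%R%:R)%:E.
Proof.
move=> X1 XZ; set s := finmap.enum_fset _.
have X0 : 0 < X := lt_trans ltr01 X1.
have B1 : Bcoef (1%:M : 'M[R]_2) < X by rewrite /Bcoef !mxE/= mulr0 addr0 mulr1 normr1.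
have G1 : G 1%:M by rewrite -(hk0 m); exact: Ghk.
have Hn D : cosets G m D -> D <> H.
 move=> cD DH; have [_ nHr DE] := coset_repP subG m1 stabG cD; apply: nHr.
 by have := double_coset_refl m1 (coset_rep D); rewrite -DE -DH.
have Binv g k : double_coset H g k -> Bcoef k = Bcoef g.
 move=> /(double_cosetP m1)[b [i [j ->]]]; rewrite /Bcoef; have [e1 e2 e3 e4] := hk_mul m1 i g j.
 have sE p q : ((-1) ^+ nat_of_bool b *: (hk m i *m g *m hk m j)) p q = (-1) ^+ nat_of_bool b * (hk m i *m g *m hk m j) p q.
 by rewrite [LHS]mxE.
 rewrite !sE e1 e2 e3 e4; congr (`|_|); have m0 : m != 0 by rewrite gt_eqF// (lt_trans ltr01).
 have h1 : m ^ (i + j) * m ^ (- (i + j)) = 1 by rewrite -expfzDr// subrr.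
 have h2 : m ^ (i - j) * m ^ (j - i) = 1 by rewrite -expfzDr// (_ : i - j + (j - i) = 0) ?expr0z//; ring.
 have h3 (b' : bool) : ((-1) ^+ nat_of_bool b') * ((-1) ^+ nat_of_bool b') = 1 :> R by case: b'; rewrite /= ?expr1 ?expr0 ?mulrNN mulr1.
 transitivity (((-1) ^+ nat_of_bool b * (-1) ^+ nat_of_bool b) * ((m ^ (i + j) * m ^ (- (i + j))) * (g 0 0 * g 1 1) +
 (m ^ (i - j) * m ^ (j - i)) * (g 0 1 * g 1 0))); first by ring.
 by rewrite h1 h2 h3 !mul1r.
pose l := H :: [seq D <- s | Bcoef (coset_rep D) < X].
have lE : [set D : set 'M[R]_2 | exists g, [/\ G g, Bcoef g < X & D = double_coset H g]] = [set` l].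
 apply/seteqP; split => [D [g [Gg gX DE]]|D].
 rewrite /l /= inE; have [Hg|nHg] := pselect (H g).
 apply/orP; left; rewrite DE; apply/eqP.
 have Hg' : double_coset H 1%:M g by rewrite double_coset1.
 by rewrite -(double_coset_trans m1 Hg') double_coset1.
 have cD : cosets G m D by exists g.
 have [Gr nHr DEr] := coset_repP subG m1 stabG cD.
 have BX : Bcoef (coset_rep D) < X.
 by rewrite -(Binv (coset_rep D) g) ?gX// -DEr DE; exact: double_coset_refl.
 apply/orP; right; rewrite mem_filter BX /= in_fset_set; last exact: finite_active.
 apply/mem_set; have [a0 b0 BE] := coset_entries cD.
 have [neg|pos] := ltP (ac D * bd D) 0.
 by apply: active_le (opposite_active cD neg); rewrite (le_trans (ltW X0)).
 have pos' : 0 < ac D * bd D by rewrite lt_neqAle pos eq_sym mulf_neq0.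
 apply: contrapT => /(rep_crossing_inactive (le_trans (ltW X0) XZ) cD).
 rewrite /rep_crossing /= crossing_same_sign ?(le_trans (ltW X0) XZ)// => /eqP.
 apply/negP; rewrite gt_eqF// lt_max; apply/orP; right.
 have h : Bcoef (coset_rep D) ^+ 2 <= Z ^+ 2 by rewrite sqr_le0l ?normr_ge0// (le_trans (ltW BX)).
 by move: h; rewrite BE; move: (ac D * bd D) (Z ^+ 2) => q z; lra.
 rewrite /l /= inE => /orP[/eqP ->|]; first by exists 1%:M; rewrite double_coset1.
 rewrite mem_filter => /andP[BX /mem_active[cD _]]; have [Gr nHr DEr] := coset_repP subG m1 stabG cD.
 by exists (coset_rep D).
rewrite /Ncount lE.
have ul : uniq l.
 rewrite /l /= filter_uniq ?finmap.fset_uniq// andbT mem_filter; apply/negP => /andP[_ /mem_active[cH _]].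
 exact: (Hn H).
have fl : finite_set [set` l] by exact: finite_seq.
have sz : size (finmap.enum_fset (fset_set [set` l])) = size l.
 apply: perm_size; apply: uniq_perm; [exact: finmap.fset_uniq|exact: ul|].
 by move=> D; rewrite in_fset_set//; apply/idP/idP => [/set_mem|/mem_set].
rewrite /counting asboolT//= [X in X%:R]sz /l /= size_filter -sum1_count -natr1 natr_sum addrC.
by congr (_%:E); congr (_ + _); rewrite big_mkcond/=; apply: eq_bigr => D _; case: ifP.
Qed.

(* Double cosets with [abcd < 0] are crossings of the axis; they contribute to [B < 1] only. *)
Lemma count_bounds : exists2 K, 0 <= K & forall X, 1 < X -> exists2 N, Ncount G m X = N%:E &
 (forall Y1 Y2, 0 <= Y1 -> Y1 <= Y2 -> Y1 ^+ 2 = X ^+ 2 - 1 ->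
 (N - K) * (Y2 ^+ 2 - Y1 ^+ 2) <= crossing_sum Y2 - crossing_sum Y1) /\
 (forall Y1 Y2, 0 <= Y1 -> Y1 <= Y2 -> 1 <= Y2 -> Y2 ^+ 2 = X ^+ 2 - 1 ->
 crossing_sum Y2 - crossing_sum Y1 <= N * (Y2 ^+ 2 - Y1 ^+ 2) +
 K * (Y2 * sqrt (Y2 ^+ 2 - Y1 ^+ 2) * sqrt Y2)).
Proof.
(* For a coset with abcd < 0 the summand 1 absorbs its place in the count and the rest bounds the
   increment of its crossing integral, so that one constant serves both inequalities. *)
pose kD (D : set 'M[R]_2) : R := 1 + sqrt ((1 + `|coset_rep D 0 0 * coset_rep D 1 1 + coset_rep D 0 1 * coset_rep D 1 0| +
 2 * `|ac D| + `|bd D|) / Num.min `|ac D| `|bd D|) * 4.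
have kD0 D : 1 <= kD D by rewrite lerDl mulr_ge0 ?sqrtr_ge0.
pose negk (D : set 'M[R]_2) : R := if ac D * bd D < 0 then kD D else 0.
have negk0 D : 0 <= negk D by rewrite /negk; case: ifP => // _; rewrite (le_trans ler01).
pose Kn := \sum_(D <- actives 0) negk D.
have Kn0 : 0 <= Kn by apply: sumr_ge0.
have KnE Z : 0 <= Z -> Kn = \sum_(D <- actives Z) negk D.
 move=> Z0; apply: active_sum_widen => // D cD nD; rewrite /negk; case: ifP => // neg.
 by case: nD; exact: opposite_active.
exists (1 + Kn) => [|X X1]; first by rewrite addr_ge0.
have X0 : 0 < X := lt_trans ltr01 X1.
pose cnt Z : R := \sum_(D <- actives Z) (Bcoef (coset_rep D) < X)%R%:R.
have cntE Z : X <= Z -> cnt Z = cnt X.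
 move=> XZ; have := Ncount_active X1 XZ; rewrite (Ncount_active X1 (lexx X)) => -[] /addrI e.
 by rewrite /cnt e.
have BX D (C : R) : cosets G m D -> C = X ^+ 2 - 1 -> (Bcoef (coset_rep D) < X) = (4 * (ac D * bd D) < C).
 move=> cD ->; have [_ _ BE] := coset_entries cD.
 rewrite -(ltr_sqr (x := Bcoef _)) ?nnegrE ?normr_ge0 ?(ltW X0)// BE; move: (ac D * bd D) (X ^+ 2) => q z.
 by apply/idP/idP; lra.
exists (1 + cnt X); first exact: Ncount_active.
split => [Y1 Y2 Y10 Y12 YE|Y1 Y2 Y10 Y12 Y21 YE].
 have Y20 := le_trans Y10 Y12; pose Z := Num.max X Y2.
 have XZ : X <= Z by rewrite le_max lexx.
 have YZ : Y2 <= Z by rewrite le_max lexx orbT.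
 have D0 : 0 <= Y2 ^+ 2 - Y1 ^+ 2 by rewrite subr_ge0 sqr_le0l.
 rewrite (crossing_sum_widen Y20 YZ) (crossing_sum_widen Y10 (le_trans Y12 YZ)) -(cntE Z XZ) (KnE Z (le_trans Y20 YZ)).
 rewrite -sumrB opprD addrACA subrr add0r -sumrB mulr_suml big_seq [leRHS]big_seq.
 apply: ler_sum => D /mem_active[cD _]; have [a0 b0 BE] := coset_entries cD.
 have mono : 0 <= rep_crossing Y2 D 0 - rep_crossing Y1 D 0.
 by rewrite subr_ge0; exact: crossing_le.
 rewrite (BX D _ cD YE) /negk; case: (ltP (ac D * bd D) 0) => [neg|pos].
 apply: le_trans mono; rewrite mulr_le0_ge0// subr_le0 (le_trans _ (kD0 D))//; by case: (_ < _).
 have pos' : 0 < ac D * bd D by rewrite lt_neqAle pos eq_sym mulf_neq0.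
 rewrite subr0; case: ltP => [lt|_]; last by rewrite mul0r.
 rewrite mul1r /rep_crossing /= !crossing_same_sign//.
 have c1 : 0 <= Y1 ^+ 2 - 4 * (ac D * bd D) by rewrite subr_ge0 ltW.
 have c2 : 0 <= Y2 ^+ 2 - 4 * (ac D * bd D) by rewrite (le_trans c1)// lerD2r -subr_ge0.
 by rewrite (max_idPr c1) (max_idPr c2) opprB addrA subrK.
have Y20 := le_trans Y10 Y12.
have YX : Y2 <= X by rewrite -(ler_sqr (x := Y2)) ?nnegrE ?(ltW X0)// YE gerBl.
have D0 : 0 <= Y2 ^+ 2 - Y1 ^+ 2 by rewrite subr_ge0 sqr_le0l.
rewrite (crossing_sum_widen Y20 YX) (crossing_sum_widen Y10 (le_trans Y12 YX)) (KnE X (ltW X0)) -sumrB.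
have W0 : 0 <= Y2 * sqrt (Y2 ^+ 2 - Y1 ^+ 2) * sqrt Y2 by rewrite !mulr_ge0 ?sqrtr_ge0.
move: W0; set W := Y2 * _ * _ => W0.
apply: (@le_trans _ _ (cnt X * (Y2 ^+ 2 - Y1 ^+ 2) + (\sum_(D <- actives X) negk D) * W)).
 rewrite !mulr_suml -big_split/= big_seq [leRHS]big_seq.
 apply: ler_sum => D /mem_active[cD _]; have [a0 b0 BE] := coset_entries cD.
 rewrite (BX D _ cD YE) /negk; case: (ltP (ac D * bd D) 0) => [neg|pos].
 apply: (le_trans (crossing_sub_le _ a0 b0 Y10 Y12 Y21)); rewrite -[leLHS]add0r -/W; apply: lerD.
 by rewrite mulr_ge0//; case: (_ < _).
 by rewrite ler_wpM2r// lerDr.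
 have pos' : 0 < ac D * bd D by rewrite lt_neqAle pos eq_sym mulf_neq0.
 rewrite mul0r addr0 /rep_crossing /= !crossing_same_sign//; case: ltP => [lt|le].
 have c2 : 0 <= Y2 ^+ 2 - 4 * (ac D * bd D) by rewrite subr_ge0 ltW.
 rewrite mul1r (max_idPr c2); have : Y1 ^+ 2 - 4 * (ac D * bd D) <= Num.max 0 (Y1 ^+ 2 - 4 * (ac D * bd D)).
 by rewrite le_max lexx orbT.
 by move: (Num.max _ _) => M; move: (ac D * bd D) => q; lra.
 have c2 : Y2 ^+ 2 - 4 * (ac D * bd D) <= 0 by rewrite subr_le0.
 have c1 : Y1 ^+ 2 - 4 * (ac D * bd D) <= 0 by rewrite (le_trans _ c2)// lerD2r -subr_ge0.
 by rewrite (max_idPl c1) (max_idPl c2) subrr mul0r.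
by apply: lerD; rewrite ler_wpM2r// lerDr.
Qed.

End CrossingSums.

(** * From increments to the asymptotic formula *)

Section Asymptotics.
Context {R : realType}.

(** The pairs (coefficient, exponent) in [l] describe the growth of [M], up to the error of
    [spectral_error_sum]. Exponents are of the form s + 2, all above the 5/2 of the error term. *)
Definition admissible (M : R -> R) (l : seq (R * R)) :=
 (forall x, x \in l -> 5 / 2 < x.2 <= 3) /\
 (forall eps, 0 < eps -> exists2 C, 0 <= C & forall Y1 Y2 eta, 0 < eta <= 1 ->
 Y1 = 0 \/ 1 <= Y1 -> Y1 <= Y2 -> 1 <= Y2 -> Y1 ^+ 2 = Y2 ^+ 2 * (1 - eta) ->
 `|M Y2 - M Y1 - (\sum_(x <- l) x.1 * Y2 `^ x.2 - \sum_(x <- l) x.1 * Y1 `^ x.2)| <=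
 C * ((Y2 ^+ 2 - Y1 ^+ 2) * sqrt Y2 * (Y2 `^ eps + sqrt eta^-1))).

Lemma exponents_above (l : seq (R * R)) b : (forall x, x \in l -> b < x.2) ->
 exists2 c, b < c & forall x, x \in l -> c < x.2.
Proof.
elim: l => [|y l IH] H; first by exists (b + 1); rewrite // ltrDl.
have [x xl|c bc Hc] := IH; first by apply: H; rewrite inE xl orbT.
have by_ := H y (mem_head _ _).
have h : b < Num.min c y.2 by rewrite lt_min bc by_.
exists ((b + Num.min c y.2) / 2); first by move: h; move: (Num.min _ _) => z; lra.
have hh : (b + Num.min c y.2) / 2 < Num.min c y.2 by move: h; move: (Num.min _ _) => z; lra.
move=> x; rewrite inE => /orP[/eqP ->|/Hc cx].
 by apply: lt_le_trans hh _; rewrite ge_min lexx orbT.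
by apply: lt_trans cx; apply: lt_le_trans hh _; rewrite ge_min lexx.
Qed.

(** Take Y1 = 0 and eta = 1: the two power sums then differ by O(Y^(5/2 + eps)), and eps can be
    chosen so that this stays below every exponent. *)
Lemma admissible_unique M (l l' : seq (R * R)) (f : R -> R) : admissible M l -> admissible M l' ->
 \sum_(x <- l) x.1 * f x.2 = \sum_(x <- l') x.1 * f x.2.
Proof.
move=> [lb H] [lb' H']; apply/eqP; rewrite -subr_eq0.
pose L := l ++ [seq (- x.1, x.2) | x <- l'].
have LE (g : R -> R) : \sum_(x <- l) x.1 * g x.2 - \sum_(x <- l') x.1 * g x.2 = \sum_(x <- L) x.1 * g x.2.
 by rewrite big_cat/= big_map/= -sumrN; congr (_ + _); apply: eq_bigr => x _; rewrite mulNr.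
have Lb x : x \in L -> 5 / 2 < x.2.
 by rewrite mem_cat => /orP[/lb/andP[]//|/mapP[y /lb'/andP[y1 _] ->]].
have [c bc cL] := exponents_above Lb.
have e0 : 0 < c - 5 / 2 by rewrite subr_gt0.
have [C C0 HC] := H _ e0; have [C' C'0 HC'] := H' _ e0.
rewrite LE (@exponential_sum_unique _ c ((C + C') * 2) L)// => Y Y1; rewrite -LE.
have Y0 := lt_le_trans ltr01 Y1.
have vanish (q : seq (R * R)) : (forall x, x \in q -> 5 / 2 < x.2 <= 3) -> \sum_(x <- q) x.1 * (0 : R) `^ x.2 = 0.
 move=> qb; rewrite big_seq big1// => x /qb/andP[x1 _]; rewrite powR0 ?mulr0// gt_eqF//; move: x1; lra.
have one : 0 < (1 : R) <= 1 by rewrite ltr01 lexx.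
have z2 : (0 : R) ^+ 2 = Y ^+ 2 * (1 - 1) by rewrite subrr mulr0 expr0n.
have := HC 0 Y 1 one (or_introl erefl) (ltW Y0) Y1 z2; have := HC' 0 Y 1 one (or_introl erefl) (ltW Y0) Y1 z2.
rewrite !vanish// !subr0 expr0n/= subr0 invr1 sqrtr1.
have bnd : Y ^+ 2 * sqrt Y * (Y `^ (c - 5 / 2) + 1) <= 2 * Y `^ c.
 have -> : Y `^ c = Y ^+ 2 * sqrt Y * Y `^ (c - 5 / 2).
 rewrite -powR12_sqrt ?(ltW Y0)// -(powR_mulrn _ (ltW Y0)) -!powRD ?(gt_eqF Y0) ?implybT//; congr powR; lra.
 have p1 : 1 <= Y `^ (c - 5 / 2) by rewrite -[leLHS](powRr0 Y) ler_powR// ltW.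
 rewrite mulrCA ler_wpM2l ?mulr_ge0 ?sqr_ge0 ?sqrtr_ge0//; move: p1; lra.
move: bnd; move: (Y ^+ 2 * _ * _) (Y `^ c) (\sum_(x <- l) _) (\sum_(x <- l') _) (M Y) (M 0) => B P s s' a b bnd h' h.
have hB : C * B <= C * (2 * P) by rewrite ler_wpM2l.
have hB' : C' * B <= C' * (2 * P) by rewrite ler_wpM2l.
move: h h'; rewrite !ler_norml => /andP[h1 h2] /andP[h3 h4]; apply/andP; split; move: hB hB' h1 h2 h3 h4.
 by rewrite (_ : (C + C') * 2 * P = C * (2 * P) + C' * (2 * P)); [lra|ring].
by rewrite (_ : (C + C') * 2 * P = C * (2 * P) + C' * (2 * P)); [lra|ring].
Qed.

Lemma sqrt_pair (Z eta : R) : 0 < Z -> 0 < eta < 1 -> exists2 Y, 0 < Y & Y ^+ 2 = Z * (1 - eta).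
Proof.
move=> Z0 /andP[e0 e1]; exists (sqrt (Z * (1 - eta))); first by rewrite sqrtr_gt0 mulr_gt0// subr_gt0.
by rewrite sqr_sqrtr// mulr_ge0 ?(ltW Z0)// subr_ge0 ltW.
Qed.

Lemma range_upper (X2 Z2 Y2 eta : R) : Z2 = X2 - 1 -> Z2 = Y2 * (1 - eta) -> 0 < eta <= 2^-1 -> 1 <= eta * X2 -> 64 <= X2 ->
 [/\ Z2 <= Y2, Y2 <= 4 * X2, `|Z2 - X2| <= 2 * eta * X2, `|Y2 - X2| <= 2 * eta * X2 & Z2 < Y2].
Proof.
move=> ZE YE /andP[e0 e1] eX X64.
have Zp : 0 < Z2 by rewrite ZE; lra.
have Yp : 0 < Y2 by move: Zp; rewrite YE pmulr_lgt0//; lra.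
have eY : 0 < eta * Y2 by rewrite mulr_gt0.
have e2 : eta * Y2 <= 2^-1 * Y2 by rewrite ler_wpM2r ?(ltW Yp).
have YZ : Y2 <= 2 * Z2 by move: YE e2; rewrite mulrBr mulr1 (mulrC Y2); lra.
have e3 : eta * Y2 <= eta * (2 * Z2) by rewrite ler_wpM2l ?(ltW e0).
have e4 : eta * (2 * Z2) <= eta * (2 * X2) by rewrite ler_wpM2l ?(ltW e0)//; rewrite ZE; lra.
have e5 : Y2 = Z2 + eta * Y2 by rewrite [X in _ = X + _]YE; ring.
have e6 : eta * (2 * X2) = 2 * eta * X2 by ring.
split; rewrite ?ler_norml; [lra|lra| | |lra]; apply/andP; split; lra.
Qed.

Lemma range_lower (X2 Z2 Y2 eta : R) : Z2 = X2 - 1 -> Y2 = Z2 * (1 - eta) -> 0 < eta <= 2^-1 -> 1 <= eta * X2 -> 64 <= X2 ->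
 [/\ 1 <= Y2, Z2 <= 4 * X2, `|Z2 - X2| <= 2 * eta * X2, `|Y2 - X2| <= 2 * eta * X2 & Y2 < Z2].
Proof.
move=> ZE YE /andP[e0 e1] eX X64.
have Zp : 0 < Z2 by rewrite ZE; lra.
have eZ : 0 < eta * Z2 by rewrite mulr_gt0.
have e2 : eta * Z2 <= 2^-1 * Z2 by rewrite ler_wpM2r ?(ltW Zp).
have e3 : eta * Z2 <= eta * X2 by rewrite ler_wpM2l ?(ltW e0)// ZE; lra.
have e5 : Y2 = Z2 - eta * Z2 by rewrite YE; ring.
split; rewrite ?ler_norml; [lra|lra| | |lra]; apply/andP; split; lra.
Qed.

(** The derivative with respect to Y^2, at Y = X, of the power sum described by [l]. *)
Definition leading (l : seq (R * R)) X := \sum_(x <- l) x.1 * (x.2 / 2 * X `^ (x.2 - 2)).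

(** With X = r^6 and eta = r^-2 both errors have size r^4: X eta from the variation of the main
    term, and Y^(1/2) (Y^eps + eta^(-1/2)), of order r^3 r, from the spectral side, with eps =
    1/6. *)
Lemma increment_asymptotic M l : admissible M l -> exists2 C, 0 <= C & forall r Y1 Y2, 1 <= r ->
 0 < (r ^+ 2)^-1 <= 1 -> 1 <= Y1 -> Y1 <= Y2 -> Y2 ^+ 2 <= 4 * (r ^+ 6) ^+ 2 ->
 Y1 ^+ 2 = Y2 ^+ 2 * (1 - (r ^+ 2)^-1) ->
 `|Y1 ^+ 2 - (r ^+ 6) ^+ 2| <= 2 * (r ^+ 2)^-1 * (r ^+ 6) ^+ 2 ->
 `|Y2 ^+ 2 - (r ^+ 6) ^+ 2| <= 2 * (r ^+ 2)^-1 * (r ^+ 6) ^+ 2 ->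
 `|M Y2 - M Y1 - leading l (r ^+ 6) * (Y2 ^+ 2 - Y1 ^+ 2)| <= (C * r ^+ 4) * (Y2 ^+ 2 - Y1 ^+ 2).
Proof.
move=> [lb H]; have e6 : 0 < 6^-1 :> R by rewrite invr_gt0.
have [C C0 HC] := H _ e6; exists (6 * C + 3 * \sum_(x <- l) `|x.1|).
 by rewrite addr_ge0 ?mulr_ge0 ?sumr_ge0.
move=> r Y1 Y2 r1 etaP Y11 Y12 Y2X YE h1 h2; have r0 := lt_le_trans ltr01 r1.
have Y10 := lt_le_trans ltr01 Y11; have Y20 := lt_le_trans Y10 Y12.
have X0 : 0 < r ^+ 6 by rewrite exprn_gt0.
have D0 : 0 <= Y2 ^+ 2 - Y1 ^+ 2 by rewrite subr_ge0 sqr_le0l// ltW.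
have main : `|\sum_(x <- l) x.1 * Y2 `^ x.2 - \sum_(x <- l) x.1 * Y1 `^ x.2 - leading l (r ^+ 6) * (Y2 ^+ 2 - Y1 ^+ 2)| <=
 3 * (\sum_(x <- l) `|x.1|) * r ^+ 4 * (Y2 ^+ 2 - Y1 ^+ 2).
 rewrite -sumrB /leading mulr_suml -sumrB (le_trans (ler_norm_sum _ _ _))// mulr_sumr !mulr_suml big_seq [leRHS]big_seq.
 apply: ler_sum => x /lb/andP[x1 x2].
 have -> : x.1 * Y2 `^ x.2 - x.1 * Y1 `^ x.2 - x.1 * (x.2 / 2 * (r ^+ 6) `^ (x.2 - 2)) * (Y2 ^+ 2 - Y1 ^+ 2) =
 x.1 * (Y2 `^ x.2 - Y1 `^ x.2 - x.2 / 2 * (r ^+ 6) `^ (x.2 - 2) * (Y2 ^+ 2 - Y1 ^+ 2)) by ring.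
 have s01 : 0 < x.2 - 2 <= 1 by move: x1 x2; lra.
 have := powR_mean s01 X0 Y10 Y12 h1 h2; rewrite subrK => B.
 rewrite normrM (_ : 3 * `|x.1| * r ^+ 4 * (Y2 ^+ 2 - Y1 ^+ 2) = `|x.1| * (3 * r ^+ 4 * (Y2 ^+ 2 - Y1 ^+ 2))); last by ring.
 rewrite ler_wpM2l//; apply: (le_trans B); apply: ler_wpM2r => //.
 have Xs : (r ^+ 6) `^ (x.2 - 2) <= r ^+ 6.
 by rewrite -[leRHS](powRr1 (ltW X0)) ler_powR ?exprn_ege1//; move: x2; lra.
 have r46 : r ^+ 6 * (r ^+ 2)^-1 = r ^+ 4 by rewrite (exprD r 4 2) mulfK// gt_eqF// exprn_gt0.
 have i0 : 0 <= (r ^+ 2)^-1 by rewrite invr_ge0 exprn_ge0// ltW.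
 have B1 : (r ^+ 6) `^ (x.2 - 2) * (r ^+ 2)^-1 <= r ^+ 4 by rewrite -r46 ler_wpM2r.
 have -> : x.2 / 2 * ((r ^+ 6) `^ (x.2 - 2) * (2 / r ^+ 2)) = x.2 * ((r ^+ 6) `^ (x.2 - 2) * (r ^+ 2)^-1).
 by field; rewrite gt_eqF.
 by apply: ler_pM => //; [move: x1; lra|rewrite mulr_ge0 ?powR_ge0].
have err := HC Y1 Y2 (r ^+ 2)^-1 etaP (or_intror Y11) Y12 (le_trans Y11 Y12) YE.
have bnd : sqrt Y2 * (Y2 `^ 6^-1 + sqrt (r ^+ 2)^-1^-1) <= 6 * r ^+ 4.
 have Y2l : Y2 <= 2 * r ^+ 6.
 have h0 : 0 <= 2 * r ^+ 6 by rewrite mulr_ge0// ltW.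
 have := Y2X; rewrite (_ : 4 * (r ^+ 6) ^+ 2 = (2 * r ^+ 6) ^+ 2); last by ring.
 by rewrite ler_sqr ?nnegrE ?(ltW Y20) ?h0.
 have s1 : sqrt Y2 <= 2 * r ^+ 3.
 have h0 : 0 <= 2 * r ^+ 3 by rewrite mulr_ge0 ?exprn_ge0// ltW.
 rewrite -[leRHS](ger0_norm h0) -sqrtr_sqr ler_wsqrtr// (le_trans Y2l)// exprMn -exprM ler_wpM2r ?(ltW X0)// expr2; lra.
 have s2 : sqrt (r ^+ 2)^-1^-1 = r by rewrite invrK sqrtr_sqr ger0_norm// ltW.
 have s3 : Y2 `^ 6^-1 <= 2 * r.
 have h0 : 0 <= 2 * r by rewrite mulr_ge0// ltW.
 have -> : 2 * r = ((2 * r) ^+ 6) `^ 6^-1.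
 by rewrite -(powR_mulrn _ h0) -powRrM mulfV ?powRr1// gt_eqF.
 apply: ge0_ler_powR; rewrite ?nnegrE ?(ltW Y20) ?(ltW e6) ?exprn_ge0//.
 by rewrite (le_trans Y2l)// exprMn ler_wpM2r ?(ltW X0)// exprS ler_peMr// exprn_ege1// ler1n.
 rewrite s2 (_ : 6 * r ^+ 4 = 2 * r ^+ 3 * (2 * r + r)); last by ring.
 by apply: ler_pM; rewrite ?sqrtr_ge0 ?addr_ge0 ?powR_ge0 ?(ltW r0)// lerD2r.
have -> : M Y2 - M Y1 - leading l (r ^+ 6) * (Y2 ^+ 2 - Y1 ^+ 2) =
 (M Y2 - M Y1 - (\sum_(x <- l) x.1 * Y2 `^ x.2 - \sum_(x <- l) x.1 * Y1 `^ x.2)) +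
 (\sum_(x <- l) x.1 * Y2 `^ x.2 - \sum_(x <- l) x.1 * Y1 `^ x.2 - leading l (r ^+ 6) * (Y2 ^+ 2 - Y1 ^+ 2)).
 by rewrite addrA subrK.
apply: (le_trans (ler_normD _ _)); rewrite mulrDl mulrDl; apply: lerD; last exact: main.
apply: (le_trans err); rewrite (_ : 6 * C * r ^+ 4 * (Y2 ^+ 2 - Y1 ^+ 2) = C * ((Y2 ^+ 2 - Y1 ^+ 2) * (6 * r ^+ 4))); last by ring.
by rewrite ler_wpM2l// -mulrA ler_wpM2l.
Qed.

(* Optimal window: [eta = X^(-1/3)]; with [X = r^6] all exponents become integral. *)
Lemma sandwich M l (K : R) (cnt : R -> R) : admissible M l -> 0 <= K ->
 (forall X, 1 < X ->
 (forall Y1 Y2, 0 <= Y1 -> Y1 <= Y2 -> Y1 ^+ 2 = X ^+ 2 - 1 ->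
 (cnt X - K) * (Y2 ^+ 2 - Y1 ^+ 2) <= M Y2 - M Y1) /\
 (forall Y1 Y2, 0 <= Y1 -> Y1 <= Y2 -> 1 <= Y2 -> Y2 ^+ 2 = X ^+ 2 - 1 ->
 M Y2 - M Y1 <= cnt X * (Y2 ^+ 2 - Y1 ^+ 2) + K * (Y2 * sqrt (Y2 ^+ 2 - Y1 ^+ 2) * sqrt Y2))) ->
 exists2 C, 0 <= C & forall X, 8 <= X -> `|cnt X - leading l X| <= C * X `^ (2 / 3).
Proof.
move=> adm K0 HN; have [C C0 HC] := increment_asymptotic adm.
exists (K + C) => [|X X8]; first exact: addr_ge0.
have X0 : 0 < X by apply: lt_le_trans X8.
pose r := X `^ 6^-1; have rX : r ^+ 6 = X by rewrite -powR_mulrn ?powR_ge0// -powRrM mulVf ?powRr1 ?(ltW X0).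
have r4 : X `^ (2 / 3) = r ^+ 4.
 by rewrite -powR_mulrn ?powR_ge0// -powRrM; congr powR; field.
have r0 : 0 < r by rewrite powR_gt0.
have r22 : 2 <= r ^+ 2.
 rewrite leNgt; apply/negP => lt; have : (r ^+ 2) ^+ 3 < 2 ^+ 3 by rewrite ltr_pXn2r ?nnegrE ?sqr_ge0.
 by rewrite -exprM rX !exprS expr0 mulr1 ltNge (_ : 2 * (2 * 2) = 8) ?X8//; lra.
have r1 : 1 <= r.
 rewrite leNgt; apply/negP => lt; move: r22; rewrite leNgt => /negP; apply.
 have h : r ^+ 2 < 1 by rewrite expr_lt1// ltW.
 by apply: lt_trans h _; rewrite ltr1n.
have eta0 : 0 < (r ^+ 2)^-1 by rewrite invr_gt0 exprn_gt0.
have eta2 : (r ^+ 2)^-1 <= 2^-1 by rewrite lef_pV2 ?posrE ?exprn_gt0.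
have etaP : 0 < (r ^+ 2)^-1 <= 2^-1 by rewrite eta0.
have etaP1 : 0 < (r ^+ 2)^-1 <= 1 by rewrite eta0 (le_trans eta2)// invf_le1// ler1n.
have X64 : 64 <= X ^+ 2.
 have : 8 * 8 <= X * X by apply: ler_pM.
 by rewrite expr2 (_ : 8 * 8 = 64)//; lra.
have eX : 1 <= (r ^+ 2)^-1 * X ^+ 2.
 rewrite ler_pdivlMl ?exprn_gt0// mulr1 -rX -exprM ler_weXn2l//.
have X1 : 1 < X by apply: lt_le_trans X8; rewrite ltr1n.
have Z0 : 0 < X ^+ 2 - 1 by move: X64; move: (X ^+ 2) => q; lra.
(* The condition B < X reads 4abcd < Z^2. The window below Z bounds the count from below, the window
   above Z bounds it from above. *)
pose Z := sqrt (X ^+ 2 - 1); have ZE : Z ^+ 2 = X ^+ 2 - 1 by rewrite sqr_sqrtr// ltW.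
have Zp : 0 < Z by rewrite sqrtr_gt0.
have sq_le (a b : R) : 0 < a -> 0 < b -> a ^+ 2 <= b ^+ 2 -> a <= b.
 by move=> a0 b0; rewrite ler_sqr ?nnegrE ?(ltW a0) ?(ltW b0).
have Z1 : 1 <= Z by apply: sq_le => //; rewrite ZE expr1n; move: X64; move: (X ^+ 2) => q; lra.
have [up lo] := HN X X1.
have p4 : 1 <= r ^+ 4 by rewrite exprn_ege1.
have cmp (a b D : R) : 0 < D -> a * D <= b * D -> a <= b by move=> D0; rewrite ler_pM2r.
have e1 : 0 < 1 - (r ^+ 2)^-1 by move: eta2; move: (_^-1) => q; lra.
rewrite r4 ler_norml; apply/andP; split.
 have [Y Y0 YE] : exists2 Y, 0 < Y & Y ^+ 2 = Z ^+ 2 * (1 - (r ^+ 2)^-1).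
 by apply: sqrt_pair; rewrite ?exprn_gt0// eta0 -subr_gt0.
 have [a1 a2 a3 a4 a5] := range_lower ZE YE etaP eX X64.
 have Y1 : 1 <= Y by apply: sq_le => //; rewrite expr1n.
 have YZ : Y <= Z by apply: sq_le => //; exact: ltW.
 have D0 : 0 < Z ^+ 2 - Y ^+ 2 by rewrite subr_gt0.
 have h1 := lo Y Z (ltW Y0) YZ Z1 ZE.
 have h2 := HC r Y Z r1 etaP1 Y1 YZ; rewrite rX in h2; have {}h2 := h2 a2 YE a4 a3.
 have cross_le : Z * sqrt (Z ^+ 2 - Y ^+ 2) * sqrt Z <= r ^+ 4 * (Z ^+ 2 - Y ^+ 2).
 have DE : Z ^+ 2 - Y ^+ 2 = (Z / r) ^+ 2 by rewrite YE expr_div_n; ring.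
 have ir : 0 <= Z / r by rewrite divr_ge0 ?ltW.
 rewrite DE sqrtr_sqr (ger0_norm ir).
 have sZ : sqrt Z <= r ^+ 3.
 have h0 : 0 <= r ^+ 3 by rewrite exprn_ge0// ltW.
 rewrite -[leRHS](ger0_norm h0) -sqrtr_sqr ler_wsqrtr// -exprM rX; apply: sq_le => //.
 by rewrite ZE gerBl.
 apply: (@le_trans _ _ (Z * (Z / r) * r ^+ 3)); first by rewrite ler_wpM2l// mulr_ge0// ltW.
 by apply: eq_ler; field; rewrite gt_eqF.
 have h3 := ler_wpM2l K0 cross_le.
 move: h2; rewrite ler_norml => /andP[h2 _].
 have h4 : (leading l X - C * r ^+ 4) * (Z ^+ 2 - Y ^+ 2) <= (cnt X + K * r ^+ 4) * (Z ^+ 2 - Y ^+ 2).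
 move: h1 h2 h3; rewrite !mulrDl !mulNr !mulrA; move: (M Z) (M Y) => MZ MY; move: (_ * sqrt _ * sqrt _) (leading _ _ * _) => A1 A2; lra.
 have := cmp _ _ _ D0 h4; rewrite mulrDl; move: (leading _ _) (cnt _) (K * _) (C * _) => b1 b2 b3 b4; lra.
have [Y Y0 YE] : exists2 Y, 0 < Y & Z ^+ 2 = Y ^+ 2 * (1 - (r ^+ 2)^-1).
 exists (sqrt (Z ^+ 2 / (1 - (r ^+ 2)^-1))); first by rewrite sqrtr_gt0 divr_gt0// exprn_gt0.
 by rewrite [X in _ = X * _]sqr_sqrtr ?divr_ge0 ?sqr_ge0 ?(ltW e1)// divfK// gt_eqF.
have [a1 a2 a3 a4 a5] := range_upper ZE YE etaP eX X64.
have YZ : Z <= Y by apply: sq_le.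
have D0 : 0 < Y ^+ 2 - Z ^+ 2 by rewrite subr_gt0.
have h1 := up Z Y (ltW Zp) YZ ZE.
have h2 := HC r Z Y r1 etaP1 Z1 YZ; rewrite rX in h2; have {}h2 := h2 a2 YE a3 a4.
move: h2; rewrite ler_norml => /andP[_ h2].
have h4 : (cnt X - K) * (Y ^+ 2 - Z ^+ 2) <= (leading l X + C * r ^+ 4) * (Y ^+ 2 - Z ^+ 2).
 by apply: (le_trans h1); rewrite mulrDl -lerBlDl.
have := cmp _ _ _ D0 h4; have := ler_wpM2l K0 p4; rewrite mulr1 mulrDl.
by move: (leading _ _) (cnt _) (K * _) (C * _) => b1 b2 b3 b4; lra.
Qed.

End Asymptotics.

(** * Complex spectral parameters and positivity of the coefficients *)

Section SpectralParameters.
Context {R : realType}.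

Lemma complex_half : (2^-1 : R[i]) = 2^-1 +i* 0.
Proof. by rewrite -[RHS]/((2^-1 : R)%:C) fmorphV rmorph_nat. Qed.

Lemma spectral_small (lam : R) (s : R[i]) : spectral_parameter lam s -> lam < 4^-1 ->
 2^-1 < complex.Re s <= 1 /\ lam = complex.Re s * (1 - complex.Re s).
Proof.
move=> [sE small _] /small; case: s sE {small} => a b sE; rewrite complex_half ltcE lecE /=.
move=> /andP[/andP[/eqP b0 a1] /andP[_ a2]]; split; first by rewrite a1.
have := congr1 (@complex.Re R) sE; rewrite b0 => h.
by transitivity (a * (1 - a) - 0 * (0 - 0)); [exact: h|ring].
Qed.

Lemma spectral_le (lam : R) (s : R[i]) : spectral_parameter lam s -> (2^-1 < s <= 1)%R = (lam < 4^-1).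
Proof.
move=> [_ small large]; case: (ltP lam 4^-1) => [/small//|/large[t _ ->]].
by rewrite complex_half ltcE /= ltxx andbF.
Qed.

Lemma spectral_ge0 (lam : R) (s : R[i]) : spectral_parameter lam s -> 0 <= lam.
Proof.
move=> sp; have [lt|] := ltP lam 4^-1; last by apply: le_trans; rewrite invr_ge0.
have [/andP[h1 h2] ->] := spectral_small sp lt.
by apply: mulr_ge0; [move: h1; lra|rewrite subr_ge0].
Qed.

Lemma gamma1_ge0 (s : R) : 2^-1 < s -> 0 <= gamma1 s.
Proof.
move=> s1; have g1 : 0 < Gamma_function (s + 2^-1) by apply: Gamma_gt0; move: s1; lra.
have g2 : 0 < Gamma_function ((s + 1) / 2) by apply: Gamma_gt0; move: s1; lra.
have g3 : 0 < Gamma_function (s / 2) by apply: Gamma_gt0; move: s1; lra.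
have s0 : 0 <= s by move: s1; lra.
have s2 : 0 <= 2 * s - 1 by move: s1; lra.
apply: mulr_ge0; last by rewrite divr_ge0// mulr_ge0.
apply: mulr_ge0; first by rewrite divr_ge0// pi_ge0.
by rewrite divr_ge0 ?exprn_ge0 ?mulr_ge0 ?ltW.
Qed.

Lemma sum_cut (a : nat -> R) N n : (forall j, (N <= j)%N -> a j = 0) -> (N <= n)%N ->
 \sum_(j < n) a j = \sum_(j < N) a j.
Proof.
move=> aN Nn; rewrite -(subnKC Nn) big_split_ord/= [X in _ + X]big1 ?addr0// => j _.
by apply: aN; rewrite leq_addr.
Qed.

Lemma sum_bounded (a : nat -> R) N n : (forall j, 0 <= a j) -> (forall j, (N <= j)%N -> a j = 0) ->
 \sum_(j < n) a j <= \sum_(j < N) a j.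
Proof.
move=> a0 aN; rewrite -(sum_cut aN (leq_addl n N)) [leRHS]big_split_ord/= lerDl; exact: sumr_ge0.
Qed.

End SpectralParameters.

(** * The crossing sum expanded over the eigenfunctions *)

Section SpectralSide.
Context {R : realType}.
Local Notation mu := (leb R).
Variables (G : set 'M[R]_2) (m : R).
Hypotheses (subG : psl2_subgroup G) (discG : discrete_subgroup G) (cocG : cocompact G).
Hypotheses (m1 : 1 < m) (stabG : axis_stabilizer G = hyperbolic_subgroup m).
Variable e : nat -> 'M[R]_2.
Hypothesis bij_e : set_bij [set: nat] G e.
Variables (F : set (R * R)) (u : nat -> R * R -> R) (lam : nat -> R) (s : nat -> R[i]).
Hypotheses (fundF : fundamental_set G F) (sysu : complete_orthonormal_system G F u).
Hypothesis eigu : forall j, eigenfunction G (lam j) (u j).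
Hypothesis spec : forall j, spectral_parameter (lam j) (s j).
Local Notation sg j := (complex.Re (s j)).

Let lam0 j : 0 <= lam j. Proof. exact: spectral_ge0 (spec j). Qed.
Let Gm : G (hyp_mx m). Proof. by rewrite (hyp_mx_hk m1); exact: Ghk. Qed.
Let C2u j : C2 (u j). Proof. by case: (eigu j). Qed.
Local Notation V := (period_fun m u).
Let dV j (x : R) : is_derive x (1 : R) (V j) (even_flux (u j) m x / (1 + x ^+ 2)).
Proof. exact: (is_derive_period_fun subG m1 Gm eigu). Qed.
Let dP j (x : R) : is_derive x (1 : R) (even_flux (u j) m) (- lam j * V j x).
Proof. exact: (is_derive_period_flux subG m1 Gm eigu). Qed.
Let P0 j : even_flux (u j) m 0 = 0. Proof. exact: even_flux0. Qed.
Let finl : finite_set [set j | lam j <= 4^-1].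
Proof. by have h := finite_small_eigenvalues subG discG cocG bij_e fundF sysu eigu; exact: h. Qed.
Let sgP j : lam j < 4^-1 -> 2^-1 < sg j <= 1 /\ lam j = sg j * (1 - sg j).
Proof. exact: spectral_small (spec j). Qed.
Let error_bound eps : 0 < eps -> exists2 C, 0 <= C & forall Y1 Y2 eta n, 0 < eta <= 1 ->
 Y1 = 0 \/ 1 <= Y1 -> Y1 <= Y2 -> 1 <= Y2 -> Y1 ^+ 2 = Y2 ^+ 2 * (1 - eta) ->
 \sum_(j < n) `|spectral_error V lam (fun j => sg j) Y1 Y2 j| <=
 C * ((Y2 ^+ 2 - Y1 ^+ 2) * sqrt Y2 * (Y2 `^ eps + sqrt eta^-1)).
Proof.
have [C0 C00 sumC] := period_sum subG discG cocG m1 Gm bij_e fundF sysu eigu lam0.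
by move=> e0; exact: (spectral_error_sum dV dP P0 finl sgP C00 sumC e0).
Qed.
Let main_part Y1 Y2 j : R := if lam j < 4^-1
 then main_term V (fun j => sg j) Y2 j - main_term V (fun j => sg j) Y1 j else 0.

Let main_part0 N : (forall j, lam j <= 4^-1 -> (j < N)%N) -> forall Y1 Y2 j, (N <= j)%N -> main_part Y1 Y2 j = 0.
Proof. by move=> HN Y1 Y2 j Nj; rewrite /main_part; case: ifP => // /ltW/HN; rewrite ltnNge Nj. Qed.
Let pairing0 j : pairing V 0 j = 0.
Proof. by rewrite /pairing set_itv1 Rintegral_set1. Qed.

(** Absolute convergence is the error estimate for the window from 0 to Y, where eta = 1, together
    with the finitely many main terms. The identity coset drops out because the kernel vanishes at v
    = 0. *)
Lemma series_crossing Y : Y = 0 \/ 1 <= Y ->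
 series (fun j => V j 0 * pairing V Y j) n @[n --> \oo] --> crossing_sum G m Y / 2.
Proof.
move=> YP; have Y0 : 0 <= Y by case: YP => [->|/(le_trans ler01)].
have B0 : 0 <= 2 / pi * Y ^+ 2 by rewrite mulr_ge0 ?sqr_ge0// divr_ge0// pi_ge0.
rewrite (_ : crossing_sum G m Y / 2 = slice_sum G m Y 0 / 4); last by rewrite slice_sum_crossing; field.
apply: (tube_spectral_series subG discG cocG m1 Gm bij_e fundF sysu eigu lam0 (@cont_ckern R Y) (ckern_ge0 Y)
 (fun v => @ckern_bound R Y v Y0) B0 (ckernN Y) Y0 (@cont_slice_sum R G m Y)).
 by move=> v v1; exact: (slice_ckern subG discG cocG m1 stabG bij_e Y0 v1).
case: YP => [->|Y1].
 by exists 0 => n; rewrite big1// => j _; rewrite (pairing0 j : \int[mu]_(x in _) _ = _) mulr0 normr0.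
have [C C0 HC] := error_bound ltr01; have [N HN] := finite_nat_bound finl.
exists (C * ((Y ^+ 2 - 0 ^+ 2) * sqrt Y * (Y `^ 1 + sqrt 1^-1)) + \sum_(j < N) `|main_part 0 Y j|) => n.
have z2 : (0 : R) ^+ 2 = Y ^+ 2 * (1 - 1) by rewrite subrr mulr0 expr0n.
have one : 0 < (1 : R) <= 1 by rewrite ltr01 lexx.
have van j : (N <= j)%N -> `|main_part 0 Y j| = 0 by move=> Nj; rewrite (main_part0 HN)// normr0.
have b1 := @sum_bounded R (fun j => `|main_part 0 Y j|) N n (fun j => normr_ge0 _) van.
apply: le_trans (lerD (HC 0 Y 1 n one (or_introl erefl) Y0 Y1 z2) b1).
rewrite -big_split/=; apply: ler_sum => j _; apply: le_trans (ler_normD _ _).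
by rewrite /spectral_error pairing0 subr0 subrK.
Qed.

Definition exponent_terms N : seq (R * R) :=
 [seq (V j 0 ^+ 2 * main_const (sg j), sg j + 2) | j <- [seq j <- index_iota 0 N | lam j < 4^-1]].

Lemma exponent_terms_sum N (f : R -> R) :
 \sum_(x <- exponent_terms N) x.1 * f x.2 =
 \sum_(j < N | lam j < 4^-1) V j 0 ^+ 2 * main_const (sg j) * f (sg j + 2).
Proof. by rewrite big_map big_filter/= big_mkord. Qed.

(** The error bound is uniform in the number of terms and passes to the limit of the partial sums;
    the doubling of constants comes from the series converging to half of the crossing sum. *)
Lemma admissible_terms N : (forall j, lam j <= 4^-1 -> (j < N)%N) -> admissible (crossing_sum G m) (exponent_terms N).
Proof.
move=> HN; split.
 move=> x /mapP[j]; rewrite mem_filter => /andP[/sgP[/andP[s1 s2] _] _] -> /=.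
 by apply/andP; split; move: s1 s2; lra.
move=> eps /error_bound[C C0 HC]; exists (2 * C); first by rewrite mulr_ge0.
move=> Y1 Y2 eta etaP Y1P Y12 Y21 YE.
have Y2P : Y2 = 0 \/ 1 <= Y2 by right.
have lim : series (fun j => V j 0 * pairing V Y2 j) n - series (fun j => V j 0 * pairing V Y1 j) n @[n --> \oo] -->
 crossing_sum G m Y2 / 2 - crossing_sum G m Y1 / 2.
 by exact: cvgB (series_crossing Y2P) (series_crossing Y1P).
have cst (c : R) : (fun=> c) n @[n --> \oo] --> c by exact: cvg_cst.
pose D := \sum_(j < N) main_part Y1 Y2 j.
have DE : \sum_(x <- exponent_terms N) x.1 * Y2 `^ x.2 - \sum_(x <- exponent_terms N) x.1 * Y1 `^ x.2 = 2 * D.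
 rewrite (exponent_terms_sum N (fun p => Y2 `^ p)) (exponent_terms_sum N (fun p => Y1 `^ p)) -sumrB /D mulr_sumr.
 rewrite [LHS]big_mkcond; apply: eq_bigr => j _; rewrite /main_part; case: ifP => _; last by rewrite mulr0.
 by rewrite /main_term; field.
rewrite DE; pose B := C * ((Y2 ^+ 2 - Y1 ^+ 2) * sqrt Y2 * (Y2 `^ eps + sqrt eta^-1)).
have bnd n : (N <= n)%N ->
 `|series (fun j => V j 0 * pairing V Y2 j) n - series (fun j => V j 0 * pairing V Y1 j) n - D| <= B.
 move=> Nn; rewrite /series /= !big_mkord /D -(sum_cut (main_part0 HN Y1 Y2) Nn) -!sumrB.
 apply: (le_trans (ler_norm_sum _ _ _)); apply: le_trans (HC Y1 Y2 eta n etaP Y1P Y12 Y21 YE).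
 by apply: ler_sum => j _; rewrite /spectral_error -mulrBr.
have up : crossing_sum G m Y2 / 2 - crossing_sum G m Y1 / 2 <= D + B.
 apply: (ler_cvg_to lim (cst _)); exists N => // n /= /bnd.
 by rewrite ler_norml => /andP[_]; rewrite lerBlDl.
have lo : D - B <= crossing_sum G m Y2 / 2 - crossing_sum G m Y1 / 2.
 apply: (ler_cvg_to (cst _) lim); exists N => // n /= /bnd.
 by rewrite ler_norml => /andP[+ _]; rewrite lerBrDl.
have -> : 2 * C * ((Y2 ^+ 2 - Y1 ^+ 2) * sqrt Y2 * (Y2 `^ eps + sqrt eta^-1)) = 2 * B by rewrite /B !mulrA.
rewrite ler_norml; move: up lo; move: (crossing_sum G m Y2) (crossing_sum G m Y1) (D) (B) => a b d q up lo.
by apply/andP; split; lra.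
Qed.

Lemma esum_leading N X : (forall j, lam j <= 4^-1 -> (j < N)%N) ->
 (\esum_(j in [set j | (2^-1 < s j <= 1)%R]) (2 / pi * gamma1 (sg j) * `|geodesic_period m (u j)| ^+ 2 * X `^ sg j)%R%:E
 = (leading (exponent_terms N) X)%:E)%E.
Proof.
move=> HN; have setE : [set j | (2^-1 < s j <= 1)%R] = [set j | lam j < 4^-1].
 by apply/funext => j /=; rewrite (spectral_le (spec j)).
have fin : finite_set [set j | lam j < 4^-1] by apply: sub_finite_set finl => j /= /ltW.
rewrite setE esum_fset//; last first.
 move=> j /set_mem/= /sgP[/andP[s1 _] _]; rewrite lee_fin.
 apply: mulr_ge0; last exact: powR_ge0.
 apply: mulr_ge0; last exact: sqr_ge0.
 by apply: mulr_ge0; [rewrite divr_ge0// pi_ge0|exact: gamma1_ge0].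
rewrite fsbig_finite//= sumEFin; congr (_%:E).
apply: (eq_trans _ (esym (exponent_terms_sum N (fun p => p / 2 * X `^ (p - 2))))) => /=.
rewrite -(big_mkord (fun j => lam j < 4^-1) (fun j => V j 0 ^+ 2 * main_const (sg j) * ((sg j + 2) / 2 * X `^ (sg j + 2 - 2)))).
rewrite (perm_big [seq j <- index_iota 0 N | lam j < 4^-1])/=; last first.
 apply: uniq_perm; [exact: finmap.fset_uniq|by rewrite filter_uniq// iota_uniq|] => j.
 rewrite in_fset_set// mem_filter mem_index_iota; apply/idP/idP => [/set_mem/= lj|/andP[lj _]].
 by rewrite lj /= HN// ltW.
 exact/mem_set.
rewrite big_filter; apply: eq_bigr => j /sgP[/andP[s1 _] _].
rewrite addrK /period_fun (even_period0 m1 (C2u j)) real_normK ?num_real//.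
by rewrite -(main_constE s1); ring.
Qed.

End SpectralSide.

(** * Enumeration of the group and the final estimate *)

Lemma psl2_enumeration (R : realType) (G : set 'M[R]_2) (m : R) : psl2_subgroup G -> discrete_subgroup G ->
 1 < m -> axis_stabilizer G = hyperbolic_subgroup m -> exists e : nat -> 'M[R]_2, set_bij [set: nat] G e.
Proof.
move=> subG discG m1 stabG; have cnt := countable_psl2 subG discG.
have inf : infinite_set G.
 move=> fin; apply: infinite_nat; apply: (finite_set_injective_image (f := fun k : nat => hk m k%:Z) (B := G)) => //.
 - move=> x y _ _ xy; have [ex _ _ _] := hkE m x%:Z; have [ey _ _ _] := hkE m y%:Z.
 move: ex; rewrite xy ey => mE; case: (ltngtP x y) => // lt.
 + have : m ^+ x < m ^+ y by rewrite ltr_eXn2l.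
 by rewrite -[m ^+ x]/(m ^ x%:Z) -[m ^+ y]/(m ^ y%:Z) mE ltxx.
 + have : m ^+ y < m ^+ x by rewrite ltr_eXn2l.
 by rewrite -[m ^+ x]/(m ^ x%:Z) -[m ^+ y]/(m ^ y%:Z) mE ltxx.
 - by move=> _ [k _ <-]; exact: Ghk.
have H : ([set: nat] #= G)%card by rewrite card_eq_sym; exact: eq_card_nat.
by have [e He] := card_set_bijP H; exists e.
Qed.

Theorem theorem1p2 (R : realType) (G : set 'M[R]_2) (m : R) :
  psl2_subgroup G -> discrete_subgroup G -> cocompact G ->
  psl2_torsion_free G ->
  1 < m -> axis_stabilizer G = hyperbolic_subgroup m ->
  exists C X0 : R,
  forall (F : set (R * R)) (u : nat -> R * R -> R) (lam : nat -> R)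
    (s : nat -> R[i]),
  fundamental_set G F ->
  complete_orthonormal_system G F u ->
  (forall j, eigenfunction G (lam j) (u j)) ->
  (forall j, spectral_parameter (lam j) (s j)) ->
  forall X : R, X0 <= X ->
  (`| Ncount G m X
      - \esum_(j in [set j | (2^-1 < s j <= 1)%R])
          (2 / pi * gamma1 (complex.Re (s j))
           * `|geodesic_period m (u j)| ^+ 2
           * X `^ complex.Re (s j))%R%:E |
   <= (C * X `^ (2 / 3))%R%:E)%E.
Proof.
move=> subG discG cocG _ m1 stabG; have [e bij_e] := psl2_enumeration subG discG m1 stabG.
have [K K0 HK] := count_bounds subG discG m1 stabG.
pose cnt X := fine (Ncount G m X).
have cntE X : 1 < X -> Ncount G m X = (cnt X)%:E by move=> /HK[N NE _]; rewrite /cnt NE.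
(* Any two spectral systems give the same main term, since both describe the growth of [crossing_sum];
 this makes the constant of a reference system uniform. *)
have terms F u lam s : fundamental_set G F -> complete_orthonormal_system G F u ->
 (forall j, eigenfunction G (lam j) (u j)) -> (forall j, spectral_parameter (lam j) (s j)) ->
 exists2 l, admissible (crossing_sum G m) l & forall X,
 (\esum_(j in [set j | (2^-1 < s j <= 1)%R]) (2 / pi * gamma1 (complex.Re (s j)) * `|geodesic_period m (u j)| ^+ 2
 * X `^ complex.Re (s j))%R%:E = (leading l X)%:E)%E.
 move=> fundF sysu eigu spec.
 have [N HN] := finite_nat_bound (finite_small_eigenvalues subG discG cocG bij_e fundF sysu eigu).
 exists (exponent_terms m u lam s N).
 exact: (admissible_terms subG discG cocG m1 stabG bij_e fundF sysu eigu spec HN).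
 by move=> X; exact: (esum_leading subG discG cocG m1 bij_e fundF sysu eigu spec X HN).
(* If no spectral system exists the bound holds vacuously; otherwise the system chosen here fixes
   the constant for all others. *)
have [[F0 [u0 [lam0 [s0 [f1 f2 f3 f4]]]]]|none] := pselect (exists F u lam s, [/\ fundamental_set G F,
 complete_orthonormal_system G F u, (forall j, eigenfunction G (lam j) (u j)) &
 (forall j, spectral_parameter (lam j) (s j))]); last first.
 by exists 0, 0 => F u lam s h1 h2 h3 h4; case: none; exists F, u, lam, s.
have [l0 adm0 _] := terms _ _ _ _ f1 f2 f3 f4.
have [|C C0 HC] := sandwich (cnt := cnt) adm0 K0.
 by move=> X /HK[N NE]; rewrite /cnt NE.
exists C, 8 => F u lam s h1 h2 h3 h4 X X8; have [l adm lE] := terms _ _ _ _ h1 h2 h3 h4.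
have X1 : 1 < X by apply: lt_le_trans X8; rewrite ltr1n.
rewrite cntE// lE -EFinB abse_EFin lee_fin.
have -> : leading l X = leading l0 X by exact: (@admissible_unique _ _ _ _ (fun p => p / 2 * X `^ (p - 2)) adm adm0).
exact: HC.
Qed.
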